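(* Let $f:D\to S^3_1$ be a CMC $1$ face with Weierstrass data $(g,\omega)$, let $p\in D$ be a singular point, and set $\varphi=dg/(g^2\omega)$. Then $f$ has a $5/2$-cuspidal edge at $p$ if and only if $\operatorname{Im}\varphi(p)\neq0$ and $\operatorname{Re}\varphi=0$ holds along a singular curve passing through $p$.
   Context: $S^3_1=\{X\in\mathrm{Herm}(2):\det X=-1\}$ is the de Sitter 3-space, with $\mathrm{Herm}(2)$ identified with $\mathbb{L}^4$ and $\langle X,X\rangle=-\det X$. For a domain $D\subset\mathbb{C}$, a meromorphic $g$ and holomorphic 1-form $\omega=h\,dz$ with $(1+|g|^2)^2|\omega|^2$ a Riemannian metric and $1-|g|^2\not\equiv0$, take a holomorphic $F:D\to SL(2,\mathbb{C})$ with $F^{-1}dF=\begin{pmatrix}g&-g^2\\1&-g\end{pmatrix}\omega$; the CMC $1$ face with Weierstrass data $(g,\omega)$ is $f=Fe_3F^*$, $e_3=\mathrm{diag}(1,-1)$. Its singular set (points where $f$ is not an immersion) is $\Sigma(f)=\{|g|=1\}$. A singular curve through $p$ is a regular curve $\gamma$ with $\gamma(0)=p$ parametrizing $\Sigma(f)$ near $p$. $f$ has a $5/2$-cuspidal edge at $p$ if its map germ at $p$ is $\mathcal{A}$-equivalent (i.e. equal after composition with diffeomorphism germs of source and target) to the germ of $(u,v)\mapsto(u,v^2,v^5)$ at the origin. *)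

(* Defs.v *)
From HB Require Import structures.
From mathcomp Require Import all_boot all_order all_algebra.
From mathcomp Require Import all_classical all_reals all_analysis.
From mathcomp Require Import complex.
Import Order.TTheory GRing.Theory Num.Theory.
Import numFieldNormedType.Exports.

Set Implicit Arguments.
Unset Strict Implicit.
Unset Printing Implicit Defensive.

Local Open Scope ring_scope.
Local Open Scope classical_set_scope.

(* the complex plane C, as a normed module over itself: derivable g z 1 is
   complex differentiability (holomorphy) *)
Notation Cplx R := ((R[i])^o).

Section Defs.
Variable R : realType.
Local Notation C := (Cplx R).

Definition toC (w : 'rV[R]_2) : C := (Complex (w 0 0) (w 0 1) : R[i]).
Definition ofC (z : C) : 'rV[R]_2 :=
  \row_(j < 2) (if val j == 0%N then complex.Re (z : R[i]) else complex.Im (z : R[i])).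

Definition mx2 (a b c d : C) : 'M[C]_2 :=
  \matrix_(i < 2, j < 2)
    (if val i == 0%N then (if val j == 0%N then a else b)
     else (if val j == 0%N then c else d)).

Definition e3 : 'M[C]_2 := mx2 1 0 0 (-1).

Definition adjC (X : 'M[C]_2) : 'M[C]_2 := (map_mx Num.conj X)^T.

(* identification Herm(2) = L^4 :
   (x0,x1,x2,x3) <-> [[x0 + x3, x1 + i x2], [x1 - i x2, x0 - x3]] *)
Definition herm_of (x : 'rV[R]_4) : 'M[C]_2 :=
  mx2 (Complex (x 0 0 + x 0 3) 0) (Complex (x 0 1) (x 0 2))
      (Complex (x 0 1) (- x 0 2)) (Complex (x 0 0 - x 0 3) 0).

Definition herm_coord (X : 'M[C]_2) : 'rV[R]_4 :=
  \row_(j < 4)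
    (match val j with
     | 0%N => complex.Re (((X 0 0 + X 1 1) / 2 : C) : R[i])
     | 1%N => complex.Re (X 0 1 : R[i])
     | 2%N => complex.Im (X 0 1 : R[i])
     | _ => complex.Re (((X 0 0 - X 1 1) / 2 : C) : R[i])
     end).

Definition deSitter3 : set 'rV[R]_4 := [set x | \det (herm_of x) = -1].

Fixpoint Ck (n m : nat) (k : nat) (U : set 'rV[R]_n)
    (f : 'rV[R]_n -> 'rV[R]_m) : Prop :=
  match k with
  | 0%N => forall x, U x -> {for x, continuous f}
  | k'.+1 => (forall x, U x -> {for x, continuous f}) /\
     forall i : 'I_n, (forall x, U x -> derivable f x (delta_mx 0 i)) /\
                      Ck k' U (fun x => 'D_(delta_mx 0 i) f x)
  end.
Definition smooth_on (n m : nat) (U : set 'rV[R]_n) (f : 'rV[R]_n -> 'rV[R]_m) :=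
  forall k, Ck k U f.

Fixpoint Ck_curve (m : nat) (k : nat) (I : set R) (c : R -> 'rV[R]_m) : Prop :=
  match k with
  | 0%N => forall t, I t -> {for t, continuous c}
  | k'.+1 => (forall t, I t -> {for t, continuous c}) /\
             (forall t, I t -> derivable c t 1) /\ Ck_curve k' I ('D_1 c)
  end.
Definition smooth_curve (m : nat) (I : set R) (c : R -> 'rV[R]_m) :=
  forall k, Ck_curve k I c.

(* Weierstrass data (g, omega = h dz) of a CMC 1 face on the domain D;
   P is the (discrete) pole set of the meromorphic function g, and F is the
   holomorphic lift F : D -> SL(2,C) with F^{-1} dF = [[g,-g^2],[1,-g]] omega *)
Definition cmc1_data (D P : set C) (g h : C -> C) (F : C -> 'M[C]_2) : Prop :=
  [/\
      open D /\ connected D /\ D !=set0,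
      [/\ P `<=` D, (forall z, D z -> \forall w \near z^', ~ P w),
          (forall z, D z -> ~ P z -> derivable g z 1) &
          (forall q, P q -> exists (U : set C) (k : C -> C),
            [/\ open U /\ U q, U `<=` D, (forall w, U w -> derivable k w 1),
                k q = 0 &
                forall w, U w -> w != q -> g w != 0 /\ k w = (g w)^-1])],
      (* omega = h dz is holomorphic, and (1 + |g|^2)^2 |omega|^2 is a
         Riemannian metric on D: positive off the poles, and at a pole q it
         extends to the positive value |g^2 h|^2(q) *)
      [/\ (forall z, D z -> derivable h z 1),
          (forall z, D z -> ~ P z -> 0 < (1 + `|g z| ^+ 2) ^+ 2 * `|h z| ^+ 2) &
          (forall q, P q -> exists (U : set C) (m : C -> C),
            [/\ open U, U q, (forall w, U w -> derivable m w 1), m q != 0 &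
                forall w, U w -> w != q -> m w = g w ^+ 2 * h w])],
      (exists z, [/\ D z, ~ P z & 1 - `|g z| ^+ 2 != 0]) &
      (forall z, D z -> derivable F z 1 /\ \det (F z) = 1) /\
      (forall z, D z -> ~ P z ->
         invmx (F z) *m 'D_1 F z = h z *: mx2 (g z) (- g z ^+ 2) 1 (- g z))].

Definition cmc1_face (F : C -> 'M[C]_2) (w : 'rV[R]_2) : 'rV[R]_4 :=
  herm_coord (F (toC w) *m e3 *m adjC (F (toC w))).

Definition singular_point (f : 'rV[R]_2 -> 'rV[R]_4) (w : 'rV[R]_2) : Prop :=
  ~ (differentiable f w /\ injective ('d f w)).

Definition singular_set (D : set C) (f : 'rV[R]_2 -> 'rV[R]_4) : set C :=
  [set z | D z /\ singular_point f (ofC z)].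

Definition singular_curve (D : set C) (f : 'rV[R]_2 -> 'rV[R]_4) (p : C)
    (gam : R -> 'rV[R]_2) (eps : R) : Prop :=
  [/\ 0 < eps,
      smooth_curve `]- eps, eps[%classic gam,
      (forall t, `]- eps, eps[%classic t -> 'D_1 gam t != 0),
      gam 0 = ofC p /\ (forall t, `]- eps, eps[%classic t -> D (toC (gam t))) &
      exists U : set C, [/\ open U, U p &
        forall z, U z ->
          (singular_set D f z <-> exists2 t, `]- eps, eps[%classic t & toC (gam t) = z)]].

Definition diffeo_germ (n : nat) (a b : 'rV[R]_n) (U : set 'rV[R]_n)
    (s : 'rV[R]_n -> 'rV[R]_n) : Prop :=
  exists (V : set 'rV[R]_n) (sinv : 'rV[R]_n -> 'rV[R]_n),
  [/\ open U /\ U a, open V /\ V b, s a = b,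
      smooth_on U s /\ smooth_on V sinv &
      (forall x, U x -> V (s x) /\ sinv (s x) = x) /\
      (forall y, V y -> U (sinv y) /\ s (sinv y) = y)].

Definition chart_germ (q : 'rV[R]_4) (U : set 'rV[R]_4)
    (Psi : 'rV[R]_4 -> 'rV[R]_3) : Prop :=
  exists (V : set 'rV[R]_3) (Phi : 'rV[R]_3 -> 'rV[R]_4),
  [/\ open U /\ U q /\ deSitter3 q, open V /\ V 0, Psi q = 0,
      smooth_on U Psi /\ smooth_on V Phi &
      (forall x, U x -> deSitter3 x -> V (Psi x) /\ Phi (Psi x) = x) /\
      (forall y, V y -> (U (Phi y) /\ deSitter3 (Phi y)) /\ Psi (Phi y) = y)].

Definition cusp52 (w : 'rV[R]_2) : 'rV[R]_3 :=
  \row_(j < 3) (match val j with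
                | 0%N => w 0 0
                | 1%N => w 0 1 ^+ 2
                | _ => w 0 1 ^+ 5
                end).

Definition cuspidal_edge_52 (D : set C) (f : 'rV[R]_2 -> 'rV[R]_4) (p : C) : Prop :=
  exists (Us : set 'rV[R]_2) (s : 'rV[R]_2 -> 'rV[R]_2)
         (Ut : set 'rV[R]_4) (Psi : 'rV[R]_4 -> 'rV[R]_3) (W : set 'rV[R]_2),
  [/\ diffeo_germ 0 (ofC p) Us s, chart_germ (f (ofC p)) Ut Psi,
      open W /\ W 0 /\ W `<=` Us &
      forall w, W w ->
        [/\ D (toC (s w)), Ut (f (s w)) & Psi (f (s w)) = cusp52 w]].

Definition phi_fn (g h : C -> C) (z : C) : C := 'D_1 g z / (g z ^+ 2 * h z).

End Defs.

(* Main.v *)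
(** Off the poles the singular set is |g| = 1, and poles are regular points.

    Necessity.  If f(s(u,v)) = Phi(u,v^2,v^5), then d_v f = v K with K even in v
    up to O(v^3).  Transported by the frame, Z = F^-1 K F^-* satisfies a linear
    relation with coefficients in g and its conjugate for v <> 0, hence also its
    v-derivative at v = 0; as f o s is an immersion off v = 0 and d_u f, K are
    independent at v = 0, this forces g' <> 0 and Re phi = 0 on v = 0.

    Sufficiency.  With g0 = g(p), zeta = -i (g - g0)/(g + g0) is a holomorphic
    coordinate straightening the singular set to the real axis.  After an isometry
    of de Sitter space the entries of f are
      i (m_i conj(m_j') - m_i' conj(m_j)) + 2 Im(zeta) m_i' conj(m_j'),
    where m_1, m_2 solve m'' = i beta m and beta = i k^2 / (4 phi) with k real on
    the real axis: beta is real there exactly when Re phi = 0.  On the curves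
    zeta = x - (2/3) beta(x) y^3 + i y the real parts of these entries have no y-
    and y^3-terms, so that they are smooth functions of (x, y^2, y^5), and
    beta(0) <> 0 makes these functions a local diffeomorphism. *)

Require Import Defs.
From HB Require Import structures.
From mathcomp Require Import all_boot all_order all_algebra.
From mathcomp Require Import all_classical all_reals all_analysis.
From mathcomp Require Import complex ring lra.
Import Order.TTheory GRing.Theory Num.Theory.
Import numFieldNormedType.Exports.
Set Implicit Arguments.
Unset Strict Implicit.
Unset Printing Implicit Defensive.
Local Open Scope ring_scope.
Local Open Scope classical_set_scope.

(** * Smooth maps and the inverse function theorem *)

Section scalar_Ck.
Context {R : realType}.

(** That an even part is a smooth function of y^2 is not taken from a division theorem for smooth
    functions. Along a sheared curve, conjugates are replaced by holomorphic reflections; each entry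
    becomes holomorphic in the curve parameter, and Cauchy integrals over a fixed circle give its
    even and odd parts as functions jointly smooth in x and w = y^2. The shear is forced: for a
    shear of size l, the y^3-coefficient of the entry (i, j) is (4 beta^2 - 6 l beta) m_i conj(m_j)
    / 3, so one l removes it from all entries at once. Reality of beta makes l real and also removes
    the linear term. Real parts of three entries suffice as coordinates: det = -1 gives the
    remaining imaginary part up to sign, and the sign is fixed near the base point. In the necessity
    part the obstacle is that N, the frame expression of the v-derivative, vanishes on v = 0. Its
    linear relation holds for N / v off v = 0 and is carried to v = 0 by continuity, together with
    its first derivative; the derivative of K vanishes there, so only the frame contributes. *)

Fixpoint sCk (n k : nat) (U : set 'rV[R]_n) (f : 'rV[R]_n -> R) : Prop :=
  match k with
  | 0%N => forall x, U x -> {for x, continuous f}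
  | k'.+1 => (forall x, U x -> {for x, continuous f}) /\
     forall i : 'I_n, (forall x, U x -> derivable f x (delta_mx 0 i)) /\
                      sCk k' U (fun x => 'D_(delta_mx 0 i) f x)
  end.

Definition ssmooth (n : nat) (U : set 'rV[R]_n) (f : 'rV[R]_n -> R) :=
  forall k, sCk k U f.

Lemma open_near (T : topologicalType) (U : set T) (x : T) (P : T -> Prop) :
  open U -> U x -> (forall y, U y -> P y) -> \forall y \near x, P y.
Proof. by move=> oU Ux UP; apply: filterS UP _; exact: open_nbhs_nbhs. Qed.

Lemma sCk_cont n k U (f : 'rV[R]_n -> R) x : sCk k U f -> U x ->
  {for x, continuous f}.
Proof. by case: k => [|k] /=; [apply|case=> + _; apply]. Qed.


Lemma continuous_ext (T W : topologicalType) (U : set T) (f g : T -> W) x :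
  open U -> U x -> (forall y, U y -> f y = g y) ->
  {for x, continuous f} -> {for x, continuous g}.
Proof.
move=> oU Ux fg cf; rewrite /prop_for /continuous_at -(fg x Ux).
apply: cvg_trans cf; apply: near_eq_cvg.
exact: open_near fg.
Qed.

Lemma sCk_ext n k (U : set 'rV[R]_n) f g : open U ->
  (forall x, U x -> f x = g x) -> sCk k U f -> sCk k U g.
Proof.
move=> oU; elim: k f g => [|k IH] f g fg /=.
  by move=> cf x Ux; apply: continuous_ext fg (cf x Ux).
move=> [cf df]; split; first by move=> x Ux; apply: continuous_ext fg (cf x Ux).
move=> i; have [di Ci] := df i; split=> [x Ux|].
  by apply: near_eq_derivable (di x Ux); exact: open_near fg.
apply: IH Ci => x Ux; apply: near_eq_derive; exact: open_near fg.
Qed.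

Lemma sCk_le n k (U : set 'rV[R]_n) f : sCk k.+1 U f -> sCk k U f.
Proof.
elim: k f => [|k IH] f; first by case.
move=> [cf df]; split=> // i; have [di Ci] := df i; split=> //; exact: IH.
Qed.

Lemma sCk_sub n k (U V : set 'rV[R]_n) f : V `<=` U -> sCk k U f -> sCk k V f.
Proof.
move=> VU; elim: k f => [|k IH] f; first by move=> cf x /VU; exact: cf.
move=> [cf df]; split=> [x /VU|i]; first exact: cf.
by have [di Ci] := df i; split=> [x /VU|]; [exact: di|exact: IH].
Qed.

Lemma sCk_cst n k (U : set 'rV[R]_n) c : open U -> sCk k U (fun=> c).
Proof.
move=> oU; elim: k c => [|k IH] c; first by move=> x _; exact: cst_continuous.
split=> [x _|i]; first exact: cst_continuous.
split=> [x _|]; first exact: derivable_cst.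
by apply: (sCk_ext oU _ (IH 0)) => x _; rewrite derive_cst.
Qed.

Lemma is_derive_coord n (x v : 'rV[R]_n) j :
  is_derive x v (fun y : 'rV[R]_n => y 0 j) (v 0 j).
Proof.
have df := @differentiable_coord R 1 n x 0 j.
apply: DeriveDef; first exact: diff_derivable.
apply/cvg_lim => //.
apply: cvg_near_cst; near=> h.
have h0 : h != 0 by near: h; exact: nbhs_dnbhs_neq.
by rewrite /= !mxE addrK /GRing.scale /= mulKf.
Unshelve. all: by end_near. Qed.

Lemma sCk_coord n k (U : set 'rV[R]_n) j : open U -> sCk k U (fun x => x 0 j).
Proof.
move=> oU; case: k => [|k]; first by move=> x _; exact: coord_continuous.
split=> [x _|i]; first exact: coord_continuous.
split=> [x _|]; first by have [] := is_derive_coord x (delta_mx 0 i) j.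
apply: (sCk_ext oU _ (sCk_cst k ((delta_mx 0 i : 'rV[R]_n) 0 j) oU)) => x _.
by have [_ ->] := is_derive_coord x (delta_mx 0 i) j.
Qed.

Lemma sCkD n k (U : set 'rV[R]_n) f g : open U -> sCk k U f -> sCk k U g ->
  sCk k U (fun x => f x + g x).
Proof.
move=> oU; elim: k f g => [|k IH] f g.
  by move=> cf cg x Ux; exact: (continuousD (cf x Ux) (cg x Ux)).
move=> [cf df] [cg dg]; split=> [x Ux|i].
  by exact: (continuousD (cf x Ux) (cg x Ux)).
have [dfi Cfi] := df i; have [dgi Cgi] := dg i; split=> [x Ux|].
  by apply: derivableD; [exact: dfi|exact: dgi].
apply: (sCk_ext oU _ (IH _ _ Cfi Cgi)) => x Ux.
by rewrite -deriveD; [|exact: dfi|exact: dgi].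
Qed.

Lemma sCkM n k (U : set 'rV[R]_n) f g : open U -> sCk k U f -> sCk k U g ->
  sCk k U (fun x => f x * g x).
Proof.
move=> oU; elim: k f g => [|k IH] f g.
  by move=> cf cg x Ux; exact: (continuousM (cf x Ux) (cg x Ux)).
move=> Cf Cg; have Cf' := sCk_le Cf; have Cg' := sCk_le Cg.
move: Cf Cg => [cf df] [cg dg]; split=> [x Ux|i].
  by exact: (continuousM (cf x Ux) (cg x Ux)).
have [dfi Cfi] := df i; have [dgi Cgi] := dg i; split=> [x Ux|].
  by apply: derivableM; [exact: dfi|exact: dgi].
apply: (sCk_ext oU _ (sCkD oU (IH _ _ Cf' Cgi) (IH _ _ Cg' Cfi))) => x Ux.
rewrite -[LHS]deriveM //; [exact: dfi|exact: dgi].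
Qed.

Lemma sCk_sum n k (U : set 'rV[R]_n) (I : Type) (r : seq I) (P : pred I) f :
  open U -> (forall i, sCk k U (f i)) ->
  sCk k U (fun x => \sum_(i <- r | P i) f i x).
Proof.
move=> oU Cf; elim: r => [|a r IH].
  by apply: (sCk_ext oU _ (sCk_cst k 0 oU)) => x _; rewrite big_nil.
case Pa : (P a).
  apply: (sCk_ext oU _ (sCkD oU (Cf a) IH)) => x _.
  by rewrite big_cons Pa.
by apply: (sCk_ext oU _ IH) => x _; rewrite big_cons Pa.
Qed.

Lemma sCk_prod n k (U : set 'rV[R]_n) (I : Type) (r : seq I) (P : pred I) f :
  open U -> (forall i, sCk k U (f i)) ->
  sCk k U (fun x => \prod_(i <- r | P i) f i x).
Proof.
move=> oU Cf; elim: r => [|a r IH].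
  by apply: (sCk_ext oU _ (sCk_cst k 1 oU)) => x _; rewrite big_nil.
case Pa : (P a).
  apply: (sCk_ext oU _ (sCkM oU (Cf a) IH)) => x _.
  by rewrite big_cons Pa.
by apply: (sCk_ext oU _ IH) => x _; rewrite big_cons Pa.
Qed.

Lemma sCkN n k (U : set 'rV[R]_n) f : open U -> sCk k U f ->
  sCk k U (fun x => - f x).
Proof.
move=> oU Cf; apply: (sCk_ext oU _ (sCkM oU (sCk_cst k (-1) oU) Cf)) => x _.
by rewrite mulN1r.
Qed.

Lemma sCkB n k (U : set 'rV[R]_n) f g : open U -> sCk k U f -> sCk k U g ->
  sCk k U (fun x => f x - g x).
Proof. by move=> oU Cf Cg; apply: sCkD => //; exact: sCkN. Qed.

Lemma sCkV n k (U : set 'rV[R]_n) f : open U -> (forall x, U x -> f x != 0) ->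
  sCk k U f -> sCk k U (fun x => (f x)^-1).
Proof.
move=> oU f0; elim: k => [|k IH].
  by move=> cf x Ux; exact: (continuousV (f0 x Ux) (cf x Ux)).
move=> Cf; have Cf' := IH (sCk_le Cf).
move: Cf => [cf df]; split=> [x Ux|i].
  by exact: (continuousV (f0 x Ux) (cf x Ux)).
have [dfi Cfi] := df i; split=> [x Ux|].
  by apply: derivableV; [exact: f0|exact: dfi].
apply: (sCk_ext oU _ (sCkN oU (sCkM oU (sCkM oU Cf' Cf') Cfi))) => x Ux.
rewrite -[RHS]/('D_(delta_mx 0 i) (fun y => (f y)^-1) x).
rewrite deriveV; [|exact: f0|exact: dfi].
by rewrite /GRing.scale /= -mulNr -exprVn expr2.
Qed.

Lemma sCkX n k (U : set 'rV[R]_n) f m : open U -> sCk k U f ->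
  sCk k U (fun x => f x ^+ m).
Proof.
move=> oU Cf; elim: m => [|m IH].
  exact: sCk_cst.
by apply: (sCk_ext oU _ (sCkM oU Cf IH)) => x _; rewrite exprS.
Qed.

Lemma for_continuous_mxP (T : topologicalType) m n (f : T -> 'M[R]_(m, n)) x :
  {for x, continuous f} <-> forall i j, {for x, continuous (fun y => f y i j)}.
Proof.
split=> [cf i j|cf].
  apply: (@continuous_comp _ _ _ f (fun M : 'M[R]_(m, n) => M i j)) => //.
  exact: coord_continuous.
apply/cvg_ballP => e e0.
near=> y; split=> // i j.
by move: i j; near: y; do 2 (apply: filter_forall => ?);
  exact: ((cvg_ballP _ _).1 (cf _ _) _ e0).
Unshelve. all: by end_near. Qed.

(** Products, quotients and determinants live on scalar coordinates; this is the passage between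
    them and vector-valued maps. *)
Lemma CkP n m k (U : set 'rV[R]_n) (f : 'rV[R]_n -> 'rV[R]_m) : open U ->
  Ck k U f <-> forall j, sCk k U (fun x => f x 0 j).
Proof.
move=> oU; elim: k f => [|k IH] f.
  split=> [cf j x Ux|cf x Ux]; first exact: (for_continuous_mxP f x).1 (cf x Ux) 0 j.
  by apply: (for_continuous_mxP f x).2 => i j; rewrite ord1; exact: cf.
split=> [[cf df] j|Cf].
  split=> [x Ux|i]; first exact: (for_continuous_mxP f x).1 (cf x Ux) 0 j.
  have [di /IH Ci] := df i; split=> [x Ux|].
    by move/derivable_mxP : (di x Ux).
  apply: (sCk_ext oU _ (Ci j)) => x Ux.
  by rewrite derive_mx ?mxE//; exact: di.
have di i x : U x -> derivable f x (delta_mx 0 i).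
  move=> Ux; apply/derivable_mxP => a j; rewrite ord1; exact: ((Cf j).2 i).1.
split=> [x Ux|i].
  by apply: (for_continuous_mxP f x).2 => i j; rewrite ord1; exact: (Cf j).1.
split; first exact: di.
apply/IH => j.
apply: (sCk_ext oU _ ((Cf j).2 i).2) => x Ux.
by rewrite derive_mx ?mxE//; exact: di.
Qed.

Lemma smoothP n m (U : set 'rV[R]_n) (f : 'rV[R]_n -> 'rV[R]_m) : open U ->
  smooth_on U f <-> forall j, ssmooth U (fun x => f x 0 j).
Proof.
move=> oU; split=> [Cf j k|Cf k]; last by apply/CkP => // j; exact: Cf.
by move/(CkP _ _ oU) : (Cf k); apply.
Qed.

(** * Differentiability of C^1 maps and the chain rule *)

Lemma is_derive_line (V W : normedModType R) (f : V -> W) (x v : V) (t : R) :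
  derivable f (x + t *: v) v ->
  is_derive t 1 (fun s => f (x + s *: v)) ('D_v f (x + t *: v)).
Proof.
move=> df.
have E : (fun h : R => h^-1 *: ((fun s => f (x + s *: v)) (h *: 1 + t) -
    f (x + t *: v))) =
   (fun h : R => h^-1 *: (f (h *: v + (x + t *: v)) - f (x + t *: v))).
  apply/funext => h; congr (_ *: (f _ - _)).
  by rewrite scalerDl [_%:A]mulr1 addrCA.
apply: DeriveDef; first by rewrite /derivable /= E.
by rewrite /derive /= E.
Qed.

(** The increments to which it is applied, such as [h 0 i], carry no sign, hence the unordered
    endpoints. *)
Lemma MVT_any (f df : R -> R) (a b : R) :
  (forall x, Num.min a b <= x <= Num.max a b -> is_derive x 1 f (df x)) ->
  exists2 c, Num.min a b <= c <= Num.max a b & f b - f a = df c * (b - a).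
Proof.
wlog ab : a b / a <= b => [H|] dfx.
  have [ab|/ltW ba] := leP a b; first by move: (H a b ab dfx); rewrite min_l ?max_r.
  have [x xab|c] := H b a ba; first by apply: dfx; rewrite minC maxC.
  rewrite min_l // max_r // => cab E; exists c => //.
  by rewrite -(opprB (f a)) E -mulrN opprB.
move: dfx; rewrite min_l // max_r // => dfx.
have [||c cab E] := @MVT_segment R f df a b ab.
- by move=> x xab; apply: dfx; move: xab; rewrite in_itv /= => /andP[/ltW -> /ltW ->].
- apply: derivable_within_continuous => x xab.
  by have [] := dfx x xab.
- by exists c => //; move: cab; rewrite in_itv.
Qed.
Lemma between_norm (a s : R) : Num.min 0 a <= s <= Num.max 0 a -> `|s| <= `|a|.
Proof.
have [a0|a0] := leP 0 a => /andP[s1 s2].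
  by rewrite !ger0_norm.
by rewrite (ltr0_norm a0) ler0_norm // lerN2.
Qed.

Lemma coord_le_norm n (h : 'rV[R]_n) i : `|h 0 i| <= `|h|.
Proof.
rewrite [leRHS]/Num.Def.normr /= mx_normrE.
exact: (le_bigmax _ (fun ij : 'I_1 * 'I_n => `|h ij.1 ij.2|) (0, i)).
Qed.

Lemma row_norm_le n (h : 'rV[R]_n) c : 0 <= c -> (forall i, `|h 0 i| <= c) -> `|h| <= c.
Proof.
move=> c0 hc; rewrite [leLHS]/Num.Def.normr /= mx_normrE.
by apply/bigmax_leP; split=> // -[i j] _; rewrite ord1; exact: hc.
Qed.

Lemma row_norm_lt n (h : 'rV[R]_n) c : 0 < c -> (forall i, `|h 0 i| < c) -> `|h| < c.
Proof.
move=> c0 hc; rewrite [ltLHS]/Num.Def.normr /= mx_normrE.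
by apply/bigmax_ltP; split=> // -[i j] _; rewrite ord1; exact: hc.
Qed.

(** Added to [x], it is corner number [k] of the staircase path from [x] to [x + h], which changes
    one coordinate at a time. *)
Definition row_trunc n (k : nat) (h : 'rV[R]_n) : 'rV[R]_n :=
  \row_j (if (j < k)%N then h 0 j else 0).

(** Each edge of the staircase path is controlled by the one-dimensional mean value theorem, and the
    partial derivative at the intermediate point is close to the one at [x]. *)
Lemma C1_eps n (U : set 'rV[R]_n) f x e : open U -> sCk 1 U f -> U x -> 0 < e ->
  exists2 r, 0 < r & forall h, `|h| < r ->
    `|f (x + h) - f x - \sum_i h 0 i * 'D_(delta_mx 0 i) f x| <= e * `|h|.
Proof.
(* The [n] edges each cost at most [e'] times the norm of [h]; [n.+1] keeps the denominator nonzero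
   in dimension 0. *)
move=> oU Cf Ux e0; pose e' := e / (n.+1)%:R.
have e'0 : 0 < e' by rewrite divr_gt0.
have : \forall y \near x, U y /\
    forall i : 'I_n, `|'D_(delta_mx 0 i) f x - 'D_(delta_mx 0 i) f y| < e'.
  near=> y; split; first by near: y; exact: open_nbhs_nbhs.
  near: y; apply: filter_forall => i.
  have := (Cf.2 i).2 x Ux; move=> /cvgrPdist_lt /(_ _ e'0); exact.
move=> /nbhs_ballP[r /= r0 rP].
exists r => // h hr.
have inball k (s : R) (i : 'I_n) : `|s| <= `|h 0 i| -> (k <= i)%N ->
    ball x r (x + row_trunc k h + s *: delta_mx 0 i).
  move=> sh ki; rewrite -ball_normE /= -addrA opprD addNKr normrN.
  apply: row_norm_lt => // j; rewrite !mxE eqxx /=.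
  apply: le_lt_trans hr; have [->|ji] := eqVneq j i.
    rewrite ltnNge ki /= add0r mulr1; apply: le_trans sh _; exact: coord_le_norm.
  rewrite mulr0 addr0; case: ifP => _; first exact: coord_le_norm.
  by rewrite normr0.
suff H k : (k <= n)%N -> `|f (x + row_trunc k h) - f x -
    \sum_(i < n | (i < k)%N) h 0 i * 'D_(delta_mx 0 i) f x| <= k%:R * e' * `|h|.
  have E : row_trunc n h = h by apply/rowP => i; rewrite mxE ltn_ord.
  have Es : \sum_(i < n | (i < n)%N) h 0 i * 'D_(delta_mx 0 i) f x =
      \sum_i h 0 i * 'D_(delta_mx 0 i) f x.
    by apply: eq_bigl => j; rewrite ltn_ord.
  have := H n (leqnn n); rewrite E Es.
  move=> /le_trans; apply; rewrite ler_wpM2r // mulrCA ler_piMr ?ltW //.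
  by rewrite ltr_pdivrMr // mul1r ltr_nat.
elim: k => [_|k IH kn].
  rewrite big_pred0 // subr0 mul0r mul0r.
  have -> : row_trunc 0 h = 0 by apply/rowP => i; rewrite !mxE.
  by rewrite addr0 subrr normr0.
pose i := Ordinal kn.
have -> : \sum_(j < n | (j < k.+1)%N) h 0 j * 'D_(delta_mx 0 j) f x =
    h 0 i * 'D_(delta_mx 0 i) f x +
    \sum_(j < n | (j < k)%N) h 0 j * 'D_(delta_mx 0 j) f x.
  rewrite (bigD1 i) //=; congr (_ + _); apply: eq_bigl => j.
  by rewrite ltnS -val_eqE /= ltn_neqAle andbC.
have tE : row_trunc k.+1 h = row_trunc k h + h 0 i *: delta_mx 0 i.
  apply/rowP => j; rewrite !mxE eqxx /= ltnS.
  have [->|ji] := eqVneq j i; first by rewrite leqnn ltnn add0r mulr1.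
  rewrite mulr0 addr0; congr (if _ then _ else _).
  by rewrite leq_eqVlt -[_ == _]/(j == i) (negbTE ji).
have [s hs|c cs Ec] := @MVT_any (fun s => f (x + row_trunc k h + s *: delta_mx 0 i))
   (fun s => 'D_(delta_mx 0 i) f (x + row_trunc k h + s *: delta_mx 0 i)) 0 (h 0 i).
  apply: is_derive_line; apply: (Cf.2 i).1.
  apply: (rP _ _).1; apply: inball => //; exact: between_norm.
move: Ec; rewrite scale0r addr0 subr0 -addrA -tE => Ec.
set A := \sum_(_ < n | _) _ in IH *.
have -> : f (x + row_trunc k.+1 h) - f x - (h 0 i * 'D_(delta_mx 0 i) f x + A) =
  (f (x + row_trunc k h) - f x - A) +
  h 0 i * ('D_(delta_mx 0 i) f (x + row_trunc k h + c *: delta_mx 0 i) -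
     'D_(delta_mx 0 i) f x).
  rewrite mulrBr [h 0 i * _ in RHS]mulrC -Ec; ring.
rewrite -natr1 mulrDl mulrDl mul1r; apply: le_trans (ler_normD _ _) _.
apply: lerD; first exact: IH (ltnW kn).
rewrite normrM mulrC; apply: ler_pM => //; last exact: coord_le_norm.
rewrite distrC ltW //; apply: (rP _ _).2; apply: inball => //; exact: between_norm.
Unshelve. all: by end_near. Qed.
Lemma C1_is_diff n (U : set 'rV[R]_n) f x : open U -> sCk 1 U f -> U x ->
  is_diff x f (fun h : 'rV[R]_n => \sum_i h 0 i * 'D_(delta_mx 0 i) f x).
Proof.
move=> oU Cf Ux.
set L := fun h : 'rV[R]_n => _.
have L_lin : linear (L : 'rV[R]_n -> R^o).
  move=> a u v; rewrite /L scaler_sumr -big_split /=; apply: eq_bigr => i _.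
  by rewrite !mxE mulrDl -mulrA.
pose Lm := GRing.isLinear.Build _ _ _ _ (L : 'rV[R]_n -> R^o) L_lin.
pose Ll : {linear 'rV[R]_n -> R^o} := HB.pack (L : 'rV[R]_n -> R^o) Lm.
have Lc : continuous Ll.
  move=> h; apply: (sCk_cont (k := 0) (U := setT) _ I).
  apply: sCk_sum => [|i]; first exact: openT.
  by apply: sCkM; [exact: openT|apply: sCk_coord; exact: openT|apply: sCk_cst; exact: openT].
pose fo : 'rV[R]_n -> R^o := f.
have dE0 := @diff_unique R 'rV[R]_n R^o fo Ll x Lc.
(* The goal is read off the premise of [dE0]: it is the little-o estimate supplied by [C1_eps]. *)
have E : ltac:(match type of dE0 with ?A -> _ => exact A end).
  apply/eqaddoP => e e0.
  have [r r0 rP] := C1_eps oU Cf Ux e0.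
  near=> h => /=.
  have hr : `|h| < r.
    near: h; apply/nbhs_ballP; exists r => // h.
    by rewrite -ball_normE /= sub0r normrN.
  rewrite -[X in `|X|]/(f (h + x) - (f x + L h)) opprD addrA [h + x]addrC.
  exact: rP.
have dE := dE0 E.
apply: DiffDef => //; apply/diff_locallyP; rewrite dE; split=> //.
Unshelve. all: by end_near. Qed.

Lemma derive_lineE (V W : normedModType R) (psi : V -> W) t v :
  'D_1 (fun s : R => psi (s *: v + t)) 0 = 'D_v psi t.
Proof.
rewrite /derive; set g1 := fun h : R => h^-1 *: _; set g2 := fun h : R => h^-1 *: _.
suff -> : g1 = g2 by [].
by rewrite funeqE /g1 /g2 => h /=; rewrite addr0 scale0r add0r [_%:A]mulr1.
Qed.

(** Only a directional derivative of [psi] is assumed. Restricted to the line through [t], [psi]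
    becomes a curve, for which derivable means differentiable, and the usual chain rule applies. *)
Lemma C1_comp_derive n (V : normedModType R) (U : set 'rV[R]_n) f
    (psi : V -> 'rV[R]_n) t v : open U -> sCk 1 U f -> U (psi t) ->
  derivable psi t v ->
  is_derive t v (f \o psi) (\sum_i ('D_v psi t) 0 i * 'D_(delta_mx 0 i) f (psi t)).
Proof.
move=> oU Cf Upsi dpsi.
pose ps (s : R) := psi (s *: v + t).
have [df dfE] := C1_is_diff oU Cf Upsi.
have dps : differentiable (ps : R^o -> _) 0.
  by apply/derivable1_diffP; move/derivable1P : dpsi.
have ps0 : ps 0 = psi t by rewrite /ps scale0r add0r.
have df0 : differentiable f (ps 0) by rewrite ps0.
have dfp : differentiable (f \o ps) 0 by apply: differentiable_comp.
apply: DeriveDef; first by apply/derivable1P/derivable1_diffP.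
rewrite -(derive_lineE (f \o psi)) -[fun s => _]/(f \o ps).
rewrite deriveE // diff_comp //= ps0 dfE; apply: eq_bigr => i _.
by rewrite -(derive_lineE psi) (@deriveE _ _ _ ps 0 1 dps).
Qed.

Lemma sCk_comp n m k (U : set 'rV[R]_n) (V : set 'rV[R]_m) f psi :
  open U -> open V -> (forall x, U x -> V (psi x)) -> sCk k V f ->
  (forall j, sCk k U (fun x => psi x 0 j)) -> sCk k U (fun x => f (psi x)).
Proof.
move=> oU oV UV; elim: k f psi UV => [|k IH] f psi UV Cf Cpsi.
  move=> x Ux; apply: (@continuous_comp _ _ _ psi f).
    by apply: (for_continuous_mxP psi x).2 => i j; rewrite ord1; exact: Cpsi.
  exact: Cf (UV _ Ux).
have Cf1 : sCk 1 V f by clear -Cf; elim: k Cf => // k IH /sCk_le.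
have dpsi x v : U x -> derivable psi x v.
  move=> Ux; apply/derivable_mxP => a j; rewrite ord1.
  have C1 : sCk 1 U (fun x => psi x 0 j).
    by move: (Cpsi j); clear; elim: k => // k IH /sCk_le.
  by have [+ _] := C1_is_diff oU C1 Ux; exact: diff_derivable.
split=> [x Ux|i].
  apply: (@continuous_comp _ _ _ psi f).
    apply: (for_continuous_mxP psi x).2 => i j; rewrite ord1.
    exact: sCk_cont (Cpsi j) Ux.
  exact: sCk_cont Cf (UV _ Ux).
have dfp x : U x -> is_derive x (delta_mx 0 i) (f \o psi)
    (\sum_j ('D_(delta_mx 0 i) psi x) 0 j * 'D_(delta_mx 0 j) f (psi x)).
  by move=> Ux; apply: C1_comp_derive oV Cf1 (UV _ Ux) (dpsi _ _ Ux).
split=> [x Ux|]; first by have [] := dfp x Ux.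
apply: (@sCk_ext n k U (fun x =>
    \sum_j 'D_(delta_mx 0 i) (fun y => psi y 0 j) x * 'D_(delta_mx 0 j) f (psi x))) => //.
  move=> x Ux; have [_ ->] := dfp x Ux; apply: eq_bigr => j _.
  by rewrite derive_mx ?mxE//; exact: dpsi.
apply: sCk_sum => // j; apply: sCkM => //; first exact: ((Cpsi j).2 i).2.
apply: (IH ('D_(delta_mx 0 j) f) psi) => //; first exact: (Cf.2 j).2.
by move=> a; apply: sCk_le; exact: Cpsi.
Qed.
Lemma C1_derivable n (U : set 'rV[R]_n) f x v : open U -> sCk 1 U f -> U x ->
  derivable f x v.
Proof. by move=> oU Cf Ux; have [+ _] := C1_is_diff oU Cf Ux; exact: diff_derivable. Qed.

Lemma C1_derive n (U : set 'rV[R]_n) f x v : open U -> sCk 1 U f -> U x ->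
  'D_v f x = \sum_i v 0 i * 'D_(delta_mx 0 i) f x.
Proof. by move=> oU Cf Ux; have [df dE] := C1_is_diff oU Cf Ux; rewrite deriveE // dE. Qed.

(** * Contractions and the inverse function theorem *)

Lemma ball_convex n (a x y : 'rV[R]_n) r s : ball a r x -> ball a r y ->
  0 <= s <= 1 -> ball a r (x + s *: (y - x)).
Proof.
rewrite -ball_normE /= => ax ay /andP[s0 s1].
have -> : a - (x + s *: (y - x)) = (1 - s) *: (a - x) + s *: (a - y).
  by apply/rowP => i; rewrite !mxE; ring.
apply: le_lt_trans (ler_normD _ _) _; rewrite !normrZ.
rewrite (ger0_norm s0) ger0_norm ?subr_ge0 //.
have [->|sn0] := eqVneq s 0; first by rewrite subr0 mul1r mul0r addr0.
have s0' : 0 < s by rewrite lt_neqAle eq_sym sn0.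
have -> : r = (1 - s) * r + s * r by ring.
by apply: ler_ltD; [rewrite ler_wpM2l ?subr_ge0 // ltW|rewrite ltr_pM2l].
Qed.

Lemma C1_lipschitz n (U : set 'rV[R]_n) f a r c x y :
  open U -> sCk 1 U f -> ball a r `<=` U -> 0 <= c ->
  (forall z i, ball a r z -> `|'D_(delta_mx 0 i) f z| <= c) ->
  ball a r x -> ball a r y -> `|f y - f x| <= n%:R * c * `|y - x|.
Proof.
move=> oU Cf BU c0 Dc Bx By.
have [s|s s01] := @MVT_any (fun s => f (x + s *: (y - x)))
   (fun s => 'D_(y - x) f (x + s *: (y - x))) 0 1.
  rewrite min_l ?max_r ?ler01 // => s01; apply: is_derive_line.
  by apply: C1_derivable oU Cf _; apply: BU; exact: ball_convex.
rewrite min_l ?max_r ?ler01 // in s01.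
rewrite scale0r addr0 scale1r addrCA subrr addr0 subr0 mulr1 => ->.
have Bs : ball a r (x + s *: (y - x)) by exact: ball_convex.
rewrite (C1_derive _ oU Cf (BU _ Bs)).
apply: le_trans (ler_norm_sum _ _ _) _.
have -> : n%:R * c * `|y - x| = \sum_(i < n) (`|y - x| * c).
  by rewrite sumr_const card_ord -[RHS]mulr_natl mulrAC -mulrA.
apply: ler_sum => i _; rewrite normrM; apply: ler_pM => //; last exact: Dc.
exact: coord_le_norm.
Qed.

Lemma fixed_point_half n (B : set 'rV[R]_n) (T : 'rV[R]_n -> 'rV[R]_n) :
  closed B -> B !=set0 -> (forall x, B x -> B (T x)) ->
  (forall x y, B x -> B y -> `|T x - T y| <= 2^-1 * `|x - y|) ->
  exists2 x, B x & x = T x.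
Proof.
move=> cB B0 TB Tc.
pose F := isFun.Build _ _ B B T TB.
pose Tf : {fun B >-> B} := HB.pack T F.
pose X : completeNormedModType R := HB.pack 'rV[R]_n (Complete.on 'rV[R]_n) (NormedModule.on 'rV[R]_n).
apply: (@banach_fixed_point R X B Tf) => //.
have q0 : (0 : R) <= 2^-1 by rewrite invr_ge0.
exists (NngNum q0); split => /=; first by rewrite invf_lt1 // ltr1n.
by move=> [x y] [Bx By] /=; exact: Tc.
Qed.

Lemma mulmx_norm_le n m (A : 'M[R]_(n, m)) :
  exists2 K, 0 < K & forall u : 'rV[R]_n, `|u *m A| <= K * `|u|.
Proof.
exists (1 + \sum_i \sum_j `|A i j|).
  by rewrite ltr_pwDl // sumr_ge0 // => i _; rewrite sumr_ge0.
move=> u; apply: row_norm_le => [|j].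
  by rewrite mulr_ge0 // addr_ge0 // sumr_ge0 // => i _; rewrite sumr_ge0.
rewrite mxE; apply: le_trans (ler_norm_sum _ _ _) _.
rewrite mulrDl mul1r mulr_suml; apply: ler_wpDl => //.
apply: ler_sum => i _; rewrite normrM mulrC; apply: ler_pM => //.
  rewrite (bigD1 j) //= ler_wpDr // sumr_ge0 //.
exact: coord_le_norm.
Qed.

Lemma sCk_det n k (U : set 'rV[R]_n) m (A : 'rV[R]_n -> 'M[R]_m) : open U ->
  (forall i j, sCk k U (fun x => A x i j)) -> sCk k U (fun x => \det (A x)).
Proof.
move=> oU CA; apply: sCk_sum => // s; apply: sCkM => //; first exact: sCk_cst.
by apply: sCk_prod.
Qed.

(** Cramer's rule: the entries of the inverse are cofactors divided by the determinant. *)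
Lemma sCk_invmx n k (U : set 'rV[R]_n) m (A : 'rV[R]_n -> 'M[R]_m) i j : open U ->
  (forall x, U x -> A x \in unitmx) ->
  (forall i j, sCk k U (fun x => A x i j)) -> sCk k U (fun x => invmx (A x) i j).
Proof.
move=> oU uA CA.
apply: (@sCk_ext _ k U (fun x => (\det (A x))^-1 *
    ((-1) ^+ (j + i) * \det (row' j (col' i (A x)))))) => //.
  by move=> x Ux; rewrite /invmx (uA x Ux) !mxE.
apply: sCkM => //.
  apply: sCkV => //; last exact: sCk_det.
  by move=> x /uA; rewrite unitmxE unitfE.
apply: sCkM => //; first exact: sCk_cst.
apply: sCk_det => // a b.
by apply: sCk_ext (CA (lift j a) (lift i b)) => // x _; rewrite !mxE.
Qed.
Lemma continuous_dist_le (K : numFieldType) (V W : normedModType K) (f : V -> W) x :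
  (forall e, 0 < e -> \forall y \near x, `|f x - f y| <= e) -> {for x, continuous f}.
Proof. by move=> H; apply/cvgrPdist_le. Qed.

Definition jac n m (f : 'rV[R]_n -> 'rV[R]_m) x : 'M[R]_(n, m) :=
  \matrix_(i, j) 'D_(delta_mx 0 i) (fun y => f y 0 j) x.

Lemma sCk_jac n m k (U : set 'rV[R]_n) (f : 'rV[R]_n -> 'rV[R]_m) i j : open U ->
  (forall j, sCk k.+1 U (fun x => f x 0 j)) -> sCk k U (fun x => jac f x i j).
Proof.
by move=> oU Cf; apply: sCk_ext ((Cf j).2 i).2 => // x _; rewrite mxE.
Qed.

Lemma C1_eps_mx n m (U : set 'rV[R]_n) (f : 'rV[R]_n -> 'rV[R]_m) x e :
  open U -> (forall j, sCk 1 U (fun x => f x 0 j)) -> U x -> 0 < e ->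
  \forall h \near (0 : 'rV[R]_n), `|f (x + h) - f x - h *m jac f x| <= e * `|h|.
Proof.
move=> oU Cf Ux e0.
have H (j : 'I_m) : \forall h \near (0 : 'rV[R]_n),
   `|f (x + h) 0 j - f x 0 j - \sum_i h 0 i * jac f x i j| <= e * `|h|.
  have [r r0 rP] := C1_eps oU (Cf j) Ux e0.
  apply/nbhs_ballP; exists r => // h; rewrite -ball_normE /= sub0r normrN => hr.
  apply: le_trans (rP h hr); rewrite le_eqVlt; apply/orP; left; apply/eqP.
  by congr (`|_ - _|); apply: eq_bigr => i _; rewrite mxE.
near=> h; apply: row_norm_le; first by rewrite mulr_ge0 // ltW.
move=> j; rewrite !mxE; move: j; near: h; apply: filter_forall => j; exact: H.
Unshelve. all: by end_near. Qed.

(** With [J] the Jacobian of a map, [N] its inverse and [h] the increment of the inverse map, the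
    error of the difference quotient is the linearization error of the map pushed through [N]. *)
Lemma scaled_residual n (v h : 'rV[R]_n) (J N : 'M[R]_n) t : t != 0 ->
  h *m J *m N = h -> v *m N - t^-1 *: h = t^-1 *: ((t *: v - h *m J) *m N).
Proof.
move=> t0 hN; rewrite mulmxBl hN -scalemxAl scalerBr scalerA mulVf //.
by rewrite scale1r.
Qed.

(** The map [psi x = x - f x *m M] has zero derivative at [a], so it is a 1/2-contraction nearby,
    and f(x) = z is solved as a fixed point of [psi x + z *m M]. The same bound makes the inverse
    Lipschitz, and from this differentiable. *)
Lemma inverse_function n (U : set 'rV[R]_n) (f : 'rV[R]_n -> 'rV[R]_n) a :
  open U -> U a -> smooth_on U f -> jac f a \in unitmx ->
  exists2 W, W `<=` U & diffeo_germ a (f a) W f.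
Proof.
move=> oU Ua sf Ju.
have Cf k j : sCk k U (fun x => f x 0 j) by move/(smoothP f oU) : sf; apply.
pose M := invmx (jac f a); pose psi x := x - f x *m M.
have Cpsi j k : sCk k U (fun x => psi x 0 j).
  apply: (@sCk_ext _ k U (fun x => x 0 j - \sum_i f x 0 i * M i j)) => //.
    by move=> x _; rewrite !mxE.
  apply: sCkB => //; first exact: sCk_coord.
  by apply: sCk_sum => // i; apply: sCkM => //; exact: sCk_cst.
have Dpsi i j : 'D_(delta_mx 0 i) (fun x => psi x 0 j) a = 0.
  have -> : (fun x => psi x 0 j) =
      (fun x : 'rV[R]_n => x 0 j) - (fun x => \sum_i (f x 0 i * M i j)).
    by apply/funext => x; rewrite /psi !mxE.
  have dfM i' : derivable (fun x => f x 0 i') a (delta_mx 0 i).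
    exact: C1_derivable oU (Cf 1%N i') Ua.
  have E : (fun x => \sum_i f x 0 i * M i j) = \sum_i ((fun x => f x 0 i * M i j)).
    by apply/funext => x; rewrite fct_sumE.
  have dM i' : is_derive a (delta_mx 0 i) (fun x => f x 0 i' * M i' j)
     (jac f a i i' * M i' j).
    rewrite (_ : (fun x => f x 0 i' * M i' j) = M i' j *: (fun x => f x 0 i')); last first.
      by apply/funext => x; rewrite mulrC.
    apply: DeriveDef; first exact: derivableZ.
    by rewrite deriveZ //= mxE mulrC.
  have [dc dcE] := is_derive_coord a (delta_mx 0 i) j.
  rewrite (deriveB dc); last first.
    by rewrite E; apply: derivable_sum => i'; have [] := dM i'.
  rewrite dcE E derive_sum; last by move=> i'; have [] := dM i'.
  rewrite (eq_bigr (fun i' => jac f a i i' * M i' j)); last first.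
    by move=> i' _; have [_ ->] := dM i'.
  have : (jac f a *m M) i j = (1%:M : 'M[R]_n) i j by rewrite mulmxV.
  by rewrite !mxE => ->; rewrite eqxx /= eq_sym subrr.
(* A bound [c] on the partials of [psi] gives a Lipschitz constant n c <= 1/2. *)
pose c : R := (2 * n.+1%:R)^-1.
have c0 : 0 < c by rewrite invr_gt0 mulr_gt0.
have cdet : \forall x \near a, \det (jac f x) != 0.
  have /cvgr_neq0 : {for a, continuous (fun x => \det (jac f x))}.
    apply: (sCk_cont (k := 0)) Ua; apply: sCk_det => // i j.
    by apply: sCk_jac.
  by apply; rewrite -unitfE -unitmxE.
have : \forall x \near a, U x /\ (\det (jac f x) != 0 /\
    forall i j, `|'D_(delta_mx 0 i) (fun x => psi x 0 j) x| <= c).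
  near=> x; split; first by near: x; exact: open_nbhs_nbhs.
  split; first by near: x.
  near: x; apply: filter_forall => i; apply: filter_forall => j.
  have : {for a, continuous (fun x => 'D_(delta_mx 0 i) (fun x => psi x 0 j) x)}.
    by have := ((Cpsi j 1%N).2 i).2 a Ua.
  move=> /cvgrPdist_le /(_ _ c0).
  by apply: filterS => x; rewrite Dpsi sub0r normrN.
move=> /nbhs_ballP[r /= r0 rP].
have BU : ball a r `<=` U by move=> x /rP[].
have lip x y : ball a r x -> ball a r y -> `|psi y - psi x| <= 2^-1 * `|y - x|.
  move=> Bx By; apply: row_norm_le => [|j].
    by rewrite mulr_ge0 // invr_ge0.
  rewrite !mxE.
  have := @C1_lipschitz n U (fun x => psi x 0 j) a r c x y oU (Cpsi j 1%N) BU (ltW c0)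
    (fun z i Bz => (rP z Bz).2.2 i j) Bx By.
  rewrite !mxE => /le_trans; apply; rewrite ler_wpM2r //.
  rewrite /c invfM mulrCA ler_piMr ?invr_ge0 //.
  by rewrite ler_pdivrMr // mul1r ler_nat.
have MJ : M *m jac f a = 1%:M by rewrite mulVmx.
have Minj u v : u *m M = v *m M -> u = v :> 'rV[R]_n.
  by move=> /(congr1 (mulmx^~ (jac f a))); rewrite -!mulmxA MJ !mulmx1.
have phiE x y : (f y - f x) *m M = (y - x) - (psi y - psi x).
  by rewrite mulmxBl /psi; apply/rowP => j; rewrite !mxE; ring.
have phi_lb x y : ball a r x -> ball a r y -> `|y - x| <= 2 * `|(f y - f x) *m M|.
  move=> Bx By; rewrite phiE.
  have := lip _ _ Bx By; have := lerB_dist (y - x) (psi y - psi x); lra.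
have r2 : ball a (r / 2) `<=` ball a r by apply: le_ball; lra.
(* If z M lies within r/4 of f(a) M, the map [psi + z *m M] sends the closed ball of radius r/2 into
   the open one: at most r/4 from the contraction, less than r/4 from z. *)
pose V := [set z : 'rV[R]_n | ball (f a *m M) (r / 4) (z *m M)].
have oV : open V.
  apply: (@open_comp _ _ (fun z : 'rV[R]_n => z *m M)); last exact: ball_open.
  move=> z _; apply: (for_continuous_mxP (fun z : 'rV[R]_n => z *m M) z).2 => i j; rewrite ord1.
  apply: (@sCk_cont n 0 setT _ z _ I).
  apply: (@sCk_ext _ 0 setT (fun x => \sum_i x 0 i * M i j) _ openT) => [x _|].
    by rewrite mxE.
  apply: (sCk_sum _ _ openT) => k; apply: (sCkM openT); [exact: sCk_coord openT|exact: sCk_cst openT].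
pose W := [set x | ball a (r / 2) x /\ V (f x)].
have WU : W `<=` U by move=> x [/r2 /BU].
have oW : open W.
  rewrite openE => x Wx; have [Bx Vx] := Wx.
  have cfx : {for x, continuous f}.
    by apply: (for_continuous_mxP f x).2 => i j; rewrite ord1; exact: Cf 0%N j _ (WU _ Wx).
  apply: filterI; first by apply: open_nbhs_nbhs; split => //; exact: ball_open.
  by apply: cfx; exact: open_nbhs_nbhs.
have exinv z : V z -> exists x, ball a (r / 2) x /\ f x = z.
  rewrite /V -ball_normE /= => Vz.
  pose B := closed_ball_ (fun x : 'rV[R]_n => `|x|) a (r / 2).
  have BB x : B x -> ball a r x.
    by rewrite -ball_normE /B /closed_ball_ /= => Bx; apply: le_lt_trans Bx _; lra.
  have TB x : B x -> `|a - (psi x + z *m M)| < r / 2.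
    move=> Bx; have := lip _ _ (BB _ Bx) (ballxx a r0).
    have -> : a - (psi x + z *m M) = (psi a - psi x) + (f a *m M - z *m M).
      by rewrite /psi; apply/rowP => j; rewrite !mxE; ring.
    move: Bx; rewrite /B /closed_ball_ /= => Bx L1.
    apply: le_lt_trans (ler_normD _ _) _; lra.
  have [||x Bx|x y Bx By|x Bx Ex] := @fixed_point_half n B (fun x => psi x + z *m M).
  - exact: closed_closed_ball_.
  - by exists a; rewrite /B /closed_ball_ /= subrr normr0; lra.
  - exact/ltW/TB.
  - by rewrite opprD addrACA subrr addr0; apply: lip; exact: BB.
  exists x; split; first by rewrite {1}Ex; exact: TB.
  apply: Minj; apply/rowP => j; move: Ex => /(congr1 (fun u : 'rV[R]_n => u 0 j)).
  rewrite /psi !mxE; lra.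
pose inv (z : 'rV[R]_n) : 'rV[R]_n := xget a [set x | ball a (r / 2) x /\ f x = z].
have invP z : V z -> ball a (r / 2) (inv z) /\ f (inv z) = z.
  by move=> /exinv; exact: (xgetPex a).
have finj x y : ball a r x -> ball a r y -> f x = f y -> x = y.
  move=> Bx By Exy; have := phi_lb _ _ By Bx; rewrite Exy subrr mul0mx normr0 mulr0.
  by rewrite normr_le0 subr_eq0 => /eqP.
have [K K0 KM] := mulmx_norm_le M.
have inv_lip z z' : V z -> V z' -> `|inv z' - inv z| <= 2 * K * `|z' - z|.
  move=> /invP[Bz Ez] /invP[Bz' Ez'].
  apply: le_trans (phi_lb _ _ (r2 _ Bz) (r2 _ Bz')) _.
  by rewrite Ez Ez' -mulrA ler_pM2l.
have inv_cont z : V z -> {for z, continuous inv}.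
  move=> Vz; apply: continuous_dist_le => e e0.
  near=> z'; rewrite distrC; apply: le_trans (inv_lip _ _ Vz _) _.
    by near: z'; exact: open_nbhs_nbhs.
  rewrite -ler_pdivlMl ?mulr_gt0 //; near: z'; apply/nbhs_ballP.
  exists ((2 * K)^-1 * e); first by rewrite /= mulr_gt0 // invr_gt0 mulr_gt0.
  by move=> z'; rewrite -ball_normE /= distrC => /ltW.
have Ju' z : V z -> jac f (inv z) \in unitmx.
  by move=> /invP[/r2 /rP[_ [d _]] _]; rewrite unitmxE unitfE.
have inv_der z v : V z -> is_derive z v inv (v *m invmx (jac f (inv z))).
  move=> Vz; set N := invmx _; have [KN KN0 KNM] := mulmx_norm_le N.
  suff H : (fun t : R => t^-1 *: (inv (t *: v + z) - inv z)) @ 0^' --> v *m N.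
    by apply: DeriveDef; [exact: cvgP H|exact: cvg_lim H].
  apply/cvgrPdist_le => e e0.
  (* Chosen so that KN e1 times the bound 2 K |v| |t| for the increment stays below e |t|; the added
     1 covers v = 0. *)
  pose e1 := e / (KN * (2 * K * (`|v| + 1))).
  have v1 : 0 < `|v| + 1 by rewrite ltr_wpDl.
  have e10 : 0 < e1 by rewrite divr_gt0 // !mulr_gt0.
  have Bz := BU _ (r2 _ (invP _ Vz).1).
  have F1 := C1_eps_mx oU (Cf 1%N) Bz e10.
  have zc : (t *: v + z) @[t --> (0 : R)] --> z.
    rewrite -[X in _ --> X]add0r -(scale0r v).
    by apply: cvgD; [exact: cvgZr_tmp|exact: cvg_cst].
  have nV : \forall t \near (0 : R), V (t *: v + z).
    by apply: zc; exact: open_nbhs_nbhs.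
  have nF : \forall t \near (0 : R), `|f (inv z + (inv (t *: v + z) - inv z)) - f (inv z)
      - (inv (t *: v + z) - inv z) *m jac f (inv z)| <= e1 * `|inv (t *: v + z) - inv z|.
    have hc : (inv (t *: v + z) - inv z) @[t --> (0 : R)] --> (0 : 'rV[R]_n).
      rewrite -(subrr (inv z)); apply: cvgB; last exact: cvg_cst.
      apply: (@cvg_comp _ _ _ (fun t : R => t *: v + z) inv); first exact: zc.
      exact: inv_cont.
    exact: hc F1.
  near=> t; have t0 : t != 0 by near: t; exact: nbhs_dnbhs_neq.
  have Vt : V (t *: v + z) by near: t; exact: nbhs_dnbhs.
  have : `|f (inv z + (inv (t *: v + z) - inv z)) - f (inv z)
      - (inv (t *: v + z) - inv z) *m jac f (inv z)| <= e1 * `|inv (t *: v + z) - inv z|.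
    by near: t; exact: nbhs_dnbhs.
  have := inv_lip _ _ Vz Vt; rewrite addrK normrZ.
  rewrite (addrC (inv z)) subrK (invP _ Vt).2 (invP _ Vz).2 addrK.
  set h := _ - inv z => hle fle.
  have -> : v *m N - t^-1 *: h = t^-1 *: ((t *: v - h *m jac f (inv z)) *m N).
    have hN : h *m jac f (inv z) *m N = h by rewrite -mulmxA mulmxV ?mulmx1 //; exact: Ju'.
    exact: scaled_residual.
  rewrite normrZ normfV ler_pdivrMl ?normr_gt0 //.
  apply: le_trans (KNM _) _; rewrite mulrC -ler_pdivlMr //.
  apply: le_trans fle _; rewrite mulrC -ler_pdivlMr //.
  apply: le_trans hle _; rewrite /e1.
  have -> : `|t| * e / KN / (e / (KN * (2 * K * (`|v| + 1)))) = 2 * K * (`|t| * (`|v| + 1)).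
    by field; rewrite !gt_eqF.
  by rewrite ler_pM2l ?mulr_gt0 // ler_wpM2l // lerDl.
have Cinv k j : sCk k V (fun z => inv z 0 j).
  elim: k j => [|k IH] j.
    by move=> z Vz; exact: (for_continuous_mxP inv z).1 (inv_cont z Vz) 0 j.
  split=> [z Vz|i]; first exact: (for_continuous_mxP inv z).1 (inv_cont z Vz) 0 j.
  split=> [z Vz|].
    by have [d _] := inv_der z (delta_mx 0 i) Vz; move/derivable_mxP : d; exact.
  (* Bootstrap: the partials of [inv] are entries of the inverse Jacobian composed with [inv]
     itself, so class k of [inv] yields class k + 1. *)
  apply: (@sCk_ext _ k V (fun z => invmx (jac f (inv z)) i j)) => //.
    move=> z Vz; have [d dE] := inv_der z (delta_mx 0 i) Vz.
    have := congr1 (fun u : 'rV[R]_n => u 0 j) dE.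
    by rewrite derive_mx // mxE => ->; rewrite -rowE mxE.
  apply: (@sCk_comp n n k V (ball a r) (fun x => invmx (jac f x) i j) inv) => //.
  - exact: ball_open.
  - by move=> z /invP[/r2].
  - apply: sCk_invmx => [|x /rP[_ [d _]]|a' b]; first exact: ball_open.
      by rewrite unitmxE unitfE.
    by apply: (sCk_sub BU); exact: sCk_jac.
exists W => //; exists V, inv; split => //.
- split=> //; split; first by apply: ballxx; lra.
  by rewrite /V /= ; apply: ballxx; lra.
- by split=> //; rewrite /V /=; apply: ballxx; lra.
- split; first by apply/(smoothP _ oW) => j k; exact: sCk_sub WU (Cf k j).
  by apply/(smoothP _ oV) => j k; exact: Cinv.
- split=> [x [Bx Vx]|z Vz].
    split=> //; apply: finj; [exact: r2 (invP _ Vx).1|exact: r2|exact: (invP _ Vx).2].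
  have [Bz Ez] := invP _ Vz; split=> //; split=> //; by rewrite Ez.
Unshelve. all: by end_near. Qed.

End scalar_Ck.

(** * Cauchy's integral formula *)

Section complex_calculus.
Context {R : realType}.
Local Notation C := (Cplx R).
Local Notation Re := complex.Re.
Local Notation Im := complex.Im.
Local Notation normc := Normc.normc.

Lemma normc_ge0 (z : R[i]) : 0 <= normc z.
Proof. by case: z => a b /=; rewrite sqrtr_ge0. Qed.

Lemma normE (z : R[i]) : `|z| = (normc z)%:C%C.
Proof. by rewrite normc_def; case: z. Qed.

Lemma normc_Re (z : R[i]) : `|Re z| <= normc z.
Proof. by have := normc_ge_Re z; rewrite normE lecR. Qed.

Lemma normc_Im (z : R[i]) : `|Im z| <= normc z.
Proof.
case: z => a b /=; rewrite -sqrtr_sqr ler_sqrt ?lerDr ?sqr_ge0 //.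
by rewrite addr_ge0 // sqr_ge0.
Qed.

Lemma normc_le (z : R[i]) : normc z <= `|Re z| + `|Im z|.
Proof.
case: z => a b /=; rewrite -[leRHS]ger0_norm ?addr_ge0 // -sqrtr_sqr.
rewrite ler_sqrt ?sqr_ge0 // sqrrD !real_normK ?num_real //.
by rewrite addrAC lerDl mulrn_wge0 // mulr_ge0.
Qed.

Lemma normc_real (a : R) : normc a%:C%C = `|a|.
Proof. by rewrite /= expr0n /= addr0 sqrtr_sqr. Qed.

Lemma normc_eq0 (z : R[i]) : (normc z == 0) = (z == 0).
Proof.
apply/eqP/eqP => [/Normc.eq0_normc //|->].
exact: Normc.normc0.
Qed.

Lemma normc_gt0 (z : R[i]) : (0 < normc z) = (z != 0).
Proof. by rewrite lt_neqAle normc_ge0 andbT eq_sym normc_eq0. Qed.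

(** The norm on [R[i]] has values in [R[i]]; estimates are made with the real modulus [normc] and
    real epsilons. *)
Lemma cvg_normcP (T : Type) (F : set_system T) (FF : Filter F) (f : T -> C) (l : C) :
  f @ F --> l <-> forall e : R, 0 < e -> \forall x \near F, normc (l - f x : R[i]) < e.
Proof.
split=> [/cvgrPdist_lt H e e0|H].
  have e0' : (0 : R[i]) < e%:C%C by rewrite ltcR.
  apply: filterS (H _ e0') => x.
  by rewrite [`|_|]normE ltcR.
apply/cvgrPdist_lt => e e0.
have e0' : 0 < Re e by move: e0; rewrite ltcE /= => /andP[].
have eE : e = (Re e)%:C%C :> R[i] by rewrite RRe_real // gtr0_real.
apply: filterS (H _ e0') => x.
by rewrite [`|_|]normE eE ltcR.
Qed.

Lemma cvg_complexP (T : Type) (F : set_system T) (FF : Filter F) (f : T -> C) (l : C) :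
  f @ F --> l <-> ((fun x => Re (f x : R[i])) @ F --> (Re (l : R[i]) : R)) /\
    ((fun x => Im (f x : R[i])) @ F --> (Im (l : R[i]) : R)).
Proof.
split=> [/cvg_normcP H|[/cvgrPdist_lt H1 /cvgrPdist_lt H2]].
  split; apply/cvgrPdist_lt => e e0; apply: filterS (H _ e0) => x; apply: le_lt_trans.
    by rewrite -raddfB; exact: normc_Re.
  by rewrite -raddfB; exact: normc_Im.
apply/cvg_normcP => e e0; have e2 : 0 < e / 2 by rewrite divr_gt0.
near=> x; apply: le_lt_trans (normc_le _) _; rewrite (splitr e) !raddfB /=.
by apply: ltrD; near: x; [exact: H1|exact: H2].
Unshelve. all: by end_near. Qed.

Lemma continuous_complexP (T : topologicalType) (f : T -> C) x :
  {for x, continuous f} <-> {for x, continuous (fun x => Re (f x : R[i]))} /\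
    {for x, continuous (fun x => Im (f x : R[i]))}.
Proof. exact: cvg_complexP. Qed.

Lemma Re_continuous : continuous (fun z : C => Re (z : R[i])).
Proof. by move=> z; have [] := (continuous_complexP id z).1 (@cvg_id _ _). Qed.

Lemma Im_continuous : continuous (fun z : C => Im (z : R[i])).
Proof. by move=> z; have [] := (continuous_complexP id z).1 (@cvg_id _ _). Qed.

Lemma conj_continuous : continuous (fun z : C => (conjc (z : R[i])) : C).
Proof.
move=> z; apply/(continuous_complexP (fun z : C => (conjc (z : R[i])) : C)); split.
  rewrite (_ : (fun _ => _) = fun z : C => Re (z : R[i])); first exact: Re_continuous.
  by apply/funext; case.
rewrite (_ : (fun _ => _) = fun z : C => - Im (z : R[i])).
  by apply: (continuousN (@Im_continuous z)).
by apply/funext; case.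
Qed.

Lemma real_complex_continuous : continuous (fun x : R => (x%:C%C : C)).
Proof.
move=> x; apply/(continuous_complexP (fun x : R => (x%:C%C : C))).
by split => /=; [exact: cvg_id|exact: cvg_cst].
Qed.

(* The library gives C no structure of normed R-module, hence derivatives of
   complex-valued maps on real spaces are taken componentwise. *)
Definition cder (V : normedModType R) (c : V -> C) (x v : V) (d : C) :=
  is_derive x v (fun y => Re (c y : R[i])) (Re (d : R[i])) /\
  is_derive x v (fun y => Im (c y : R[i])) (Im (d : R[i])).

Lemma is_deriveP (V W : normedModType R) (f : V -> W) x v d :
  is_derive x v f d <-> (fun h : R => h^-1 *: (f (h *: v + x) - f x)) @ 0^' --> d.
Proof.
split=> [[df <-]|H]; first exact: df.
by apply: DeriveDef; [exact: cvgP H|exact: cvg_lim H].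
Qed.

Lemma is_deriveCP (f : C -> C) (z d : C) :
  is_derive z 1 f d <-> (fun h : C => h^-1 * (f (h + z) - f z)) @ 0^' --> d.
Proof.
have E : (fun h : C => h^-1 *: (f (h *: 1 + z) - f z)) =
         (fun h : C => h^-1 * (f (h + z) - f z)).
  by apply/funext => h; rewrite [h%:A]mulr1.
split=> [[df <-]|H]; first by rewrite -E; exact: df.
by rewrite -E in H; apply: DeriveDef; [exact: cvgP H|exact: cvg_lim H].
Qed.

Lemma cderP (V : normedModType R) (c : V -> C) (x v : V) (d : C) :
  cder c x v d <->
  (fun h : R => (h^-1)%:C%C * (c (h *: v + x) - c x) : C) @ 0^' --> d.
Proof.
rewrite /cder !is_deriveP; rewrite cvg_complexP.
have E1 : (fun h : R => Re ((h^-1)%:C%C * (c (h *: v + x) - c x) : R[i])) =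
   (fun h : R => h^-1 *: (Re (c (h *: v + x) : R[i]) - Re (c x : R[i]))).
  by apply/funext => h; case: (c _) => a b; case: (c x) => a' b' /=; rewrite mul0r subr0.
have E2 : (fun h : R => Im ((h^-1)%:C%C * (c (h *: v + x) - c x) : R[i])) =
   (fun h : R => h^-1 *: (Im (c (h *: v + x) : R[i]) - Im (c x : R[i]))).
  by apply/funext => h; case: (c _) => a b; case: (c x) => a' b' /=; rewrite mul0r addr0.
by rewrite E1 E2.
Qed.

Lemma cvg_shift (K : numFieldType) (V : normedModType K) (z : V) :
  (h + z) @[h --> (0 : V)] --> z.
Proof.
have H : (h + z) @[h --> (0 : V)] --> 0 + z by apply: cvgD; [exact: cvg_id|exact: cvg_cst].
by rewrite add0r in H.
Qed.

(** The slope function, completed at [z] by the derivative, is continuous at [z]. In this form the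
    product, inverse and chain rules become algebraic identities between slopes. *)
Lemma caratheodory (f : C -> C) (z d : C) : is_derive z 1 f d -> exists q : C -> C,
  [/\ forall w, f w - f z = q w * (w - z), {for z, continuous q} & q z = d].
Proof.
move=> /is_deriveCP H.
pose q (w : C) : C := if w == z then d else (f w - f z) / (w - z).
exists q; split; last by rewrite /q eqxx.
  move=> w; rewrite /q; case: eqVneq => [->|wz]; first by rewrite !subrr mulr0.
  by rewrite divfK // subr_eq0.
apply: (@continuous_dist_le _ C C) => e e0.
move/cvgrPdist_le : H => /(_ _ e0) /nbhs_ballP[r /= r0 rP].
apply/nbhs_ballP; exists r => // w; rewrite -ball_normE /= => zw.
have [->|wz] := eqVneq w z; first by rewrite subrr normr0 ltW.
rewrite /q eqxx (negbTE wz).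
have := rP (w - z); rewrite -ball_normE /= sub0r normrN distrC subr_eq0.
by move=> /(_ zw wz); rewrite subrK mulrC.
Qed.

Lemma caratheodory_der (f q : C -> C) (z : C) :
  (\forall w \near z, f w - f z = q w * (w - z)) -> {for z, continuous q} ->
  is_derive z 1 f (q z).
Proof.
move=> H cq; apply/is_deriveCP.
have sz := @cvg_shift _ C z.
have : (fun h : C => q (h + z)) @ (0 : C)^' --> q z.
  by move=> A /cq /sz; exact: nbhs_dnbhs.
apply: cvg_trans; apply: near_eq_cvg.
have H0 : \forall h \near (0 : C)^', f (h + z) - f z = q (h + z) * (h + z - z).
  by apply: nbhs_dnbhs; exact: (sz _ H).
near=> h.
have h0 : h != 0 by near: h; exact: nbhs_dnbhs_neq.
have -> : f (h + z) - f z = q (h + z) * (h + z - z) by near: h.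
by rewrite addrK mulrC mulfK.
Unshelve. all: by end_near. Qed.

(** The slope [q] of [f] at [c x] multiplies the real difference quotient of [c]. This is the bridge
    from complex derivatives to directional derivatives on real spaces. *)
Lemma chain_rule (V : normedModType R) (f : C -> C) (c : V -> C) x v d d' :
  is_derive (c x) 1 f d -> cder c x v d' -> {for x, continuous c} ->
  cder (fun y => f (c y)) x v (d * d').
Proof.
move=> /caratheodory[q [qE cq qd]] /cderP cd cc; apply/cderP.
have E : (fun h : R => (h^-1)%:C%C * (f (c (h *: v + x)) - f (c x)) : C) =
  (fun h : R => q (c (h *: v + x)) * ((h^-1)%:C%C * (c (h *: v + x) - c x) : C) : C).
  by apply/funext => h; rewrite qE mulrCA.
rewrite E -qd; apply: cvgM; last exact: cd.
have sx : (h *: v + x) @[h --> (0 : R)] --> x.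
  have H : (h *: v + x) @[h --> (0 : R)] --> (0 : R) *: v + x.
    by apply: cvgD; [apply: cvgZr_tmp; exact: cvg_id|exact: cvg_cst].
  by rewrite scale0r add0r in H.
by move=> A /cq /cc /sx; exact: nbhs_dnbhs.
Qed.

(** * Integrals over an interval that depend on a parameter *)

Definition itg (T : R) (g : R -> R) : R :=
  (\int[@lebesgue_measure R]_(t in `[0%R, T]) g t)%R.

(** Tube lemma: compactness of [0, T] turns neighbourhoods chosen for each [t] into one that serves
    all [t]. *)
Lemma tube_near (X : topologicalType) (T : R) (x : X) (P : X -> R -> Prop) :
  (forall t, 0 <= t <= T -> \forall p \near (x, t), P p.1 p.2) ->
  \forall y \near x, forall t, 0 <= t <= T -> P y t.
Proof.
move=> H.
have cK := (compact_near_coveringP `[0, T]%classic).1 (@segment_compact R 0 T).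
have : \forall y \near x, `[0, T]%classic `<=` P y.
  apply: (cK X (nbhs x) P) => t; rewrite /= in_itv /= => tT.
  have [[A B] /= [xA tB] AB] := H t tT.
  by exists (B, A) => //= -[b a] /= [Bb Aa]; exact: (AB (a, b)).
by apply: filterS => y Py t tT; apply: Py; rewrite /= in_itv.
Qed.

Section itg_theory.
Variables (T : R) (T0 : 0 < T).
Implicit Types g : R -> R.

Definition cts g := forall t, 0 <= t <= T -> {for t, continuous g}.

Lemma cts_within g : cts g -> {within `[0, T], continuous g}.
Proof.
move=> cg; apply: continuous_in_subspaceT => t.
by rewrite inE /= in_itv /=; exact: cg.
Qed.

Lemma cts_integrable g : cts g ->
  (@lebesgue_measure R).-integrable `[0, T] (EFin \o g).
Proof.
move=> cg; apply: continuous_compact_integrable; first exact: segment_compact.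
exact: cts_within.
Qed.

Lemma itg_ext f g : (forall t, 0 <= t <= T -> f t = g t) -> itg T f = itg T g.
Proof.
by move=> fg; apply: eq_Rintegral => t; rewrite inE /= in_itv /=; exact: fg.
Qed.

Lemma itgD f g : cts f -> cts g -> itg T (fun t => f t + g t) = itg T f + itg T g.
Proof. by move=> cf cg; apply: RintegralD => //; exact: cts_integrable. Qed.

Lemma itgB f g : cts f -> cts g -> itg T (fun t => f t - g t) = itg T f - itg T g.
Proof. by move=> cf cg; apply: RintegralB => //; exact: cts_integrable. Qed.

Lemma itgZ c g : cts g -> itg T (fun t => c * g t) = c * itg T g.
Proof. by move=> cg; apply: RintegralZl => //; exact: cts_integrable. Qed.

Lemma itg_cst c : itg T (fun=> c) = c * T.
Proof.
transitivity (c * fine (@lebesgue_measure R `[0, T]%classic)).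
  exact: Rintegral_cst.
by rewrite lebesgue_measure_itv /= lte_fin T0 -EFinD /= subr0.
Qed.

Lemma cts_norm g : cts g -> cts (fun t => `|g t|).
Proof.
move=> cg t tT; apply: (@continuous_comp _ _ _ g (fun x : R => `|x|)); first exact: cg.
exact: norm_continuous.
Qed.

Lemma cts_cst c : cts (fun=> c).
Proof. by move=> t _; exact: cst_continuous. Qed.

Lemma ctsB f g : cts f -> cts g -> cts (fun t => f t - g t).
Proof. by move=> cf cg t tT; exact: (continuousB (cf t tT) (cg t tT)). Qed.

Lemma ctsM f g : cts f -> cts g -> cts (fun t => f t * g t).
Proof. by move=> cf cg t tT; exact: (continuousM (cf t tT) (cg t tT)). Qed.

Lemma itg_norm_le g M : cts g -> (forall t, 0 <= t <= T -> `|g t| <= M) ->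
  `|itg T g| <= M * T.
Proof.
move=> cg gM; apply: le_trans (le_normr_Rintegral _ (cts_integrable cg)) _ => //.
rewrite -itg_cst; have I1 := cts_integrable (cts_norm cg).
have I2 := cts_integrable (@cts_cst M).
by apply: le_Rintegral => // t; rewrite /= in_itv /=; exact: gM.
Qed.

Lemma itg_FTC g G : cts g -> (forall t, 0 <= t <= T -> is_derive t 1 G (g t)) ->
  itg T g = G T - G 0.
Proof.
move=> cg dG.
have cG t : 0 <= t <= T -> {for t, continuous G}.
  move=> tT; have [d _] := dG t tT.
  by apply/differentiable_continuous/derivable1_diffP.
rewrite /itg /Rintegral (@continuous_FTC2 _ g G) //.
- exact: cts_within.
- split.
  + by move=> t; rewrite in_itv /= => /andP[/ltW t0 /ltW tT]; have [] := dG t; rewrite ?t0.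
  + apply: cvg_at_right_filter; apply: cG; by rewrite lexx ltW.
  + apply: cvg_at_left_filter; apply: cG; by rewrite lexx ltW.
- move=> t; rewrite in_itv /= => /andP[/ltW t0 /ltW tT].
  rewrite derive1E; have [|_ ->//] := dG t; by rewrite t0.
Qed.

Lemma itg_continuous (X : topologicalType) (G : X -> R -> R) x :
  (\forall y \near x, cts (G y)) ->
  (forall t, 0 <= t <= T -> {for (x, t), continuous (fun p => G p.1 p.2)}) ->
  {for x, continuous (fun y => itg T (G y))}.
Proof.
move=> cG jG; rewrite /prop_for /continuous_at; apply/cvgrPdist_le => e e0.
have cGx := nbhs_singleton cG.
pose e' := e / T; have e'0 : 0 < e' by rewrite divr_gt0.
have : \forall y \near x, forall t, 0 <= t <= T -> `|G x t - G y t| <= e'.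
  apply: tube_near => t tT.
  have e'2 : 0 < e' / 2 by rewrite divr_gt0.
  have /cvgrPdist_le /(_ _ e'2) H1 := jG t tT.
  have H2 : \forall p \near (x, t), `|G x t - G x p.2| <= e' / 2.
    have /cvgrPdist_le /(_ _ e'2) H := cGx t tT.
    by apply: (@cvg_snd _ _ (nbhs x) (nbhs t)) H.
  near=> p; rewrite -(subrKA (G x t)) (splitr e').
  apply: le_trans (ler_normD _ _) _; apply: lerD; last by near: p.
  by rewrite distrC; near: p.
move=> nG; near=> y.
have cGy : cts (G y) by near: y.
rewrite -itgB //.
have -> : e = e' * T by rewrite divfK // gt_eqF.
apply: itg_norm_le; last by near: y.
exact: ctsB cGx cGy.
Unshelve. all: by end_near. Qed.

(** By the mean value theorem in the parameter, the difference quotient of [G] is a value of [dG] at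
    a nearby parameter, and [tube_near] makes it close to [dG x] uniformly in [t]. *)
Lemma itg_derive (V : normedModType R) (G dG : V -> R -> R) (x v : V) :
  (\forall y \near x, cts (G y)) -> cts (dG x) ->
  (\forall y \near x, forall t, 0 <= t <= T -> is_derive y v (G^~ t) (dG y t)) ->
  (forall t, 0 <= t <= T -> {for (x, t), continuous (fun p => dG p.1 p.2)}) ->
  is_derive x v (fun y => itg T (G y)) (itg T (dG x)).
Proof.
move=> cG cdG dG1 jdG; apply/is_deriveP; apply/cvgrPdist_le => e e0.
have cGx := nbhs_singleton cG.
pose e' := e / T; have e'0 : 0 < e' by rewrite divr_gt0.
have nd : \forall y \near x, forall t, 0 <= t <= T -> `|dG x t - dG y t| <= e'.
  apply: tube_near => t tT.
  have e'2 : 0 < e' / 2 by rewrite divr_gt0.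
  have /cvgrPdist_le /(_ _ e'2) H1 := jdG t tT.
  have H2 : \forall p \near (x, t), `|dG x t - dG x p.2| <= e' / 2.
    have /cvgrPdist_le /(_ _ e'2) H := cdG t tT.
    by apply: (@cvg_snd _ _ (nbhs x) (nbhs t)) H.
  near=> p; rewrite -(subrKA (dG x t)) (splitr e').
  apply: le_trans (ler_normD _ _) _; apply: lerD; last by near: p.
  by rewrite distrC; near: p.
have sx : (h *: v + x) @[h --> (0 : R)] --> x.
  have H : (h *: v + x) @[h --> (0 : R)] --> (0 : R) *: v + x.
    by apply: cvgD; [apply: cvgZr_tmp; exact: cvg_id|exact: cvg_cst].
  by rewrite scale0r add0r in H.
have : \forall h \near (0 : R), cts (G (h *: v + x)) /\ (forall t, 0 <= t <= T ->
    is_derive (h *: v + x) v (G^~ t) (dG (h *: v + x) t) /\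
    `|dG x t - dG (h *: v + x) t| <= e').
  near=> h; split; first by near: h; exact: sx cG.
  move=> t tT; split; last by move: t tT; near: h; exact: sx nd.
  by move: t tT; near: h; exact: sx dG1.
move=> /nbhs_ballP[r /= r0 rP].
near=> h; have h0 : h != 0 by near: h; exact: nbhs_dnbhs_neq.
have hr : `|h| < r by near: h; exact: dnbhs0_lt.
have Bh (s : R) : `|s| <= `|h| -> ball 0 r s.
  by rewrite -ball_normE /= sub0r normrN => /le_lt_trans; apply.
have [cGh _] := rP h (Bh h (lexx _)).
have cB : cts (fun t => G (h *: v + x) t - G x t).
  exact: ctsB cGh cGx.
rewrite -itgB // [_ *: _](_ : _ = itg T (fun t => h^-1 * (G (h *: v + x) t - G x t))); last first.
  by rewrite itgZ.
rewrite -itgB //; last first.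
  exact: ctsM (@cts_cst _) cB.
have -> : e = e' * T by rewrite divfK // gt_eqF.
apply: itg_norm_le => [|t tT].
  exact: ctsB cdG (ctsM (@cts_cst _) cB).
have [s hs|s hs Es] := @MVT_any _ (fun s => G (x + s *: v) t) (fun s => dG (x + s *: v) t) 0 h.
  have [_ /(_ t tT)[[dd dE] _]] := rP s (Bh s (between_norm hs)).
  rewrite addrC in dd dE; rewrite -dE.
  exact: (@is_derive_line _ V R^o (G^~ t)).
move: Es; rewrite scale0r addr0 subr0 (addrC x) => ->.
rewrite [dG _ t * h]mulrC mulKf // (addrC x).
by have [_ /(_ t tT)[_]] := rP s (Bh s (between_norm hs)).
Unshelve. all: by end_near. Qed.

End itg_theory.

(** * Differentiation rules and integrals for complex-valued maps *)

Lemma cder_cst (V : normedModType R) (a : C) (x v : V) : cder (fun=> a) x v 0.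
Proof. by split; exact: is_derive_cst. Qed.

Lemma ReM (z w : C) : Re (z * w : R[i]) = Re (z : R[i]) * Re (w : R[i]) - Im (z : R[i]) * Im (w : R[i]).
Proof. by case: z => ? ?; case: w. Qed.

Lemma ImM (z w : C) : Im (z * w : R[i]) = Re (z : R[i]) * Im (w : R[i]) + Im (z : R[i]) * Re (w : R[i]).
Proof. by case: z => ? ?; case: w. Qed.

Lemma ReD (z w : C) : Re (z + w : R[i]) = Re (z : R[i]) + Re (w : R[i]).
Proof. by case: z => ? ?; case: w. Qed.

Lemma ImD (z w : C) : Im (z + w : R[i]) = Im (z : R[i]) + Im (w : R[i]).
Proof. by case: z => ? ?; case: w. Qed.

Lemma cderD (V : normedModType R) (c1 c2 : V -> C) (x v : V) d1 d2 :
  cder c1 x v d1 -> cder c2 x v d2 -> cder (fun y => c1 y + c2 y) x v (d1 + d2).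
Proof.
move=> [a1 b1] [a2 b2]; split.
  have H := is_deriveD a1 a2; rewrite -ReD in H.
  by rewrite (_ : (fun y => _) = (fun y => Re (c1 y : R[i])) + (fun y => Re (c2 y : R[i]))) //;
     apply/funext => y; exact: ReD.
have H := is_deriveD b1 b2; rewrite -ImD in H.
by rewrite (_ : (fun y => _) = (fun y => Im (c1 y : R[i])) + (fun y => Im (c2 y : R[i]))) //;
   apply/funext => y; exact: ImD.
Qed.

Lemma ccontD (T : topologicalType) (f g : T -> C) x :
  {for x, continuous f} -> {for x, continuous g} -> {for x, continuous (fun y => f y + g y)}.
Proof. exact: continuousD. Qed.

Lemma ccontB (T : topologicalType) (f g : T -> C) x :
  {for x, continuous f} -> {for x, continuous g} -> {for x, continuous (fun y => f y - g y)}.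
Proof. exact: continuousB. Qed.

Lemma ccontM (T : topologicalType) (f g : T -> C) x :
  {for x, continuous f} -> {for x, continuous g} -> {for x, continuous (fun y => f y * g y)}.
Proof. exact: continuousM. Qed.

Lemma ccontV (T : topologicalType) (f : T -> C) x : f x != 0 ->
  {for x, continuous f} -> {for x, continuous (fun y => (f y)^-1)}.
Proof. exact: continuousV. Qed.

Lemma ccont_cst (T : topologicalType) (a : C) (x : T) : {for x, continuous (fun=> a)}.
Proof. exact: cst_continuous. Qed.

Lemma ccont_comp (T S : topologicalType) (f : S -> C) (g : T -> S) x :
  {for g x, continuous f} -> {for x, continuous g} -> {for x, continuous (fun y => f (g y))}.
Proof. by move=> cf cg; exact: (@continuous_comp _ _ _ g f). Qed.

Lemma derivable1_continuous (K : numFieldType) (W : normedModType K) (f : K -> W) (x : K) :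
  derivable f x 1 -> {for x, continuous f}.
Proof. by move=> /derivable1_diffP; exact: differentiable_continuous. Qed.

Lemma cder_continuous (c : R -> C) x d : cder c x 1 d -> {for x, continuous c}.
Proof.
move=> [[d1 _] [d2 _]]; apply/(continuous_complexP c).
split; [exact: (derivable1_continuous (K := R) d1)|exact: (derivable1_continuous (K := R) d2)].
Qed.

Lemma cderM (V : normedModType R) (c1 c2 : V -> C) (x v : V) d1 d2 :
  cder c1 x v d1 -> cder c2 x v d2 ->
  cder (fun y => c1 y * c2 y) x v (c1 x * d2 + d1 * c2 x).
Proof.
move=> [a1 b1] [a2 b2]; split.
  rewrite (_ : (fun y => _) = (fun y => Re (c1 y : R[i]) * Re (c2 y : R[i])) -
    (fun y => Im (c1 y : R[i]) * Im (c2 y : R[i]))); last first.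
    by apply/funext => y; exact: ReM.
  apply: is_derive_eq (is_deriveB (is_deriveM a1 a2) (is_deriveM b1 b2)) _.
  by rewrite /GRing.scale /= ReD !ReM; ring.
rewrite (_ : (fun y => _) = (fun y => Re (c1 y : R[i]) * Im (c2 y : R[i])) +
    (fun y => Im (c1 y : R[i]) * Re (c2 y : R[i]))); last first.
  by apply/funext => y; exact: ImM.
apply: is_derive_eq (is_deriveD (is_deriveM a1 b2) (is_deriveM b1 a2)) _.
by rewrite /GRing.scale /= ImD !ImM; ring.
Qed.

Lemma cderZ (V : normedModType R) (a : C) (c : V -> C) (x v : V) d :
  cder c x v d -> cder (fun y => a * c y) x v (a * d).
Proof. by move=> /(cderM (cder_cst a x v)); rewrite mul0r addr0. Qed.

Lemma is_derive_invC (z : C) : z != 0 ->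
  is_derive z 1 (fun w : C => w^-1) (- (z ^+ 2)^-1 : C).
Proof.
move=> z0; rewrite expr2.
apply: (caratheodory_der (q := fun w => - (w * z)^-1)); last first.
  apply: (@continuousN C); apply: ccontV; first by rewrite mulf_neq0.
  by apply: ccontM; [exact: cvg_id|exact: ccont_cst].
have nz : \forall w \near z, w != 0.
  by have /cvgr_neq0 : {for z, continuous (fun w : C => w)}; [exact: cvg_id|apply].
apply: filterS nz => w w0; rewrite mulNr invfM mulrBr mulrAC mulVf // mul1r.
by rewrite mulfVK // opprB.
Qed.

Lemma cderV (V : normedModType R) (c : V -> C) (x v : V) d :
  c x != 0 -> {for x, continuous c} -> cder c x v d ->
  cder (fun y => (c y)^-1) x v (- d / c x ^+ 2).
Proof.
move=> c0 cc dc.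
have H := is_derive_invC c0.
by have := chain_rule H dc cc; rewrite mulNr mulrC -mulNr.
Qed.

Lemma cder_real (x : R) : cder (fun y : R => y%:C%C : C) x 1 1.
Proof. by split => /=; [exact: is_derive_id|exact: is_derive_cst]. Qed.

Definition citg (T : R) (c : R -> C) : C :=
  Complex (itg T (fun t => Re (c t : R[i]))) (itg T (fun t => Im (c t : R[i]))).

Section citg_theory.
Variables (T : R) (T0 : 0 < T).
Implicit Types c : R -> C.

Definition ccts c := forall t, 0 <= t <= T -> {for t, continuous c}.

Lemma ccts_Re c : ccts c -> cts T (fun t => Re (c t : R[i])).
Proof. by move=> cc t /cc /continuous_complexP[]. Qed.

Lemma ccts_Im c : ccts c -> cts T (fun t => Im (c t : R[i])).
Proof. by move=> cc t /cc /continuous_complexP[]. Qed.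

Lemma citg_ext c1 c2 : (forall t, 0 <= t <= T -> c1 t = c2 t) -> citg T c1 = citg T c2.
Proof.
by move=> E; congr Complex; apply: itg_ext => t /E ->.
Qed.

Lemma citgZ (k : C) c : ccts c -> citg T (fun t => k * c t) = k * citg T c.
Proof.
move=> cc; have cR := ccts_Re cc; have cI := ccts_Im cc.
apply/eqP; rewrite eq_complex; case: k => a b /=; apply/andP; split; apply/eqP.
  rewrite -!itgZ // -itgB //; first (apply: itg_ext => t _; by case: (c t)).
  - exact: ctsM (@cts_cst _ _) cR.
  - exact: ctsM (@cts_cst _ _) cI.
rewrite -!itgZ // -itgD //; first (apply: itg_ext => t _; by case: (c t)).
- exact: ctsM (@cts_cst _ _) cI.
- exact: ctsM (@cts_cst _ _) cR.
Qed.

Lemma citg_cst (a : C) : citg T (fun=> a) = a * (T%:C%C : C).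
Proof.
rewrite /citg !itg_cst //; case: a => a b /=.
by apply/eqP; rewrite eq_complex /= !mulr0 subr0 add0r mulrC eqxx /=.
Qed.

Lemma citg_FTC c G : ccts c -> (forall t, 0 <= t <= T -> cder G t 1 (c t)) ->
  citg T c = G T - G 0.
Proof.
move=> cc dG; rewrite /citg.
rewrite (itg_FTC T0 (ccts_Re cc) (fun t tT => (dG t tT).1)).
rewrite (itg_FTC T0 (ccts_Im cc) (fun t tT => (dG t tT).2)).
by case: (G T) => ? ?; case: (G 0).
Qed.

Lemma citg_continuous (X : topologicalType) (G : X -> R -> C) x :
  (\forall y \near x, ccts (G y)) ->
  (forall t, 0 <= t <= T -> {for (x, t), continuous (fun p => G p.1 p.2)}) ->
  {for x, continuous (fun y => citg T (G y))}.
Proof.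
move=> cG jG; apply/(continuous_complexP (fun y => citg T (G y))); split => /=.
  apply: (itg_continuous T0 (G := fun y t => Re (G y t : R[i]))).
    by apply: filterS cG => y; exact: ccts_Re.
  by move=> t tT; have [] := (continuous_complexP (fun p => G p.1 p.2) (x, t)).1 (jG t tT).
apply: (itg_continuous T0 (G := fun y t => Im (G y t : R[i]))).
  by apply: filterS cG => y; exact: ccts_Im.
by move=> t tT; have [] := (continuous_complexP (fun p => G p.1 p.2) (x, t)).1 (jG t tT).
Qed.

Lemma citg_cder (V : normedModType R) (G dG : V -> R -> C) (x v : V) :
  (\forall y \near x, ccts (G y)) -> ccts (dG x) ->
  (\forall y \near x, forall t, 0 <= t <= T -> cder (G^~ t) y v (dG y t)) ->
  (forall t, 0 <= t <= T -> {for (x, t), continuous (fun p => dG p.1 p.2)}) ->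
  cder (fun y => citg T (G y)) x v (citg T (dG x)).
Proof.
move=> cG cdG dG1 jdG; split => /=.
  apply: (itg_derive T0 (G := fun y t => Re (G y t : R[i])) (dG := fun y t => Re (dG y t : R[i]))).
  - by apply: filterS cG => y; exact: ccts_Re.
  - exact: ccts_Re.
  - by apply: filterS dG1 => y H t /H[].
  - by move=> t tT; have [] := (continuous_complexP (fun p => dG p.1 p.2) (x, t)).1 (jdG t tT).
apply: (itg_derive T0 (G := fun y t => Im (G y t : R[i])) (dG := fun y t => Im (dG y t : R[i]))).
- by apply: filterS cG => y; exact: ccts_Im.
- exact: ccts_Im.
- by apply: filterS dG1 => y H t /H[].
- by move=> t tT; have [] := (continuous_complexP (fun p => dG p.1 p.2) (x, t)).1 (jdG t tT).
Qed.

End citg_theory.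

(** * Circles and Cauchy's formula *)

Definition i_ : C := Complex 0 1.

Lemma i_sqr : i_ * i_ = -1.
Proof. by apply/eqP; rewrite eq_complex /= !mul0r !mulr0 !mulr1 !add0r ?oppr0 ?addr0 !eqxx. Qed.

Lemma i_neq0 : i_ != 0.
Proof. by rewrite eq_complex /= oner_eq0 andbF. Qed.

Definition tau : R := pi *+ 2.

Lemma tau_gt0 : 0 < tau.
Proof. by rewrite /tau mulrn_wgt0 // pi_gt0. Qed.

Definition circ (r t : R) : C := Complex (r * cos t) (r * sin t).

Lemma normc_circ r t : 0 <= r -> normc (circ r t : R[i]) = r.
Proof.
move=> r0; rewrite /= !exprMn -mulrDr cos2Dsin2 mulr1 sqrtr_sqr ger0_norm //.
Qed.

Lemma cder_circ r t : cder (circ r) t 1 (i_ * circ r t).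
Proof.
split => /=.
  rewrite (_ : (fun y => _) = r *: (cos : R -> R)) //.
  by apply: is_derive_eq (is_deriveZ r (is_derive_cos t)) _; rewrite /GRing.scale /=; ring.
rewrite (_ : (fun y => _) = r *: (sin : R -> R)) //.
by apply: is_derive_eq (is_deriveZ r (is_derive_sin t)) _; rewrite /GRing.scale /=; ring.
Qed.

Lemma circ_continuous r t : {for t, continuous (circ r)}.
Proof. exact: cder_continuous (cder_circ r t). Qed.

Lemma circ_tau r : circ r tau = circ r 0.
Proof. by rewrite /circ /tau cos2pi sin2pi cos0 sin0. Qed.

(** Continuity of the derivative belongs to the notion because Cauchy's formula is proved by
    differentiating under the integral sign. [chol_derive] shows that the class is closed under
    derivation. *)
Definition chol (O : set C) (f : C -> C) :=
  (forall z, O z -> derivable f z 1) /\ (forall z, O z -> {for z, continuous ('D_1 f)}).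

Definition disc (p : C) (r : R) : set C := [set z | normc (z - p : R[i]) < r].

Lemma normcN (z : R[i]) : normc (- z) = normc z.
Proof. by case: z => a b /=; rewrite !sqrrN. Qed.

Lemma normcD (z w : R[i]) : normc (z + w) <= normc z + normc w.
Proof. by have := ler_normD z w; rewrite !normE -rmorphD lecR. Qed.

Lemma continuous_realI (T : topologicalType) (f : T -> R) x :
  (forall e, 0 < e -> \forall y \near x, `|f x - f y| < e) -> {for x, continuous f}.
Proof. by move=> H; apply/cvgrPdist_lt. Qed.

Lemma normc_continuous : continuous (fun z : C => normc (z : R[i])).
Proof.
move=> z; apply: continuous_realI => e e0.
have /cvg_normcP /(_ e e0) : id @ z --> z by exact: cvg_id.
apply: filterS => w; apply: le_lt_trans.
have H1 := normcD (z : R[i]) (w - z); have H2 := normcD (w : R[i]) (z - w).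
have E : normc (w - z : R[i]) = normc (z - w : R[i]) by rewrite -normcN opprB.
rewrite addrC subrK in H1; rewrite addrC subrK in H2.
by rewrite ler_norml; apply/andP; split; lra.
Qed.

Lemma disc_open p r : open (disc p r).
Proof.
have -> : disc p r = (fun z : C => normc (z - p : R[i])) @^-1` [set x | x < r] by [].
apply: open_comp; last exact: open_lt.
move=> z _; apply: (@continuous_comp _ _ _ (fun z : C => z - p)).
  by apply: ccontB; [exact: cvg_id|exact: ccont_cst].
exact: normc_continuous.
Qed.

Lemma nbhs_disc (p : C) (A : set C) : nbhs p A -> exists2 r, 0 < r & disc p r `<=` A.
Proof.
move=> /nbhs_ballP[e /= e0 eA]; exists (Re (e : R[i])).
  by move: e0; rewrite ltcE /= => /andP[].
move=> z pz; apply: eA; rewrite -ball_normE /= -normrN opprB.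
rewrite [`|_|]normE.
have -> : e = (Re (e : R[i]))%:C%C :> R[i] by rewrite RRe_real // gtr0_real.
by rewrite ltcR.
Qed.

Lemma disc_center p r : 0 < r -> disc p r p.
Proof. by rewrite /disc /= subrr Normc.normc0. Qed.

Lemma derivable_continuousC (f : C -> C) (z : C) : derivable f z 1 -> {for z, continuous f}.
Proof. exact: (derivable1_continuous (K := R[i]) (W := C)). Qed.
Lemma cder_eq (V : normedModType R) (c : V -> C) (x v : V) d d' :
  cder c x v d -> d = d' -> cder c x v d'.
Proof. by move=> ? <-. Qed.

Lemma cder_const01 (c : R -> C) :
  (forall s : R, 0 <= s <= 1 -> cder c s 1 0) -> c 1 = c 0.
Proof.
move=> H; have c01 (s : R) : Num.min 0 1 <= s <= Num.max 0 1 -> 0 <= s <= 1.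
  by rewrite min_l ?max_r.
have [s /c01/H[]//|s _ E1] := @MVT_any _ (fun s => Re (c s : R[i])) (fun=> 0) 0 1.
have [s' /c01/H[]//|s' _ E2] := @MVT_any _ (fun s => Im (c s : R[i])) (fun=> 0) 0 1.
move: E1 E2; rewrite !mul0r => /subr0_eq E1 /subr0_eq E2.
by case: (c 1) (c 0) E1 E2 => ? ? [? ?] /= -> ->.
Qed.

(** The s-derivative of the integrand is the t-derivative of a function [H] with equal values at 0
    and [tau]; its integral vanishes, so the integral of [G s] is constant in s. *)
Lemma citg_deform (G dG : R -> R -> C) :
  (forall s : R, 0 <= s <= 1 ->
    [/\ \forall s' \near s, ccts tau (G s'), ccts tau (dG s),
        \forall s' \near s, forall t : R, 0 <= t <= tau -> cder (G^~ t) s' 1 (dG s' t),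
        forall t : R, 0 <= t <= tau -> {for (s, t), continuous (fun p => dG p.1 p.2)} &
        exists2 H : R -> C, H tau = H 0 & forall t, cder H t 1 (dG s t)]) ->
  citg tau (G 1) = citg tau (G 0).
Proof.
move=> HH; apply: (@cder_const01 (fun s => citg tau (G s))) => s s01.
have [c1 c2 c3 c4 [H H0 dH]] := HH s s01.
have := citg_cder tau_gt0 c1 c2 c3 c4.
by rewrite (citg_FTC tau_gt0 c2 (fun t _ => dH t)) H0 subrr.
Qed.

Lemma near_lt_continuous (T : topologicalType) (f : T -> R) x c :
  {for x, continuous f} -> f x < c -> \forall y \near x, f y < c.
Proof. by move=> cf fx; exact: (cvgr_lt (f x)). Qed.

Lemma circ_sub_neq0 r t (w : C) : normc (w : R[i]) < r -> circ r t - w != 0.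
Proof.
move=> wr; have r0 := ltW (le_lt_trans (normc_ge0 _) wr).
by rewrite subr_eq0; apply: contraTneq wr => <-; rewrite normc_circ // ltxx.
Qed.

Lemma near_normc_lt (T : topologicalType) (f : T -> C) x c :
  {for x, continuous f} -> normc (f x : R[i]) < c -> \forall y \near x, normc (f y : R[i]) < c.
Proof.
move=> cf fc; apply: (near_lt_continuous (f := fun y => normc (f y : R[i]))) => //.
exact: (@continuous_comp _ _ _ f (fun z : C => normc (z : R[i])) x cf (@normc_continuous _)).
Qed.

Lemma ccont_real (T : topologicalType) (f : T -> R) x :
  {for x, continuous f} -> {for x, continuous (fun y => (f y)%:C%C : C)}.
Proof.
by move=> cf; exact: (@continuous_comp _ _ _ f (fun z : R => z%:C%C : C) x cf (@real_complex_continuous _)).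
Qed.

Lemma ccont_circ (T : topologicalType) r (f : T -> R) x :
  {for x, continuous f} -> {for x, continuous (fun y => circ r (f y))}.
Proof. by move=> cf; exact: (@continuous_comp _ _ _ f (circ r) x cf (@circ_continuous r _)). Qed.

Lemma fst_continuous (X Y : topologicalType) (p : X * Y) : {for p, continuous (@fst X Y)}.
Proof. exact: cvg_fst. Qed.

Lemma snd_continuous (X Y : topologicalType) (p : X * Y) : {for p, continuous (@snd X Y)}.
Proof. exact: cvg_snd. Qed.

(** The point [a] is moved to the centre along s a; at the centre the kernel is the constant 1. *)
Lemma kernel_integral (a : C) r : normc (a : R[i]) < r ->
  citg tau (fun t => circ r t / (circ r t - a)) = tau%:C%C.
Proof.
move=> ar; have r0 := le_lt_trans (normc_ge0 _) ar.
pose w (s t : R) : C := circ r t + (- a) * (s%:C%C : C).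
pose G s t := circ r t * (w s t)^-1.
pose dG s t := circ r t * (- (0 + - a * 1) / w s t ^+ 2).
have w0 (s t : R) : normc (a * (s%:C%C : C) : R[i]) < r -> w s t != 0.
  by move=> /(circ_sub_neq0 t); rewrite /w mulNr.
have as_cont (s : R) : {for s, continuous (fun s : R => a * (s%:C%C : C))}.
  by apply: ccontM; [exact: ccont_cst|exact: real_complex_continuous].
have wt s t : {for t, continuous (w s)}.
  by apply: ccontD; [exact: circ_continuous|exact: ccont_cst].
have ws s t : {for s, continuous (w^~ t)}.
  apply: ccontD; [exact: ccont_cst|].
  by apply: ccontM; [exact: ccont_cst|exact: real_complex_continuous].
have E : citg tau (G 1) = citg tau (G 0).
  apply: (@citg_deform G dG) => s s01.
  have sr : normc (a * (s%:C%C : C) : R[i]) < r.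
    rewrite Normc.normcM normc_real; apply: le_lt_trans ar.
    by rewrite ler_piMr ?normc_ge0 // ger0_norm; case/andP: s01.
  have nr := near_normc_lt (as_cont s) sr.
  split.
  - apply: filterS nr => s' s'r t _; apply: ccontM; first exact: circ_continuous.
    by apply: ccontV; [exact: w0|exact: wt].
  - move=> t _; apply: ccontM; first exact: circ_continuous.
    apply: ccontM; first exact: ccont_cst.
    apply: ccontV; first by rewrite expf_neq0 // w0.
    by apply: ccontM; exact: wt.
  - apply: filterS nr => s' s'r t _; apply: cderZ; apply: cderV; [exact: w0|exact: ws|].
    by apply: cderD; [exact: cder_cst|apply: cderZ; exact: cder_real].
  - move=> t _; have cw : {for (s, t), continuous (fun p => w p.1 p.2)}.
      apply: ccontD; first by apply: ccont_circ; exact: snd_continuous.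
      by apply: ccontM; [exact: ccont_cst|apply: ccont_real; exact: fst_continuous].
    apply: ccontM; first by apply: ccont_circ; exact: snd_continuous.
    apply: ccontM; first exact: ccont_cst.
    by apply: ccontV; [rewrite expf_neq0 // w0|exact: ccontM].
  (* Since [circ] has t-derivative [i_ * circ], this function has t-derivative a circ / w^2, which
     is [dG]. *)
  - exists (fun t => i_ * a * (w s t)^-1); first by rewrite /w circ_tau.
    move=> t; apply: cder_eq.
      apply: cderZ; apply: cderV; [exact: w0|exact: wt|].
      by apply: cderD; [exact: cder_circ|exact: cder_cst].
    rewrite /dG add0r mulr1 opprK addr0.
    have -> : i_ * a * (- (i_ * circ r t) / w s t ^+ 2) =
       - (i_ * i_) * (circ r t * (a / w s t ^+ 2)) by ring.
    by rewrite i_sqr opprK mul1r.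
have E1 : citg tau (fun t => circ r t / (circ r t - a)) = citg tau (G 1).
  by apply: citg_ext => t _; rewrite /G /w mulr1.
rewrite E1 E (@citg_ext tau _ (fun=> 1)).
  by rewrite (citg_cst tau_gt0) mul1r.
by move=> t _; rewrite /G /w mulr0 addr0 divff // -[circ r t]subr0 circ_sub_neq0 // Normc.normc0.
Qed.

Lemma chol_continuous O f z : chol O f -> O z -> {for z, continuous f}.
Proof. by move=> [df _] /df; exact: derivable_continuousC. Qed.

Lemma chol_is_derive O f z : chol O f -> O z -> is_derive z 1 f ('D_1 f z).
Proof. by move=> [df _] /df; exact: derivableP. Qed.

(** The circle is contracted to [z] by w = z + s (circ - a). The kernel cancels the factor circ - a
    produced by the s-derivative, which leaves circ f'(w), the t-derivative of f(w) / (i s). *)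
Lemma cauchy_formula f (p z : C) r r' : r < r' -> chol (disc p r') f ->
  normc (z - p : R[i]) < r ->
  citg tau (fun t => f (p + circ r t) * (circ r t / (circ r t - (z - p)))) =
  f z * tau%:C%C.
Proof.
move=> rr' hf; set a := z - p => ar; have r0 := le_lt_trans (normc_ge0 _) ar.
pose k t := circ r t / (circ r t - a).
have k0 t : circ r t - a != 0 by exact: circ_sub_neq0.
have kc t : {for t, continuous k}.
  apply: ccontM; first exact: circ_continuous.
  by apply: ccontV => //; apply: ccontB; [exact: circ_continuous|exact: ccont_cst].
pose w (s t : R) : C := z + (circ r t - a) * (s%:C%C : C).
pose G s t := k t * f (w s t).
pose dG s t := k t * ('D_1 f (w s t) * (0 + (circ r t - a) * 1)).
have wt s t : {for t, continuous (w s)}.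
  apply: ccontD; first exact: ccont_cst.
  apply: ccontM; last exact: ccont_cst.
  by apply: ccontB; [exact: circ_continuous|exact: ccont_cst].
have ws s t : {for s, continuous (w^~ t)}.
  apply: ccontD; [exact: ccont_cst|].
  by apply: ccontM; [exact: ccont_cst|exact: real_complex_continuous].
have cw p1 : {for p1, continuous (fun p : R * R => w p.1 p.2)}.
  apply: ccontD; first exact: ccont_cst.
  apply: ccontM; last by apply: ccont_real; exact: fst_continuous.
  apply: ccontB; last exact: ccont_cst.
  by apply: ccont_circ; exact: snd_continuous.
(* A continuous bound for |w - p|. It is at most r on [0, 1], hence still below r' slightly beyond
   the endpoints, where the s-derivative must also make sense. *)
pose S (s : R) := normc ((1 - s%:C%C) * a : R[i]) + normc (s%:C%C * r%:C%C : R[i]).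
have Sc : continuous S.
  move=> s.
  have S1 : {for s, continuous (fun s : R => (1 - s%:C%C) * a : C)}.
    apply: ccontM; last exact: ccont_cst.
    by apply: ccontB; [exact: ccont_cst|exact: real_complex_continuous].
  have S2 : {for s, continuous (fun s : R => s%:C%C * r%:C%C : C)}.
    by apply: ccontM; [exact: real_complex_continuous|exact: ccont_cst].
  have N1 := @continuous_comp _ _ _ _ (fun z : C => normc (z : R[i])) s S1 (@normc_continuous _).
  have N2 := @continuous_comp _ _ _ _ (fun z : C => normc (z : R[i])) s S2 (@normc_continuous _).
  exact: (continuousD N1 N2).
have Sw s t : S s < r' -> disc p r' (w s t).
  rewrite /disc /= /S; apply: le_lt_trans.
  have -> : w s t - p = (1 - s%:C%C) * a + s%:C%C * circ r t :> C.
    by rewrite /w /a; ring.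
  apply: le_trans (normcD _ _) _; rewrite lerD2l !Normc.normcM normc_circ ?(ltW r0) //.
  by rewrite normc_real [normc r%:C%C]normc_real (gtr0_norm r0).
have E : citg tau (G 1) = citg tau (G 0).
  apply: (@citg_deform G dG) => s s01.
  have sr : S s < r'.
    move: s01 => /andP[s0 s1].
    rewrite /S !Normc.normcM !normc_real -(rmorphB (real_complex R) 1 s) normc_real.
    rewrite (gtr0_norm r0) (ger0_norm s0) ger0_norm ?subr_ge0 //.
    by have := normc_ge0 (a : R[i]); nra.
  have nr := near_lt_continuous (Sc s) sr.
  have dwt (s' t : R) : cder (w s') t 1 (0 + ((i_ * circ r t + 0) * (s'%:C%C : C) + (circ r t - a) * 0)).
    apply: cderD; first exact: cder_cst.
    have H := cderM (cderD (cder_circ r t) (cder_cst (- a) t 1)) (cder_cst (s'%:C%C : C) t 1).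
    by apply: cder_eq H _; rewrite addrC.
  split.
  - apply: filterS nr => s' s'r t _; apply: ccontM; first exact: kc.
    by apply: ccont_comp (wt s' t); exact: chol_continuous hf (Sw _ _ s'r).
  - move=> t _; apply: ccontM; first exact: kc.
    apply: ccontM.
      by apply: (ccont_comp (f := 'D_1 f)) (wt s t); exact: hf.2 _ (Sw _ _ sr).
    apply: ccontD; first exact: ccont_cst.
    apply: ccontM; last exact: ccont_cst.
    by apply: ccontB; [exact: circ_continuous|exact: ccont_cst].
  - apply: filterS nr => s' s'r t _; apply: cderZ; apply: chain_rule.
    + exact: chol_is_derive hf (Sw _ _ s'r).
    + apply: cderD; first exact: cder_cst.
      by apply: cderZ; exact: cder_real.
    + exact: ws.
  - move=> t _; have ck : {for (s, t), continuous (fun p : R * R => k p.2)}.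
      by apply: (ccont_comp (f := k)); [exact: kc|exact: snd_continuous].
    apply: ccontM; first exact: ck.
    apply: ccontM.
      apply: (ccont_comp (f := 'D_1 f)) (cw (s, t)); exact: hf.2 _ (Sw _ _ sr).
    apply: ccontD; first exact: ccont_cst.
    apply: ccontM; last exact: ccont_cst.
    by apply: ccontB; [apply: ccont_circ; exact: snd_continuous|exact: ccont_cst].
  (* At s = 0 the primitive f(w) / (i s) is meaningless; there w is constantly z, and a multiple of
     [circ] serves. *)
  - have [s_0|s_0] := eqVneq s 0.
      exists (fun t => 'D_1 f z * (- i_) * circ r t); first by rewrite circ_tau.
      move=> t; apply: cder_eq (cderZ _ (cder_circ r t)) _.
      have -> : dG s t = k t * (circ r t - a) * 'D_1 f z.
        by rewrite /dG /w s_0 mulr0 addr0 add0r mulr1; ring.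
      rewrite /k divfK //.
      have -> : 'D_1 f z * - i_ * (i_ * circ r t) = - (i_ * i_) * (circ r t * 'D_1 f z) by ring.
      by rewrite i_sqr opprK mul1r.
    have sC0 : (s%:C%C : C) != 0 by rewrite eq_complex /= negb_and s_0.
    exists (fun t => (i_ * s%:C%C)^-1 * f (w s t)); first by rewrite /w circ_tau.
    move=> t; apply: cder_eq.
      apply: cderZ; apply: chain_rule (dwt s t) (wt s t).
      exact: chol_is_derive hf (Sw _ _ sr).
    have -> : dG s t = k t * (circ r t - a) * 'D_1 f (w s t).
      by rewrite /dG add0r mulr1; ring.
    rewrite /k divfK //; set q := (_ * _)^-1; set D := 'D_1 f _.
    have -> : q * (D * (0 + ((i_ * circ r t + 0) * (s%:C%C : C) + (circ r t - a) * 0))) =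
      (q * (i_ * s%:C%C)) * (circ r t * D) by ring.
    by rewrite mulVf ?mul1r // mulf_neq0 // i_neq0.
have -> : citg tau (fun t => f (p + circ r t) * (circ r t / (circ r t - a))) = citg tau (G 1).
  apply: citg_ext => t _; rewrite /G mulrC /k; congr (_ * f _).
  by rewrite /w mulr1 /a; ring.
rewrite E -(kernel_integral ar) -citgZ; last by move=> t _; exact: kc.
by apply: citg_ext => t _; rewrite /G /w mulr0 addr0 mulrC.
Qed.

(** * Integrals of Cauchy type and their derivatives *)

Definition cauchy_int (c : R -> C) (r : R) (n : nat) (a : C) : C :=
  citg tau (fun t => c t * (circ r t - a)^-1 ^+ n).

Lemma ccontX (T : topologicalType) (f : T -> C) x n :
  {for x, continuous f} -> {for x, continuous (fun y => f y ^+ n)}.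
Proof.
move=> cf; elim: n => [|n IH]; first exact: ccont_cst.
rewrite (_ : (fun y => _) = (fun y => f y * f y ^+ n)).
  exact: ccontM.
by apply/funext => y; rewrite exprS.
Qed.

Section cauchy_int.
Variables (c : R -> C) (r : R).
Hypothesis cc : forall t, {for t, continuous c}.

Lemma kernel_continuous2 n (a : C) t : normc (a : R[i]) < r ->
  {for (a, t), continuous (fun p : C * R => (circ r p.2 - p.1)^-1 ^+ n)}.
Proof.
move=> ar; apply: ccontX; apply: ccontV; first exact: circ_sub_neq0.
by apply: ccontB; [apply: ccont_circ; exact: snd_continuous|exact: fst_continuous].
Qed.

Lemma kernel_continuous n (a : C) t : normc (a : R[i]) < r ->
  {for t, continuous (fun t => (circ r t - a)^-1 ^+ n)}.
Proof.
move=> ar; apply: ccontX; apply: ccontV; first exact: circ_sub_neq0.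
by apply: ccontB; [exact: circ_continuous|exact: ccont_cst].
Qed.

Lemma near_disc0 (a : C) : normc (a : R[i]) < r -> \forall b \near a, normc (b : R[i]) < r.
Proof. by apply: near_normc_lt; exact: cvg_id. Qed.

Lemma cauchy_int_cts n m a b : normc (a : R[i]) < r -> normc (b : R[i]) < r ->
  ccts tau (fun t => c t * ((circ r t - a)^-1 ^+ n * (circ r t - b)^-1 ^+ m)).
Proof.
move=> ar br t _; apply: ccontM; first exact: cc.
by apply: ccontM; exact: kernel_continuous.
Qed.

(** Integrals with two kernels arise as slopes in [b] at [a] of Cauchy integrals; their continuity
    at [b = a] is what [caratheodory_der] asks for. *)
Lemma cauchy_int2_continuous n m (a : C) : normc (a : R[i]) < r ->
  {for a, continuous (fun b => citg tau (fun t => c t *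
     ((circ r t - b)^-1 ^+ n * (circ r t - a)^-1 ^+ m)))}.
Proof.
move=> ar; apply: (citg_continuous tau_gt0
   (G := fun b t => c t * ((circ r t - b)^-1 ^+ n * (circ r t - a)^-1 ^+ m))).
  by apply: filterS (near_disc0 ar) => b br; exact: cauchy_int_cts.
move=> t _; apply: ccontM.
  by apply: (ccont_comp (f := c)); [exact: cc|exact: snd_continuous].
apply: ccontM; first exact: kernel_continuous2.
apply: ccontX; apply: ccontV; first exact: circ_sub_neq0.
by apply: ccontB; [apply: ccont_circ; exact: snd_continuous|exact: ccont_cst].
Qed.

Lemma cauchy_int_continuous n (a : C) : normc (a : R[i]) < r ->
  {for a, continuous (cauchy_int c r n)}.
Proof.
move=> ar; have := @cauchy_int2_continuous n 0 a ar.
rewrite (_ : (fun b => _) = cauchy_int c r n) //.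
by apply/funext => b; apply: citg_ext => t _; rewrite expr0 mulr1.
Qed.

Lemma citgD f g : ccts tau f -> ccts tau g ->
  citg tau (fun t => f t + g t) = citg tau f + citg tau g.
Proof.
move=> cf cg; apply/eqP; rewrite eq_complex; apply/andP; split; apply/eqP => /=.
  rewrite -(itgD (ccts_Re cf) (ccts_Re cg)); apply: itg_ext => t _; exact: ReD.
rewrite -(itgD (ccts_Im cf) (ccts_Im cg)); apply: itg_ext => t _; exact: ImD.
Qed.

(** Partial fractions: 1/(u-b) - 1/(u-a) = (b-a) / ((u-b)(u-a)), so the slope is the two-kernel
    integral [q b]. *)
Lemma is_derive_cauchy_int1 (a : C) : normc (a : R[i]) < r ->
  is_derive a 1 (cauchy_int c r 1) (cauchy_int c r 2 a).
Proof.
move=> ar; pose q b := citg tau (fun t => c t * ((circ r t - b)^-1 ^+ 1 * (circ r t - a)^-1 ^+ 1)).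
have -> : cauchy_int c r 2 a = q a.
  by apply: citg_ext => t _; rewrite -exprD.
apply: caratheodory_der; last exact: cauchy_int2_continuous.
apply: filterS (near_disc0 ar) => b br.
rewrite /q mulrC -citgZ; last exact: cauchy_int_cts.
have C1 x : normc (x : R[i]) < r -> ccts tau (fun t => c t * (circ r t - x)^-1 ^+ 1).
  by move=> xr t _; apply: ccontM; [exact: cc|exact: kernel_continuous].
rewrite /cauchy_int -[X in _ - X]mul1r -mulNr -citgZ; last exact: C1.
rewrite -citgD; first last.
- by move=> t tT; apply: ccontM; [exact: ccont_cst|exact: C1].
- exact: C1.
apply: citg_ext => t _; have := circ_sub_neq0 t ar; have := circ_sub_neq0 t br.
rewrite !expr1; set u := circ r t => u1 u2; rewrite mulN1r -mulrBr.
rewrite mulrCA; congr (_ * _).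
by field; rewrite u1 u2.
Qed.

(** The difference of the squared kernels is b - a times a sum of two mixed products; each
    contributes one [cauchy_int c r 3 a] at [b = a], whence the factor 2. *)
Lemma is_derive_cauchy_int2 (a : C) : normc (a : R[i]) < r ->
  is_derive a 1 (cauchy_int c r 2) (2%:R * cauchy_int c r 3 a).
Proof.
move=> ar.
pose q b := citg tau (fun t => c t * ((circ r t - b)^-1 ^+ 2 * (circ r t - a)^-1 ^+ 1)) +
   citg tau (fun t => c t * ((circ r t - b)^-1 ^+ 1 * (circ r t - a)^-1 ^+ 2)).
have -> : 2%:R * cauchy_int c r 3 a = q a.
  rewrite mulr_natl mulr2n /q; congr (_ + _); apply: citg_ext => t _; by rewrite -exprD.
apply: caratheodory_der; last first.
  by apply: ccontD; exact: cauchy_int2_continuous.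
apply: filterS (near_disc0 ar) => b br.
rewrite /q mulrC -citgD; [|exact: cauchy_int_cts|exact: cauchy_int_cts].
rewrite -citgZ; last first.
  by move=> t tT; apply: ccontD; [exact: (@cauchy_int_cts 2 1 b a)|exact: (@cauchy_int_cts 1 2 b a)].
have C1 x : normc (x : R[i]) < r -> ccts tau (fun t => c t * (circ r t - x)^-1 ^+ 2).
  by move=> xr t _; apply: ccontM; [exact: cc|exact: kernel_continuous].
rewrite /cauchy_int -[X in _ - X]mul1r -mulNr -citgZ; last exact: C1.
rewrite -citgD; first last.
- by move=> t tT; apply: ccontM; [exact: ccont_cst|exact: C1].
- exact: C1.
apply: citg_ext => t _; have := circ_sub_neq0 t ar; have := circ_sub_neq0 t br.
set u := circ r t => u1 u2; rewrite mulN1r -mulrBr -mulrDr.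
rewrite mulrCA; congr (_ * _).
by field; rewrite u1 u2.
Qed.

End cauchy_int.

Lemma near_all (T : topologicalType) (x : T) (P : T -> Prop) :
  (forall y, P y) -> \forall y \near x, P y.
Proof. exact: nearW. Qed.

Lemma is_derive_compC (f g : C -> C) (z d d' : C) :
  is_derive (g z) 1 f d -> is_derive z 1 g d' -> is_derive z 1 (fun w => f (g w)) (d * d').
Proof.
move=> /caratheodory[q [qE cq <-]] dg.
have cg : {for z, continuous g} by apply: derivable_continuousC; case: dg.
have [q' [qE' cq' <-]] := caratheodory dg.
apply: (caratheodory_der (q := fun w => q (g w) * q' w)).
  by apply: near_all => w; rewrite qE qE' mulrA.
exact: (ccontM (ccont_comp cq cg) cq').
Qed.

Lemma is_deriveDC (f g : C -> C) (z d d' : C) :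
  is_derive z 1 f d -> is_derive z 1 g d' -> is_derive z 1 (fun w => f w + g w) (d + d').
Proof.
move=> /caratheodory[q [qE cq <-]] /caratheodory[q' [qE' cq' <-]].
apply: (caratheodory_der (q := fun w => q w + q' w)); last exact: (ccontD cq cq').
by apply: near_all => w; rewrite mulrDl -qE -qE' opprD addrACA.
Qed.

Lemma is_deriveMC (f g : C -> C) (z d d' : C) :
  is_derive z 1 f d -> is_derive z 1 g d' ->
  is_derive z 1 (fun w => f w * g w) (f z * d' + d * g z).
Proof.
move=> /caratheodory[q [qE cq <-]] dg.
have cg : {for z, continuous g} by apply: derivable_continuousC; case: dg.
have [q' [qE' cq' <-]] := caratheodory dg.
apply: (caratheodory_der (q := fun w => f z * q' w + q w * g w)).
  apply: near_all => w.
  have -> : (f z * q' w + q w * g w) * (w - z) = f z * (q' w * (w - z)) + q w * (w - z) * g w.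
    by ring.
  by rewrite -qE -qE'; ring.
exact: (ccontD (ccontM (@ccont_cst _ (f z) z) cq') (ccontM cq cg)).
Qed.

Lemma is_derive_cstC (a z : C) : is_derive z 1 (fun=> a) (0 : C).
Proof. exact: is_derive_cst. Qed.

Lemma is_derive_idC (z : C) : is_derive z 1 (fun w : C => w) (1 : C).
Proof. exact: is_derive_id. Qed.

Lemma is_deriveZC (a : C) (f : C -> C) (z d : C) :
  is_derive z 1 f d -> is_derive z 1 (fun w => a * f w) (a * d).
Proof. by move=> df; have := is_deriveMC (is_derive_cstC a z) df; rewrite mul0r addr0. Qed.

Lemma is_derive_eqC (f : C -> C) (z d d' : C) : is_derive z 1 f d -> d = d' -> is_derive z 1 f d'.
Proof. by move=> ? <-. Qed.

Lemma is_derive_shiftC (f : C -> C) (a z d : C) :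
  is_derive (z - a) 1 f d -> is_derive z 1 (fun w => f (w - a)) d.
Proof.
move=> df; have H := is_deriveDC (is_derive_idC z) (is_derive_cstC (- a) z).
have H2 := @is_derive_compC f (fun w => w - a) z d (1 + 0) df H.
by rewrite addr0 mulr1 in H2.
Qed.

Lemma is_derive_nearC (f g : C -> C) (z d : C) :
  (\forall w \near z, f w = g w) -> is_derive z 1 f d -> is_derive z 1 g d.
Proof. by move=> fg; apply: near_eq_is_derive. Qed.

Lemma chol_intro (O : set C) (f f' : C -> C) : open O ->
  (forall z, O z -> is_derive z 1 f (f' z)) ->
  (forall z, O z -> {for z, continuous f'}) -> chol O f.
Proof.
move=> oO df cf'; split=> z Oz; first by have [] := df z Oz.
apply: continuous_ext oO Oz _ (cf' z Oz) => w Ow.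
by have [_ ->] := df w Ow.
Qed.

Lemma chol_sub (O O' : set C) f : O' `<=` O -> chol O f -> chol O' f.
Proof. by move=> OO [df cf]; split=> z /OO; [exact: df|exact: cf]. Qed.

(** On a small disc f is a Cauchy integral of its boundary values, so f' and f'' are Cauchy
    integrals with kernel exponents 2 and 3, and these are continuous. *)
Lemma chol_derive (O : set C) f : open O -> chol O f -> chol O ('D_1 f).
Proof.
move=> oO hf.
have H z : O z -> exists2 A : set C, open A /\ A z & exists2 f'' : C -> C,
    (forall w, A w -> is_derive w 1 ('D_1 f) (f'' w)) & {for z, continuous f''}.
  move=> Oz; have [r' r'0 rO] := nbhs_disc (open_nbhs_nbhs (conj oO Oz)).
  have hf' := chol_sub rO hf.
  pose r := r' / 2; have r0 : 0 < r by rewrite divr_gt0.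
  have rr' : r < r' by rewrite /r; lra.
  pose c t := f (z + circ r t) * circ r t.
  have cc t : {for t, continuous c}.
    apply: ccontM; last exact: circ_continuous.
    apply: (ccont_comp (f := f)).
      apply: chol_continuous hf' _; rewrite /disc /= addrC addKr normc_circ //; exact: ltW.
    by apply: ccontD; [exact: ccont_cst|exact: circ_continuous].
  pose T1 : C := (tau%:C%C)^-1.
  have tau0 : (tau%:C%C : C) != 0 by rewrite eq_complex /= negb_and gt_eqF ?tau_gt0.
  have fE w : disc z r w -> T1 * cauchy_int c r 1 (w - z) = f w.
    move=> zw; have := cauchy_formula rr' hf' zw.
    rewrite (@citg_ext tau _ (fun t => c t * (circ r t - (w - z))^-1 ^+ 1)).
      by move=> E; rewrite /cauchy_int E mulrC mulfK.
    by move=> t _; rewrite /c expr1 mulrA.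
  have oD := @disc_open z r.
  have dD w : disc z r w -> is_derive w 1 f (T1 * cauchy_int c r 2 (w - z)).
    move=> zw; apply: is_derive_nearC (open_near oD zw fE) _.
    by apply: is_deriveZC; apply: is_derive_shiftC; exact: is_derive_cauchy_int1.
  exists (disc z r); first by split => //; exact: disc_center.
  exists (fun w => T1 * (2%:R * cauchy_int c r 3 (w - z))).
    move=> w zw; apply: (@is_derive_nearC (fun w => T1 * cauchy_int c r 2 (w - z))).
      by apply: open_near oD zw _ => w' /dD [_ ->].
    by apply: is_deriveZC; apply: is_derive_shiftC; exact: is_derive_cauchy_int2.
  apply: ccontM; first exact: ccont_cst.
  apply: ccontM; first exact: ccont_cst.
  apply: (ccont_comp (f := cauchy_int c r 3)).
    by apply: cauchy_int_continuous => //; rewrite subrr Normc.normc0.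
  by apply: ccontB; [exact: cvg_id|exact: ccont_cst].
split=> z Oz; have [A [oA Az] [f'' df cf'']] := H z Oz.
  by have [] := df z Az.
apply: continuous_ext oA Az _ cf'' => w Aw.
by have [_ ->] := df w Aw.
Qed.

End complex_calculus.

(** * Holomorphic and smooth complex functions *)

Section holomorphic_maps.
Context {R : realType}.
Local Notation C := (Cplx R).
Local Notation Re := complex.Re.
Local Notation Im := complex.Im.

Lemma cholD (O : set C) (f g : C -> C) : open O -> chol O f -> chol O g -> chol O (fun z => f z + g z).
Proof.
move=> oO hf hg; apply: (chol_intro (f' := fun z => 'D_1 f z + 'D_1 g z) oO) => z Oz.
  exact: (is_deriveDC (chol_is_derive hf Oz) (chol_is_derive hg Oz)).
exact: (ccontD (hf.2 z Oz) (hg.2 z Oz)).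
Qed.

Lemma cholM (O : set C) (f g : C -> C) : open O -> chol O f -> chol O g -> chol O (fun z => f z * g z).
Proof.
move=> oO hf hg.
have D z : O z -> is_derive z 1 (fun z => f z * g z) (f z * 'D_1 g z + 'D_1 f z * g z).
  by move=> Oz; exact: (is_deriveMC (chol_is_derive hf Oz) (chol_is_derive hg Oz)).
apply: (chol_intro oO D) => z Oz.
apply: ccontD; first exact: (ccontM (chol_continuous hf Oz) (hg.2 z Oz)).
exact: (ccontM (hf.2 z Oz) (chol_continuous hg Oz)).
Qed.

Lemma chol_cst (O : set C) (a : C) : open O -> chol O (fun=> a).
Proof.
move=> oO; apply: (chol_intro (f' := fun=> 0) oO (fun z _ => is_derive_cstC a z)).
by move=> z _; exact: ccont_cst.
Qed.

Lemma chol_id (O : set C) : open O -> chol O (fun z => z).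
Proof.
move=> oO; apply: (chol_intro (f' := fun=> 1) oO (fun z _ => is_derive_idC z)).
by move=> z _; exact: ccont_cst.
Qed.

Lemma chol_comp (O O' : set C) (f g : C -> C) : open O -> open O' -> (forall z, O z -> O' (g z)) ->
  chol O' f -> chol O g -> chol O (fun z => f (g z)).
Proof.
move=> oO oO' OO hf hg.
apply: (chol_intro (f' := fun z => 'D_1 f (g z) * 'D_1 g z) oO) => z Oz.
  exact: (is_derive_compC (chol_is_derive hf (OO _ Oz)) (chol_is_derive hg Oz)).
exact: (ccontM (ccont_comp (hf.2 _ (OO _ Oz)) (chol_continuous hg Oz)) (hg.2 z Oz)).
Qed.

Lemma cholV (O : set C) (f : C -> C) : open O -> (forall z, O z -> f z != 0) -> chol O f ->
  chol O (fun z => (f z)^-1).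
Proof.
move=> oO f0 hf.
have D z : O z -> is_derive z 1 (fun z => (f z)^-1) (- (f z ^+ 2)^-1 * 'D_1 f z).
  by move=> Oz; exact: (is_derive_compC (is_derive_invC (f0 z Oz)) (chol_is_derive hf Oz)).
apply: (chol_intro oO D) => z Oz.
apply: ccontM (hf.2 z Oz).
apply: (@continuousN C); apply: ccontV; first by rewrite expf_neq0 // f0.
by apply: ccontX; exact: chol_continuous hf Oz.
Qed.

Lemma chol_ext (O : set C) (f g : C -> C) : open O -> (forall z, O z -> f z = g z) -> chol O f -> chol O g.
Proof.
move=> oO fg hf; apply: (chol_intro (f' := 'D_1 f) oO) => z Oz; last exact: hf.2.
exact: is_derive_nearC (open_near oO Oz fg) (chol_is_derive hf Oz).
Qed.

Lemma cholX (O : set C) (f : C -> C) n : open O -> chol O f -> chol O (fun z => f z ^+ n).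
Proof.
move=> oO hf; elim: n => [|n IH]; first exact: chol_cst.
by apply: chol_ext (cholM oO hf IH) => // z _; rewrite exprS.
Qed.

(* The holomorphic function that agrees with the conjugate of [f] on the real axis. *)
Definition sharp (f : C -> C) (z : C) : C := conjc (f (conjc (z : R[i])) : R[i]).

Lemma conjcM (z w : C) : conjc (z * w : R[i]) = (conjc (z : R[i]) * conjc (w : R[i])) :> R[i].
Proof. exact: rmorphM. Qed.

Lemma conjcB (z w : C) : conjc (z - w : R[i]) = (conjc (z : R[i]) - conjc (w : R[i])) :> R[i].
Proof. exact: rmorphB. Qed.

Lemma conjcD (z w : C) : conjc (z + w : R[i]) = (conjc (z : R[i]) + conjc (w : R[i])) :> R[i].
Proof. exact: rmorphD. Qed.

Lemma ccont_conj (T : topologicalType) (f : T -> C) x :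
  {for x, continuous f} -> {for x, continuous (fun y => conjc (f y : R[i]) : C)}.
Proof.
by move=> cf; exact: (@continuous_comp _ _ _ f (fun z : C => conjc (z : R[i]) : C) x cf (@conj_continuous R _)).
Qed.

Lemma is_derive_sharp (f : C -> C) (z d : C) :
  is_derive (conjc (z : R[i]) : C) 1 f d -> is_derive z 1 (sharp f) (conjc (d : R[i]) : C).
Proof.
move=> /caratheodory[q [qE cq <-]].
apply: (caratheodory_der (q := sharp q)).
  by apply: near_all => w; rewrite /sharp -conjcB qE conjcM conjcB !conjcK.
apply: ccont_conj; apply: (ccont_comp (f := q)); first exact: cq.
exact: (@conj_continuous R).
Qed.

Definition conjset (O : set C) : set C := [set z | O (conjc (z : R[i]) : C)].

Lemma conjset_open (O : set C) : open O -> open (conjset O).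
Proof.
move=> oO; apply: (@open_comp _ _ (fun z : C => conjc (z : R[i]) : C)) oO => z _.
exact: (@conj_continuous R).
Qed.

Lemma chol_sharp (O : set C) (f : C -> C) : open O -> chol O f -> chol (conjset O) (sharp f).
Proof.
move=> oO hf; apply: (chol_intro (f' := sharp ('D_1 f)) (conjset_open oO)) => z Oz.
- exact: is_derive_sharp (chol_is_derive hf Oz).
- apply: ccont_conj; apply: (ccont_comp (f := 'D_1 f)); first exact: hf.2.
  exact: (@conj_continuous R).
Qed.

(** * Complex-valued functions of class C^k on real spaces *)

Definition cSk (n k : nat) (U : set 'rV[R]_n) (f : 'rV[R]_n -> C) : Prop :=
  sCk k U (fun x => Re (f x : R[i])) /\ sCk k U (fun x => Im (f x : R[i])).

Section cSk.
Variables (n k : nat) (U : set 'rV[R]_n).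
Hypothesis oU : open U.
Implicit Types f g : 'rV[R]_n -> C.

Lemma cSk_ext f g : (forall x, U x -> f x = g x) -> cSk k U f -> cSk k U g.
Proof. by move=> fg [H1 H2]; split; [apply: sCk_ext H1|apply: sCk_ext H2] => // x /fg ->. Qed.

Lemma cSkD f g : cSk k U f -> cSk k U g -> cSk k U (fun x => f x + g x).
Proof.
move=> [f1 f2] [g1 g2]; split.
  by apply: sCk_ext (sCkD oU f1 g1) => // x _; by case: (f x) => ? ?; case: (g x).
by apply: sCk_ext (sCkD oU f2 g2) => // x _; by case: (f x) => ? ?; case: (g x).
Qed.

Lemma cSkM f g : cSk k U f -> cSk k U g -> cSk k U (fun x => f x * g x).
Proof.
move=> [f1 f2] [g1 g2]; split.
  by apply: sCk_ext (sCkB oU (sCkM oU f1 g1) (sCkM oU f2 g2)) => // x _; by case: (f x) => ? ?; case: (g x).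
by apply: sCk_ext (sCkD oU (sCkM oU f1 g2) (sCkM oU f2 g1)) => // x _; by case: (f x) => ? ?; case: (g x).
Qed.

Lemma cSk_cst (a : C) : cSk k U (fun=> a).
Proof. by split; exact: sCk_cst. Qed.

Lemma cSkX f m : cSk k U f -> cSk k U (fun x => f x ^+ m).
Proof.
move=> Cf; elim: m => [|m IH]; first exact: cSk_cst.
by apply: cSk_ext (cSkM Cf IH) => x _; rewrite exprS.
Qed.

Lemma cSk_real (f : 'rV[R]_n -> R) : sCk k U f -> cSk k U (fun x => (f x)%:C%C : C).
Proof. by move=> Cf; split => //=; exact: sCk_cst. Qed.

Lemma cSk_conj f : cSk k U f -> cSk k U (fun x => conjc (f x : R[i]) : C).
Proof.
move=> [f1 f2]; split; first by apply: sCk_ext f1 => // x _; case: (f x).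
by apply: sCk_ext (sCkN oU f2) => // x _; case: (f x).
Qed.

End cSk.

Lemma toC_ofC (z : C) : toC (ofC z) = z.
Proof. by rewrite /toC !mxE /=; case: z. Qed.

Lemma ofC_toC (w : 'rV[R]_2) : ofC (toC w) = w.
Proof.
apply/rowP => j; rewrite mxE /toC /=; case: j => [[|[|//]]] /= j2;
  by congr (w 0 _); apply/val_inj.
Qed.

Lemma toC_continuous : continuous (@toC R).
Proof.
move=> w; apply/(continuous_complexP (@toC R)); split; exact: coord_continuous.
Qed.

Definition prec (O : set C) : set 'rV[R]_2 := [set w | O (toC w)].

Lemma prec_open (O : set C) : open O -> open (prec O).
Proof. by move=> oO; apply: (@open_comp _ _ (@toC R)) oO => w _; exact: toC_continuous. Qed.

Lemma cder_toC (w v : 'rV[R]_2) : cder (@toC R) w v (toC v).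
Proof. by split; exact: is_derive_coord. Qed.

Lemma cder_holo (O : set C) (f : C -> C) (w v : 'rV[R]_2) : chol O f -> O (toC w) ->
  cder (fun w => f (toC w)) w v ('D_1 f (toC w) * toC v).
Proof.
move=> hf Ow; apply: chain_rule (chol_is_derive hf Ow) (cder_toC w v) _.
exact: toC_continuous.
Qed.

(** The partials are f' times the constants [toC (delta_mx 0 i)], and f' is again [chol], so the
    induction runs over all holomorphic functions at once. *)
Lemma cSk_holo k (O : set C) (f : C -> C) : open O -> chol O f -> cSk k (prec O) (fun w => f (toC w)).
Proof.
move=> oO; have oP := prec_open oO.
elim: k f => [|k IH] f hf.
  split=> w Ow; have cf : {for w, continuous (fun w => f (toC w))}.
  - by apply: (ccont_comp (f := f)); [exact: chol_continuous hf Ow|exact: toC_continuous].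
  - by have [] := (continuous_complexP (fun w => f (toC w)) w).1 cf.
  - by apply: (ccont_comp (f := f)); [exact: chol_continuous hf Ow|exact: toC_continuous].
  - by have [] := (continuous_complexP (fun w => f (toC w)) w).1 cf.
have cf w : prec O w -> {for w, continuous (fun w => f (toC w))}.
  move=> Ow.
  by apply: (ccont_comp (f := f)); [exact: chol_continuous hf Ow|exact: toC_continuous].
have [IH1 IH2] := IH _ (chol_derive oO hf).
split; split => [w Ow|i].
- by have [] := (continuous_complexP (fun w => f (toC w)) w).1 (cf w Ow).
- split=> [w Ow|]; first by have [[+ _] _] := cder_holo (delta_mx 0 i) hf Ow.
  apply: (@sCk_ext _ _ k _ (fun w => Re ('D_1 f (toC w) * toC (delta_mx 0 i) : R[i]))) => //.
    by move=> w Ow; have [[_ ->] _] := cder_holo (delta_mx 0 i) hf Ow.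
  have [] // := cSkM oP (conj IH1 IH2) (@cSk_cst _ k _ oP (toC (delta_mx 0 i))).
- by have [] := (continuous_complexP (fun w => f (toC w)) w).1 (cf w Ow).
- split=> [w Ow|]; first by have [_ [+ _]] := cder_holo (delta_mx 0 i) hf Ow.
  apply: (@sCk_ext _ _ k _ (fun w => Im ('D_1 f (toC w) * toC (delta_mx 0 i) : R[i]))) => //.
    by move=> w Ow; have [_ [_ ->]] := cder_holo (delta_mx 0 i) hf Ow.
  have [] // := cSkM oP (conj IH1 IH2) (@cSk_cst _ k _ oP (toC (delta_mx 0 i))).
Qed.

Lemma cSk_comp n k (U : set 'rV[R]_n) (O : set C) (f : C -> C) (psi : 'rV[R]_n -> C) :
  open U -> open O -> (forall x, U x -> O (psi x)) -> chol O f -> cSk k U psi ->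
  cSk k U (fun x => f (psi x)).
Proof.
move=> oU oO UO hf [p1 p2]; have [h1 h2] := cSk_holo k oO hf.
have Cpsi j : sCk k U (fun x => ofC (psi x) 0 j).
  case: j => [[|[|//]]] /= j2; [apply: sCk_ext p1|apply: sCk_ext p2] => // x _;
    by rewrite mxE.
have UP x : U x -> prec O (ofC (psi x)) by move=> Ux; rewrite /prec /= toC_ofC; exact: UO.
split.
  apply: sCk_ext (sCk_comp oU (prec_open oO) UP h1 Cpsi) => // x _.
  by rewrite toC_ofC.
apply: sCk_ext (sCk_comp oU (prec_open oO) UP h2 Cpsi) => // x _.
by rewrite toC_ofC.
Qed.

(** * Integration over the last coordinate *)

Definition emb n (x : 'rV[R]_n) (t : R) : 'rV[R]_n.+1 :=
  \row_j (if unlift ord_max j is Some i then x 0 i else t).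

Definition init n (y : 'rV[R]_n.+1) : 'rV[R]_n := \row_i y 0 (lift ord_max i).

Lemma emb_lift n (x : 'rV[R]_n) t i : emb x t 0 (lift ord_max i) = x 0 i.
Proof. by rewrite mxE liftK. Qed.

Lemma emb_max n (x : 'rV[R]_n) t : emb x t 0 ord_max = t.
Proof. by rewrite mxE unlift_none. Qed.

Lemma initK n (x : 'rV[R]_n) t : init (emb x t) = x.
Proof. by apply/rowP => i; rewrite mxE emb_lift. Qed.

Lemma init_continuous n : continuous (@init n).
Proof.
move=> y; apply: (for_continuous_mxP (@init n) y).2 => i j; rewrite ord1.
rewrite (_ : (fun y => _) = fun y : 'rV[R]_n.+1 => y 0 (lift ord_max j)).
  exact: coord_continuous.
by apply/funext => z; rewrite mxE.
Qed.

Lemma emb_continuous n (p : 'rV[R]_n * R) : {for p, continuous (fun p => emb p.1 p.2)}.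
Proof.
apply: (for_continuous_mxP (fun p : 'rV[R]_n * R => emb p.1 p.2) p).2 => a j.
rewrite ord1; case: (unliftP ord_max j) => [i ->|->].
  rewrite (_ : (fun y => _) = fun y : 'rV[R]_n * R => y.1 0 i).
    apply: (@continuous_comp _ _ _ fst (fun x : 'rV[R]_n => x 0 i)).
      exact: fst_continuous.
    exact: coord_continuous.
  by apply/funext => y; rewrite emb_lift.
rewrite (_ : (fun y => _) = fun y : 'rV[R]_n * R => y.2); first exact: snd_continuous.
by apply/funext => y; rewrite emb_max.
Qed.

Lemma emb_continuous2 n (x : 'rV[R]_n) t : {for t, continuous (emb x)}.
Proof.
apply: (for_continuous_mxP (emb x) t).2 => a j.
rewrite ord1; case: (unliftP ord_max j) => [i ->|->].
  rewrite (_ : (fun y => _) = fun=> x 0 i); first exact: cst_continuous.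
  by apply/funext => y; rewrite emb_lift.
rewrite (_ : (fun y => _) = id); first exact: cvg_id.
by apply/funext => y; rewrite emb_max.
Qed.

Lemma emb_addZ n (x : 'rV[R]_n) (h t : R) i :
  emb (h *: delta_mx 0 i + x) t = h *: delta_mx 0 (lift ord_max i) + emb x t.
Proof.
apply/rowP => j; case: (unliftP ord_max j) => [k ->|->].
  by rewrite emb_lift !mxE liftK (inj_eq lift_inj).
rewrite emb_max !mxE unlift_none.
by rewrite (negbTE (neq_lift _ _)) andbF mulr0 add0r.
Qed.

(** A partial of the integral is the integral of the partial of [H] in the lifted direction, so the
    induction stays within integrals of this shape. *)
Lemma sCk_itg n k (U : set 'rV[R]_n) (H : 'rV[R]_n.+1 -> R) T : 0 < T -> open U ->
  sCk k (@init n @^-1` U) H -> sCk k U (fun x => itg T (fun t => H (emb x t))).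
Proof.
move=> T0 oU; elim: k H => [|k IH] H CH.
  move=> x Ux; apply: (itg_continuous T0 (G := fun x t => H (emb x t))).
    apply: open_near oU Ux _ => y Uy t _.
    apply: (@continuous_comp _ _ _ (emb y) H); first exact: emb_continuous2.
    by apply: CH; rewrite /preimage /= initK.
  move=> t _; apply: (@continuous_comp _ _ _ (fun p : 'rV[R]_n * R => emb p.1 p.2) H).
    exact: emb_continuous.
  by apply: CH; rewrite /preimage /= initK.
have CH0 : sCk 0 (@init n @^-1` U) H by move=> x Ux; exact: sCk_cont CH Ux.
have cG y : U y -> cts T (fun t => H (emb y t)).
  move=> Uy t _; apply: (@continuous_comp _ _ _ (emb y) H); first exact: emb_continuous2.
  by apply: CH0; rewrite /preimage /= initK.
have dI x i : U x -> is_derive x (delta_mx 0 i) (fun x => itg T (fun t => H (emb x t)))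
   (itg T (fun t => 'D_(delta_mx 0 (lift ord_max i)) H (emb x t))).
  move=> Ux.
  have cdH : sCk 0 (@init n @^-1` U) ('D_(delta_mx 0 (lift ord_max i)) H).
    by move=> y Uy; exact: sCk_cont (CH.2 _).2 Uy.
  apply: (itg_derive T0 (G := fun x t => H (emb x t))
    (dG := fun x t => 'D_(delta_mx 0 (lift ord_max i)) H (emb x t))).
  - by apply: open_near oU Ux _ => y Uy; exact: cG.
  - move=> t _; apply: (@continuous_comp _ _ _ (emb x) ('D_(delta_mx 0 (lift ord_max i)) H)).
      exact: emb_continuous2.
    by apply: cdH; rewrite /preimage /= initK.
  - apply: open_near oU Ux _ => y Uy t _; apply/is_deriveP.
    have dH : derivable H (emb y t) (delta_mx 0 (lift ord_max i)).
      by apply: (CH.2 _).1; rewrite /preimage /= initK.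
    rewrite (_ : (fun h : R => _) = (fun h : R => h^-1 *: (H (h *: delta_mx 0 (lift ord_max i) + emb y t) - H (emb y t)))).
      exact: dH.
    by apply/funext => h; rewrite emb_addZ.
  - move=> t _; apply: (@continuous_comp _ _ _ (fun p : 'rV[R]_n * R => emb p.1 p.2) ('D_(delta_mx 0 (lift ord_max i)) H)).
      exact: emb_continuous.
    by apply: cdH; rewrite /preimage /= initK.
split.
  move=> x Ux; apply: (itg_continuous T0 (G := fun x t => H (emb x t))).
    by apply: open_near oU Ux _ => y Uy; exact: cG.
  move=> t _; apply: (@continuous_comp _ _ _ (fun p : 'rV[R]_n * R => emb p.1 p.2) H).
    exact: emb_continuous.
  by apply: CH0; rewrite /preimage /= initK.
move=> i; split=> [x Ux|]; first by have [] := dI x i Ux.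
apply: sCk_ext (IH _ (CH.2 (lift ord_max i)).2) => // x Ux.
by have [_ ->] := dI x i Ux.
Qed.

Lemma is_derive_comp1 (V : normedModType R) (u : R -> R) (f : V -> R) (x v : V) du df :
  is_derive (f x) 1 u du -> is_derive x v f df ->
  is_derive x v (fun y => u (f y)) (du * df).
Proof.
move=> Hu [d dE].
pose ps (s : R) := f (s *: v + x).
have ps0 : ps 0 = f x by rewrite /ps scale0r add0r.
have dps : is_derive (0 : R) 1 ps df.
  have dl := derive_lineE f x v; rewrite dE in dl.
  by apply: DeriveDef; [exact: (derivable1P f x v).1 d|exact: dl].
rewrite -ps0 in Hu; have [d1 d1E] := is_derive1_comp Hu dps.
have dl := derive_lineE (fun y => u (f y)) x v.
apply: DeriveDef; first exact: (derivable1P (fun y => u (f y)) x v).2 d1.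
by rewrite -dl.
Qed.

Lemma sCk_cos_sin n k (U : set 'rV[R]_n) (f : 'rV[R]_n -> R) : open U -> sCk k U f ->
  sCk k U (fun x => cos (f x)) /\ sCk k U (fun x => sin (f x)).
Proof.
move=> oU; elim: k => [|k IH] Cf.
  split=> x Ux; [apply: (@continuous_comp _ _ _ f cos)|apply: (@continuous_comp _ _ _ f sin)];
    try exact: Cf; [exact: continuous_cos|exact: continuous_sin].
have [IHa IHb] := IH (sCk_le Cf).
have dc x i : U x -> is_derive x (delta_mx 0 i) (fun y => cos (f y))
    (- sin (f x) * 'D_(delta_mx 0 i) f x).
  by move=> Ux; apply: is_derive_comp1 (derivableP ((Cf.2 i).1 x Ux)); exact: is_derive_cos.
have ds x i : U x -> is_derive x (delta_mx 0 i) (fun y => sin (f y))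
    (cos (f x) * 'D_(delta_mx 0 i) f x).
  by move=> Ux; apply: is_derive_comp1 (derivableP ((Cf.2 i).1 x Ux)); exact: is_derive_sin.
split; (split; first by move=> x Ux; first [exact: sCk_cont IHa Ux|exact: sCk_cont IHb Ux]);
  move=> i; split.
- by move=> x Ux; have [] := dc x i Ux.
- apply: sCk_ext (sCkM oU (sCkN oU IHb) (Cf.2 i).2) => // x Ux.
  by have [_ ->] := dc x i Ux.
- by move=> x Ux; have [] := ds x i Ux.
- apply: sCk_ext (sCkM oU IHa (Cf.2 i).2) => // x Ux.
  by have [_ ->] := ds x i Ux.
Qed.

Lemma cSk_circ n k (U : set 'rV[R]_n) (f : 'rV[R]_n -> R) (r : R) : open U -> sCk k U f ->
  cSk k U (fun x => circ r (f x)).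
Proof.
move=> oU /(sCk_cos_sin oU)[c s].
by split; apply: (sCkM oU (sCk_cst k r oU)).
Qed.

End holomorphic_maps.

(** It follows the syntax of sums, products and powers. Differences in the functions passed to it
    are therefore written in the form [f + (-1) * g]. *)
Ltac chol_auto oO := lazymatch goal with
  | H : chol ?O ?q |- chol ?O ?q => exact H
  | H : chol ?O ?q |- chol ?O (fun z => ?q z) => exact H
  | |- chol ?O (fun z => z) => exact (chol_id oO)
  | |- chol ?O (fun _ => ?a) => exact (chol_cst a oO)
  | |- chol ?O (fun z => @?f z + @?g z) => refine (@cholD _ O f g oO _ _); chol_auto oO
  | |- chol ?O (fun z => @?f z * @?g z) => refine (@cholM _ O f g oO _ _); chol_auto oO
  | |- chol ?O (fun z => @?f z ^+ ?n) => refine (@cholX _ O f n oO _); chol_auto oO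
  end.

(** * Jets and Cauchy moments *)

Section jets.
Context {R : realType}.
Local Notation C := (Cplx R).
Local Notation normc := Normc.normc.

Lemma sCk_sqrt n k (U : set 'rV[R]_n) (f : 'rV[R]_n -> R) : open U ->
  (forall x, U x -> 0 < f x) -> sCk k U f -> sCk k U (fun x => Num.sqrt (f x)).
Proof.
move=> oU f0; elim: k => [|k IH] Cf.
  move=> x Ux; apply: (@continuous_comp _ _ _ f Num.sqrt); first exact: Cf.
  exact: sqrt_continuous.
have IH' := IH (sCk_le Cf).
have d x i : U x -> is_derive x (delta_mx 0 i) (fun y => Num.sqrt (f y))
    ((2 * Num.sqrt (f x))^-1 * 'D_(delta_mx 0 i) f x).
  move=> Ux; apply: is_derive_comp1 (derivableP ((Cf.2 i).1 x Ux)).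
  exact: is_derive1_sqrt (f0 x Ux).
split; first by move=> x Ux; exact: sCk_cont IH' Ux.
move=> i; split; first by move=> x Ux; have [] := d x i Ux.
have Cv : sCk k U (fun x => (2 * Num.sqrt (f x))^-1).
  apply: sCkV oU _ (sCkM oU (sCk_cst k 2 oU) IH') => x Ux.
  by rewrite mulf_neq0 // gt_eqF // sqrtr_gt0 f0.
apply: sCk_ext (sCkM oU Cv (Cf.2 i).2) => // x Ux.
by have [_ ->] := d x i Ux.
Qed.

Lemma disc0E (r : R) (z : C) : disc 0 r z = (normc (z : R[i]) < r).
Proof. by rewrite /disc /= -[X in normc X]/(z - 0) subr0. Qed.

Lemma tau_neq0 : (tau%:C%C : C) != 0.
Proof. by rewrite eq_complex /= negb_and gt_eqF ?tau_gt0. Qed.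

Lemma cauchy_formula0 (r r' : R) (f : C -> C) (z : C) : r < r' -> chol (disc 0 r') f ->
  normc (z : R[i]) < r ->
  f z = (tau%:C%C)^-1 * citg tau (fun t => f (circ r t) * (circ r t / (circ r t - z))).
Proof.
move=> rr' hf zr; have zr' : normc (z - 0 : R[i]) < r by rewrite subr0.
have := cauchy_formula rr' hf zr'.
rewrite (@citg_ext R tau _ (fun t => f (circ r t) * (circ r t / (circ r t - z)))).
  by move=> ->; rewrite mulrC mulfK // tau_neq0.
by move=> t _; rewrite add0r subr0.
Qed.

Lemma chol_local (O : set C) (f : C -> C) :
  (forall z, O z -> exists2 O' : set C, O' z & chol O' f) -> chol O f.
Proof. by move=> H; split=> z /H [A Az [df cf]]; [exact: df|exact: cf]. Qed.

Lemma openC0 : open [set w : C | w != 0].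
Proof.
have -> : [set w : C | w != 0] = (fun z : C => normc (z : R[i])) @^-1` [set x | 0 < x].
  by apply/seteqP; split=> w /=; rewrite normc_gt0.
by apply: open_comp; [move=> z _; exact: normc_continuous|exact: open_gt].
Qed.

(** Removable singularity of the difference quotient at 0: since u/(u-h) - 1 = h/(u-h), Cauchy's
    formula writes f(h) - f(0) as h times a Cauchy integral, which is holomorphic at 0 as well. *)
Lemma chol_divided (r : R) (f : C -> C) : chol (disc 0 r) f ->
  exists2 f1, chol (disc 0 r) f1 & forall h, disc 0 r h -> f h = f 0 + h * f1 h.
Proof.
move=> hf; pose f1 (h : C) : C := if h == 0 then 'D_1 f 0 else (f h - f 0) / h.
have oD := @disc_open R 0 r.
exists f1; last first.
  move=> h hr; rewrite /f1; case: eqVneq => [->|h0]; first by rewrite mul0r addr0.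
  by rewrite mulrC divfK // addrC subrK.
apply: chol_local => z zr; have [z0|z0] := eqVneq z 0; last first.
  pose O := disc 0 r `&` [set w : C | w != 0].
  have oO : open O by apply: openI => //; exact: openC0.
  exists O => //; apply: (@chol_ext R O (fun h => (f h - f 0) * h^-1)) => //.
    by move=> w [_ /= w0]; rewrite /f1 (negbTE w0).
  apply: cholM => //.
    apply: cholD => //; last exact: chol_cst.
    by apply: chol_sub hf => w [].
  by apply: cholV => //; [move=> w []|exact: chol_id].
have r0 : 0 < r by apply: le_lt_trans zr; rewrite normc_ge0.
pose r1 := r / 2; have r10 : 0 < r1 by rewrite divr_gt0.
have r1r : r1 < r by rewrite /r1; lra.
have oD1 := @disc_open R 0 r1.
pose c t := f (circ r1 t).
have cc t : {for t, continuous c}.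
  apply: (ccont_comp (f := f)); last exact: circ_continuous.
  by apply: chol_continuous hf _; rewrite disc0E normc_circ //; exact: ltW.
pose T1 : C := (tau%:C%C)^-1.
exists (disc 0 r1); first by rewrite z0; exact: disc_center.
have dE w : disc 0 r1 w -> f w = f 0 + w * (T1 * cauchy_int c r1 1 w).
  move=> w1.
  have w1' : normc (w : R[i]) < r1 by move: w1; rewrite disc0E.
  have o1' : normc (0 : R[i]) < r1 by rewrite Normc.normc0.
  rewrite (cauchy_formula0 r1r hf w1') (cauchy_formula0 r1r hf o1').
  rewrite mulrCA -mulrDr; congr (_ * _).
  have k1 u t : normc (u : R[i]) < r1 -> {for t, continuous (fun t => c t * (circ r1 t - u)^-1 ^+ 1)}.
    by move=> ur; apply: ccontM; [exact: cc|exact: kernel_continuous].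
  rewrite /cauchy_int -citgZ; last by move=> t _; exact: k1.
  rewrite -citgD.
  - apply: citg_ext => t _; rewrite subr0.
    have n1 := circ_sub_neq0 t w1'.
    have n0 : circ r1 t != 0 by rewrite -[circ _ _]subr0 circ_sub_neq0 // Normc.normc0.
    rewrite /c; move: (circ r1 t) (f (circ r1 t)) n0 n1 => u fu n0 n1.
    by rewrite expr1; field; rewrite ?n0 ?n1.
  - move=> t _; apply: ccontM; first exact: cc.
    apply: ccontM; first exact: circ_continuous.
    apply: ccontV; first by apply: circ_sub_neq0; rewrite Normc.normc0.
    by apply: ccontB; [exact: circ_continuous|exact: ccont_cst].
  - by move=> t _; apply: ccontM; [exact: ccont_cst|exact: k1].
have hg : chol (disc 0 r1) (fun w => T1 * cauchy_int c r1 1 w).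
  have d0 w : disc 0 r1 w -> normc (w : R[i]) < r1 by rewrite disc0E.
  apply: (@chol_intro R _ _ (fun w => T1 * cauchy_int c r1 2 w) oD1) => w w1.
    by apply: is_deriveZC; apply: is_derive_cauchy_int1 => //; exact: d0.
  by apply: ccontM; [exact: ccont_cst|apply: cauchy_int_continuous => //; exact: d0].
apply: (chol_ext oD1 _ hg) => w w1; rewrite /f1; case: eqVneq => [w0|w0].
  have D0 : disc 0 r1 (0 : C) by exact: disc_center.
  have H := is_deriveDC (is_derive_cstC (f 0) 0) (is_deriveMC (is_derive_idC 0) (chol_is_derive hg D0)).
  have [_ ->] := is_derive_nearC (open_near oD1 D0 (fun w w1 => esym (dE w w1))) H.
  by rewrite mul0r !add0r mul1r w0.
by rewrite (dE w) // [f 0 + _]addrC addrK mulrAC mulfV // mul1r.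
Qed.
Lemma is_derive_XC k (h : C) : is_derive h 1 (fun h : C => h ^+ k) (k%:R * h ^+ k.-1 : C).
Proof.
elim: k => [|k IH]; first by rewrite mul0r; exact: is_derive_cstC.
have := is_deriveMC (is_derive_idC h) IH.
rewrite (_ : (fun w : C => w * w ^+ k) = (fun h : C => h ^+ k.+1)); last first.
  by apply/funext => w; rewrite exprS.
move=> H; apply: is_derive_eqC H _ => /=; rewrite mul1r -natr1 mulrDl mul1r; congr (_ + _).
by case: k {IH} => [|k]; rewrite ?mul0r ?mulr0 //= mulrCA -exprS.
Qed.

Lemma continuous_real_zero (E : C -> C) (r : R) : 0 < r -> {for 0, continuous E} ->
  (forall x : R, 0 < x < r -> E x%:C%C = 0) -> E 0 = 0.
Proof.
move=> r0 cE EZ; apply/eqP; rewrite -normc_eq0; apply/negPn/negP => E0.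
have e0 : 0 < normc (E 0 : R[i]) by rewrite lt_neqAle eq_sym E0 normc_ge0.
have [d d0 dE] := nbhs_disc ((cvg_normcP _ _ _).1 cE _ e0).
pose x := Num.min (r / 2) (d / 2).
have x0 : 0 < x by rewrite lt_min !divr_gt0.
have xr : x < r by rewrite gt_min; apply/orP; left; lra.
have xd : x < d by rewrite gt_min; apply/orP; right; lra.
have /dE /= : disc 0 d (x%:C%C : C) by rewrite disc0E normc_real ger0_norm // ltW.
have xr2 : 0 < x < r by rewrite x0.
by rewrite (EZ _ xr2) (subr0 (E 0)) ltxx.
Qed.
(** Powers of h are split off one at a time: f = h^(k+1) p gives (k+1) p + h p' = h^(n-k) q off 0,
    hence at 0 by continuity, so p(0) = 0 as long as k < n. *)
Lemma chol_zero_order (r : R) (n : nat) (f q : C -> C) : chol (disc 0 r) f -> chol (disc 0 r) q ->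
  f 0 = 0 -> (forall h, disc 0 r h -> 'D_1 f h = h ^+ n * q h) ->
  exists2 p, chol (disc 0 r) p & forall h, disc 0 r h -> f h = h ^+ n.+1 * p h.
Proof.
move=> hf hq f0 df.
have oD := @disc_open R 0 r.
have [r0|r0] := leP r 0.
  exists (fun=> 0); first exact: chol_cst.
  by move=> h; rewrite disc0E => /lt_le_trans/(_ r0); rewrite ltNge normc_ge0.
have D0 : disc 0 r (0 : C) by exact: disc_center.
suff : forall k, (k <= n)%N -> exists2 p, chol (disc 0 r) p & forall h, disc 0 r h -> f h = h ^+ k.+1 * p h.
  exact.
elim=> [|k IH] kn.
  have [p hp pE] := chol_divided hf; exists p => // h hr.
  by rewrite expr1 pE // f0 add0r.
have [p hp pE] := IH (ltnW kn).
have dp h : disc 0 r h -> k.+1%:R * p h + h * 'D_1 p h = h ^+ (n - k) * q h.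
  suff H z : disc 0 r z -> z != 0 -> k.+1%:R * p z + z * 'D_1 p z - z ^+ (n - k) * q z = 0.
    move=> hr; apply/eqP; rewrite -subr_eq0; apply/eqP.
    have [h0|h0] := eqVneq h 0; last exact: H.
    rewrite h0; apply: (continuous_real_zero r0 (E := fun z => k.+1%:R * p z + z * 'D_1 p z - z ^+ (n - k) * q z)).
      apply: ccontB.
        apply: ccontD; first by apply: ccontM; [exact: ccont_cst|exact: chol_continuous hp D0].
        by apply: ccontM; [exact: cvg_id|exact: hp.2].
      apply: ccontM; last exact: chol_continuous hq D0.
      by apply: ccontX; exact: cvg_id.
    move=> x /andP[x0 xr]; apply: H; first by rewrite disc0E normc_real ger0_norm // ltW.
    by rewrite eq_complex /= negb_and gt_eqF.
  move=> zr z0.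
  have H := is_derive_nearC (open_near oD zr (fun w wr => esym (pE w wr))) (is_deriveMC (is_derive_XC k.+1 z) (chol_is_derive hp zr)).
  have [_ E] := H; rewrite (df z zr) in E.
  have zk : z ^+ k != 0 by rewrite expf_neq0.
  apply: (mulfI zk); rewrite mulr0 mulrBr mulrA -exprD subnKC ?(ltnW kn) // E exprS /=; ring.
have [p1 h1 p1E] := chol_divided hp.
exists p1 => // h hr; rewrite pE // p1E //.
have := dp 0 D0; rewrite mul0r addr0 expr0n subn_eq0 leqNgt kn mul0r => /eqP.
have k0 : (k.+1%:R : C) != 0 by rewrite pnatr_eq0.
by rewrite mulf_eq0 (negbTE k0) /= => /eqP ->; rewrite add0r [h ^+ k.+2]exprSr mulrA.
Qed.

(** Order 4 is enough because expansions are made of derivatives of the entries: the y^5-term of an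
    entry comes from the fourth-order term of its derivative. *)
Definition jet5 (r : R) (f : C -> C) (c0 c1 c2 c3 c4 : C) := exists2 q, chol (disc 0 r) q &
  forall h, disc 0 r h ->
    f h = c0 + c1 * h + c2 * h ^+ 2 + c3 * h ^+ 3 + c4 * h ^+ 4 + h ^+ 5 * q h.

Lemma jet5_at0 r f c0 c1 c2 c3 c4 : 0 < r -> jet5 r f c0 c1 c2 c3 c4 -> f 0 = c0.
Proof.
move=> r0 [q _ ->]; last exact: disc_center.
by rewrite !expr0n /= !mulr0 !addr0 mul0r addr0.
Qed.

Lemma jet5_ext r f g c0 c1 c2 c3 c4 : (forall h, disc 0 r h -> f h = g h) ->
  jet5 r f c0 c1 c2 c3 c4 -> jet5 r g c0 c1 c2 c3 c4.
Proof. by move=> fg [q hq E]; exists q => // h hr; rewrite -fg // E. Qed.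

Lemma jet5_eq r f c0 c1 c2 c3 c4 d0 d1 d2 d3 d4 : jet5 r f c0 c1 c2 c3 c4 ->
  c0 = d0 -> c1 = d1 -> c2 = d2 -> c3 = d3 -> c4 = d4 -> jet5 r f d0 d1 d2 d3 d4.
Proof. by move=> H <- <- <- <- <-. Qed.

Lemma jet5_exists r f : chol (disc 0 r) f ->
  exists c1 c2 c3 c4, jet5 r f (f 0) c1 c2 c3 c4.
Proof.
move=> /chol_divided[f1 /chol_divided[f2 /chol_divided[f3 /chol_divided[f4 /chol_divided[f5 h5 E5] E4] E3] E2] E1].
exists (f1 0), (f2 0), (f3 0), (f4 0), f5 => // h hr.
rewrite E1 // E2 // E3 // E4 // E5 //; ring.
Qed.

Lemma jet5D r f g c0 c1 c2 c3 c4 d0 d1 d2 d3 d4 :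
  jet5 r f c0 c1 c2 c3 c4 -> jet5 r g d0 d1 d2 d3 d4 ->
  jet5 r (fun h => f h + g h) (c0 + d0) (c1 + d1) (c2 + d2) (c3 + d3) (c4 + d4).
Proof.
move=> [p hp E] [q hq F]; have oD := @disc_open R 0 r.
exists (fun h => p h + q h); first exact: cholD.
move=> h hr; rewrite E // F //; ring.
Qed.

Lemma jet5M r f g c0 c1 c2 c3 c4 d0 d1 d2 d3 d4 :
  jet5 r f c0 c1 c2 c3 c4 -> jet5 r g d0 d1 d2 d3 d4 ->
  jet5 r (fun h => f h * g h) (c0 * d0) (c0 * d1 + c1 * d0) (c0 * d2 + c1 * d1 + c2 * d0)
    (c0 * d3 + c1 * d2 + c2 * d1 + c3 * d0)
    (c0 * d4 + c1 * d3 + c2 * d2 + c3 * d1 + c4 * d0).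
Proof.
move=> [p hp E] [q hq F]; have oD := @disc_open R 0 r.
exists (fun h => p h * (d0 + d1 * h + d2 * h ^+ 2 + d3 * h ^+ 3 + d4 * h ^+ 4 + h ^+ 5 * q h) +
  (c0 + c1 * h + c2 * h ^+ 2 + c3 * h ^+ 3 + c4 * h ^+ 4) * q h +
  (c1 * d4 + c2 * d3 + c3 * d2 + c4 * d1 + (c2 * d4 + c3 * d3 + c4 * d2) * h +
   (c3 * d4 + c4 * d3) * h ^+ 2 + c4 * d4 * h ^+ 3)); first by chol_auto oD.
by move=> h hr; rewrite E // F //; ring.
Qed.

Lemma jet5_cst r a : jet5 r (fun=> a) a 0 0 0 0.
Proof.
exists (fun=> 0); first exact: (chol_cst _ (@disc_open R 0 r)).
by move=> h _; ring.
Qed.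

Lemma jet5_id r : jet5 r (fun h => h) 0 1 0 0 0.
Proof.
exists (fun=> 0); first exact: (chol_cst _ (@disc_open R 0 r)).
by move=> h _; ring.
Qed.

Lemma jet5_derive r f c0 c1 c2 c3 c4 : 0 < r -> jet5 r f c0 c1 c2 c3 c4 ->
  exists d4, jet5 r ('D_1 f) c1 (2%:R * c2) (3%:R * c3) (4%:R * c4) d4.
Proof.
move=> r0 [q hq E]; have oD := @disc_open R 0 r.
have [p hp pE] : exists2 p, chol (disc 0 r) p & forall h, disc 0 r h -> 5%:R * q h + h * 'D_1 q h =
    5%:R * q 0 + h * p h.
  have h1 : chol (disc 0 r) (fun h => 5%:R * q h + h * 'D_1 q h).
    have hq' := chol_derive oD hq; chol_auto oD.
  have [p hp pE] := chol_divided h1; exists p => // h hr.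
  by rewrite pE // mul0r addr0.
exists (5%:R * q 0), p => // h hr.
have X k := is_derive_XC k h.
have H := is_deriveDC (is_deriveDC (is_deriveDC (is_deriveDC (is_deriveDC (is_derive_cstC c0 h)
  (is_deriveZC c1 (is_derive_idC h))) (is_deriveZC c2 (X 2%N))) (is_deriveZC c3 (X 3%N)))
  (is_deriveZC c4 (X 4%N))) (is_deriveMC (X 5%N) (chol_is_derive hq hr)).
have [_ ->] := is_derive_nearC (open_near oD hr (fun w wr => esym (E w wr))) H.
transitivity (c1 + 2%:R * c2 * h + 3%:R * c3 * h ^+ 2 + 4%:R * c4 * h ^+ 3 +
   h ^+ 4 * (5%:R * q h + h * 'D_1 q h)); first by rewrite /=; ring.
by rewrite pE //; ring.
Qed.

(** Applied to a function and its [sharp], it shows that functions real on the axis have real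
    coefficients; applied to one function with two expansions, it compares coefficients. *)
Lemma jet5_real_uniq r f g c0 c1 c2 c3 c4 d0 d1 d2 d3 d4 : 0 < r ->
  jet5 r f c0 c1 c2 c3 c4 -> jet5 r g d0 d1 d2 d3 d4 ->
  (forall x : R, 0 < x < r -> f x%:C%C = g x%:C%C) ->
  [/\ c0 = d0, c1 = d1, c2 = d2, c3 = d3 & c4 = d4].
Proof.
move=> r0 [p hp E] [q hq F] fg; have oD := @disc_open R 0 r.
have D0 : disc 0 r (0 : C) by exact: disc_center.
have step (a : C) (u : C -> C) : chol (disc 0 r) u ->
  (forall x : R, 0 < x < r -> a + x%:C%C * u x%:C%C = 0) ->
  a = 0 /\ forall x : R, 0 < x < r -> u x%:C%C = 0.
  move=> hu H; have a0 : a = 0.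
    have := @continuous_real_zero (fun z => a + z * u z) r r0 _ H.
    rewrite mul0r addr0; apply; apply: ccontD; first exact: ccont_cst.
    by apply: ccontM; [exact: cvg_id|exact: chol_continuous hu D0].
  split=> // x xr; have := H x xr; rewrite a0 add0r => /eqP.
  rewrite mulf_eq0 => /orP[|/eqP //].
  by rewrite eq_complex /= eqxx andbT => /eqP x0; move: xr; rewrite x0 ltxx.
pose u4 z := (c4 - d4) + z * (p z + (-1) * q z).
pose u3 z := (c3 - d3) + z * u4 z.
pose u2 z := (c2 - d2) + z * u3 z.
pose u1 z := (c1 - d1) + z * u2 z.
have h5 : chol (disc 0 r) (fun z => p z + (-1) * q z) by chol_auto oD.
have h4 : chol (disc 0 r) u4 by rewrite /u4; chol_auto oD.
have h3 : chol (disc 0 r) u3 by rewrite /u3; chol_auto oD.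
have h2 : chol (disc 0 r) u2 by rewrite /u2; chol_auto oD.
have h1 : chol (disc 0 r) u1 by rewrite /u1; chol_auto oD.
have [/subr0_eq e0 z1] : c0 - d0 = 0 /\ forall x : R, 0 < x < r -> u1 x%:C%C = 0.
  apply: step => // x xr; have xr' : disc 0 r (x%:C%C : C).
    by case/andP: xr => x0 xr; rewrite disc0E normc_real ger0_norm // ltW.
  have := fg x xr; rewrite E // F // => /eqP; rewrite -subr_eq0 => /eqP <-.
  by rewrite /u1 /u2 /u3 /u4; ring.
have [/subr0_eq e1 z2] := step _ _ h2 z1.
have [/subr0_eq e2 z3] := step _ _ h3 z2.
have [/subr0_eq e3 z4] := step _ _ h4 z3.
by have [/subr0_eq e4 _] := step _ _ h5 z4.
Qed.

Lemma jet5_sharp r f c0 c1 c2 c3 c4 : jet5 r f c0 c1 c2 c3 c4 ->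
  jet5 r (sharp f) (conjc (c0 : R[i])) (conjc (c1 : R[i])) (conjc (c2 : R[i])) (conjc (c3 : R[i])) (conjc (c4 : R[i])).
Proof.
move=> [q hq E]; have oD := @disc_open R 0 r.
have D h : disc 0 r h -> disc 0 r (conjc (h : R[i]) : C).
  by rewrite !disc0E; case: h => a b; rewrite /= sqrrN.
exists (sharp q).
  by apply: chol_sub (chol_sharp oD hq) => h /D.
move=> h /D hr; rewrite /sharp E // !rmorphD !rmorphM /= ?rmorphXn /= !conjcK.
by [].
Qed.
(* For holomorphic [f] and real y, f(y) = cmoment 0 (y^2) + y cmoment 1 (y^2): the
   moments split [f] into its even and odd parts as smooth functions of y^2. *)
Definition cmoment (r : R) (f : C -> C) (k : nat) (w : R) : C :=
  (tau%:C%C)^-1 * citg tau (fun t => f (circ r t) * (circ r t)^-1 ^+ k *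
    (circ r t ^+ 2 / (circ r t ^+ 2 - w%:C%C))).

Lemma circ_neq0 (r t : R) : 0 < r -> circ r t != 0.
Proof. by move=> r0; rewrite -normc_gt0 normc_circ // ltW. Qed.

Lemma circ2_sub_neq0 (r t w : R) : 0 <= r -> `|w| < r ^+ 2 -> circ r t ^+ 2 - w%:C%C != 0.
Proof.
move=> r0 wr; rewrite subr_eq0; apply: contraTneq wr => E.
have := normc_real w; rewrite -E expr2 Normc.normcM normc_circ // => <-.
by rewrite -expr2 ltxx.
Qed.

Section moments.
Variables (r : R) (f : C -> C).
Hypothesis r0 : 0 < r.
Hypothesis cf : forall t, {for t, continuous (fun t => f (circ r t))}.

Lemma cmoment_cts k w : `|w| < r ^+ 2 -> ccts tau (fun t => f (circ r t) * (circ r t)^-1 ^+ k *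
    (circ r t ^+ 2 / (circ r t ^+ 2 - w%:C%C))).
Proof.
move=> wr t _; have c2 : {for t, continuous (fun t => circ r t ^+ 2)}.
  by apply: ccontX; exact: circ_continuous.
apply: ccontM.
  apply: ccontM; first exact: cf.
  by apply: ccontX; apply: ccontV; [exact: circ_neq0|exact: circ_continuous].
apply: ccontM; first exact: c2.
apply: ccontV; first by apply: circ2_sub_neq0 => //; exact: ltW.
by apply: ccontB; [exact: c2|exact: ccont_cst].
Qed.

(** From u^2/(u^2-w) = 1 + w/(u^2-w). Once the moments 1 and 3 vanish at w = 0, two applications
    turn the odd part y [cmoment] 1 into y^5 [cmoment] 5. *)
Lemma cmoment_rec k w : `|w| < r ^+ 2 ->
  cmoment r f k w = cmoment r f k 0 + w%:C%C * cmoment r f k.+2 w.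
Proof.
move=> wr; have o : `|0 : R| < r ^+ 2 by rewrite normr0 exprn_gt0.
rewrite /cmoment [w%:C%C * _]mulrCA -mulrDr; congr (_ * _).
rewrite -citgZ; last exact: cmoment_cts.
rewrite -citgD; first last.
- by move=> t tT; apply: ccontM; [exact: ccont_cst|exact: cmoment_cts].
- exact: cmoment_cts.
apply: citg_ext => t _.
have := circ2_sub_neq0 t (ltW r0) wr; have := circ_neq0 t r0.
rewrite [0%:C%C](_ : _ = 0 :> C) //.
move: (circ r t) (f (circ r t)) (w%:C%C : C) => u fu z u0 uz.
rewrite (exprS _ k.+1) (exprS _ k); move: (u^-1 ^+ k) => v.
by field; rewrite ?u0 ?uz.
Qed.

End moments.

Lemma chol_circ (r r' : R) f : 0 < r < r' -> chol (disc 0 r') f ->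
  forall t, {for t, continuous (fun t => f (circ r t))}.
Proof.
move=> /andP[r0 rr'] hf t; apply: (ccont_comp (f := f)); last exact: circ_continuous.
by apply: chol_continuous hf _; rewrite disc0E normc_circ // ltW.
Qed.

(** The Cauchy kernel splits as u/(u-y) = (1 + y/u) u^2/(u^2-y^2). *)
Lemma cmoment_split (r r' : R) f (y : R) : 0 < r < r' -> chol (disc 0 r') f -> `|y| < r ->
  f y%:C%C = cmoment r f 0 (y ^+ 2) + y%:C%C * cmoment r f 1 (y ^+ 2).
Proof.
move=> rr hf yr; have cf := chol_circ rr hf; have /andP[r0 rr'] := rr.
have y2 : `|y ^+ 2| < r ^+ 2 by rewrite normrX ltrXn2r // ?nnegrE ?ltW.
have yr' : normc (y%:C%C : R[i]) < r by rewrite normc_real.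
rewrite (cauchy_formula0 rr' hf yr') /cmoment [y%:C%C * _]mulrCA -mulrDr; congr (_ * _).
rewrite -citgZ; last exact: cmoment_cts.
rewrite -citgD; first last.
- by move=> t tT; apply: ccontM; [exact: ccont_cst|exact: cmoment_cts].
- exact: cmoment_cts.
apply: citg_ext => t _.
have := circ2_sub_neq0 t (ltW r0) y2; have := circ_neq0 t r0; have := circ_sub_neq0 t yr'.
rewrite (_ : ((y ^+ 2)%:C%C : C) = y%:C%C ^+ 2); last by rewrite rmorphXn.
move: (circ r t) (f (circ r t)) (y%:C%C : C) => u fu z u1 u0 uz.
rewrite expr0 expr1 mulr1.
by field; rewrite ?u0 ?uz ?u1.
Qed.

Lemma circ_negpow_integral (r : R) k : 0 < r -> citg tau (fun t => (circ r t)^-1 ^+ k.+1) = 0.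
Proof.
move=> r0; have c0 t := circ_neq0 t r0.
have cc j t : {for t, continuous (fun t => (circ r t)^-1 ^+ j)}.
  by apply: ccontX; apply: ccontV => //; exact: circ_continuous.
pose a : C := k.+1%:R * i_.
have a0 : a != 0 by rewrite mulf_neq0 ?i_neq0 // pnatr_eq0.
pose G t := - a^-1 * (circ r t)^-1 ^+ k.+1.
rewrite (citg_FTC tau_gt0 (G := G)).
- by rewrite /G circ_tau subrr.
- by move=> t _; exact: cc.
move=> t _.
have H1 := is_derive_compC (is_derive_XC k.+1 (circ r t)^-1) (is_derive_invC (c0 t)).
have H := chain_rule (is_deriveZC (- a^-1) H1) (cder_circ r t) (@circ_continuous R r t).
apply: cder_eq H _.
rewrite /a (exprS _ k) /=; move: (c0 t) (@i_neq0 R); move: (circ r t) (i_ : C) a0 => u j _ u0 j0.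
have k0 : (k.+1%:R : C) != 0 by rewrite pnatr_eq0.
move: (u^-1 ^+ k) (k.+1%:R : C) k0 => v n n0.
by field; rewrite ?u0 ?j0 ?n0.
Qed.

Lemma cmoment_at0 (r : R) f k : 0 < r ->
  cmoment r f k 0 = (tau%:C%C)^-1 * citg tau (fun t => f (circ r t) * (circ r t)^-1 ^+ k).
Proof.
move=> r0; congr (_ * _); apply: citg_ext => t _.
by rewrite subr0 divff ?mulr1 // expf_neq0 // circ_neq0.
Qed.

Lemma cmoment_value (r r' : R) f : 0 < r < r' -> chol (disc 0 r') f -> cmoment r f 0 0 = f 0.
Proof.
move=> rr hf; have := cmoment_split rr hf (_ : `|0| < r).
rewrite normr0 expr0n mul0r addr0 => -> //; by case/andP: rr.
Qed.

(** The constant [a] meets a negative power of u, whose integral vanishes. Iterated, the lemma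
    identifies moment k at 0 with the k-th Taylor coefficient. *)
Lemma cmoment_step (r r' : R) f f1 a k : 0 < r < r' -> chol (disc 0 r') f1 ->
  (forall h, disc 0 r' h -> f h = a + h * f1 h) ->
  cmoment r f k.+1 0 = cmoment r f1 k 0.
Proof.
move=> rr hf1 E; have cf1 := chol_circ rr hf1; have /andP[r0 rr'] := rr.
rewrite !cmoment_at0 //; congr (_ * _).
have ci j : ccts tau (fun t => (circ r t)^-1 ^+ j).
  by move=> t _; apply: ccontX; apply: ccontV; [exact: circ_neq0|exact: circ_continuous].
rewrite -[RHS]add0r -[X in X + _](mulr0 a) -(circ_negpow_integral k r0) -citgZ //.
rewrite -citgD.
- apply: citg_ext => t _; rewrite E; last by rewrite disc0E normc_circ // ltW.
  have := circ_neq0 t r0; rewrite exprS; move: (circ r t) (f1 (circ r t)) => u g u0.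
  by move: (u^-1 ^+ k) => v; field; rewrite ?u0.
- by move=> t tT; apply: ccontM; [exact: ccont_cst|exact: ci].
- by move=> t tT; apply: ccontM; [exact: cf1|exact: ci].
Qed.

Lemma cmoment_derivative (r r' : R) f d0 d1 d2 d3 d4 : 0 < r < r' -> chol (disc 0 r') f ->
  jet5 r' ('D_1 f) d0 d1 d2 d3 d4 ->
  [/\ cmoment r f 1 0 = d0, cmoment r f 2 0 = d1 / 2%:R, cmoment r f 3 0 = d2 / 3%:R &
      cmoment r f 5 0 = d4 / 5%:R].
Proof.
move=> rr hf [q hq E]; have /andP[r0 rr'] := rr; have oD := @disc_open R 0 r'.
(* A primitive of the polynomial part of f'. The difference f - T vanishes at 0 and has derivative
   h^5 q, so it is divisible by h^6. *)
pose T h := f 0 + h * (d0 + h * (d1 / 2%:R + h * (d2 / 3%:R + h * (d3 / 4%:R + h * (d4 / 5%:R))))).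
have hT : chol (disc 0 r') T by rewrite /T; chol_auto oD.
have dT (h : C) : is_derive h 1 T (d0 + d1 * h + d2 * h ^+ 2 + d3 * h ^+ 3 + d4 * h ^+ 4).
  have I := is_derive_idC h; have K a := is_derive_cstC a h.
  apply: is_derive_eqC (is_deriveDC (K _) (is_deriveMC I (is_deriveDC (K _) (is_deriveMC I
    (is_deriveDC (K _) (is_deriveMC I (is_deriveDC (K _) (is_deriveMC I (is_deriveDC (K _)
     (is_deriveMC I (K _))))))))))) _.
  by field; rewrite ?pnatr_eq0.
have hg : chol (disc 0 r') (fun h => f h + (-1) * T h) by chol_auto oD.
have [|h hr|p hp pE] := chol_zero_order (n := 5) hg hq.
- by rewrite /T; ring.
- have [_ ->] := is_deriveDC (chol_is_derive hf hr) (is_deriveZC (-1) (dT h)).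
  by rewrite E //; ring.
pose f5 h := d4 / 5%:R + h * p h.
pose f4 h := d3 / 4%:R + h * f5 h.
pose f3 h := d2 / 3%:R + h * f4 h.
pose f2 h := d1 / 2%:R + h * f3 h.
pose f1 h := d0 + h * f2 h.
have h5 : chol (disc 0 r') f5 by rewrite /f5; chol_auto oD.
have h4 : chol (disc 0 r') f4 by rewrite /f4; chol_auto oD.
have h3 : chol (disc 0 r') f3 by rewrite /f3; chol_auto oD.
have h2 : chol (disc 0 r') f2 by rewrite /f2; chol_auto oD.
have h1 : chol (disc 0 r') f1 by rewrite /f1; chol_auto oD.
have fE h : disc 0 r' h -> f h = f 0 + h * f1 h.
  move=> /pE H; have -> : f h = (f h + (-1) * T h) + T h by ring.
  by rewrite H /T /f1 /f2 /f3 /f4 /f5; ring.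
have S k := cmoment_step k rr h1 fE.
have S1 k := cmoment_step k rr h2 (fun h _ => erefl (f1 h)).
have S2 k := cmoment_step k rr h3 (fun h _ => erefl (f2 h)).
have S3 k := cmoment_step k rr h4 (fun h _ => erefl (f3 h)).
have S4 k := cmoment_step k rr h5 (fun h _ => erefl (f4 h)).
split.
- by rewrite S (cmoment_value rr h1) /f1 mul0r addr0.
- by rewrite S S1 (cmoment_value rr h2) /f2 mul0r addr0.
- by rewrite S S1 S2 (cmoment_value rr h3) /f3 mul0r addr0.
- by rewrite S S1 S2 S3 S4 (cmoment_value rr h5) /f5 mul0r addr0.
Qed.

End jets.

(** * The sheared polar form *)

Section sheared_polar_form.
Context {R : realType}.
Local Notation C := (Cplx R).
Local Notation normc := Normc.normc.

(* For real [e] this is x - l e^3 + i e; it is polynomial, hence holomorphic, in [e]. *)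
Definition shear (x l : R) (e : C) : C := x%:C%C + (i_ * e + (- (l%:C%C : C)) * e ^+ 3).

Definition shear' (l : R) (e : C) : C := i_ + (- (3%:R * (l%:C%C : C))) * e ^+ 2.

Lemma is_derive_shear (x l : R) (e : C) : is_derive e 1 (shear x l) (shear' l e).
Proof.
have H := is_deriveDC (is_derive_cstC x%:C%C e) (is_deriveDC (is_deriveZC i_ (is_derive_idC e))
  (is_deriveZC (- (l%:C%C : C)) (is_derive_XC 3 e))).
by apply: is_derive_eqC H _; rewrite /shear' /=; ring.
Qed.

Lemma sharp_realC (f : C -> C) (y : R) : sharp f (y%:C%C : C) = conjc (f (y%:C%C : C) : R[i]).
Proof. by rewrite /sharp /= oppr0. Qed.

Section pullback.
Variables (R0 x l r : R).
Hypothesis r0 : 0 < r.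
Hypothesis fit : r + `|l| * r ^+ 3 <= R0 - `|x|.

Let oD := @disc_open R 0 r.
Let oD0 := @disc_open R 0 R0.

(** On the disc of radius [r] the displacement i e - l e^3 has modulus below r + |l| r^3, the
    quantity bounded by [fit]. *)
Lemma shear_lt e : disc 0 r e -> normc (shear x l e - x%:C%C : R[i]) < R0 - `|x|.
Proof.
rewrite disc0E => er; rewrite /shear addrC addKr.
apply: lt_le_trans fit; apply: le_lt_trans (normcD _ _) _.
apply: ltr_leD.
  by rewrite Normc.normcM (_ : normc (i_ : R[i]) = 1) ?mul1r // /= expr0n add0r expr1n sqrtr1.
rewrite Normc.normcM normcN normc_real ler_wpM2l //.
by rewrite !exprS expr0 mulr1 !Normc.normcM !mulr1 !ler_pM ?mulr_ge0 ?normc_ge0 // ltW.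
Qed.

Lemma shear_disc e : disc 0 r e -> disc 0 R0 (shear x l e).
Proof.
move=> /shear_lt H; rewrite disc0E -[shear x l e](subrK (x%:C%C : C)).
by apply: le_lt_trans (normcD _ _) _; rewrite normc_real -ltrBrDr.
Qed.

Definition pull (f : C -> C) (e : C) : C := f (shear x l e).

Lemma chol_shear : chol (disc 0 r) (shear x l).
Proof. by rewrite /shear; chol_auto oD. Qed.

Lemma pull_chol f : chol (disc 0 R0) f -> chol (disc 0 r) (pull f).
Proof. by move=> hf; exact: (chol_comp oD oD0 shear_disc hf chol_shear). Qed.

Lemma is_derive_pull f e : chol (disc 0 R0) f -> disc 0 r e ->
  is_derive e 1 (pull f) (pull ('D_1 f) e * shear' l e).
Proof.
move=> hf er; exact: (is_derive_compC (chol_is_derive hf (shear_disc er)) (is_derive_shear x l e)).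
Qed.

Lemma jet5_pull (f : C -> C) (p0 p1 p2 p3 p4 : C) : jet5 (R0 - `|x|) (fun h : C => f (x%:C%C + h)) p0 p1 p2 p3 p4 ->
  jet5 r (pull f) p0 (i_ * p1) (- p2) (- (i_ * p3) - l%:C%C * p1) (p4 - 2%:R * i_ * l%:C%C * p2).
Proof.
move=> [q hq E]; pose k e := i_ * e + (- (l%:C%C : C)) * e ^+ 3.
have oE := @disc_open R 0 (R0 - `|x|).
have kd e : disc 0 r e -> disc 0 (R0 - `|x|) (k e).
  by move=> /shear_lt; rewrite disc0E /shear addrC addKr.
have hk : chol (disc 0 r) k by rewrite /k; chol_auto oD.
have jk : jet5 r k 0 i_ 0 (- (l%:C%C : C)) 0.
  by exists (fun=> 0); [chol_auto oD|move=> e er; rewrite /k; ring].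
have [q1 [q2 [q3 [q4 jq]]]] := jet5_exists (chol_comp oD oE kd hq hk).
have j2 := jet5M jk jk; have j3 := jet5M jk j2; have j4 := jet5M jk j3; have j5 := jet5M jk j4.
have J := jet5D (jet5D (jet5D (jet5D (jet5D (jet5_cst r p0) (jet5M (jet5_cst r p1) jk))
  (jet5M (jet5_cst r p2) j2)) (jet5M (jet5_cst r p3) j3)) (jet5M (jet5_cst r p4) j4)) (jet5M j5 jq).
apply: jet5_ext (jet5_eq J _ _ _ _ _).
- move=> e er; have /= := E _ (kd e er); rewrite /pull /shear -/(k e) => ->.
  by move: (k e) (q (k e)) => u v; ring.
- by ring: (@i_sqr R).
- by ring: (@i_sqr R).
- by ring: (@i_sqr R).
- by ring: (@i_sqr R).
- by ring: (@i_sqr R).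
Qed.

End pullback.

(* [hform] along a sheared curve, with conjugates replaced by [sharp] so that it
   becomes holomorphic in the curve parameter (see [polar_real]). *)
Definition polar (u u' v v' : C -> C) (e : C) : C :=
  i_ * (u e * v' e - u' e * v e) + 2%:R * e * (u' e * v' e).
(** Comparing coefficients in f'' = i b f expresses a2, a3, a4 through the two initial values; the
    divisors 2, 6, 12 are (k+1)(k+2). *)
Lemma jet5_ode r (f b : C -> C) B0 B1 B2 B3 B4 : 0 < r -> chol (disc 0 r) f ->
  jet5 r b B0 B1 B2 B3 B4 ->
  (forall h, disc 0 r h -> 'D_1 ('D_1 f) h = i_ * b h * f h) ->
  let a0 := f 0 in let a1 := 'D_1 f 0 in
  let a2 := i_ * B0 * a0 / 2%:R in let a3 := i_ * (B0 * a1 + B1 * a0) / 6%:R in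
  let a4 := i_ * (B0 * a2 + B1 * a1 + B2 * a0) / 12%:R in
  exists e, jet5 r f a0 a1 a2 a3 a4 /\
    jet5 r ('D_1 f) a1 (2%:R * a2) (3%:R * a3) (4%:R * a4) e.
Proof.
move=> r0 hf jb ode a0 a1 a2 a3 a4; have oD := @disc_open R 0 r.
have [p1 [p2 [p3 [p4 jf]]]] := jet5_exists hf.
have [e je] := jet5_derive r0 jf.
have [e' je'] := jet5_derive r0 je.
have E1 : p1 = a1 by rewrite -(jet5_at0 r0 je).
have jr := jet5M (jet5M (jet5_cst r i_) jb) jf.
have jr' : jet5 r ('D_1 ('D_1 f)) _ _ _ _ _ := jet5_ext (fun h hr => esym (ode h hr)) jr.
have [e2 e3 e4 _ _] := jet5_real_uniq r0 je' jr' (fun _ _ => erefl).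
have n2 : (2%:R : C) != 0 by rewrite pnatr_eq0.
have n3 : (3%:R : C) != 0 by rewrite pnatr_eq0.
have E2 : p2 = a2.
  by apply: (mulfI n2); rewrite e2 /a2 -/a0; field.
have E3 : p3 = a3.
  apply: (mulfI n2); apply: (mulfI n3); transitivity (2%:R * (3%:R * p3)); first by ring.
  by rewrite e3 /a3 -/a0 E1; field.
have E4 : p4 = a4.
  apply: (mulfI n3); apply: (mulfI (mulf_neq0 n2 n2)); transitivity (3%:R * (4%:R * p4)); first by ring.
  by rewrite e4 /a4 -/a0 E1 E2; field.
by exists e; rewrite -E1 -E2 -E3 -E4; split.
Qed.

Lemma disc0_conj (r : R) z : disc 0 r z -> disc 0 r (conjc (z : R[i]) : C).
Proof. by rewrite !disc0E; case: z => a b; rewrite /= sqrrN. Qed.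

Lemma chol_sharp0 (r : R) f : chol (disc 0 r) f -> chol (disc 0 r) (sharp f).
Proof. move=> hf; apply: chol_sub (chol_sharp (@disc_open R 0 r) hf) => h; exact: disc0_conj. Qed.

Lemma conj_shear' l (e : C) : conjc (shear' l (conjc (e : R[i])) : R[i]) = - i_ - 3%:R * (l%:C%C : C) * e ^+ 2 :> C.
Proof.
by case: e => a c; apply/eqP; rewrite eq_complex /=; apply/andP; split; apply/eqP; ring.
Qed.

Lemma is_derive_sharp_pull (R0 x l r : R) f e : r + `|l| * r ^+ 3 <= R0 - `|x| ->
  chol (disc 0 R0) f -> disc 0 r e ->
  is_derive e 1 (sharp (pull x l f))
    (sharp (pull x l ('D_1 f)) e * (- i_ - 3%:R * (l%:C%C : C) * e ^+ 2)).
Proof.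
move=> fit hf er.
apply: is_derive_eqC (is_derive_sharp (is_derive_pull fit hf (disc0_conj er))) _.
by rewrite (conjcM (pull x l ('D_1 f) (conjc (e : R[i]))) (shear' l (conjc (e : R[i])))) conj_shear'.
Qed.

Section shift.
Variables (R0 x : R) (f b : C -> C).
Hypothesis hf : chol (disc 0 R0) f.
Let oD0 := @disc_open R 0 R0.
Let oE := @disc_open R 0 (R0 - `|x|).

Lemma shift_disc h : disc 0 (R0 - `|x|) h -> disc 0 R0 (x%:C%C + h).
Proof.
rewrite !disc0E => hr; apply: le_lt_trans (normcD _ _) _.
by rewrite normc_real addrC -ltrBrDr.
Qed.

Lemma is_derive_shift (h : C) : disc 0 (R0 - `|x|) h ->
  is_derive h 1 (fun h : C => f (x%:C%C + h)) ('D_1 f (x%:C%C + h)).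
Proof.
move=> hr; have H := is_deriveDC (is_derive_cstC x%:C%C h) (is_derive_idC h).
apply: is_derive_eqC (is_derive_compC (chol_is_derive hf (shift_disc hr)) H) _.
by rewrite add0r mulr1.
Qed.

Lemma shift_deriveE (h : C) : disc 0 (R0 - `|x|) h ->
  'D_1 (fun h : C => f (x%:C%C + h)) h = 'D_1 f (x%:C%C + h).
Proof. by move=> hr; have [_ H] := is_derive_shift hr; exact: H. Qed.

Lemma shift_deriveE0 (z : C) : 0 < R0 - `|x| -> z = x%:C%C ->
  'D_1 (fun h : C => f (x%:C%C + h)) 0 = 'D_1 f z.
Proof.
move=> rx ->; rewrite (shift_deriveE (disc_center 0 rx)).
by have -> : x%:C%C + 0 = x%:C%C :> C by exact: addr0.
Qed.

Lemma shift_chol : chol (disc 0 (R0 - `|x|)) (fun h => f (x%:C%C + h)).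
Proof.
have hs : chol (disc 0 (R0 - `|x|)) (fun h => x%:C%C + h) by chol_auto oE.
exact: (chol_comp oE oD0 shift_disc hf hs).
Qed.

End shift.

Lemma shift_ode (R0 x : R) (f b : C -> C) : chol (disc 0 R0) f ->
  (forall z, disc 0 R0 z -> 'D_1 ('D_1 f) z = i_ * b z * f z) ->
  forall h : C, disc 0 (R0 - `|x|) h -> 'D_1 ('D_1 (fun h : C => f (x%:C%C + h))) h =
    i_ * b (x%:C%C + h) * f (x%:C%C + h).
Proof.
move=> hf ode h hr; rewrite -ode; last exact: shift_disc.
have oE := @disc_open R 0 (R0 - `|x|).
have E (w : C) : disc 0 (R0 - `|x|) w -> 'D_1 f (x%:C%C + w) = 'D_1 (fun h : C => f (x%:C%C + h)) w.
  by move=> wr; have [_ ->] := is_derive_shift hf wr.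
have [_ H] := is_derive_nearC (open_near oE hr E)
  (is_derive_shift (chol_derive (@disc_open R 0 R0) hf) hr).
exact: H.
Qed.

Lemma rCdiv (b : R) n : (((b / n%:R)%:C%C : R[i]) = b%:C%C / n%:R :> C).
Proof. by rewrite fmorph_div rmorph_nat. Qed.

Section polar_derivative.
Variables (R0 x l r : R).
Hypothesis r0 : 0 < r.
Hypothesis fit : r + `|l| * r ^+ 3 <= R0 - `|x|.
Variables m n b : C -> C.
Hypotheses (hm : chol (disc 0 R0) m) (hn : chol (disc 0 R0) n) (hb : chol (disc 0 R0) b).
Hypothesis odem : forall z, disc 0 R0 z -> 'D_1 ('D_1 m) z = i_ * b z * m z.
Hypothesis oden : forall z, disc 0 R0 z -> 'D_1 ('D_1 n) z = i_ * b z * n z.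
Let oD := @disc_open R 0 r.
Let oD0 := @disc_open R 0 R0.
Let u := pull x l m.
Let u' := pull x l ('D_1 m).
Let v := sharp (pull x l n).
Let v' := sharp (pull x l ('D_1 n)).
Let S e := pull x l b e * shear' l e.
Let Phi := polar u u' v v'.

Let hu : chol (disc 0 r) u := pull_chol fit hm.
Let hu' : chol (disc 0 r) u' := pull_chol fit (chol_derive oD0 hm).
Let hv : chol (disc 0 r) v := chol_sharp0 (pull_chol fit hn).
Let hv' : chol (disc 0 r) v' := chol_sharp0 (pull_chol fit (chol_derive oD0 hn)).

Lemma polar_chol : chol (disc 0 r) Phi.
Proof.
have -> : Phi = fun e => i_ * (u e * v' e + (-1) * (u' e * v e)) + 2%:R * e * (u' e * v' e).
  by apply/funext => e; rewrite /Phi /polar mulN1r.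
by chol_auto oD.
Qed.

(** The u' v' terms from the bracket add up to -2 u' v' and cancel against the derivative of the
    factor 2 e. What remains contains second derivatives of m and n, which the differential equation
    turns into products with b. *)
Lemma polar_derive e : disc 0 r e ->
  'D_1 Phi e = u e * v e * (S e + sharp S e) +
    2%:R * i_ * e * (S e * u e * v' e - sharp S e * u' e * v e).
Proof.
move=> er; have er' := disc0_conj er.
pose L : C := l%:C%C; pose B := pull x l b e; pose B' := sharp (pull x l b) e.
have uu : pull x l ('D_1 ('D_1 m)) e = i_ * B * u e by exact: (odem (shear_disc fit er)).
have vv : sharp (pull x l ('D_1 ('D_1 n))) e = - i_ * B' * v e.
  have E : pull x l ('D_1 ('D_1 n)) (conjc (e : R[i])) = i_ * b (shear x l (conjc (e : R[i]))) * n (shear x l (conjc (e : R[i]))).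
    exact: (oden (shear_disc fit er')).
  rewrite /sharp E (conjcM (i_ * b _) (n _)) (conjcM i_ (b _)); congr (_ * _ * _).
  by apply/eqP; rewrite eq_complex /= oppr0 !eqxx.
have sS : sharp S e = B' * (- i_ - 3%:R * L * e ^+ 2).
  by rewrite /S {1}/sharp (conjcM (pull x l b (conjc (e : R[i]))) (shear' l (conjc (e : R[i])))) conj_shear'.
have du : is_derive e 1 u (u' e * (i_ + (- (3%:R * L)) * e ^+ 2)) := is_derive_pull fit hm er.
have du' : is_derive e 1 u' (i_ * B * u e * (i_ + (- (3%:R * L)) * e ^+ 2)).
  by apply: is_derive_eqC (is_derive_pull fit (chol_derive oD0 hm) er) _; rewrite uu.
have dv : is_derive e 1 v (v' e * (- i_ - 3%:R * L * e ^+ 2)) := is_derive_sharp_pull fit hn er.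
have dv' : is_derive e 1 v' (- i_ * B' * v e * (- i_ - 3%:R * L * e ^+ 2)).
  by apply: is_derive_eqC (is_derive_sharp_pull fit (chol_derive oD0 hn) er) _; rewrite vv.
have SE : S e = B * (i_ + (- (3%:R * L)) * e ^+ 2) by [].
rewrite sS SE; move: du du' dv dv'; rewrite /Phi /polar.
generalize u u' v v' B B' L => U U' V V' D D' M du du' dv dv'.
have H := is_deriveDC (is_deriveZC i_ (is_deriveDC (is_deriveMC du dv') (is_deriveZC (-1) (is_deriveMC du' dv))))
  (is_deriveMC (is_deriveZC 2%:R (is_derive_idC e)) (is_deriveMC du' dv')).
have E : (fun w => i_ * (U w * V' w + -1 * (U' w * V w)) + 2%:R * w * (U' w * V' w)) =
   (fun w => i_ * (U w * V' w - U' w * V w) + 2%:R * w * (U' w * V' w)).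
  by apply/funext => w; rewrite mulN1r.
rewrite -E; have [_ ->] := H.
move: (U e) (U' e) (V e) (V' e) => a a' c c'.
by ring: (@i_sqr R).
Qed.

Hypothesis xR : `|x| < R0.
Variables (b0 b1 b2 : R) (B3 B4 : C).
Hypothesis jb : jet5 (R0 - `|x|) (fun h => b (x%:C%C + h)) b0%:C%C b1%:C%C b2%:C%C B3 B4.
Hypothesis lB : l = 2%:R / 3%:R * b0.

Lemma shift_ode_jet f : chol (disc 0 R0) f ->
  (forall z, disc 0 R0 z -> 'D_1 ('D_1 f) z = i_ * b z * f z) ->
  exists a4 a3' a4', let a : C := f x%:C%C in let a1 : C := 'D_1 f x%:C%C in
  jet5 r (pull x l f) a (i_ * a1) (- (i_ * ((b0 / 2%:R)%:C%C * a)))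
     ((b0 / 6%:R - l)%:C%C * a1 + (b1 / 6%:R)%:C%C * a) a4 /\
  jet5 r (pull x l ('D_1 f)) a1 (- (b0%:C%C * a)) (- (i_ * ((b0 / 2%:R)%:C%C * a1 + (b1 / 2%:R)%:C%C * a))) a3' a4'.
Proof.
move=> hf ode; have rx : 0 < R0 - `|x| by rewrite subr_gt0.
have D0 : disc 0 (R0 - `|x|) (0 : C) by exact: disc_center.
have oE := @disc_open R 0 (R0 - `|x|).
have [e [jf jf']] := jet5_ode rx (shift_chol x hf) jb (shift_ode hf ode).
have E1 : 'D_1 (fun h : C => f (x%:C%C + h)) 0 = 'D_1 f x%:C%C.
  exact: (shift_deriveE0 hf rx erefl).
rewrite E1 addr0 in jf jf'.
have jf'' := @jet5_ext R _ _ (fun h => 'D_1 f (x%:C%C + h)) _ _ _ _ _ (fun h hr => shift_deriveE hf hr) jf'.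
have p1 := jet5_pull fit jf; have p2 := jet5_pull (f := 'D_1 f) fit jf''.
do 3![eexists]; split.
  apply: (jet5_eq p1 (erefl _) (erefl _) _ _ (erefl _)).
- by rewrite rCdiv; field: (@i_sqr R).
- by rewrite rmorphB !rCdiv /=; field: (@i_sqr R).
apply: (jet5_eq p2 (erefl _) _ _ (erefl _) (erefl _)).
  by field: (@i_sqr R).
by rewrite !rCdiv; field: (@i_sqr R).
Qed.

Lemma conjc_pull_jet (a a1 : C) (p q : R) :
  [/\ conjc (i_ * a : R[i]) = - (i_ * (conjc (a : R[i]) : C)) :> C,
      conjc (- (i_ * (p%:C%C * a)) : R[i]) = i_ * (p%:C%C * (conjc (a : R[i]) : C)) :> C,
      conjc (- (p%:C%C * a) : R[i]) = - (p%:C%C * (conjc (a : R[i]) : C)) :> C,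
      conjc (p%:C%C * a1 + q%:C%C * a : R[i]) = p%:C%C * (conjc (a1 : R[i]) : C) + q%:C%C * (conjc (a : R[i]) : C) :> C &
      conjc (- (i_ * (p%:C%C * a1 + q%:C%C * a)) : R[i]) = i_ * (p%:C%C * (conjc (a1 : R[i]) : C) + q%:C%C * (conjc (a : R[i]) : C)) :> C].
Proof.
by case: a => s t; case: a1 => s' t'; split; apply/eqP; rewrite eq_complex /=; apply/andP; split; apply/eqP; ring.
Qed.

Lemma jetS : exists s3 s4, jet5 r S (i_ * b0%:C%C) (- (b1%:C%C : C))
  (- ((3%:R * l * b0)%:C%C + i_ * b2%:C%C)) s3 s4.
Proof.
have p := jet5M (jet5_pull fit jb) (jet5D (jet5_cst r i_) (jet5M (jet5_cst r (- (3%:R * (l%:C%C : C)))) (jet5M (jet5_id r) (jet5_id r)))).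
do 2![eexists]; apply: (jet5_eq (jet5_ext _ p)) => //.
- by ring.
- by ring: (@i_sqr R).
- by rewrite !rmorphM /= rmorph_nat; ring.
Qed.

Lemma jet5_sharp_pull f : chol (disc 0 R0) f ->
  (forall z, disc 0 R0 z -> 'D_1 ('D_1 f) z = i_ * b z * f z) ->
  exists a4 a3' a4', let a : C := conjc (f x%:C%C : R[i]) in let a1 : C := conjc ('D_1 f x%:C%C : R[i]) in
  jet5 r (sharp (pull x l f)) a (- (i_ * a1)) (i_ * ((b0 / 2%:R)%:C%C * a))
     ((b0 / 6%:R - l)%:C%C * a1 + (b1 / 6%:R)%:C%C * a) a4 /\
  jet5 r (sharp (pull x l ('D_1 f))) a1 (- (b0%:C%C * a)) (i_ * ((b0 / 2%:R)%:C%C * a1 + (b1 / 2%:R)%:C%C * a)) a3' a4'.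
Proof.
move=> hf ode; have [a4 [a3' [a4' [jf jf']]]] := shift_ode_jet hf ode.
have H p q := conjc_pull_jet (f x%:C%C) ('D_1 f x%:C%C) p q.
have H' p q := conjc_pull_jet ('D_1 f x%:C%C) ('D_1 f x%:C%C) p q.
do 3![eexists]; split.
  have [_ e2 _ _ _] := H (b0 / 2%:R) 0; have [_ _ _ e3 _] := H (b0 / 6%:R - l) (b1 / 6%:R).
  have [e1 _ _ _ _] := H' 0 0.
  exact: (jet5_eq (jet5_sharp jf) (erefl _) e1 e2 e3 (erefl _)).
have [_ _ e1 _ _] := H b0 0; have [_ _ _ _ e2] := H (b0 / 2%:R) (b1 / 2%:R).
exact: (jet5_eq (jet5_sharp jf') (erefl _) e1 e2 (erefl _) (erefl _)).
Qed.

(** The constant coefficient vanishes because b0 is real. In the second one the terms in b1 cancel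
    and (4 b0^2 - 6 l b0) m(x) conj(n(x)) is left, which is 0 for l = 2/3 b0. The two value patterns
    are the initial conditions at x = 0 of the pairs (m1, m2) and (m1, m1). *)
Lemma polar_jet : exists d1 d3 d4, [/\ jet5 r ('D_1 Phi) 0 d1 0 d3 d4,
  m x%:C%C = 0 -> 'D_1 m x%:C%C = 1 -> n x%:C%C = 1 -> 'D_1 n x%:C%C = 0 -> d1 = - (2%:R * (b0%:C%C : C)) &
  m x%:C%C = 0 -> 'D_1 m x%:C%C = 1 -> n x%:C%C = 0 -> 'D_1 n x%:C%C = 1 -> d1 = 0 /\ d4 = 8%:R * (b0%:C%C : C) ^+ 2].
Proof.
have [u4 [u3' [u4' [ju ju']]]] := shift_ode_jet hm odem.
have [v4 [v3' [v4' [jv jv']]]] := jet5_sharp_pull hn oden.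
have [s3 [s4 jS]] := jetS.
have c2 : conjc (- ((3%:R * l * b0)%:C%C + i_ * b2%:C%C) : R[i]) = - (3%:R * l * b0)%:C%C + i_ * b2%:C%C :> C.
  by apply/eqP; rewrite eq_complex /=; apply/andP; split; apply/eqP; ring.
have c1 : conjc (- (b1%:C%C) : R[i]) = - (b1%:C%C) :> C.
  by apply/eqP; rewrite eq_complex /=; apply/andP; split; apply/eqP; ring.
have c0 : conjc (i_ * b0%:C%C : R[i]) = - (i_ * b0%:C%C) :> C.
  by apply/eqP; rewrite eq_complex /=; apply/andP; split; apply/eqP; ring.
have jT := jet5_eq (jet5_sharp jS) c0 c1 c2 (erefl _) (erefl _).
have J := jet5D (jet5M (jet5M ju jv) (jet5D jS jT))
  (jet5M (jet5M (jet5_cst r (2%:R * i_)) (jet5_id r))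
     (jet5D (jet5M (jet5M jS ju) jv') (jet5M (jet5_cst r (-1)) (jet5M (jet5M jT ju') jv)))).
have E (e : C) : disc 0 r e -> u e * v e * (S e + sharp S e) +
    2%:R * i_ * e * (S e * u e * v' e + -1 * (sharp S e * u' e * v e)) = 'D_1 Phi e.
  by move=> er; rewrite (polar_derive er) mulN1r.
have J' := jet5_ext E J.
have l1 : (b0 / 6%:R - l)%:C%C = - (b0%:C%C / 2%:R) :> C.
  by rewrite -rCdiv -rmorphN; congr (_%:C%C); rewrite lB; field.
have l2 : (3%:R * l * b0)%:C%C = 2%:R * b0%:C%C ^+ 2 :> C.
  by rewrite -rmorphXn -(rmorph_nat (@real_complex R)) -rmorphM; congr (_%:C%C); rewrite lB; field.
rewrite l1 l2 !rCdiv in J'.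
have bE : b0%:C%C = 2%:R * (b0%:C%C / 2%:R) :> C by field.
do 3![eexists]; split.
- apply: (jet5_eq J' _ (erefl _) _ (erefl _) (erefl _)).
    by ring.
  move: (m x%:C%C) ('D_1 m x%:C%C) (conjc (n x%:C%C : R[i]) : C) (conjc ('D_1 n x%:C%C : R[i]) : C)
    i_ (@i_sqr R) (b0%:C%C : C) (b0%:C%C / 2%:R : C) bE (b1%:C%C : C) (b1%:C%C / 2%:R : C) (b2%:C%C : C).
  by move=> /= {jS jT J E J' l1 l2} A A1 B B1 i i2 _ y0 -> x1 y1 x2; ring: i2.
- move=> E0 E1 E2 E3; rewrite E0 E1 E2 E3 conjc1 conjc0.
  by move: i_ (@i_sqr R) (b0%:C%C : C) => i i2 y0; ring: i2.
- move=> E0 E1 E2 E3; rewrite E0 E1 E2 E3 conjc1 conjc0.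
  move: i_ (@i_sqr R) (b0%:C%C : C) (b0%:C%C / 2%:R : C) bE (b1%:C%C : C) (b1%:C%C / 2%:R : C)
    (b1%:C%C / 6%:R : C) (b2%:C%C : C).
  move=> /= {jS jT J E J' l1 l2} i i2 _ y0 -> x1 y1 z1 x2.
  move: (conjc (s3 : R[i]) : C) (conjc (s4 : R[i]) : C) => t3 t4.
  by split; [ring|ring: i2].
Qed.

End polar_derivative.

End sheared_polar_form.

(** * The normal form of the edge *)

Section edge_normal_form.
Context {R : realType}.
Local Notation C := (Cplx R).
Local Notation Re := complex.Re.
Local Notation Im := complex.Im.

Lemma cSkV n k (U : set 'rV[R]_n) (f : 'rV[R]_n -> C) : open U -> (forall x, U x -> f x != 0) ->
  cSk k U f -> cSk k U (fun x => (f x)^-1).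
Proof.
move=> oU f0 Cf; apply: (cSk_comp (O := [set w : C | w != 0]) (f := fun w => w^-1) oU _ f0 _ Cf).
  exact: openC0.
apply: cholV; [exact: openC0|by []|apply: chol_id; exact: openC0].
Qed.

Lemma cSk_citg n k (U : set 'rV[R]_n) (G : 'rV[R]_n.+1 -> C) T : 0 < T -> open U ->
  cSk k (@init R n @^-1` U) G -> cSk k U (fun x => citg T (fun t => G (emb x t))).
Proof. by move=> T0 oU [G1 G2]; split; [exact: (sCk_itg T0 oU G1)|exact: (sCk_itg T0 oU G2)]. Qed.

Definition hform (m n : C -> C) (z : C) : C :=
  i_ * (m z * (conjc ('D_1 n z : R[i]) : C) - 'D_1 m z * (conjc (n z : R[i]) : C)) +
  2%:R * (Im (z : R[i]))%:C%C * ('D_1 m z * (conjc ('D_1 n z : R[i]) : C)).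

Lemma Im_shear (x l y : R) : Im (shear x l (y%:C%C : C) : R[i]) = y.
Proof. by rewrite /shear !exprS expr0 /=; ring. Qed.

(** For real y the parameter is exactly the imaginary part of the sheared point, so the factor 2 e
    of [polar] is the factor 2 Im z of [hform]. *)
Lemma polar_real (x l : R) m n (y : R) :
  polar (pull x l m) (pull x l ('D_1 m)) (sharp (pull x l n)) (sharp (pull x l ('D_1 n))) (y%:C%C : C) =
  hform m n (shear x l y%:C%C).
Proof. by rewrite /polar /hform !sharp_realC Im_shear. Qed.

Lemma half_lt (x : R) : 0 < x -> x / 2 < x.
Proof. by move=> x0; lra. Qed.

Lemma fit_arith (r0 q s L r : R) : r * (1 + L) <= r0 / 2 -> q <= L * r -> s < r0 / 2 ->
  r + q <= r0 - s.
Proof. by move=> *; lra. Qed.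

Section normal_form.
Variables (R0 : R) (b : C -> C).
Hypothesis R00 : 0 < R0.
Hypothesis hb : chol (disc 0 R0) b.
Hypothesis breal : forall x : R, `|x| < R0 -> Im (b x%:C%C : R[i]) = 0.

(* The shear that cancels the third-order odd coefficient of every entry. *)
Definition lam (x : R) : R := 2%:R / 3%:R * Re (b x%:C%C : R[i]).

(** The size of the shear varies with x, so one radius r has to fit all small x; continuity of b at
    0 bounds [lam] by L. *)
Lemma lam_fit : exists r d : R, [/\ 0 < r, 0 < d, d <= R0 &
  forall x : R, `|x| < d -> r + `|lam x| * r ^+ 3 <= R0 - `|x|].
Proof.
have h2 : R0 / 2 <= R0 by rewrite ler_pdivrMr // ler_peMr ?ler1n // ltW.
pose L : R := `|lam 0| + 1.
have cl : {for 0, continuous (fun x : R => Re (b x%:C%C : R[i]))}.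
  apply: (@continuous_comp _ _ _ (fun x : R => b x%:C%C) (fun z : C => Re (z : R[i]))); last exact: Re_continuous.
  apply: (ccont_comp (f := b)); last exact: real_complex_continuous.
  by apply: chol_continuous hb _; exact: disc_center.
(* A variation of Re b below 3/2 is a variation of [lam] below 1. *)
have e0 : (0 : R) < 3%:R / 2%:R by rewrite divr_gt0.
have /(cvgrPdist_lt (FF := nbhs_filter _))/(_ _ e0)/nbhs_ballP[d1 d10 H] := cl.
pose r := Num.min 1 (R0 / (2 * (1 + L))).
have L0 : 0 < 1 + L by rewrite /L; have := normr_ge0 (lam 0); lra.
have r0 : 0 < r by rewrite lt_min ltr01 divr_gt0 // mulr_gt0.
exists r, (Num.min d1 (R0 / 2)); split=> //.
- by rewrite lt_min d10 divr_gt0.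
- by rewrite ge_min h2 orbT.
move=> x; rewrite lt_min => /andP[xd xR].
have lx : `|lam x| <= L.
  have : ball 0 d1 x by rewrite -ball_normE /= sub0r normrN.
  move=> /H /=; rewrite /L -lerBlDl => lH.
  apply: le_trans (lerB_dist _ _) _.
  rewrite distrC /lam -mulrBr normrM ger0_norm ?divr_ge0 //.
  by rewrite -ler_pdivlMl // mulr1 invf_div ltW.
have r1 : r <= 1 by rewrite ge_min lexx.
have r3 : r ^+ 3 <= r by rewrite exprS ger_pMr // exprn_ile1 // ltW.
have rL : r * (1 + L) <= R0 / 2.
  rewrite -ler_pdivlMr // ge_min; apply/orP; right.
  by rewrite invfM mulrA.
have : `|lam x| * r ^+ 3 <= L * r.
  apply: ler_pM => //; first by rewrite exprn_ge0 // ltW.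
by move=> ql; exact: (fit_arith rL ql xR).
Qed.

(** On the real axis b agrees with its [sharp], so uniqueness of jets makes the coefficients
    self-conjugate. *)
Lemma real_jet x : `|x| < R0 -> exists b1 b2 B3 B4,
  jet5 (R0 - `|x|) (fun h => b (x%:C%C + h)) (Re (b x%:C%C : R[i]))%:C%C b1%:C%C b2%:C%C B3 B4.
Proof.
move=> xR; have rx : 0 < R0 - `|x| by rewrite subr_gt0.
have [p1 [p2 [p3 [p4 jb]]]] := jet5_exists (shift_chol x hb).
have js := jet5_sharp jb.
have [] := jet5_real_uniq rx jb js.
  move=> y /andP[y0 yr]; rewrite sharp_realC.
  have := @breal (x + y); rewrite rmorphD /= => H.
  have /H : `|x + y| < R0.
    by apply: le_lt_trans (ler_normD _ _) _; rewrite (ger0_norm (ltW y0)) addrC -ltrBrDr.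
  by case: (b _) => s t /= ->; rewrite oppr0.
have E (z : C) : z = conjc (z : R[i]) -> z = (Re (z : R[i]))%:C%C.
  case: z => s t /eqP; rewrite eq_complex /= eqxx /= => /eqP H; congr Complex.
  by lra.
rewrite addr0 => /E e0 /E e1 /E e2 _ _; rewrite addr0 in jb.
exists (Re (p1 : R[i])), (Re (p2 : R[i])), p3, p4.
exact: (jet5_eq jb e0 e1 e2 erefl erefl).
Qed.

Variables (r d : R).
Hypotheses (r0 : 0 < r) (d0 : 0 < d) (dR : d <= R0).
Hypothesis fit : forall x : R, `|x| < d -> r + `|lam x| * r ^+ 3 <= R0 - `|x|.
Let rho := r / 2.
Let rho0 : 0 < rho. Proof. by rewrite divr_gt0. Qed.
Let rho_r : 0 < rho < r. Proof. by rewrite rho0 half_lt. Qed.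

Definition phi m n (x : R) : C -> C := polar (pull x (lam x) m) (pull x (lam x) ('D_1 m))
  (sharp (pull x (lam x) n)) (sharp (pull x (lam x) ('D_1 n))).

Definition moment m n k (x w : R) : C := cmoment rho (phi m n x) k w.

(** The coordinates stand for (x, y^2, y^5). The third one is unbounded because [theta] is affine in
    it. *)
Definition mdom : set 'rV[R]_3 := [set y | `|y 0 0| < d /\ `|y 0 1| < rho ^+ 2].

Lemma mdom_open : open mdom.
Proof.
have -> : mdom = (fun y : 'rV[R]_3 => `|y 0 0|) @^-1` [set x | x < d] `&`
                 (fun y : 'rV[R]_3 => `|y 0 1|) @^-1` [set x | x < rho ^+ 2] by [].
apply: openI; apply: open_comp; try exact: open_lt; move=> y _.
  apply: (@continuous_comp _ _ _ (fun y : 'rV[R]_3 => y 0 0) (fun x : R => `|x|)).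
    exact: coord_continuous.
  exact: norm_continuous.
apply: (@continuous_comp _ _ _ (fun y : 'rV[R]_3 => y 0 1) (fun x : R => `|x|)).
  exact: coord_continuous.
exact: norm_continuous.
Qed.

Section smooth_moment.
Variables (N : nat).
Let U := @init R 3 @^-1` mdom.
Let oU : open U.
Proof. by apply: open_comp; [move=> y _; exact: init_continuous|exact: mdom_open]. Qed.
(** The integrand of a moment is a function on R^4: the three coordinates of [mdom], then the angle
    on the circle. *)
Let xc (e : 'rV[R]_4) : R := e 0 (lift ord_max 0).
Let wc (e : 'rV[R]_4) : R := e 0 (lift ord_max 1).
Let gc (e : 'rV[R]_4) : C := circ rho (e 0 ord_max).
Let Cx : cSk N U (fun e => (xc e)%:C%C : C).
Proof. by apply: cSk_real => //; exact: sCk_coord. Qed.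
Let Cw : cSk N U (fun e => (wc e)%:C%C : C).
Proof. by apply: cSk_real => //; exact: sCk_coord. Qed.
Let Cg : cSk N U gc.
Proof. by apply: cSk_circ => //; exact: sCk_coord. Qed.

Let xd e : U e -> `|xc e| < d.
Proof. by move=> [+ _]; rewrite mxE. Qed.

Let Cl : cSk N U (fun e => (lam (xc e))%:C%C : C).
Proof.
apply: cSk_real => //; apply: sCkM => //; first exact: sCk_cst.
have [] // := cSk_comp (O := disc 0 R0) oU (@disc_open R 0 R0) _ hb Cx.
by move=> e /xd xd'; rewrite disc0E normc_real (lt_le_trans xd').
Qed.

Lemma cSk_shear (gam : 'rV[R]_4 -> C) : cSk N U gam -> cSk N U (fun e => shear (xc e) (lam (xc e)) (gam e)).
Proof.
move=> Cgam; apply: (cSk_ext oU (f := fun e => (xc e)%:C%C + (i_ * gam e + -1 * ((lam (xc e))%:C%C * gam e ^+ 3)))).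
  by move=> e _; rewrite /shear mulN1r mulNr.
apply: (cSkD oU Cx); apply: (cSkD oU).
  exact: (cSkM oU (cSk_cst _ oU _) Cgam).
apply: (cSkM oU (cSk_cst _ oU _)); exact: (cSkM oU Cl (cSkX oU _ Cgam)).
Qed.

Lemma cSk_pull f (gam : 'rV[R]_4 -> C) : chol (disc 0 R0) f -> (forall e, disc 0 r (gam e)) ->
  cSk N U gam -> cSk N U (fun e => pull (xc e) (lam (xc e)) f (gam e)).
Proof.
move=> hf gr Cgam; apply: (cSk_comp oU (@disc_open R 0 R0) _ hf (cSk_shear Cgam)) => e Ue.
exact: (shear_disc (fit (xd Ue)) (gr e)).
Qed.

Lemma cSk_moment_integrand m n k : chol (disc 0 R0) m -> chol (disc 0 R0) n ->
  cSk N U (fun e => phi m n (xc e) (gc e) * (gc e)^-1 ^+ k * (gc e ^+ 2 / (gc e ^+ 2 - (wc e)%:C%C))).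
Proof.
move=> hm hn; have oD0 := @disc_open R 0 R0.
have hm' := chol_derive oD0 hm; have hn' := chol_derive oD0 hn.
have gr e : disc 0 r (gc e) by rewrite disc0E normc_circ; [case/andP: rho_r|exact: ltW].
have gr' e : disc 0 r (conjc (gc e : R[i]) : C) by exact: disc0_conj.
have Cg' := cSk_conj oU Cg.
have Cm := cSk_pull hm gr Cg; have Cm' := cSk_pull hm' gr Cg.
have Cn := cSk_conj oU (cSk_pull hn gr' Cg'); have Cn' := cSk_conj oU (cSk_pull hn' gr' Cg').
have C2 := cSkX oU 2 Cg.
apply: (cSkM oU); first apply: (cSkM oU).
- apply: (cSkD oU).
    apply: (cSkM oU (cSk_cst _ oU _)); apply: (cSk_ext oU _ (cSkD oU (cSkM oU Cm Cn') (cSkM oU (cSk_cst _ oU (-1)) (cSkM oU Cm' Cn)))).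
    by move=> e _; rewrite mulN1r.
  exact: (cSkM oU (cSkM oU (cSk_cst _ oU _) Cg) (cSkM oU Cm' Cn')).
- apply: (cSkX oU); apply: (cSkV oU _ Cg) => e _; exact: circ_neq0.
- apply: (cSkM oU C2); apply: (cSkV oU).
    move=> e [_]; rewrite mxE => wr; apply: circ2_sub_neq0 => //; exact: ltW.
  apply: (cSk_ext oU _ (cSkD oU C2 (cSkM oU (cSk_cst _ oU (-1)) Cw))).
  by move=> e _; rewrite mulN1r.
Qed.

Lemma cSk_moment m n k : chol (disc 0 R0) m -> chol (disc 0 R0) n ->
  cSk N mdom (fun y => moment m n k (y 0 0) (y 0 1)).
Proof.
move=> hm hn; have oM := mdom_open.
have := cSkM oM (cSk_cst N oM (tau%:C%C)^-1) (cSk_citg (@tau_gt0 R) oM (cSk_moment_integrand k hm hn)).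
apply: (cSk_ext oM) => y _; congr (_ * _); apply: citg_ext => t _.
by rewrite /xc /wc /gc !emb_lift emb_max.
Qed.

End smooth_moment.

Definition ode (f : C -> C) := chol (disc 0 R0) f /\
  forall z, disc 0 R0 z -> 'D_1 ('D_1 f) z = i_ * b z * f z.

Lemma phi_chol m n x : ode m -> ode n -> `|x| < d -> chol (disc 0 r) (phi m n x).
Proof. by move=> [hm _] [hn _] xd; exact: (polar_chol (fit xd) hm hn). Qed.

(** Moment k of an entry is the coefficient of order k - 1 of its derivative divided by k, so
    [polar_jet] gives the values. *)
Lemma moments m n x : ode m -> ode n -> `|x| < d ->
  [/\ moment m n 1 x 0 = 0, moment m n 3 x 0 = 0,
  (m x%:C%C = 0 -> 'D_1 m x%:C%C = 1 -> n x%:C%C = 1 -> 'D_1 n x%:C%C = 0 ->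
    moment m n 2 x 0 = - (b x%:C%C)) &
  (m x%:C%C = 0 -> 'D_1 m x%:C%C = 1 -> n x%:C%C = 0 -> 'D_1 n x%:C%C = 1 ->
    moment m n 2 x 0 = 0 /\ moment m n 5 x 0 = 8%:R / 5%:R * (b x%:C%C) ^+ 2)].
Proof.
move=> hm hn xd; have hphi := phi_chol hm hn xd.
have xR := lt_le_trans xd dR.
have [b1 [b2 [B3 [B4 jb]]]] := real_jet xR.
have [d1 [d3 [d4 [J K1 K2]]]] := polar_jet (fit xd) hm.1 hn.1 hm.2 hn.2 xR jb erefl.
have [M1 M2 M3 M5] := cmoment_derivative rho_r hphi J.
have bE : b x%:C%C = (Re (b x%:C%C : R[i]))%:C%C.
  by have := breal xR; case: (b _) => s t /= ->.
split.
- exact: M1.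
- by rewrite [LHS]M3 mul0r.
- move=> E0 E1 E2 E3; rewrite [LHS]M2 (K1 E0 E1 E2 E3) bE.
  by rewrite mulNr mulrC mulKf // pnatr_eq0.
move=> E0 E1 E2 E3; have [e1 e4] := K2 E0 E1 E2 E3; rewrite bE; split.
  by rewrite [LHS]M2 e1 mul0r.
by rewrite [LHS]M5 e4 mulrAC.
Qed.

(* [theta (x, y^2, y^5)] recovers Re [hform m n]: the odd part starts at y^5. *)
Definition theta m n (y : 'rV[R]_3) : R :=
  Re (moment m n 0 (y 0 0) (y 0 1) : R[i]) + y 0 2 * Re (moment m n 5 (y 0 0) (y 0 1) : R[i]).

Lemma ssmooth_theta m n : ode m -> ode n -> ssmooth mdom (theta m n).
Proof.
move=> [hm _] [hn _] N; have oM := mdom_open.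
have [C0 _] := cSk_moment N 0 hm hn; have [C5 _] := cSk_moment N 5 hm hn.
by apply: (sCkD oM C0); apply: (sCkM oM _ C5); exact: sCk_coord.
Qed.

Lemma theta_hform m n (y : 'rV[R]_3) (x t : R) : ode m -> ode n -> `|x| < d -> `|t| < rho ->
  y 0 0 = x -> y 0 1 = t ^+ 2 -> y 0 2 = t ^+ 5 ->
  theta m n y = Re (hform m n (shear x (lam x) t%:C%C) : R[i]).
Proof.
move=> hm hn xd tr y0 y1 y2; have hphi := phi_chol hm hn xd.
have t2 : `|t ^+ 2| < rho ^+ 2 by rewrite normrX ltrXn2r // ?nnegrE ?ltW.
have cf := chol_circ rho_r hphi.
have [M1 M3 _ _] := moments hm hn xd.
rewrite -polar_real -/(phi m n x) (cmoment_split rho_r hphi tr) -/(moment m n 0 x _).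
rewrite (cmoment_rec rho0 cf 1 t2) (cmoment_rec rho0 cf 3 t2).
rewrite -/(moment m n 1 x _) -/(moment m n 3 x _) -/(moment m n 5 x _) M1 M3 !add0r.
rewrite /theta y0 y1 y2; move: (moment m n 0 x _) (moment m n 5 x _) => [p q] [p' q'] /=.
by ring.
Qed.

Lemma lineE n (i : 'I_n) (s : R) (j : 'I_n) : (s *: delta_mx 0 i + 0 : 'rV[R]_n) 0 j = s *+ (i == j).
Proof. by rewrite addr0 !mxE eqxx /= eq_sym; case: eqP; rewrite ?mulr1 ?mulr0. Qed.

Lemma is_derive_line0 n (f : 'rV[R]_n -> R) (g : R -> R) (i : 'I_n) (e dg : R) : 0 < e ->
  (forall s, `|s| < e -> f (s *: delta_mx 0 i + 0) = g s) -> is_derive (0 : R) 1 g dg ->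
  'D_(delta_mx 0 i) f 0 = dg.
Proof.
move=> e0 fg Hg; rewrite -derive_lineE.
have H : \forall s \near (0 : R), g s = f (s *: delta_mx 0 i + 0).
  by apply/nbhs_ballP; exists e => // s; rewrite -ball_normE /= sub0r normrN => /fg.
by have [_ ->] := near_eq_is_derive H Hg.
Qed.

Lemma cder_chol_real (O : set C) f (x : R) : chol O f -> O x%:C%C ->
  cder (fun s : R => f s%:C%C) x 1 ('D_1 f x%:C%C).
Proof.
move=> hf Ox; apply: cder_eq (chain_rule (chol_is_derive hf Ox) (cder_real x) _) _.
  exact: real_complex_continuous.
by rewrite mulr1.
Qed.

Lemma cder_conj (V : normedModType R) (c : V -> C) (x v : V) (dc : C) : cder c x v dc ->
  cder (fun y => conjc (c y : R[i]) : C) x v (conjc (dc : R[i]) : C).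
Proof.
move=> [H1 H2]; split.
  rewrite (_ : (fun y => _) = (fun y => Re (c y : R[i]))); last by apply/funext => y; case: (c y).
  by case: dc H1 H2 => ? ? H1 _.
rewrite (_ : (fun y => _) = (fun y => - Im (c y : R[i]))); last by apply/funext => y; case: (c y).
by case: dc H1 H2 => ? ? _ /= H2; exact: is_deriveN.
Qed.

Lemma hform_real m n x : hform m n (x%:C%C : C) =
  i_ * (m x%:C%C * (conjc ('D_1 n x%:C%C : R[i]) : C) - 'D_1 m x%:C%C * (conjc (n x%:C%C : R[i]) : C)).
Proof. by rewrite /hform [X in _ + X](_ : _ = 0) ?addr0 // [Im _]/= mulr0 mul0r. Qed.

(** At y = 0 the curve point is x itself, and along the real axis the derivative of i (m conj(n') -
    m' conj(n)) is 2 b m conj(n), by the equation and the reality of b. *)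
Lemma theta_dx m n : ode m -> ode n ->
  'D_(delta_mx 0 0) (theta m n) 0 = 2%:R * Re (b 0 * m 0 * (conjc (n 0 : R[i]) : C) : R[i]).
Proof.
move=> hm hn; have oD0 := @disc_open R 0 R0.
have D0 : disc 0 R0 (0%:C%C : C) by exact: disc_center.
have c1 := cder_chol_real hm.1 D0; have c2 := cder_eq (cder_chol_real (chol_derive oD0 hm.1) D0) (hm.2 _ D0).
have c3 := cder_conj (cder_chol_real hn.1 D0).
have c4 := cder_conj (cder_eq (cder_chol_real (chol_derive oD0 hn.1) D0) (hn.2 _ D0)).
have [H _] := cderZ i_ (cderD (cderM c1 c4) (cderZ (-1) (cderM c2 c3))).
apply: (is_derive_line0 d0 _ (is_derive_eq H _)).
  move=> s sd; rewrite (@theta_hform m n _ s 0) ?normr0 // ?lineE ?expr0n //=.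
  have -> : shear s (lam s) 0%:C%C = s%:C%C.
    by rewrite /shear expr0n !mulr0 !addr0.
  by rewrite hform_real mulN1r.
have b0 : Im (b 0 : R[i]) = 0 by apply: breal; rewrite normr0.
move: b0; rewrite [0%:C%C](_ : _ = 0 :> C) //.
case: (m 0) (n 0) (b 0) ('D_1 m 0) ('D_1 n 0) => [p q] [p' q'] [s t] [u v] [u' v'] /= ->.
by ring.
Qed.

(** By [cmoment_rec] the even part is its value at w = 0 plus w times moment 2, so the w-derivative
    at 0 is the value of moment 2. *)
Lemma theta_dw m n : ode m -> ode n -> 'D_(delta_mx 0 1) (theta m n) 0 = Re (moment m n 2 0 0 : R[i]).
Proof.
move=> hm hn; have oM := mdom_open.
have M0 : mdom (0 : 'rV[R]_3) by split; rewrite mxE normr0 // exprn_gt0.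
have xd : `|0 : R| < d by rewrite normr0.
have cf := chol_circ rho_r (phi_chol hm hn xd).
have [C2 _] := cSk_moment 1 2 hm.1 hn.1.
have e0 : 0 < rho ^+ 2 by rewrite exprn_gt0.
pose g (s : R) := Re (moment m n 0 0 0 : R[i]) + s * Re (moment m n 2 0 s : R[i]).
have Hd1 : derivable (fun s : R => Re (moment m n 2 0 s : R[i])) 0 1.
  have /(_ (delta_mx 0 1)) := fun v => (derivable1P _ _ v).1 (C1_derivable (v := v) oM C2 M0).
  have -> : (fun s : R => Re (moment m n 2 ((s *: delta_mx 0 1 + 0 : 'rV[R]_3) 0 0)
     ((s *: delta_mx 0 1 + 0 : 'rV[R]_3) 0 1) : R[i])) = (fun s : R => Re (moment m n 2 0 s : R[i])).
    by apply/funext => s; rewrite !lineE.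
  exact.
apply: (is_derive_line0 e0 (g := g)).
  move=> s sd; have [x0 x1 x2] : [/\ (s *: delta_mx 0 1 + 0 : 'rV[R]_3) 0 0 = 0,
     (s *: delta_mx 0 1 + 0 : 'rV[R]_3) 0 1 = s & (s *: delta_mx 0 1 + 0 : 'rV[R]_3) 0 2 = 0] by rewrite !lineE.
  rewrite /theta x0 x1 x2 mul0r addr0 /g /moment (cmoment_rec rho0 cf 0 sd).
  by case: (cmoment _ _ _ _) => p q; case: (cmoment _ _ _ _) => p' q' /=; ring.
have Hg := is_deriveD (is_derive_cst (Re (moment m n 0 0 0 : R[i])) (0 : R) 1) (is_deriveM (is_derive_id (0 : R) 1) (derivableP Hd1)).
apply: is_derive_eq Hg _.
by rewrite /GRing.scale /= mul0r !add0r mulr1.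
Qed.

Lemma theta_dt m n : 'D_(delta_mx 0 2) (theta m n) 0 = Re (moment m n 5 0 0 : R[i]).
Proof.
pose g (s : R) := Re (moment m n 0 0 0 : R[i]) + s * Re (moment m n 5 0 0 : R[i]).
apply: (is_derive_line0 d0 (g := g)).
  by move=> s sd; rewrite /theta !lineE.
have Hg := is_deriveD (is_derive_cst (Re (moment m n 0 0 0 : R[i])) (0 : R) 1)
  (is_deriveM (is_derive_id (0 : R) 1) (is_derive_cst (Re (moment m n 5 0 0 : R[i])) (0 : R) 1)).
apply: is_derive_eq Hg _.
by rewrite /GRing.scale /= mul0r !add0r mulr1.
Qed.

Variables m1 m2 : C -> C.
Hypotheses (hm1 : ode m1) (hm2 : ode m2) (m10 : m1 0 = 0) (m11 : 'D_1 m1 0 = 1)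
  (m20 : m2 0 = 1) (m21 : 'D_1 m2 0 = 0) (b0 : b 0 != 0).

Definition Theta (y : 'rV[R]_3) : 'rV[R]_3 :=
  \row_(j < 3) (match val j with
                | 0%N => theta m2 m2 y
                | 1%N => theta m1 m2 y
                | _ => theta m1 m1 y
                end).

Lemma smooth_Theta : smooth_on mdom Theta.
Proof.
apply/(smoothP _ mdom_open) => j k.
have E f : (forall y, Theta y 0 j = f y) -> ssmooth mdom f -> sCk k mdom (fun y => Theta y 0 j).
  by move=> fE Cf; apply: (sCk_ext mdom_open _ (Cf k)) => y _; rewrite fE.
case: j E => [[|[|j]]] j3 E.
- by apply: E (ssmooth_theta hm2 hm2) => y; rewrite mxE.
- by apply: E (ssmooth_theta hm1 hm2) => y; rewrite mxE.
- by apply: E (ssmooth_theta hm1 hm1) => y; rewrite mxE.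
Qed.

(** In the chosen order of components the Jacobian is lower triangular with diagonal 2 b(0), - b(0),
    8/5 b(0)^2; the entries above the diagonal vanish because m1(0) = 0. *)
Lemma unit_jac_Theta : jac Theta 0 \in unitmx.
Proof.
have B0 : b 0 = (Re (b 0 : R[i]))%:C%C.
  have := @breal 0; rewrite normr0 => /(_ R00); rewrite [0%:C%C](_ : _ = 0 :> C) //.
  by case: (b 0) => s t /= ->.
have B1 : Re (b 0 : R[i]) != 0 by apply: contraNneq b0 => E; rewrite B0 E.
have JE i j : jac Theta 0 i j = 'D_(delta_mx 0 i) (match val j with
     | 0%N => theta m2 m2 | 1%N => theta m1 m2 | _ => theta m1 m1 end) 0.
  rewrite mxE; congr ('D__ _ _); apply/funext => y; rewrite mxE.
  by case: j => [[|[|j]]].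
have xd : `|0 : R| < d by rewrite normr0.
have [_ _ K12 _] := moments hm1 hm2 xd; have [_ _ _ K11] := moments hm1 hm1 xd.
have K12' : moment m1 m2 2 0 0 = - b 0 := K12 m10 m11 m20 m21.
have [K11a K11b] : moment m1 m1 2 0 0 = 0 /\ moment m1 m1 5 0 0 = 8%:R / 5%:R * b 0 ^+ 2 := K11 m10 m11 m10 m11.
have J0 : jac Theta 0 0 0 = 2%:R * Re (b 0 : R[i]).
  apply: etrans (JE 0 0) _; apply: etrans (theta_dx hm2 hm2) _.
  by rewrite m20 conjc1 !mulr1.
have J1 : jac Theta 0 1 1 = - Re (b 0 : R[i]).
  apply: etrans (JE 1 1) _; apply: etrans (theta_dw hm1 hm2) _.
  by rewrite K12'; case: (b 0).
have J2 : jac Theta 0 2 2 = 8%:R / 5%:R * Re (b 0 : R[i]) ^+ 2.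
  apply: etrans (JE 2 2) _; apply: etrans (theta_dt m1 m1) _.
  rewrite K11b B0 -(rmorph_nat (@real_complex R)) -(rmorph_nat (@real_complex R) 5).
  by rewrite -fmorph_div -rmorphXn -rmorphM.
have J01 (j : 'I_3) : (0 < j)%N -> jac Theta 0 0 j = 0.
  move=> j0; apply: etrans (JE 0 j) _.
  by case: j j0 => [[|[|j]]] // j3 _; apply: etrans (theta_dx hm1 _) _ => //;
    rewrite m10 mulr0 mul0r /= mulr0.
have J12 : jac Theta 0 1 2 = 0.
  apply: etrans (JE 1 2) _; apply: etrans (theta_dw hm1 hm1) _.
  by rewrite K11a.
rewrite unitmxE det_trig; last first.
  apply/is_trig_mxP => i j ij.
  have [i0|i0] := posnP i.
    have -> : i = 0 by apply/val_inj.
    by apply: J01; rewrite -[X in (X < _)%N]i0.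
  rewrite (_ : i = 1); last first.
    by apply/val_inj; move: ij i0; case: i j => [[|[|[|i]]] i3] [[|[|[|j]]] j3].
  rewrite (_ : j = 2) //.
  by apply/val_inj; move: ij i0; case: i j => [[|[|[|i]]] i3] [[|[|[|j]]] j3].
rewrite !big_ord_recl big_ord0 mulr1 unitfE.
rewrite (_ : lift ord0 (lift ord0 ord0) = 2); last exact/val_inj.
rewrite (_ : lift ord0 ord0 = 1); last exact/val_inj.
rewrite J0 J1 J2.
by rewrite !mulf_neq0 ?oppr_eq0 ?expf_neq0 ?invr_eq0 ?pnatr_eq0.
Qed.

Lemma Theta_hform (w : 'rV[R]_2) : `|w 0 0| < d -> `|w 0 1| < rho ->
  let z := shear (w 0 0) (lam (w 0 0)) (w 0 1)%:C%C in
  [/\ mdom (cusp52 w), disc 0 R0 z & Theta (cusp52 w) = \row_(j < 3) (match val j with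
     | 0%N => Re (hform m2 m2 z : R[i])
     | 1%N => Re (hform m1 m2 z : R[i])
     | _ => Re (hform m1 m1 z : R[i]) end)].
Proof.
move=> xd tr z; split.
- split; rewrite mxE //= normrX ltrXn2r // ?nnegrE ?ltW //.
- apply: (shear_disc (fit xd)); rewrite disc0E normc_real.
  by apply: lt_trans tr _; case/andP: rho_r.
apply/rowP => j; rewrite !mxE.
by case: j => [[|[|j]]] j3; apply: (theta_hform _ _ xd tr); rewrite ?mxE.
Qed.

End normal_form.

Lemma normal_form (R0 : R) (b m1 m2 : C -> C) : 0 < R0 -> chol (disc 0 R0) b ->
  (forall x : R, `|x| < R0 -> Im (b x%:C%C : R[i]) = 0) -> b 0 != 0 ->
  ode R0 b m1 -> ode R0 b m2 -> m1 0 = 0 -> 'D_1 m1 0 = 1 -> m2 0 = 1 -> 'D_1 m2 0 = 0 ->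
  exists (U : set 'rV[R]_3) (T : 'rV[R]_3 -> 'rV[R]_3) (d : R),
  [/\ open U /\ U 0, smooth_on U T, jac T 0 \in unitmx, 0 < d <= R0 &
  forall w : 'rV[R]_2, `|w 0 0| < d -> `|w 0 1| < d ->
  let z := shear (w 0 0) (lam b (w 0 0)) (w 0 1)%:C%C in
  [/\ U (cusp52 w), disc 0 R0 z & T (cusp52 w) = \row_(j < 3) (match val j with
     | 0%N => Re (hform m2 m2 z : R[i])
     | 1%N => Re (hform m1 m2 z : R[i])
     | _ => Re (hform m1 m1 z : R[i]) end)]].
Proof.
move=> R00 hb breal b0 hm1 hm2 m10 m11 m20 m21.
have [r [d [r0 d0 dR fit]]] := lam_fit R00 hb.
have rho0 : 0 < r / 2 by rewrite divr_gt0.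
exists (mdom r d), (Theta b r m1 m2), (Num.min d (r / 2)); split.
- split; first exact: mdom_open.
  by split; rewrite mxE normr0 // exprn_gt0.
- exact: (smooth_Theta hb r0 dR fit hm1 hm2).
- exact: (unit_jac_Theta R00 hb breal r0 d0 dR fit hm1 hm2 m10 m11 m20 m21 b0).
- by rewrite lt_min d0 rho0 ge_min dR.
move=> w; rewrite !lt_min => /andP[xd _] /andP[_ tr].
exact: (Theta_hform hb breal r0 dR fit hm1 hm2 xd tr).
Qed.

End edge_normal_form.

(** * The condition on a cuspidal edge *)

Section edge_necessary_condition.
Context {R : realType}.
Local Notation C := (Cplx R).
Local Notation Re := complex.Re.
Local Notation Im := complex.Im.

(** Relations obtained by cancelling v hold for v != 0; this carries them to v = 0 together with
    their first derivative. *)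
Lemma cder_zero_punctured (E : R -> C) (dE : C) (e : R) : 0 < e -> cder E 0 1 dE ->
  (forall v, v != 0 -> `|v| < e -> E v = 0) -> E 0 = 0 /\ dE = 0.
Proof.
move=> e0 [dR dI] EZ.
have aux (f : R -> R) (l : R) : is_derive (0 : R) 1 f l -> (forall v, v != 0 -> `|v| < e -> f v = 0) ->
    f 0 = 0 /\ l = 0.
  move=> df fZ; have cf : {for 0, continuous f} by apply: differentiable_continuous; apply/derivable1_diffP; case: df.
  have f0 : f 0 = 0.
    apply/eqP/negPn/negP => f0.
    have a0 : 0 < `|f 0| by rewrite normr_gt0.
    have /(cvgrPdist_lt (FF := nbhs_filter _))/(_ _ a0)/nbhs_ballP[r /= r0 rE] := cf.
    pose v := Num.min (r / 2) (e / 2).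
    have v0 : 0 < v by rewrite lt_min !divr_gt0.
    have vr : v < r by rewrite gt_min half_lt.
    have ve : v < e by rewrite gt_min orbC half_lt.
    have /rE : ball 0 r v by rewrite -ball_normE /= sub0r normrN gtr0_norm.
    have fv : f v = 0 by apply: fZ; rewrite ?gt_eqF // gtr0_norm.
    by rewrite /= fv subr0 ltxx.
  split=> //; have H : \forall v \near (0 : R), (fun=> 0 : R) v = f v.
    apply/nbhs_ballP; exists e => // v; rewrite -ball_normE /= sub0r normrN => ve.
    by have [->|v0] := eqVneq v 0; rewrite ?f0 ?fZ.
  have [_ E1] := near_eq_is_derive H (is_derive_cst (0 : R) (0 : R) 1).
  by have [_ E2] := df; rewrite -E2 E1.
have [r0 lr] := aux _ _ dR (fun v v0 ve => congr1 (fun z : C => Re (z : R[i])) (EZ v v0 ve)).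
have [i0 li] := aux _ _ dI (fun v v0 ve => congr1 (fun z : C => Im (z : R[i])) (EZ v v0 ve)).
by split; apply/eqP; rewrite eq_complex ?r0 ?i0 ?lr ?li /= !eqxx.
Qed.

Definition cj (z : C) : C := conjc (z : R[i]).

Lemma cjD x y : cj (x + y) = cj x + cj y. Proof. exact: conjcD. Qed.
Lemma cjB x y : cj (x - y) = cj x - cj y. Proof. exact: conjcB. Qed.
Lemma cjM x y : cj (x * y) = cj x * cj y. Proof. exact: conjcM. Qed.
Lemma cjN x : cj (- x) = - cj x. Proof. exact: (rmorphN (@conjc R)). Qed.
Lemma cjK x : cj (cj x) = x. Proof. exact: conjcK. Qed.
Lemma cjX x n : cj (x ^+ n) = cj x ^+ n. Proof. exact: (rmorphXn (@conjc R)). Qed.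
Lemma cjV x : cj (x^-1) = (cj x)^-1. Proof. exact: (fmorphV (@conjc R)). Qed.
Lemma cj_real (x : R) : cj x%:C%C = x%:C%C. Proof. by rewrite /cj /= oppr0. Qed.
Lemma cj1 : cj 1 = 1. Proof. exact: conjc1. Qed.
Lemma cj_eq0 x : (cj x == 0) = (x == 0). Proof. exact: (fmorph_eq0 (@conjc R)). Qed.

Lemma cder_cj (V : normedModType R) (f : V -> C) (x v : V) (df : C) : cder f x v df ->
  cder (fun y => cj (f y)) x v (cj df).
Proof. exact: cder_conj. Qed.

(** Modulo the first relations, the differentiated relation factors as (conj(G)^2 Gv - conj(Gv)) G
    (x - G conj(y)), and the last two factors are not zero. *)
Lemma edge_algebra (G Gv t x y : C) : G * cj G = 1 -> cj t = - (t * G ^+ 2) -> cj x = x ->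
  y = 2%:R * G * x - G ^+ 2 * cj y -> G != 0 -> x != G * cj y ->
  (1 + G * cj G) * (- (t * G * (x - G * cj y)) - cj (t * G * (x - G * cj y))) +
  (0 + (G * cj Gv + Gv * cj G)) * x +
  -1 * (cj G * (- (t * G * (y - G * x)) - cj (t * (x - G * cj y))) + cj Gv * y +
   (G * cj (- (t * G * (y - G * x)) - cj (t * (x - G * cj y))) + Gv * cj y)) = 0 ->
  cj G ^+ 2 * Gv = cj Gv.
Proof.
move=> GG e2 rx ye G0 xy; rewrite !(cjD, cjB, cjM, cjN, cjK) rx e2 => H.
have : (cj G ^+ 2 * Gv - cj Gv) * (G * (x - G * cj y)) = 0.
  rewrite -H; move: ye; move: (cj y) => Y ->.
  by ring: GG.
move=> /eqP; rewrite mulf_eq0 subr_eq0 => /orP[/eqP //|].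
by rewrite mulf_eq0 (negbTE G0) subr_eq0 (negbTE xy).
Qed.

(* F = [[a, b], [c, d]]; [fr] gives the entries of F N F^*, and v K = F N F^* is the
   v-derivative of the face along the curve [z]. *)
Section edge.
Variables (O : set C) (g h a b c d : C -> C).
Hypotheses (oO : open O) (hg : chol O g) (hh : chol O h)
  (ha : chol O a) (hb : chol O b) (hc : chol O c) (hd : chol O d).
Hypothesis h0 : forall z, O z -> h z != 0.
Hypothesis detF : forall z, O z -> a z * d z - b z * c z = 1.
Hypothesis da : forall z, O z -> 'D_1 a z = h z * (a z * g z + b z).
Hypothesis db : forall z, O z -> 'D_1 b z = - g z * (h z * (a z * g z + b z)).
Hypothesis dc : forall z, O z -> 'D_1 c z = h z * (c z * g z + d z).
Hypothesis dd : forall z, O z -> 'D_1 d z = - g z * (h z * (c z * g z + d z)).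

Variables (z zd : R -> C) (zdd : C) (e : R).
Hypotheses (e0 : 0 < e) (zO : forall v, `|v| < e -> O (z v)).
Hypothesis zder : forall v, `|v| < e -> cder z v 1 (zd v).
Hypothesis zdder : cder zd 0 1 zdd.
Hypothesis zd0 : zd 0 != 0.

Variables (K00 K01 K11 : R -> C).
Hypotheses (dK00 : cder K00 0 1 0) (dK01 : cder K01 0 1 0) (dK11 : cder K11 0 1 0).
Hypotheses (rK00 : forall v, cj (K00 v) = K00 v) (rK11 : forall v, cj (K11 v) = K11 v).

Let T v := zd v * h (z v).
Let N00 v := T v * g (z v) + cj (T v * g (z v)).
Let N01 v := T v * g (z v) ^+ 2 + cj (T v).
Let fr (p q p' q' : C -> C) (n00 n01 n11 : C) v :=
  p (z v) * cj (p' (z v)) * n00 + p (z v) * cj (q' (z v)) * n01 +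
  q (z v) * cj (p' (z v)) * cj n01 + q (z v) * cj (q' (z v)) * n11.
Hypothesis K00E : forall v, `|v| < e -> v%:C%C * K00 v = fr a b a b (N00 v) (N01 v) (N00 v) v.
Hypothesis K01E : forall v, `|v| < e -> v%:C%C * K01 v = fr a b c d (N00 v) (N01 v) (N00 v) v.
Hypothesis K11E : forall v, `|v| < e -> v%:C%C * K11 v = fr c d c d (N00 v) (N01 v) (N00 v) v.

(** At a singular point every tangent vector of the face comes from a real multiple of [[1, G],
    [conj G, 1]] by the congruence with F. The hypothesis says that K at 0 is not on that line. *)
Hypothesis indep : forall x : R,
  ~ (K00 0 = fr a b a b x%:C%C (x%:C%C * g (z 0)) x%:C%C 0 /\
     K01 0 = fr a b c d x%:C%C (x%:C%C * g (z 0)) x%:C%C 0 /\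
     K11 0 = fr c d c d x%:C%C (x%:C%C * g (z 0)) x%:C%C 0).

(** The entries of Z, with [[d, -b], [-c, a]] as the inverse of F since det F = 1. *)
Let Z00 v := fr d (fun w => -1 * b w) d (fun w => -1 * b w) (K00 v) (K01 v) (K11 v) v.
Let Z01 v := fr d (fun w => -1 * b w) (fun w => -1 * c w) a (K00 v) (K01 v) (K11 v) v.
Let Z11 v := fr (fun w => -1 * c w) a (fun w => -1 * c w) a (K00 v) (K01 v) (K11 v) v.

Let o0 : `|0 : R| < e. Proof. by rewrite normr0. Qed.

(** Composition of two congruences by 2x2 matrices; used with F and its inverse in either order. *)
Lemma frameK p q p' q' r s r' s' v (n00 n01 n11 : C) :
  let k00 := fr p q p q n00 n01 n11 v in let k01 := fr p q r s n00 n01 n11 v in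
  let k11 := fr r s r s n00 n01 n11 v in
  cj n00 = n00 -> cj n11 = n11 ->
  fr p' q' r' s' k00 k01 k11 v =
   fr (fun w => p' w * p w + q' w * r w) (fun w => p' w * q w + q' w * s w)
      (fun w => r' w * p w + s' w * r w) (fun w => r' w * q w + s' w * s w) n00 n01 n11 v.
Proof.
move=> /= r0 r1; rewrite /fr !(cjD, cjM, cjK) r0 r1.
by ring.
Qed.

Lemma Z_eq v : `|v| < e -> [/\ v%:C%C * Z00 v = N00 v, v%:C%C * Z01 v = N01 v & v%:C%C * Z11 v = N00 v].
Proof.
move=> ve; have D := detF (zO ve).
have r0 : cj (N00 v) = N00 v by rewrite /N00 cjD cjK addrC.
have ZE p q p' q' : v%:C%C * fr p q p' q' (K00 v) (K01 v) (K11 v) v =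
   fr p q p' q' (v%:C%C * K00 v) (v%:C%C * K01 v) (v%:C%C * K11 v) v.
  by rewrite /fr cjM cj_real; ring.
have D' : cj (a (z v)) * cj (d (z v)) - cj (b (z v)) * cj (c (z v)) = 1.
  by rewrite -!cjM -cjB D /cj conjc1.
have E1 : a (z v) * d (z v) = 1 + b (z v) * c (z v) by rewrite -D subrK.
have E2 : cj (a (z v)) * cj (d (z v)) = 1 + cj (b (z v)) * cj (c (z v)) by rewrite -D' subrK.
have N1 : cj (-1) = -1 by rewrite /cj rmorphN rmorph1.
rewrite /Z00 /Z01 /Z11 !ZE (K00E ve) (K01E ve) (K11E ve).
split; rewrite (frameK _ _ _ _ _ _ _ _ _ _ r0 r0) /fr !(cjD, cjM) N1.
- by ring: E1 E2.
- by ring: E1 E2.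
- by ring: E1 E2.
Qed.

Lemma cder_comp_z (f : C -> C) (f' : C) : is_derive (z 0) 1 f f' -> cder (fun v => f (z v)) 0 1 (f' * zd 0).
Proof. by move=> H; apply: chain_rule H (zder o0) _; exact: (cder_continuous (zder o0)). Qed.

Lemma cder_fr (p q p' q' : C -> C) (pd qd pd' qd' : C) :
  cder (fun v => p (z v)) 0 1 pd -> cder (fun v => q (z v)) 0 1 qd ->
  cder (fun v => p' (z v)) 0 1 pd' -> cder (fun v => q' (z v)) 0 1 qd' ->
  cder (fun v => fr p q p' q' (K00 v) (K01 v) (K11 v) v) 0 1
   ((pd * cj (p' (z 0)) + p (z 0) * cj pd') * K00 0 + (pd * cj (q' (z 0)) + p (z 0) * cj qd') * K01 0 +
    (qd * cj (p' (z 0)) + q (z 0) * cj pd') * cj (K01 0) + (qd * cj (q' (z 0)) + q (z 0) * cj qd') * K11 0).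
Proof.
move=> Hp Hq /cder_cj Hp' /cder_cj Hq'.
have H := cderD (cderD (cderD (cderM (cderM Hp Hp') dK00) (cderM (cderM Hp Hq') dK01))
  (cderM (cderM Hq Hp') (cder_cj dK01))) (cderM (cderM Hq Hq') dK11).
apply: cder_eq H _.
rewrite (_ : cj 0 = 0); last by rewrite /cj conjc0.
by rewrite /fr; ring.
Qed.

Let t := T 0.
Let G := g (z 0).

(** The derivative of K vanishes at 0, so only the inverse frame is differentiated. Its derivative
    is the Weierstrass matrix times the frame, which expresses the result through Z, G and t. *)
Lemma Z_der : let x := Z00 0 in let y := Z01 0 in let x' := Z11 0 in
  [/\ cder Z00 0 1 (- (t * G * (x - G * cj y)) - cj (t * G * (x - G * cj y))),
      cder Z01 0 1 (- (t * G * (y - G * x')) - cj (t * (x - G * cj y))) &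
      exists x1, cder Z11 0 1 x1].
Proof.
move=> x y x'; have Oz := zO o0.
have Da := cder_comp_z (is_derive_eqC (chol_is_derive ha Oz) (da Oz)).
have Db := cder_comp_z (is_derive_eqC (chol_is_derive hb Oz) (db Oz)).
have Dc := cder_comp_z (is_derive_eqC (chol_is_derive hc Oz) (dc Oz)).
have Dd := cder_comp_z (is_derive_eqC (chol_is_derive hd Oz) (dd Oz)).
have Db' := cderZ (-1) Db; have Dc' := cderZ (-1) Dc.
split.
- apply: cder_eq (cder_fr Dd Db' Dd Db') _.
  rewrite /t /G /T /x /y /Z00 /Z01 /fr !(cjD, cjB, cjM, cjN, cjK) cj1 !rK00 !rK11.
  by ring.
- apply: cder_eq (cder_fr Dd Db' Dc' Da) _.
  rewrite /t /G /T /x /y /x' /Z00 /Z01 /Z11 /fr !(cjD, cjB, cjM, cjN, cjK) cj1 !rK00 !rK11.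
  by ring.
- by eexists; exact: (cder_fr Dc' Da Dc' Da).
Qed.

Lemma K_eq : [/\ K00 0 = fr a b a b (Z00 0) (Z01 0) (Z11 0) 0,
  K01 0 = fr a b c d (Z00 0) (Z01 0) (Z11 0) 0 & K11 0 = fr c d c d (Z00 0) (Z01 0) (Z11 0) 0].
Proof.
have D := detF (zO o0).
have E1 : a (z 0) * d (z 0) = 1 + b (z 0) * c (z 0) by rewrite -D subrK.
have E2 : cj (a (z 0)) * cj (d (z 0)) = 1 + cj (b (z 0)) * cj (c (z 0)).
  by rewrite -!cjM E1 cjD cj1 cjM.
rewrite /Z00 /Z01 /Z11.
split; rewrite (frameK _ _ _ _ _ _ _ _ _ _ (rK00 0) (rK11 0)) /fr !(cjD, cjM) cjN cj1.
- by ring: E1 E2.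
- by ring: E1 E2.
- by ring: E1 E2.
Qed.

Let phi : C := 'D_1 g (z 0) / (G ^+ 2 * h (z 0)).

(** For every v, N satisfies (1 + |g|^2) N00 = conj(g) N01 + g conj(N01). For v != 0 this divides by
    v, and the limit at v = 0 gives a relation for Z(0) and one for its derivative; the latter feeds
    [edge_algebra]. *)
Lemma edge_condition : [/\ G * cj G = 1, 'D_1 g (z 0) != 0 & phi + cj phi = 0].
Proof.
have Oz := zO o0; have [HZ0 HZ1 [x1 HZ2]] := Z_der; have [k0 k1 k2] := K_eq.
set x := Z00 0 in HZ0 HZ1 k0 k1 k2; set y := Z01 0 in HZ0 HZ1 k0 k1 k2.
set x' := Z11 0 in HZ1 k0 k1 k2.
have [n0 n1 n2] := Z_eq o0.
have t0 : t != 0 by rewrite mulf_neq0 // h0.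
have ct0 : cj t != 0 by rewrite cj_eq0.
have E0 : 0%:C%C = 0 :> C by [].
(* At v = 0 the relation v Z = N says N(0) = 0, whatever Z(0) is. *)
have e1 : t * G + cj t * cj G = 0 by rewrite -cjM -[LHS]/(N00 0) -n0 E0 mul0r.
have e2 : cj t = - (t * G ^+ 2).
  by apply/eqP; rewrite -addr_eq0 addrC -[X in X == 0]/(N01 0) -n1 E0 mul0r.
have G0 : G != 0 by apply: contraNneq ct0 => H; rewrite e2 H expr0n mulr0 oppr0.
have GG : G * cj G = 1.
  apply: (mulfI (mulf_neq0 t0 G0)); rewrite mulr1.
  by move: e1; rewrite e2 mulNr => /eqP; rewrite subr_eq0 => /eqP {2}->; ring.
pose Gv := 'D_1 g (z 0) * zd 0.
have Dg := cder_comp_z (chol_is_derive hg Oz); rewrite -/Gv in Dg.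
have Dcg := cder_cj Dg.
have rx : cj x = x.
  by rewrite /x /Z00 /fr !(cjD, cjM, cjK) rK00 rK11 cjN cj1; ring.
pose E v := (1 + g (z v) * cj (g (z v))) * Z00 v + (-1) * (cj (g (z v)) * Z01 v + g (z v) * cj (Z01 v)).
have HE := cderD (cderM (cderD (cder_cst 1 (0 : R) 1) (cderM Dg Dcg)) HZ0)
  (cderZ (-1) (cderD (cderM Dcg HZ1) (cderM Dg (cder_cj HZ1)))).
have EZ v : v != 0 -> `|v| < e -> E v = 0.
  move=> v0 ve; have [z0 z1 _] := Z_eq ve.
  have vC : (v%:C%C : C) != 0 by rewrite eq_complex /= eqxx andbT.
  apply: (mulfI vC); rewrite mulr0 /E.
  transitivity ((1 + g (z v) * cj (g (z v))) * (v%:C%C * Z00 v) + (-1) * (cj (g (z v)) * (v%:C%C * Z01 v) + g (z v) * cj (v%:C%C * Z01 v))).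
    by rewrite cjM cj_real; ring.
  by rewrite z0 z1 /N00 /N01; move: (T v) => Tv; rewrite !(cjD, cjM, cjX, cjK); ring.
have [E00 dE0] := cder_zero_punctured e0 HE EZ.
have xx' : x' = x.
  have [|+ _] := cder_zero_punctured e0 (cderD HZ2 (cderZ (-1) HZ0)).
    move=> v v0 ve; have [z0 _ z1] := Z_eq ve.
    have vC : (v%:C%C : C) != 0 by rewrite eq_complex /= eqxx andbT.
    by apply: (mulfI vC); rewrite mulr0 mulrDr mulN1r mulrN z0 z1 subrr.
  by rewrite mulN1r => /eqP; rewrite subr_eq0 => /eqP.
have ye : y = 2%:R * G * x - G ^+ 2 * cj y.
  have : G * E 0 = 0 by rewrite [E 0]E00 mulr0.
  rewrite /E -/G -/x -/y GG => /eqP; rewrite -subr_eq0 => /eqP H.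
  apply/eqP; rewrite eq_sym -subr_eq0 -H; apply/eqP.
  by ring: GG.
(* Otherwise y = x G and Z(0) = x [[1, G], [conj G, 1]], which [indep] excludes. *)
have xy : x != G * cj y.
  apply/eqP => H.
  have yx : y = x * G by rewrite ye; rewrite H; ring.
  have xr : x = (Re (x : R[i]))%:C%C.
    move: rx; rewrite /cj; case: (x) => s s' /eqP; rewrite eq_complex /= eqxx /= => /eqP s0.
    by congr Complex; lra.
  apply: (@indep (Re (x : R[i]))); rewrite -xr.
  by rewrite k0 k1 k2 xx' yx.
(* Equivalently conj(G) Gv is real: to first order g moves radially along the curve. *)
have key : cj G ^+ 2 * Gv = cj Gv.
  by rewrite xx' in dE0; exact: (edge_algebra GG e2 rx ye G0 xy dE0).
(* If g were stationary at v = 0, the derivative of v Z01 = N01 would read y = T' G^2 + conj(T'), so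
   y = G^2 conj(y) and therefore x = G conj(y). *)
have Gv0 : Gv != 0.
  apply/eqP => Gv0.
  have [Tv DT] : exists Tv, cder (fun v => zd v * h (z v)) 0 1 Tv.
    by eexists; exact: (cderM zdder (cder_comp_z (chol_is_derive hh Oz))).
  have DN := cderD (cderM DT (cderM Dg Dg)) (cder_cj DT).
  have [v v0 ve|_] := cder_zero_punctured e0 (cderD (cderM (cder_real 0) HZ1) (cderZ (-1) DN)).
    have [_ z1 _] := Z_eq ve; rewrite z1 /N01 /T mulN1r expr2.
    by rewrite subrr.
  rewrite Gv0 -/G -/y E0 => H.
  have yE : y = Tv * (G * G) + cj Tv.
    by apply/eqP; rewrite -subr_eq0 -[X in _ == X]H; apply/eqP; ring.
  case/negP: xy; apply/eqP.
  have n2' : (2%:R * G : C) != 0 by rewrite mulf_neq0 // pnatr_eq0.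
  apply: (mulfI n2').
  have -> : 2%:R * G * x = y + G ^+ 2 * cj y by rewrite {1}ye subrK.
  by rewrite yE; rewrite !(cjD, cjM, cjK); ring: GG.
have zd' := zd0; have h' := h0 Oz.
split=> //.
  by apply: contraNneq Gv0 => H; rewrite /Gv H mul0r.
have pE : phi = Gv / (G ^+ 2 * t).
  by rewrite /phi /Gv /t /T; field; rewrite ?G0 ?zd' ?h'.
rewrite pE cjM cjV cjM cjX e2 -key.
have cG0 : cj G != 0 by rewrite cj_eq0.
by field; rewrite ?G0 ?t0 ?cG0.
Qed.

End edge.

End edge_necessary_condition.

(** * The face and its singular set *)

Section face_geometry.
Context {R : realType}.
Local Notation C := (Cplx R).
Local Notation Re := complex.Re.
Local Notation Im := complex.Im.
Local Notation normc := Normc.normc.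

Definition hp (F : C -> 'M[C]_2) (i j : 'I_2) (z : C) : C :=
  F z i 0 * cj (F z j 0) + (-1) * (F z i 1 * cj (F z j 1)).

Definition hcoord (x00 x01 x11 : C) : 'rV[R]_4 :=
  \row_(j < 4)
    (match val j with
     | 0%N => (Re (x00 : R[i]) + Re (x11 : R[i])) / 2
     | 1%N => Re (x01 : R[i])
     | 2%N => Im (x01 : R[i])
     | _ => (Re (x00 : R[i]) - Re (x11 : R[i])) / 2
     end).

Lemma conj_cj (z : C) : Num.conj z = cj z.
Proof. by []. Qed.

Lemma Re_half (z : C) : Re (z / 2 : R[i]) = Re (z : R[i]) / 2.
Proof.
have -> : (2 : C) = (2%:R : R)%:C%C by rewrite rmorph_nat.
by rewrite -fmorphV; case: z => s t /=; rewrite mulr0 subr0.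
Qed.

Lemma herm_coordE (X : 'M[C]_2) : herm_coord X = hcoord (X 0 0) (X 0 1) (X 1 1).
Proof.
apply/rowP => j; rewrite !mxE; case: j => [[|[|[|[|//]]]]] j4 //=.
  by rewrite Re_half; case: (X 0 0) => ? ?; case: (X 1 1).
by rewrite Re_half; case: (X 0 0) => ? ?; case: (X 1 1).
Qed.

Lemma face_entry (F : C -> 'M[C]_2) z i j : (F z *m e3 R *m adjC (F z)) i j = hp F i j z.
Proof.
rewrite /hp mxE !big_ord_recl big_ord0 addr0 !mxE !big_ord_recl !big_ord0 !addr0 !mxE /=.
have -> : lift ord0 ord0 = 1 :> 'I_2 by exact/val_inj.
have -> : ord0 = 0 :> 'I_2 by [].
by rewrite !conj_cj; ring.
Qed.

Lemma cmc1_faceE (F : C -> 'M[C]_2) w :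
  cmc1_face F w = hcoord (hp F 0 0 (toC w)) (hp F 0 1 (toC w)) (hp F 1 1 (toC w)).
Proof. by rewrite /cmc1_face herm_coordE !face_entry. Qed.

Lemma hp_real F i z : cj (hp F i i z) = hp F i i z.
Proof. by rewrite /hp !(cjD, cjM, cjK) cjN cj1; ring. Qed.

Lemma hp_sym F i j z : cj (hp F i j z) = hp F j i z.
Proof. by rewrite /hp !(cjD, cjM, cjK) cjN cj1; ring. Qed.

Lemma hcoord_herm (x00 x01 x11 : C) : cj x00 = x00 -> cj x11 = x11 ->
  herm_of (hcoord x00 x01 x11) = mx2 x00 x01 (cj x01) x11.
Proof.
have rE (z : C) : cj z = z -> z = (Re (z : R[i]))%:C%C.
  rewrite /cj; case: z => s t /eqP; rewrite eq_complex /= eqxx /= => /eqP s0.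
  by congr Complex; lra.
move=> /rE E0 /rE E1; rewrite /herm_of !mxE /=.
congr mx2.
- by rewrite [RHS]E0; congr Complex; field.
- by case: x01.
- by case: x01.
- by rewrite [RHS]E1; congr Complex; field.
Qed.

Lemma det_mx2 (x y x' y' : C) : \det (mx2 x y x' y') = x * y' - y * x'.
Proof. by rewrite (expand_det_row _ 0) !big_ord_recl big_ord0 /cofactor !det_mx11 !mxE /= /bump /=; ring. Qed.

Lemma det_M2 (M : 'M[C]_2) : \det M = M 0 0 * M 1 1 - M 0 1 * M 1 0.
Proof.
rewrite -det_mx2; congr (\det _); apply/matrixP => i j; rewrite mxE.
by case: i => [[|[|//]]] i2; case: j => [[|[|//]]] j2; rewrite /=; congr (M _ _); exact/val_inj.
Qed.

Lemma face_deSitter (F : C -> 'M[C]_2) z : \det (F z) = 1 -> deSitter3 (hcoord (hp F 0 0 z) (hp F 0 1 z) (hp F 1 1 z)).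
Proof.
rewrite /deSitter3 /= => dF; rewrite (hcoord_herm _ (hp_real _ _ _) (hp_real _ _ _)) det_mx2 hp_sym.
move: dF; rewrite det_M2 => dF.
have dF' : cj (F z 0 0) * cj (F z 1 1) = 1 + cj (F z 0 1) * cj (F z 1 0).
  by rewrite -!cjM -[X in _ = X + _]cj1 -cjD; congr cj; rewrite -dF subrK.
have dF1 : F z 0 0 * F z 1 1 = 1 + F z 0 1 * F z 1 0 by rewrite -dF subrK.
by rewrite /hp; ring: dF1 dF'.
Qed.

(** * Singular points through directional derivatives *)

Lemma C1_differentiable n m (U : set 'rV[R]_n) (f : 'rV[R]_n -> 'rV[R]_m) x : open U ->
  (forall j, sCk 1 U (fun y => f y 0 j)) -> U x -> differentiable f x.
Proof.
move=> oU Cf Ux.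
have -> : f = fun y => \sum_(j < m) (fun y => f y 0 j *: (delta_mx 0 j : 'rV[R]_m)) y.
  by apply/funext => y; rewrite [LHS]matrix_sum_delta big_ord1.
have -> : (fun y => \sum_(j < m) (fun y => f y 0 j *: (delta_mx 0 j : 'rV[R]_m)) y) =
    \sum_(j < m) (fun y => f y 0 j *: (delta_mx 0 j : 'rV[R]_m)).
  by apply/funext => y; rewrite fct_sumE.
apply: differentiable_sum => j; apply: differentiableZl.
by have [] := C1_is_diff oU (Cf j) Ux.
Qed.

Lemma singular_pointP n (U : set 'rV[R]_2) (f : 'rV[R]_2 -> 'rV[R]_4) w : n = 1%N -> open U -> U w ->
  (forall j, sCk n U (fun y => f y 0 j)) ->
  singular_point f w <-> exists2 v, v != 0 & 'D_v f w = 0.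
Proof.
move=> -> oU Uw Cf; have df := C1_differentiable oU Cf Uw.
split=> [ns|[v v0 dv] [_ inj]].
  apply: contrapT => H; apply: ns; split=> // v1 v2 E.
  apply/eqP; rewrite -subr_eq0; apply/negPn/negP => v0; apply: H; exists (v1 - v2) => //.
  by rewrite deriveE // linearB /= E subrr.
case/negP: v0; apply/eqP; apply: inj.
by rewrite -deriveE // dv linear0.
Qed.

Definition hpd (F : C -> 'M[C]_2) (i j : 'I_2) (z eta : C) : C :=
  (F z i 0 * cj ('D_1 (fun z => F z j 0) z * eta) + ('D_1 (fun z => F z i 0) z * eta) * cj (F z j 0)) +
  (-1) * (F z i 1 * cj ('D_1 (fun z => F z j 1) z * eta) + ('D_1 (fun z => F z i 1) z * eta) * cj (F z j 1)).

Lemma hpd_real F i z eta : cj (hpd F i i z eta) = hpd F i i z eta.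
Proof.
rewrite /hpd; move: (F z i 0) (F z i 1) ('D_1 (fun z => F z i 0) z) ('D_1 (fun z => F z i 1) z) => p q p' q'.
by rewrite !(cjD, cjM, cjK) cjN cj1; ring.
Qed.

Lemma cj_i : cj i_ = - (i_ : C).
Proof. by apply/eqP; rewrite /cj eq_complex /= oppr0 !eqxx. Qed.

Section face_calculus.
Variables (O : set C) (F : C -> 'M[C]_2).
Hypotheses (oO : open O) (hF : forall i j, chol O (fun z => F z i j)).
Let oP := prec_open oO.

Lemma cSk_hp k i j : cSk k (prec O) (fun w => hp F i j (toC w)).
Proof.
have H i' j' := cSk_holo k oO (hF i' j').
apply: (cSkD oP (cSkM oP (H i 0) (cSk_conj oP (H j 0)))).
exact: (cSkM oP (cSk_cst k oP (-1)) (cSkM oP (H i 1) (cSk_conj oP (H j 1)))).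
Qed.

Lemma ssmooth_face j : ssmooth (prec O) (fun w => cmc1_face F w 0 j).
Proof.
move=> k; have [r00 _] := cSk_hp k 0 0; have [r01 i01] := cSk_hp k 0 1; have [r11 _] := cSk_hp k 1 1.
have c2 := sCk_cst k (2^-1 : R) oP.
case: j => [[|[|[|[|//]]]]] j4.
- apply: (sCk_ext oP _ (sCkM oP (sCkD oP r00 r11) c2)) => w _; by rewrite cmc1_faceE mxE.
- apply: (sCk_ext oP _ r01) => w _; by rewrite cmc1_faceE mxE.
- apply: (sCk_ext oP _ i01) => w _; by rewrite cmc1_faceE mxE.
- apply: (sCk_ext oP _ (sCkM oP (sCkB oP r00 r11) c2)) => w _; by rewrite cmc1_faceE mxE.
Qed.

Lemma cder_hp i j w v : O (toC w) ->
  cder (fun w => hp F i j (toC w)) w v (hpd F i j (toC w) (toC v)).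
Proof.
move=> Ow; have H i' j' := cder_holo v (hF i' j') Ow.
exact: (cderD (cderM (H i 0) (cder_cj (H j 0))) (cderZ (-1) (cderM (H i 1) (cder_cj (H j 1))))).
Qed.

Lemma face_derive w v : O (toC w) ->
  'D_v (cmc1_face F) w = hcoord (hpd F 0 0 (toC w) (toC v)) (hpd F 0 1 (toC w) (toC v)) (hpd F 1 1 (toC w) (toC v)).
Proof.
move=> Ow; have df := C1_differentiable oP (fun j => @ssmooth_face j 1) Ow.
have [H00 _] := cder_hp 0 0 v Ow; have [H01 H01'] := cder_hp 0 1 v Ow; have [H11 _] := cder_hp 1 1 v Ow.
rewrite derive_mx; last exact: diff_derivable.
apply/rowP => j; rewrite !mxE.
have E (f : 'rV[R]_2 -> R) d : (forall y, cmc1_face F y 0 j = f y) -> is_derive w v f d ->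
    'D_v (fun y => cmc1_face F y 0 j) w = d.
  by move=> fE [_ <-]; congr ('D__ _ _); apply/funext.
case: j E => [[|[|[|[|//]]]]] j4 E.
- apply: E; first by move=> y; rewrite cmc1_faceE mxE.
  apply: is_derive_eq (is_deriveM (is_deriveD H00 H11) (is_derive_cst (2^-1 : R) w v)) _.
  by rewrite scaler0 add0r /GRing.scale /= mulrC.
- by apply: E H01 => y; rewrite cmc1_faceE mxE.
- by apply: E H01' => y; rewrite cmc1_faceE mxE.
- apply: E; first by move=> y; rewrite cmc1_faceE mxE.
  apply: is_derive_eq (is_deriveM (is_deriveB H00 H11) (is_derive_cst (2^-1 : R) w v)) _.
  by rewrite scaler0 add0r /GRing.scale /= mulrC.
Qed.

Definition frm (i j : 'I_2) (n00 n01 n11 z : C) : C :=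
  F z i 0 * cj (F z j 0) * n00 + F z i 0 * cj (F z j 1) * n01 +
  F z i 1 * cj (F z j 0) * cj n01 + F z i 1 * cj (F z j 1) * n11.

Section point.
Variables (z mu al be : C).
Hypotheses (Oz : O z) (detF : F z 0 0 * F z 1 1 - F z 0 1 * F z 1 0 = 1).
(** [al : be] is g in homogeneous coordinates and [mu] rescales h accordingly: (g, 1) with h off the
    poles, (1, 0) with the extension of g^2 h at a pole. One computation then serves both cases. *)
Hypothesis D0 : forall i, 'D_1 (fun z => F z i 0) z = mu * (F z i 0 * (al * be) + F z i 1 * be ^+ 2).
Hypothesis D1 : forall i, 'D_1 (fun z => F z i 1) z = - (mu * (F z i 0 * al ^+ 2 + F z i 1 * (al * be))).

Lemma hpd_frame i j eta : let t := eta * mu in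
  hpd F i j z eta = frm i j (t * al * be + cj (t * al * be)) (t * al ^+ 2 + cj (t * be ^+ 2))
    (t * al * be + cj (t * al * be)) z.
Proof.
move=> t; rewrite /hpd !D0 !D1 /frm /t.
move: (F z i 0) (F z i 1) (F z j 0) (F z j 1) => p q p' q'.
by rewrite !(cjD, cjM, cjK, cjX, cjN) ; ring.
Qed.

(** Congruence by F is invertible; the two combinations in the proof are entries of the inverse
    congruence. *)
Lemma frm_eq0 n00 n01 : cj n00 = n00 -> frm 0 0 n00 n01 n00 z = 0 -> frm 0 1 n00 n01 n00 z = 0 ->
  frm 1 1 n00 n01 n00 z = 0 -> n00 = 0 /\ n01 = 0.
Proof.
move=> r0; rewrite /frm; move: detF.
move: (F z 0 0) (F z 0 1) (F z 1 0) (F z 1 1) => p q p' q' dF H00 H01 H11.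
have E1 : p * q' = 1 + q * p' by rewrite -dF subrK.
have E2 : cj p * cj q' = 1 + cj q * cj p' by rewrite -!cjM E1 cjD cj1.
pose X00 := p * cj p * n00 + p * cj q * n01 + q * cj p * cj n01 + q * cj q * n00.
pose X01 := p * cj p' * n00 + p * cj q' * n01 + q * cj p' * cj n01 + q * cj q' * n00.
pose X11 := p' * cj p' * n00 + p' * cj q' * n01 + q' * cj p' * cj n01 + q' * cj q' * n00.
have c01 : cj X01 = cj p * p' * n00 + cj p * q' * cj n01 + cj q * p' * n01 + cj q * q' * n00.
  by rewrite /X01 !(cjD, cjM, cjK) r0.
have Z0 : cj X01 = 0 by rewrite /X01 H01 /cj conjc0.
split.
  transitivity (q' * cj q' * X00 - q' * cj q * X01 - q * cj q' * cj X01 + q * cj q * X11).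
    by rewrite c01 /X00 /X01 /X11; ring: E1 E2.
  by rewrite Z0 /X00 /X01 /X11 H00 H01 H11 !mulr0 !subr0 addr0.
transitivity (- (q' * cj p') * X00 + q' * cj p * X01 + q * cj p' * cj X01 - q * cj p * X11).
  by rewrite c01 /X00 /X01 /X11; ring: E1 E2.
by rewrite Z0 /X00 /X01 /X11 H00 H01 H11 !mulr0 !addr0 subr0.
Qed.

Lemma hcoord_eq0 (x00 x01 x11 : C) : cj x00 = x00 -> cj x11 = x11 ->
  hcoord x00 x01 x11 = 0 -> [/\ x00 = 0, x01 = 0 & x11 = 0].
Proof.
move=> r0 r1 /rowP H; have := H 0; have := H 1; have := H 2; have := H 3; rewrite !mxE /=.
clear H; move: r0 r1; rewrite /cj; case: x00 x01 x11 => [p p'] [q q'] [s s'] /=.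
move=> /eqP; rewrite eq_complex /= eqxx /= => /eqP p0 /eqP; rewrite eq_complex /= eqxx /= => /eqP s0.
by move=> h3 -> -> h0; split=> //; congr Complex; lra.
Qed.

Lemma hcoord0 : hcoord 0 0 0 = 0.
Proof. by apply/rowP => j; rewrite !mxE; case: j => [[|[|[|[|//]]]]] j4 //=; rewrite ?addr0 ?subr0 mul0r. Qed.

Lemma norm_cj (w : C) : w * cj w = (normc (w : R[i]) ^+ 2)%:C%C.
Proof.
case: w => s t; rewrite /cj /= sqr_sqrtr ?addr_ge0 ?sqr_ge0 //.
by apply/eqP; rewrite eq_complex /=; apply/andP; split; apply/eqP; ring.
Qed.

(** With t = eta mu, the direction eta is annihilated exactly when t al be is imaginary and t al^2 =
    - conj(t be^2). The second equation forces |al| = |be|. *)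
Lemma singular_iff : mu != 0 -> al != 0 \/ be != 0 ->
  singular_point (cmc1_face F) (ofC z) <-> al * cj al = be * cj be.
Proof.
move=> mu0 ab0; have Pz : prec O (ofC z) by rewrite /prec /= toC_ofC.
rewrite (singular_pointP (erefl _) oP Pz (fun j => @ssmooth_face j 1)).
split=> [[v v0]|E].
  have Oz' : O (toC (ofC z)) by rewrite toC_ofC.
  rewrite (face_derive v Oz') toC_ofC => /(hcoord_eq0 (hpd_real _ _ _ _) (hpd_real _ _ _ _))[].
  rewrite !hpd_frame; set t := toC v * mu => H00 H01 H11.
  have r0 : cj (t * al * be + cj (t * al * be)) = t * al * be + cj (t * al * be).
    by rewrite cjD cjK addrC.
  have [_ n01] := frm_eq0 r0 H00 H01 H11.
  have t0 : t != 0.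
    rewrite mulf_neq0 //; apply: contraNneq v0 => H.
    by rewrite -[v]ofC_toC H; apply/eqP/rowP => j; rewrite !mxE /=; case: ifP.
  have : normc (t * al ^+ 2 : R[i]) = normc (t * be ^+ 2 : R[i]).
    have -> : t * al ^+ 2 = - cj (t * be ^+ 2) by apply/eqP; rewrite -addr_eq0 n01.
    by rewrite normcN /cj; case: (t * be ^+ 2) => s s' /=; rewrite sqrrN.
  have nt : normc (t : R[i]) != 0 by rewrite normc_eq0.
  rewrite (Normc.normcM t (al ^+ 2)) (Normc.normcM t (be ^+ 2)) => /(mulfI nt).
  by rewrite !expr2 !Normc.normcM -!expr2 !norm_cj => ->.
have [al0 be0] : al != 0 /\ be != 0.
  have E' : (al == 0) = (be == 0).
    have H (w : C) : (w == 0) = (w * cj w == 0) by rewrite mulf_eq0 cj_eq0 orbb.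
    by rewrite H E -H.
  by move: ab0; rewrite E'; case: (be == 0) => -[].
(* This t makes t al be equal to i |al|^2 |be|^2, and t al^2 + conj(t be^2) a multiple of |al|^2 -
   |be|^2. *)
pose t := i_ * cj al * cj be; have t0 : t != 0 by rewrite !mulf_neq0 ?cj_eq0 // i_neq0.
exists (ofC (t / mu)).
  apply/eqP => H; have : toC (ofC (t / mu)) = 0 by rewrite H /toC !mxE.
  by rewrite toC_ofC => /eqP; rewrite mulf_eq0 invr_eq0 (negbTE t0) (negbTE mu0).
rewrite (face_derive (ofC (t / mu)) (_ : O (toC (ofC z)))) ?toC_ofC // !hpd_frame divfK //.
have ci := cj_i.
have n00 : t * al * be + cj (t * al * be) = 0.
  by rewrite /t !(cjM, cjK) ci; ring.
have n01 : t * al ^+ 2 + cj (t * be ^+ 2) = 0.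
  rewrite /t !(cjM, cjK, cjX) ci.
  transitivity (i_ * al * cj be * (al * cj al - be * cj be)); first by ring.
  by rewrite E subrr mulr0.
rewrite n00 n01 /frm (_ : cj 0 = 0) ?mulr0 ?addr0 ?hcoord0 //.
by rewrite /cj conjc0.
Qed.

End point.

End face_calculus.

(** * The frame near regular points and near poles *)

Lemma is_derive_entry (F : C -> 'M[C]_2) (z : C) i j : derivable F z 1 ->
  is_derive z 1 (fun z => F z i j : C) ('D_1 F z i j).
Proof.
move=> dF; apply/is_deriveCP.
have H : (fun h : C => h^-1 *: (F (h *: 1 + z) - F z)) @ 0^' --> 'D_1 F z := dF.
have cc : {for 'D_1 F z, continuous (fun M : 'M[C]_2 => M i j : C)} := @coord_continuous _ _ _ i j _.
have := cvg_comp _ _ H cc.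
have -> : (fun M : 'M[C]_2 => M i j : C) \o (fun h : C => h^-1 *: (F (h *: 1 + z) - F z)) =
  (fun h : C => h^-1 * (F (h + z) i j - F z i j)).
  by apply/funext => h /=; rewrite !mxE [h *: 1]mulr1.
exact.
Qed.

(** By the mean value theorem on [0, t], the difference quotient at 0 is a value of [psi] at an
    arbitrarily small argument. *)
Lemma real_removable (f psi : R -> R) (d r : R) : 0 < r -> is_derive (0 : R) 1 f d ->
  (forall t, 0 < t < r -> is_derive t 1 f (psi t)) -> {for 0, continuous psi} -> d = psi 0.
Proof.
move=> r0 df dpsi cpsi; apply/eqP; rewrite -subr_eq0 -normr_le0 leNgt; apply/negP => e2.
have e0 : 0 < `|d - psi 0| / 2 by rewrite divr_gt0.
have cf : {for 0, continuous f} by apply: differentiable_continuous; apply/derivable1_diffP; case: df.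
have /cvgrPdist_lt/(_ _ e0) := (is_deriveP _ _ _ _).1 df.
rewrite /dnbhs /within /= => /nbhs_ballP[s /= s0 Hs].
have /(cvgrPdist_lt (FF := nbhs_filter _))/(_ _ e0)/nbhs_ballP[s' /= s'0 Hs'] := cpsi.
pose t := Num.min (r / 2) (Num.min (s / 2) (s' / 2)).
have t0 : 0 < t by rewrite !lt_min !divr_gt0.
have tr : t < r by rewrite gt_min half_lt.
have ts : t < s by rewrite !gt_min half_lt // orbT.
have ts' : t < s' by rewrite !gt_min (half_lt s'0) !orbT.
have cc : {within `[0, t], continuous f}.
  apply: continuous_in_subspaceT => x; rewrite inE /= in_itv /= => /andP[x0 xt].
  move: x0; rewrite le_eqVlt => /orP[/eqP <-|x0]; first exact: cf.
  have xr : 0 < x < r by rewrite x0 (le_lt_trans xt).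
  by apply: differentiable_continuous; apply/derivable1_diffP; case: (dpsi x xr).
have dd x : x \in `]0, t[%R -> is_derive x 1 f (psi x).
  by rewrite in_itv /= => /andP[x0 xt]; apply: dpsi; rewrite x0 (lt_trans xt).
have [c ct E] := MVT t0 dd cc.
move: ct; rewrite in_itv /= => /andP[c0 ct].
have B1 : `|d - psi c| < `|d - psi 0| / 2.
  have := Hs t; rewrite -ball_normE /= sub0r normrN gtr0_norm // => /(_ ts (lt0r_neq0 t0)).
  by rewrite [t *: 1]mulr1 addr0 E subr0 [_ *: _]mulrC mulfK // gt_eqF.
have B2 : `|psi 0 - psi c| < `|d - psi 0| / 2.
  by apply: Hs'; rewrite -ball_normE /= sub0r normrN gtr0_norm // (lt_trans ct).
have := ler_normB (d - psi c) (psi 0 - psi c).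
rewrite (_ : d - psi c - (psi 0 - psi c) = d - psi 0); last by ring.
by rewrite leNgt => /negP; apply; rewrite [X in _ < X]splitr ltrD.
Qed.

(** Since f is complex differentiable at [q] too, it suffices to test along the real ray from [q].
    This reads the frame equation at a pole from its values nearby. *)
Lemma removable_derivative (f E : C -> C) (q : C) (r : R) : 0 < r ->
  (forall w, disc q r w -> derivable f w 1) -> {for q, continuous E} ->
  (forall w, disc q r w -> w != q -> 'D_1 f w = E w) -> 'D_1 f q = E q.
Proof.
move=> r0 df cE dE.
have Dt (t : R) : `|t| < r -> disc q r (q + t%:C%C).
  by move=> tr; rewrite /disc /= addrC addKr normc_real.
have dt (t : R) : `|t| < r -> cder (fun t : R => f (q + t%:C%C)) t 1 ('D_1 f (q + t%:C%C)).
  move=> tr; have H := cderD (cder_cst q t 1) (cder_real t).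
  have := chain_rule (derivableP (df _ (Dt t tr))) H (cder_continuous H).
  by rewrite add0r mulr1.
have o : `|0 : R| < r by rewrite normr0.
have q0 : q + 0%:C%C = q by rewrite [0%:C%C](_ : _ = 0 :> C) // addr0.
have E0 : forall t : R, 0 < t < r -> 'D_1 f (q + t%:C%C) = E (q + t%:C%C).
  move=> t /andP[t0 tr]; apply: dE; first by apply: Dt; rewrite gtr0_norm.
  by rewrite -subr_eq0 addrC addKr eq_complex /= negb_and gt_eqF.
have cq : {for 0, continuous (fun t : R => E (q + t%:C%C))}.
  apply: (ccont_comp (f := E)); first by rewrite q0.
  by apply: ccontD; [exact: ccont_cst|exact: real_complex_continuous].
have [H0 H1] := dt 0 o; rewrite q0 in H0 H1.
have [cR cI] := (continuous_complexP _ _).1 cq.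
have dE' (t : R) : 0 < t < r -> cder (fun t : R => f (q + t%:C%C)) t 1 (E (q + t%:C%C)).
  by move=> tr; have := E0 t tr; case/andP: tr => t0 tr <-; apply: dt; rewrite gtr0_norm.
have e1 := real_removable r0 H0 (fun t tr => (dE' t tr).1) cR.
have e2 := real_removable r0 H1 (fun t tr => (dE' t tr).2) cI.
by apply/eqP; rewrite eq_complex e1 e2 q0 !eqxx.
Qed.

Lemma is_derive_continuousC (f : C -> C) (z d : C) : is_derive z 1 f d -> {for z, continuous f}.
Proof. by move=> [df _]; exact: derivable_continuousC. Qed.

Lemma punctured_disc (D P : set C) (z : C) : open D -> D z -> (\forall w \near z^', ~ P w) ->
  exists2 r, 0 < r & forall w, disc z r w -> D w /\ (w != z -> ~ P w).
Proof.
move=> oD Dz nP; have nD : nbhs z D by apply: open_nbhs_nbhs.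
have nP' : nbhs z [set w | w != z -> ~ P w] by exact: nP.
have [r r0 rE] := nbhs_disc (filterI nD nP').
by exists r => // w /rE[].
Qed.

Section frame_derivative.
Variables (F : C -> 'M[C]_2) (z mu al be : C).
Hypotheses (dF : derivable F z 1) (detF : \det (F z) = 1).

Lemma frame_derivative (A : 'M[C]_2) : invmx (F z) *m 'D_1 F z = A ->
  forall i j, 'D_1 F z i j = F z i 0 * A 0 j + F z i 1 * A 1 j.
Proof.
move=> AE i j; have u : F z \in unitmx by rewrite unitmxE detF unitr1.
have -> : 'D_1 F z = F z *m A by rewrite -AE mulKVmx.
rewrite mxE !big_ord_recl big_ord0 addr0.
by have -> : lift ord0 ord0 = 1 :> 'I_2 by exact/val_inj.
Qed.

End frame_derivative.

Definition frame_data (O : set C) (g h : C -> C) (F : C -> 'M[C]_2) :=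
  [/\ chol O g, chol O h, (forall i j, chol O (fun z => F z i j : C)), (forall z, O z -> h z != 0) &
  [/\ forall z, O z -> F z 0 0 * F z 1 1 - F z 0 1 * F z 1 0 = 1,
   (forall z i, O z -> 'D_1 (fun z => F z i 0 : C) z = h z * (F z i 0 * g z + F z i 1)) &
   (forall z i, O z -> 'D_1 (fun z => F z i 1 : C) z = - g z * (h z * (F z i 0 * g z + F z i 1)))]].

(** The data provide complex differentiability, not [chol]. The frame equation makes F' continuous,
    so F and then F' are [chol]; as det F = 1, both h and g h are polynomials in the entries of F
    and F', which upgrades h and g. *)
Lemma frame_at D P g h F z : cmc1_data D P g h F -> D z -> ~ P z ->
  exists2 r, 0 < r & [/\ disc z r `<=` D, (forall w, disc z r w -> ~ P w) & frame_data (disc z r) g h F].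
Proof.
move=> [[oD _] [PD Pd gd _] [hd hpos _] _ [Fd Fe]] Dz Pz.
have [r r0 rE] := punctured_disc oD Dz (Pd z Dz).
have rP w : disc z r w -> ~ P w.
  by move=> wr; have [->|wz] := eqVneq w z; [|exact: (rE w wr).2].
have rD w : disc z r w -> D w by case/rE.
exists r => //; split; [exact: rD|exact: rP|].
pose O := disc z r; have oO : open O := @disc_open R z r.
have cg w : O w -> {for w, continuous g} by move=> Ow; apply: derivable_continuousC; exact: gd (rD w Ow) (rP w Ow).
have ch w : O w -> {for w, continuous h} by move=> Ow; apply: derivable_continuousC; exact: hd (rD w Ow).
have dE w i j : O w -> is_derive w 1 (fun z => F z i j : C) ('D_1 F w i j).
  by move=> Ow; apply: is_derive_entry; exact: (Fd w (rD w Ow)).1.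
have cF w i j : O w -> {for w, continuous (fun z => F z i j : C)}.
  by move=> Ow; exact: is_derive_continuousC (dE w i j Ow).
have det w : O w -> F w 0 0 * F w 1 1 - F w 0 1 * F w 1 0 = 1.
  by move=> Ow; rewrite -det_M2; exact: (Fd w (rD w Ow)).2.
have E w i j : O w -> 'D_1 F w i j = F w i 0 * (h w *: mx2 (g w) (- g w ^+ 2) 1 (- g w)) 0 j +
   F w i 1 * (h w *: mx2 (g w) (- g w ^+ 2) 1 (- g w)) 1 j.
  move=> Ow; have [dw ew] := Fd w (rD w Ow).
  exact: (frame_derivative ew (Fe w (rD w Ow) (rP w Ow))).
have E0 w i : O w -> 'D_1 F w i 0 = h w * (F w i 0 * g w + F w i 1).
  by move=> Ow; rewrite E // !mxE /=; ring.
have E1 w i : O w -> 'D_1 F w i 1 = - g w * (h w * (F w i 0 * g w + F w i 1)).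
  by move=> Ow; rewrite E // !mxE /=; ring.
have hF i j : chol O (fun z => F z i j : C).
  have [->|->] : j = 0 \/ j = 1.
    by case: j => [[|[|//]]] j2; [left|right]; exact/val_inj.
    apply: (chol_intro oO (fun w Ow => is_derive_eqC (dE w i 0 Ow) (E0 w i Ow))) => w Ow.
    apply: ccontM; first exact: ch.
    by apply: ccontD; [apply: ccontM; [exact: cF|exact: cg]|exact: cF].
  apply: (chol_intro oO (fun w Ow => is_derive_eqC (dE w i 1 Ow) (E1 w i Ow))) => w Ow.
  apply: ccontM; first by apply: (@continuousN C); exact: cg.
  apply: ccontM; first exact: ch.
  by apply: ccontD; [apply: ccontM; [exact: cF|exact: cg]|exact: cF].
have h0 w : O w -> h w != 0.
  move=> Ow; have := hpos w (rD w Ow) (rP w Ow).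
  by apply: contraTneq => ->; rewrite normr0 expr0n mulr0 ltxx.
have D0 w i : O w -> 'D_1 (fun z => F z i 0 : C) w = h w * (F w i 0 * g w + F w i 1).
  by move=> Ow; have [_ ->] := dE w i 0 Ow; exact: E0.
have D1 w i : O w -> 'D_1 (fun z => F z i 1 : C) w = - g w * (h w * (F w i 0 * g w + F w i 1)).
  by move=> Ow; have [_ ->] := dE w i 1 Ow; exact: E1.
have hF' i j := chol_derive oO (hF i j).
have hh : chol O h.
  apply: (chol_ext oO _ (cholD oO (cholM oO (hF 0 0) (hF' 1 0)) (cholM oO (chol_cst (-1) oO) (cholM oO (hF 1 0) (hF' 0 0))))).
  move=> w Ow; rewrite (D0 w 0 Ow) (D0 w 1 Ow).
  by transitivity (h w * (F w 0 0 * F w 1 1 - F w 0 1 * F w 1 0)); [ring|rewrite det // mulr1].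
have hgh : chol O (fun w => g w * h w).
  apply: (chol_ext oO _ (cholD oO (cholM oO (hF 1 1) (hF' 0 0)) (cholM oO (chol_cst (-1) oO) (cholM oO (hF 0 1) (hF' 1 0))))).
  move=> w Ow; rewrite (D0 w 0 Ow) (D0 w 1 Ow).
  by transitivity (g w * h w * (F w 0 0 * F w 1 1 - F w 0 1 * F w 1 0)); [ring|rewrite det // mulr1].
have hg : chol O g.
  apply: (chol_ext oO _ (cholM oO hgh (cholV oO h0 hh))) => w Ow.
  by rewrite mulfK // h0.
exact: (And5 hg hh hF h0 (And3 det D0 D1)).
Qed.

(** With k = 1/g and m = g^2 h the frame equation extends over the pole in the homogeneous form (1,
    k); there k = 0, so the two moduli differ. *)
Lemma nonsingular_pole D P g h F (q : C) : cmc1_data D P g h F -> P q -> ~ singular_point (cmc1_face F) (ofC q).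
Proof.
move=> [[oD _] [PD Pd gd gP] [hd hpos hP] _ [Fd Fe]] Pq.
have [U [k [[oU Uq] UD dk k0 kE]]] := gP q Pq.
have [U' [m [oU' U'q dm m0 mE]]] := hP q Pq.
have [r r0 rE] := punctured_disc (openI (openI oD oU) oU') (conj (conj (PD q Pq) Uq) U'q) (Pd q (PD q Pq)).
pose O := disc q r; have oO : open O := @disc_open R q r.
have Oq : O q by exact: disc_center.
have OD w : O w -> D w by case/rE => -[[]].
have OU w : O w -> U w by case/rE => -[[]].
have OU' w : O w -> U' w by case/rE => -[[]].
have ck w : O w -> {for w, continuous k} by move=> Ow; apply: derivable_continuousC; exact: dk (OU w Ow).
have cm w : O w -> {for w, continuous m} by move=> Ow; apply: derivable_continuousC; exact: dm (OU' w Ow).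
have dE w i j : O w -> is_derive w 1 (fun z => F z i j : C) ('D_1 F w i j).
  by move=> Ow; apply: is_derive_entry; exact: (Fd w (OD w Ow)).1.
have cF w i j : O w -> {for w, continuous (fun z => F z i j : C)}.
  by move=> Ow; exact: is_derive_continuousC (dE w i j Ow).
have E w i j : O w -> w != q -> 'D_1 F w i j = F w i 0 * (h w *: mx2 (g w) (- g w ^+ 2) 1 (- g w)) 0 j +
   F w i 1 * (h w *: mx2 (g w) (- g w ^+ 2) 1 (- g w)) 1 j.
  move=> Ow wq; have [dw ew] := Fd w (OD w Ow).
  exact: (frame_derivative ew (Fe w (OD w Ow) ((rE w Ow).2 wq))).
pose E0 i w := m w * (F w i 0 * k w + F w i 1 * k w ^+ 2).
pose E1 i w := - (m w * (F w i 0 + F w i 1 * k w)).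
have cE0 w i : O w -> {for w, continuous (E0 i)}.
  move=> Ow; apply: ccontM; first exact: cm.
  apply: ccontD; apply: ccontM; try exact: cF; first exact: ck.
  by apply: ccontX; exact: ck.
have cE1 w i : O w -> {for w, continuous (E1 i)}.
  move=> Ow; apply: (@continuousN C); apply: ccontM; first exact: cm.
  apply: ccontD; first exact: cF.
  by apply: ccontM; [exact: cF|exact: ck].
have D0 w i : O w -> 'D_1 (fun z => F z i 0 : C) w = E0 i w.
  move=> Ow; have H v : O v -> v != q -> 'D_1 (fun z => F z i 0 : C) v = E0 i v.
    move=> Ov vq; have [_ ->] := dE v i 0 Ov; rewrite (E v i 0 Ov vq) !mxE /= /E0.
    have [g0 kg] := kE v (OU v Ov) vq; rewrite kg (mE v (OU' v Ov) vq).
    by field; rewrite g0.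
  have [->|wq] := eqVneq w q; last exact: H.
  apply: (removable_derivative r0 _ (cE0 q i Oq) H) => v Ov.
  by have [] := dE v i 0 Ov.
have D1 w i : O w -> 'D_1 (fun z => F z i 1 : C) w = E1 i w.
  move=> Ow; have H v : O v -> v != q -> 'D_1 (fun z => F z i 1 : C) v = E1 i v.
    move=> Ov vq; have [_ ->] := dE v i 1 Ov; rewrite (E v i 1 Ov vq) !mxE /= /E1.
    have [g0 kg] := kE v (OU v Ov) vq; rewrite kg (mE v (OU' v Ov) vq).
    by field; rewrite g0.
  have [->|wq] := eqVneq w q; last exact: H.
  apply: (removable_derivative r0 _ (cE1 q i Oq) H) => v Ov.
  by have [] := dE v i 1 Ov.
have hF i j : chol O (fun z => F z i j : C).
  have [->|->] : j = 0 \/ j = 1.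
    by case: j => [[|[|//]]] j2; [left|right]; exact/val_inj.
    apply: (chol_intro oO (fun w Ow => is_derive_eqC (dE w i 0 Ow) _) (fun w Ow => cE0 w i Ow)) => w Ow.
    by have [_ <-] := dE w i 0 Ow; exact: D0.
  apply: (chol_intro oO (fun w Ow => is_derive_eqC (dE w i 1 Ow) _) (fun w Ow => cE1 w i Ow)) => w Ow.
  by have [_ <-] := dE w i 1 Ow; exact: D1.
have det : F q 0 0 * F q 1 1 - F q 0 1 * F q 1 0 = 1.
  by rewrite -det_M2; exact: (Fd q (OD q Oq)).2.
have := @singular_iff O F oO hF q (m q) 1 0 Oq det _ _ m0 (or_introl (oner_neq0 _)).
move=> H; apply/(H _ _) => [i|i|].
- by rewrite (D0 q i Oq) /E0 k0; ring.
- by rewrite (D1 q i Oq) /E1 k0; ring.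
by rewrite cj1 mulr1 mul0r => /eqP; rewrite oner_eq0.
Qed.

Lemma singular_at D P g h F (z : C) : cmc1_data D P g h F -> D z -> ~ P z ->
  singular_point (cmc1_face F) (ofC z) <-> g z * cj (g z) = 1.
Proof.
move=> data Dz Pz; have [r r0 [_ _ [hg hh hF h0 [det D0 D1]]]] := frame_at data Dz Pz.
have Oz := disc_center z r0.
have H0 i : 'D_1 (fun z => F z i 0 : C) z = h z * (F z i 0 * (g z * 1) + F z i 1 * 1 ^+ 2).
  by rewrite (D0 z i Oz); ring.
have H1 i : 'D_1 (fun z => F z i 1 : C) z = - (h z * (F z i 0 * g z ^+ 2 + F z i 1 * (g z * 1))).
  by rewrite (D1 z i Oz); ring.
have := singular_iff (@disc_open R z r) hF Oz (det z Oz) H0 H1 (h0 z Oz) (or_intror (oner_neq0 _)).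
by rewrite cj1 mulr1.
Qed.

End face_geometry.

(** * Necessity *)

Section edge_necessity.
Context {R : realType}.
Local Notation C := (Cplx R).
Local Notation Re := complex.Re.
Local Notation Im := complex.Im.

Lemma is_derive_row (V : normedModType R) n (f : V -> 'rV[R]_n) (x v : V) (d : 'rV[R]_n) :
  (forall j, is_derive x v (fun y => f y 0 j) (d 0 j)) -> is_derive x v f d.
Proof.
move=> H; have df : derivable f x v.
  by apply/derivable_mxP => i j; rewrite ord1; case: (H j).
apply: DeriveDef => //; rewrite derive_mx //; apply/rowP => j; rewrite mxE.
by have [_ ->] := H j.
Qed.

Lemma is_derive_rowP (V : normedModType R) n (f : V -> 'rV[R]_n) (x v : V) (d : 'rV[R]_n) j :
  is_derive x v f d -> is_derive x v (fun y => f y 0 j) (d 0 j).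
Proof.
move=> [df <-]; have [dj _] : derivable (fun y => f y 0 j) x v /\ True.
  by split=> //; move/derivable_mxP : df => /(_ 0 j).
by apply: DeriveDef => //; rewrite derive_mx // mxE.
Qed.

Lemma chain_rV (V : normedModType R) n m (U : set 'rV[R]_n) (f : 'rV[R]_n -> 'rV[R]_m)
    (psi : V -> 'rV[R]_n) (t v : V) (d : 'rV[R]_n) : open U ->
  (forall j, sCk 1 U (fun y => f y 0 j)) -> U (psi t) -> is_derive t v psi d ->
  is_derive t v (fun s => f (psi s)) ('D_d f (psi t)).
Proof.
move=> oU Cf Ut [dpsi dE]; apply: is_derive_row => j.
have df : derivable f (psi t) d by apply: diff_derivable; exact: C1_differentiable oU Cf Ut.
have [H1 H2] := C1_comp_derive oU (Cf j) Ut dpsi.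
apply: DeriveDef; first exact: H1.
have -> : 'D_d f (psi t) 0 j = 'D_d (fun y => f y 0 j) (psi t) by rewrite derive_mx // mxE.
by rewrite [LHS]H2 (C1_derive d oU (Cf j) Ut) dE.
Qed.

Lemma is_derive_id_rV n (x v : 'rV[R]_n) : is_derive x v (fun y : 'rV[R]_n => y) v.
Proof. by apply: is_derive_row => j; exact: is_derive_coord. Qed.

(** Differentiate g(f(y)) = y in the direction v. It serves both the source diffeomorphism and the
    parametrization of the target. *)
Lemma immersion_left_inverse n m (U : set 'rV[R]_n) (V : set 'rV[R]_m)
    (f : 'rV[R]_n -> 'rV[R]_m) (g : 'rV[R]_m -> 'rV[R]_n) (x v : 'rV[R]_n) :
  open U -> open V -> U x -> (forall j, sCk 1 U (fun y => f y 0 j)) -> (forall j, sCk 1 V (fun y => g y 0 j)) ->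
  (forall y, U y -> V (f y) /\ g (f y) = y) -> 'D_v f x = 0 -> v = 0.
Proof.
move=> oU oV Ux Cf Cg fg df0.
have df := C1_differentiable oU Cf Ux.
have H : is_derive x v f 0 by apply: DeriveDef => //; exact: diff_derivable.
have H2 := chain_rV oV Cg (fg x Ux).1 H.
have E : \forall y \near x, (fun y => g (f y)) y = (fun y => y) y.
  by apply: open_near oU Ux _ => y /fg[].
have [_ E1] := near_eq_is_derive E H2; have [_ E2] := is_derive_id_rV x v.
rewrite E1 in E2; rewrite -E2 deriveE; first exact: linear0.
exact: C1_differentiable oV Cg (fg x Ux).1.
Qed.

Definition pt (t v : R) : 'rV[R]_2 := \row_(j < 2) (if val j == 0%N then t else v).

Lemma pt0 t v : pt t v 0 0 = t. Proof. by rewrite mxE. Qed.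
Lemma pt1 t v : pt t v 0 1 = v. Proof. by rewrite mxE. Qed.

Lemma pt_eta (w : 'rV[R]_2) : pt (w 0 0) (w 0 1) = w.
Proof.
by apply/rowP => j; rewrite mxE; case: j => [[|[|//]]] j2 /=; congr (w _ _); exact/val_inj.
Qed.

Lemma pt_norm t v d : 0 < d -> `|t| < d -> `|v| < d -> `|pt t v| < d.
Proof.
by move=> d0 td vd; apply: row_norm_lt => // j; rewrite mxE; case: ifP.
Qed.

Lemma is_derive_pt0 (t v : R) : is_derive t 1 (pt ^~ v) (delta_mx 0 0 : 'rV[R]_2).
Proof.
apply: is_derive_row => j; rewrite mxE /=.
case: j => [[|[|//]]] j2 /=.
  rewrite (_ : (fun _ => _) = (fun s => s)); first exact: is_derive_id.
  by apply/funext => s; rewrite mxE.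
rewrite (_ : (fun _ => _) = (fun=> v)); first exact: is_derive_cst.
by apply/funext => s; rewrite mxE.
Qed.

Lemma is_derive_pt1 (t v : R) : is_derive v 1 (pt t) (delta_mx 0 1 : 'rV[R]_2).
Proof.
apply: is_derive_row => j; rewrite mxE /=.
case: j => [[|[|//]]] j2 /=.
  rewrite (_ : (fun _ => _) = (fun=> t)); first exact: is_derive_cst.
  by apply/funext => s; rewrite mxE.
rewrite (_ : (fun _ => _) = (fun s => s)); first exact: is_derive_id.
by apply/funext => s; rewrite mxE.
Qed.

Definition dcusp (w x : 'rV[R]_2) : 'rV[R]_3 :=
  \row_(j < 3) (match val j with
                | 0%N => x 0 0
                | 1%N => 2%:R * w 0 1 * x 0 1
                | _ => 5%:R * w 0 1 ^+ 4 * x 0 1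
                end).

Lemma is_derive_cusp52 w x : is_derive w x (@cusp52 R) (dcusp w x).
Proof.
have H0 := is_derive_coord w x 0; have H1 := is_derive_coord w x 1.
apply: is_derive_row => j; rewrite mxE; case: j => [[|[|[|//]]]] j3 /=.
- by rewrite (_ : (fun _ => _) = (fun y : 'rV[R]_2 => y 0 0)) //; apply/funext => y; rewrite mxE.
- rewrite (_ : (fun _ => _) = (fun y : 'rV[R]_2 => y 0 1 * y 0 1)); last first.
    by apply/funext => y; rewrite mxE expr2.
  by apply: is_derive_eq (is_deriveM H1 H1) _; rewrite /GRing.scale /=; ring.
- rewrite (_ : (fun _ => _) = (fun y : 'rV[R]_2 => y 0 1 * (y 0 1 * (y 0 1 * (y 0 1 * y 0 1))))); last first.
    by apply/funext => y; rewrite mxE /=; ring.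
  apply: is_derive_eq (is_deriveM H1 (is_deriveM H1 (is_deriveM H1 (is_deriveM H1 H1)))) _.
  by rewrite !fctE /GRing.scale /=; ring.
Qed.

Lemma Ck_curve_ext m k (I : set R) (c1 c2 : R -> 'rV[R]_m) : open I -> (forall t, I t -> c1 t = c2 t) ->
  Ck_curve k I c1 -> Ck_curve k I c2.
Proof.
move=> oI; elim: k c1 c2 => [|k IH] c1 c2 E /=.
  by move=> H t It; exact: continuous_ext oI It E (H t It).
move=> [H1 [H2 H3]]; have D t : I t -> is_derive t 1 c2 ('D_1 c1 t).
  by move=> It; exact: near_eq_is_derive (open_near oI It E) (derivableP (H2 t It)).
split; first by move=> t It; exact: continuous_ext oI It E (H1 t It).
split; first by move=> t It; case: (D t It).
by apply: (IH ('D_1 c1)) H3 => t It; case: (D t It).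
Qed.

Lemma smooth_curve_pt m (U : set 'rV[R]_2) (psi : 'rV[R]_2 -> 'rV[R]_m) (I : set R) v : open U -> open I ->
  (forall t, I t -> U (pt t v)) -> smooth_on U psi -> smooth_curve I (fun t => psi (pt t v)).
Proof.
move=> oU oI IU Cpsi k; elim: k psi Cpsi => [|k IH] psi Cpsi.
  move=> t It; apply: (@continuous_comp _ _ _ (pt ^~ v) psi).
    by apply: differentiable_continuous; apply/derivable1_diffP; case: (is_derive_pt0 t v).
  exact: (Cpsi 0%N (pt t v) (IU t It)).
have Cj := (smoothP psi oU).1 Cpsi.
have D t : I t -> is_derive t 1 (fun t => psi (pt t v)) ('D_(delta_mx 0 0) psi (pt t v)).
  by move=> It; exact: (chain_rV (f := psi) (psi := pt ^~ v) oU (fun j => Cj j 1%N) (IU t It) (is_derive_pt0 t v)).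
split.
  by move=> t It; apply: differentiable_continuous; apply/derivable1_diffP; case: (D t It).
split; first by move=> t It; case: (D t It).
apply: (@Ck_curve_ext _ _ _ (fun t => 'D_(delta_mx 0 0) psi (pt t v)) _ oI) => [t It|].
  by have [_ ->] := D t It.
by apply: (IH ('D_(delta_mx 0 0) psi)) => k'; exact: (((Cpsi k'.+1).2 0).2).
Qed.

Lemma near_derive (V W : normedModType R) (O : set V) (f g : V -> W) (x v : V) (d : W) : open O -> O x ->
  (forall y, O y -> f y = g y) -> is_derive x v f d -> is_derive x v g d.
Proof. by move=> oO Ox fg; apply: near_eq_is_derive; exact: open_near oO Ox fg. Qed.

Lemma hcoord_inv (x00 x01 x11 : C) : cj x00 = x00 -> cj x11 = x11 ->
  let k := hcoord x00 x01 x11 in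
  [/\ x00 = (k 0 0 + k 0 3)%:C%C, x01 = Complex (k 0 1) (k 0 2) & x11 = (k 0 0 - k 0 3)%:C%C].
Proof.
rewrite /cj; case: x00 x01 x11 => [p p'] [q q'] [s s'] /=.
move=> /eqP; rewrite eq_complex /= eqxx /= => /eqP p0 /eqP; rewrite eq_complex /= eqxx /= => /eqP s0.
by rewrite !mxE /=; split=> //; congr Complex; lra.
Qed.

Lemma ofC_continuous : continuous (@ofC R).
Proof.
move=> z; apply: (for_continuous_mxP (@ofC R) z).2 => i j.
case: j => [[|[|//]]] j2.
  rewrite (_ : (fun _ => _) = (fun z : C => Re (z : R[i]))); first exact: Re_continuous.
  by apply/funext => y; rewrite mxE.
rewrite (_ : (fun _ => _) = (fun z : C => Im (z : R[i]))); first exact: Im_continuous.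
by apply/funext => y; rewrite mxE.
Qed.

Lemma cder_toC_curve (V : normedModType R) (psi : V -> 'rV[R]_2) (x v : V) (q : 'rV[R]_2) :
  is_derive x v psi q -> cder (fun y => toC (psi y)) x v (toC q).
Proof. by move=> H; split; exact: is_derive_rowP H. Qed.

Lemma frame_hpd (O : set C) g h F i j z eta : frame_data O g h F -> O z -> let t := eta * h z in
  hpd F i j z eta = frm F i j (t * g z + cj (t * g z)) (t * g z ^+ 2 + cj t) (t * g z + cj (t * g z)) z.
Proof.
move=> [_ _ _ _ [_ D0 D1]] Oz.
have H0 i' : 'D_1 (fun z => F z i' 0 : C) z = h z * (F z i' 0 * (g z * 1) + F z i' 1 * 1 ^+ 2).
  by rewrite (D0 z i' Oz); ring.
have H1 i' : 'D_1 (fun z => F z i' 1 : C) z = - (h z * (F z i' 0 * g z ^+ 2 + F z i' 1 * (g z * 1))).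
  by rewrite (D1 z i' Oz); ring.
by rewrite (hpd_frame H0 H1) expr1n !mulr1.
Qed.

Lemma is_derive_cusp_pt (t : R) : is_derive (0 : R) 1 (fun v => cusp52 (pt t v)) 0.
Proof.
apply: is_derive_row => j; rewrite mxE; case: j => [[|[|[|//]]]] j3.
- rewrite (_ : (fun _ => _) = (fun=> t)); first exact: is_derive_cst.
  by apply/funext => v; rewrite !mxE.
- rewrite (_ : (fun _ => _) = (fun v => v * v)).
    by apply: is_derive_eq (is_deriveM (is_derive_id (0 : R) 1) (is_derive_id (0 : R) 1)) _; rewrite !scale0r addr0.
  by apply/funext => v; rewrite !mxE /= expr2.
- rewrite (_ : (fun _ => _) = (fun v => v * (v * (v * (v * v))))).
    pose I := is_derive_id (0 : R) 1.
    apply: is_derive_eq (is_deriveM I (is_deriveM I (is_deriveM I (is_deriveM I I)))) _.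
    by rewrite !fctE /GRing.scale /=; ring.
  by apply/funext => v; rewrite !mxE /=; ring.
Qed.

Section edge_germ.
Variables (D P : set C) (g h : C -> C) (F : C -> 'M[C]_2) (p : C).
Hypotheses (data : cmc1_data D P g h F) (Dp : D p) (Pp : ~ P p).
Let f := cmc1_face F.
Variables (r : R) (Us V : set 'rV[R]_2) (s sinv : 'rV[R]_2 -> 'rV[R]_2).
Hypothesis fd : frame_data (disc p r) g h F.
Hypotheses (discD : disc p r `<=` D) (discP : forall z, disc p r z -> ~ P z).
Hypotheses (oUs : open Us) (oV : open V) (Cs : smooth_on Us s) (Csinv : smooth_on V sinv).
Hypotheses (sK : forall x, Us x -> V (s x) /\ sinv (s x) = x)
  (sinvK : forall y, V y -> Us (sinv y) /\ s (sinv y) = y).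
Variables (Ut : set 'rV[R]_4) (Psi : 'rV[R]_4 -> 'rV[R]_3) (V' : set 'rV[R]_3) (Phi : 'rV[R]_3 -> 'rV[R]_4).
Hypotheses (oUt : open Ut) (oV' : open V') (CPsi : smooth_on Ut Psi) (CPhi : smooth_on V' Phi).
Hypothesis PhiK : forall y, V' y -> Ut (Phi y) /\ Psi (Phi y) = y.
Variable d : R.
Hypothesis d0 : 0 < d.
Hypothesis Wd : forall w, `|w| < d -> [/\ Us w, disc p r (toC (s w)), V' (cusp52 w) & f (s w) = Phi (cusp52 w)].

Let Cs1 j : sCk 1 Us (fun y => s y 0 j) := (smoothP s oUs).1 Cs j 1%N.
Let Csinv1 j : sCk 1 V (fun y => sinv y 0 j) := (smoothP sinv oV).1 Csinv j 1%N.
Let CPhi1 j : sCk 1 V' (fun y => Phi y 0 j) := (smoothP Phi oV').1 CPhi j 1%N.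
Let CPsi1 j : sCk 1 Ut (fun y => Psi y 0 j) := (smoothP Psi oUt).1 CPsi j 1%N.
Let oO : open (disc p r) := @disc_open R p r.
Let hF : forall i j, chol (disc p r) (fun z => F z i j : C). Proof. by case: fd. Qed.
Let Cf j : sCk 1 (prec (disc p r)) (fun y => f y 0 j) := ssmooth_face oO hF j 1.

Lemma s_immersion w v : Us w -> 'D_v s w = 0 -> v = 0.
Proof. by move=> Uw; exact: (immersion_left_inverse oUs oV Uw Cs1 Csinv1 sK). Qed.

Lemma Phi_immersion y v : V' y -> 'D_v Phi y = 0 -> v = 0.
Proof. by move=> Vy; exact: (immersion_left_inverse oV' oUt Vy CPhi1 CPsi1 PhiK). Qed.

Lemma face_s_derive w v : `|w| < d -> 'D_('D_v s w) f (s w) = 'D_(dcusp w v) Phi (cusp52 w).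
Proof.
move=> wd; have [Uw Ow Vw E] := Wd wd.
have ds := derivableP (diff_derivable (C1_differentiable oUs Cs1 Uw) (v := v)).
have H1 := chain_rV (f := f) (prec_open oO) Cf Ow ds.
have H2 := chain_rV (f := Phi) oV' CPhi1 Vw (is_derive_cusp52 w v).
have oB : open [set w : 'rV[R]_2 | `|w| < d].
  by apply: (@open_comp _ _ (fun w : 'rV[R]_2 => `|w|) [set x | x < d]); [move=> x _; exact: norm_continuous|exact: open_lt].
have WE y : `|y| < d -> f (s y) = Phi (cusp52 y) by case/Wd.
have [_ E1] := near_derive (g := fun w => Phi (cusp52 w)) oB wd WE H1.
by have [_ E2] := H2; rewrite -E1 -E2.
Qed.

(** Off v = 0 both (u, v^2, v^5) and [Phi] are immersions; on v = 0 the v-direction is annihilated.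
    The singular set is thus the image of the u-axis. *)
Lemma singular_s w : `|w| < d -> singular_point f (s w) <-> w 0 1 = 0.
Proof.
move=> wd; have [Uw Ow Vw E] := Wd wd.
rewrite (singular_pointP (erefl _) (prec_open oO) Ow Cf); split=> [[eta e0 fe]|w1].
  have [Vs sinvs] := sK Uw.
  pose z := 'D_eta sinv (s w).
  have dsi := derivableP (diff_derivable (C1_differentiable oV Csinv1 Vs) (v := eta)).
  have Uw' : Us (sinv (s w)) by rewrite sinvs.
  have H := chain_rV (f := s) oUs Cs1 Uw' dsi; rewrite sinvs -/z in H.
  have zE : 'D_z s w = eta.
    have [_ E1] := near_derive (g := id) oV Vs (fun y Vy => (sinvK Vy).2) H.
    by have [_ E2] := is_derive_id_rV (s w) eta; rewrite -E1 E2.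
  have := face_s_derive z wd; rewrite zE fe => /esym /(Phi_immersion Vw) /rowP dz.
  apply/eqP/negPn/negP => w10.
  have z0 : z = 0.
    have := dz 0; have := dz 1; rewrite !mxE /= => /eqP.
    rewrite !mulf_eq0 pnatr_eq0 (negbTE w10) /= => /eqP z1 z0.
    by rewrite -(pt_eta z) z0 z1; apply/rowP => j; rewrite !mxE if_same.
  by case/negP: e0; rewrite -zE z0 deriveE ?linear0 //; exact: C1_differentiable oUs Cs1 Uw.
exists ('D_(delta_mx 0 1) s w).
  apply/eqP => /(s_immersion Uw) /matrixP /(_ 0 1); rewrite !mxE /= => /eqP.
  by rewrite oner_eq0.
rewrite face_s_derive // (_ : dcusp w _ = 0).
  by rewrite deriveE ?linear0 //; exact: C1_differentiable oV' CPhi1 Vw.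
by apply/rowP => j; rewrite !mxE w1; case: j => [[|[|[|//]]]] j3 /=; rewrite ?expr0n /= ?mulr0 ?mul0r.
Qed.

Section at_point.
Variable t : R.
Hypothesis td : `|t| < d.
Let e1 : 'rV[R]_2 := delta_mx 0 1.
Let z v := toC (s (pt t v)).
Let zd v := toC ('D_e1 s (pt t v)).
(** The v-derivative of (t, v^2, v^5) is v (0, 2, 5 v^3); this is the second factor. *)
Let kdir v : 'rV[R]_3 := 2%:R *: delta_mx 0 1 + (5%:R * v ^+ 3) *: delta_mx 0 2.
Let Kv v : 'rV[R]_4 := 'D_(kdir v) Phi (cusp52 (pt t v)).

Let ptd v : `|v| < d -> `|pt t v| < d. Proof. by move=> vd; exact: pt_norm. Qed.

Lemma face_t_derive v : `|v| < d -> 'D_('D_e1 s (pt t v)) f (s (pt t v)) = v *: Kv v.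
Proof.
move=> vd; have wd := ptd vd; have [Uw Ow Vw E] := Wd wd.
rewrite face_s_derive // /Kv; have dP := C1_differentiable oV' CPhi1 Vw.
rewrite !deriveE // -linearZ; congr ('d _ _ _).
apply/rowP => j; rewrite !mxE /=; case: j => [[|[|[|//]]]] j3 /=; ring.
Qed.

(** Both sources of dependence on v are flat at 0: [cusp52 (pt t v)] is stationary there, and the
    coefficient 5 v^3 has no linear term. *)
Lemma Kv_derive j : is_derive (0 : R) 1 (fun v => Kv v 0 j) 0.
Proof.
have o0 : `|0 : R| < d by rewrite normr0.
have [_ _ Vw _] := Wd (ptd o0).
have Cp i : sCk 1 V' ('D_(delta_mx 0 i) (fun y => Phi y 0 j)) := (((smoothP Phi oV').1 CPhi j 2%N).2 i).2.
have dcp : derivable (fun v => cusp52 (pt t v)) 0 1 by case: (is_derive_cusp_pt t).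
have dcE : 'D_1 (fun v => cusp52 (pt t v)) 0 = 0 by case: (is_derive_cusp_pt t).
have dp i : is_derive (0 : R) 1 (fun v => 'D_(delta_mx 0 i) (fun y => Phi y 0 j) (cusp52 (pt t v))) 0.
  have [A B] := C1_comp_derive (psi := fun v => cusp52 (pt t v)) (t := 0) (v := 1) oV' (Cp i) Vw dcp.
  apply: DeriveDef; first exact: A.
  rewrite [LHS]B dcE; apply: big1 => i' _.
  by rewrite mxE mul0r.
pose I := is_derive_id (0 : R) 1.
have H := is_deriveD (is_deriveM (is_derive_cst (2%:R : R) (0 : R) 1) (dp 1))
  (is_deriveM (is_deriveM (is_derive_cst (5%:R : R) (0 : R) 1) (is_deriveM I (is_deriveM I I))) (dp 2)).
have oB : open [set v : R | `|v| < d].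
  by apply: (@open_comp _ _ (fun v : R => `|v|) [set x | x < d]); [move=> x _; exact: norm_continuous|exact: open_lt].
have H' : is_derive (0 : R) 1 (fun v : R => 2%:R * 'D_(delta_mx 0 1) (fun y => Phi y 0 j) (cusp52 (pt t v)) +
    5%:R * (v * (v * v)) * 'D_(delta_mx 0 2) (fun y => Phi y 0 j) (cusp52 (pt t v))) 0.
  by apply: is_derive_eq H _; rewrite !fctE /GRing.scale /=; ring.
apply: (near_derive oB o0 _ H') => v vd.
have [_ _ Vv _] := Wd (ptd vd).
have dP := C1_differentiable oV' CPhi1 Vv.
have -> : Kv v 0 j = 'D_(kdir v) (fun y => Phi y 0 j) (cusp52 (pt t v)).
  by rewrite /Kv derive_mx ?mxE //; exact: diff_derivable.
rewrite (C1_derive (kdir v) oV' (CPhi1 j) Vv) !big_ord_recl big_ord0 !mxE /=.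
rewrite (_ : lift ord0 (lift ord0 ord0) = 2); last exact/val_inj.
rewrite (_ : lift ord0 ord0 = 1); last exact/val_inj.
by rewrite (_ : v ^+ 3 = v * (v * v)) //; ring.
Qed.

Lemma zd_derive : exists q, cder zd 0 1 q.
Proof.
have o0 : `|0 : R| < d by rewrite normr0.
have [Uw _ _ _] := Wd (ptd o0).
have C2 : Ck 1 Us ('D_e1 s) := ((Cs 2%N).2 1).2.
have C1 j : sCk 1 Us (fun y => 'D_e1 s y 0 j) by move/(CkP 1 _ oUs): C2; exact.
eexists; apply: cder_toC_curve.
exact: (chain_rV (f := 'D_e1 s) (psi := pt t) oUs C1 Uw (is_derive_pt1 t 0)).
Qed.

Lemma z_derive v : `|v| < d -> cder z v 1 (zd v).
Proof.
move=> vd; have [Uw _ _ _] := Wd (ptd vd); apply: cder_toC_curve.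
exact: (chain_rV (f := s) (psi := pt t) oUs Cs1 Uw (is_derive_pt1 t v)).
Qed.

Let K00 v : C := (Kv v 0 0 + Kv v 0 3)%:C%C.
Let K01 v : C := Complex (Kv v 0 1) (Kv v 0 2).
Let K11 v : C := (Kv v 0 0 - Kv v 0 3)%:C%C.
Let T v := zd v * h (z v).

Lemma K_frame v : `|v| < d ->
  let n00 := T v * g (z v) + cj (T v * g (z v)) in let n01 := T v * g (z v) ^+ 2 + cj (T v) in
  [/\ v%:C%C * K00 v = frm F 0 0 n00 n01 n00 (z v), v%:C%C * K01 v = frm F 0 1 n00 n01 n00 (z v) &
      v%:C%C * K11 v = frm F 1 1 n00 n01 n00 (z v)].
Proof.
move=> vd n00 n01; have [Uw Ow Vw E] := Wd (ptd vd).
have FE i j := frame_hpd i j (zd v) fd Ow.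
have [] := @hcoord_inv _ (hpd F 0 1 (z v) (zd v)) _ (hpd_real F 0 (z v) (zd v)) (hpd_real F 1 (z v) (zd v)).
rewrite -(face_derive oO hF ('D_e1 s (pt t v)) Ow) -/f face_t_derive // !FE -/n00 -/n01 => e0 e1' e2.
split.
- by rewrite e0 /K00 !mxE; apply/eqP; rewrite eq_complex /=; apply/andP; split; apply/eqP; ring.
- by rewrite e1' /K01 !mxE; apply/eqP; rewrite eq_complex /=; apply/andP; split; apply/eqP; ring.
- by rewrite e2 /K11 !mxE; apply/eqP; rewrite eq_complex /=; apply/andP; split; apply/eqP; ring.
Qed.

Lemma zd_neq0 : zd 0 != 0.
Proof.
have o0 : `|0 : R| < d by rewrite normr0.
have [Uw _ _ _] := Wd (ptd o0).
apply/eqP => H; have /(s_immersion Uw) /matrixP /(_ 0 1) : 'D_e1 s (pt t 0) = 0.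
  by rewrite -[LHS]ofC_toC -/(zd 0) H; apply/rowP => j; rewrite !mxE if_same.
by rewrite !mxE /= => /eqP; rewrite oner_eq0.
Qed.

Lemma norm_g_at : g (z 0) * cj (g (z 0)) = 1.
Proof.
have o0 : `|0 : R| < d by rewrite normr0.
have [Uw Ow _ _] := Wd (ptd o0).
apply: (singular_at data (discD Ow) (discP Ow)).1.
by rewrite /z ofC_toC; apply/(singular_s (ptd o0)); rewrite pt1.
Qed.

(** On |g| = 1 the off-diagonal entry t g^2 + conj(t) equals g (t g + conj(t g)), which gives the
    one-parameter form with X = 2 Re(t g). *)
Lemma Phi_frame_u : exists X : R, 'D_(delta_mx 0 0) Phi (cusp52 (pt t 0)) =
  hcoord (frm F 0 0 X%:C%C (X%:C%C * g (z 0)) X%:C%C (z 0))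
         (frm F 0 1 X%:C%C (X%:C%C * g (z 0)) X%:C%C (z 0))
         (frm F 1 1 X%:C%C (X%:C%C * g (z 0)) X%:C%C (z 0)).
Proof.
have o0 : `|0 : R| < d by rewrite normr0.
have [Uw Ow _ _] := Wd (ptd o0); have GG := norm_g_at.
have dE : dcusp (pt t 0) (delta_mx 0 0) = delta_mx 0 0.
  by apply/rowP => j; rewrite !mxE /= expr0n /= !mulr0; case: j => [[|[|[|//]]]] j3.
rewrite -{1}dE -(face_s_derive (delta_mx 0 0) (ptd o0)).
rewrite (face_derive oO hF _ Ow) -/(z 0).
set eta := toC _; pose t1 := eta * h (z 0).
have FE i j := frame_hpd i j eta fd Ow.
exists (Re (t1 * g (z 0) + cj (t1 * g (z 0)) : R[i])).
have XE : (Re (t1 * g (z 0) + cj (t1 * g (z 0)) : R[i]))%:C%C = t1 * g (z 0) + cj (t1 * g (z 0)) :> C.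
  by rewrite /cj; case: (t1 * g (z 0)) => p1 p2; apply/eqP; rewrite eq_complex /= subrr !eqxx.
have YE : t1 * g (z 0) ^+ 2 + cj t1 = (t1 * g (z 0) + cj (t1 * g (z 0))) * g (z 0).
  by rewrite cjM; ring: GG.
by rewrite XE -YE !FE.
Qed.

(** If K(0) were on the line of the u-derivative of [Phi], then X K(0) = x d_u Phi. Injectivity of
    the differential of [Phi] forces X = 0 and then d_u Phi = 0, again impossible. *)
Lemma indepK (x : R) : ~ (K00 0 = frm F 0 0 x%:C%C (x%:C%C * g (z 0)) x%:C%C (z 0) /\
  K01 0 = frm F 0 1 x%:C%C (x%:C%C * g (z 0)) x%:C%C (z 0) /\
  K11 0 = frm F 1 1 x%:C%C (x%:C%C * g (z 0)) x%:C%C (z 0)).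
Proof.
move=> [E0 [E1 E2]]; have o0 : `|0 : R| < d by rewrite normr0.
have [_ _ Vw _] := Wd (ptd o0); have dP := C1_differentiable oV' CPhi1 Vw.
have [X XE] := Phi_frame_u.
have KE : Kv 0 = hcoord (K00 0) (K01 0) (K11 0).
  apply/rowP => j; rewrite !mxE; case: j => [[|[|[|[|//]]]]] j4 /=.
  - by rewrite (_ : Ordinal j4 = 0); [field|exact/val_inj].
  - by congr (Kv 0 _ _); exact/val_inj.
  - by congr (Kv 0 _ _); exact/val_inj.
  - by rewrite (_ : Ordinal j4 = 3); [field|exact/val_inj].
rewrite E0 E1 E2 in KE.
have lin (i j : 'I_2) (c x' : R) : c%:C%C * frm F i j x'%:C%C (x'%:C%C * g (z 0)) x'%:C%C (z 0) =
    frm F i j (c * x')%:C%C ((c * x')%:C%C * g (z 0)) (c * x')%:C%C (z 0).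
  by rewrite /frm rmorphM /= !cjM !cj_real; ring.
have hl (c : R) (x00 x01 x11 : C) : c *: hcoord x00 x01 x11 = hcoord (c%:C%C * x00) (c%:C%C * x01) (c%:C%C * x11).
  apply/rowP => j; rewrite !mxE; case: x00 x01 x11 => [p1 p2] [q1 q2] [r1 r2] /=.
  by case: j => [[|[|[|[|//]]]]] j4 /=; field.
have L : X *: Kv 0 - x *: 'D_(delta_mx 0 0) Phi (cusp52 (pt t 0)) = 0.
  by rewrite KE XE !hl !lin (mulrC x X) subrr.
have vE : 'D_(X *: kdir 0 - x *: delta_mx 0 0) Phi (cusp52 (pt t 0)) = 0.
  by rewrite -[RHS]L /Kv !deriveE // linearB !linearZ.
have /(Phi_immersion Vw) v0 := vE.
have X0 : X = 0.
  by have /rowP/(_ 1) := v0; rewrite !mxE /= => H; lra.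
have : 'D_(delta_mx 0 0) Phi (cusp52 (pt t 0)) = 0.
  rewrite XE X0 /frm [0%:C%C](_ : _ = 0 :> C) // mul0r (_ : cj 0 = 0); last by rewrite /cj conjc0.
  by rewrite !mulr0 !addr0 hcoord0.
move=> /(Phi_immersion Vw) /rowP/(_ 0); rewrite !mxE /= => /eqP.
by rewrite oner_eq0.
Qed.

Lemma necessity_at : 'D_1 g (z 0) != 0 /\ phi_fn g h (z 0) + cj (phi_fn g h (z 0)) = 0.
Proof.
have [hg hh _ h0 [det D0 D1]] := fd; have [q dq] := zd_derive.
have zO v : `|v| < d -> disc p r (z v) by move=> vd; case: (Wd (ptd vd)).
have d00 : cder K00 0 1 0.
  by split=> /=; [apply: is_derive_eq (is_deriveD (Kv_derive 0) (Kv_derive 3)) _; rewrite addr0|exact: is_derive_cst].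
have d11 : cder K11 0 1 0.
  by split=> /=; [apply: is_derive_eq (is_deriveB (Kv_derive 0) (Kv_derive 3)) _; rewrite subr0|exact: is_derive_cst].
have d01 : cder K01 0 1 0 by split=> /=; exact: Kv_derive.
have K0 v vd := let: And3 a _ _ := @K_frame v vd in a.
have K1 v vd := let: And3 _ a _ := @K_frame v vd in a.
have K2 v vd := let: And3 _ _ a := @K_frame v vd in a.
have [_ g' ph] := edge_condition hg hh (hF 0 0) (hF 0 1) (hF 1 0) (hF 1 1) h0 det
  (fun z Oz => D0 z 0 Oz) (fun z Oz => D1 z 0 Oz) (fun z Oz => D0 z 1 Oz) (fun z Oz => D1 z 1 Oz)
  d0 zO z_derive dq zd_neq0 d00 d01 d11 (fun v => cj_real _) (fun v => cj_real _) K0 K1 K2 indepK.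
by [].
Qed.

End at_point.

Hypothesis s0 : s 0 = ofC p.

Let gam t := s (pt t 0).

Lemma itvP t : `]- d, d[%classic t <-> `|t| < d.
Proof. by rewrite /= in_itv /= ltr_norml. Qed.

Lemma pt_small t : `|t| < d -> `|pt t 0| < d.
Proof. by move=> td; apply: pt_norm; rewrite ?normr0. Qed.

(** The neighbourhood is a disc on which [sinv] has norm below d, so every singular point in it has
    its parameter in the interval. *)
Lemma necessity_curve : singular_curve D f p gam d.
Proof.
have pt00 : pt 0 0 = 0 by apply/rowP => j; rewrite !mxE if_same.
have dgam (t : R) : `|t| < d -> is_derive t 1 gam ('D_(delta_mx 0 0) s (pt t 0)).
  move=> td; have [Uw _ _ _] := Wd (pt_small td).
  exact: (chain_rV (f := s) (psi := pt ^~ 0) oUs Cs1 Uw (is_derive_pt0 t 0)).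
have o0 : `|0 : 'rV[R]_2| < d by rewrite normr0.
split=> //.
- apply: (smooth_curve_pt oUs _ _ Cs); first exact: itv_open.
  by move=> t /itvP td; case: (Wd (pt_small td)).
- move=> t /itvP td; have [_ ->] := dgam t td; have [Uw _ _ _] := Wd (pt_small td).
  apply/eqP => /(s_immersion Uw) /matrixP /(_ 0 0); rewrite !mxE /= => /eqP.
  by rewrite oner_eq0.
- split; first by rewrite /gam pt00.
  by move=> t /itvP td; have [_ Ow _ _] := Wd (pt_small td); exact: discD.
have [U0 _ _ _] := Wd o0; have Vp : V (ofC p) by rewrite -s0; exact: (sK U0).1.
have csi y : V y -> {for y, continuous sinv}.
  by move=> Vy; exact: (Csinv 0%N y Vy).
have nV : nbhs (ofC p) [set y | V y /\ `|sinv y| < d].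
  have nVp : nbhs (ofC p) V by apply: open_nbhs_nbhs.
  have sp : sinv (ofC p) = 0 by rewrite -s0; exact: (sK U0).2.
  have cn : {for ofC p, continuous (fun y => `|sinv y|)}.
    apply: (@continuous_comp _ _ _ sinv (fun x : 'rV[R]_2 => `|x|)); first exact: csi.
    exact: norm_continuous.
  have /(near_lt_continuous cn) H : `|sinv (ofC p)| < d by rewrite sp normr0.
  by apply: filterS (filterI nVp H).
have nC : nbhs p [set z : C | V (ofC z) /\ `|sinv (ofC z)| < d] := ofC_continuous nV.
have [e e0 eE] := nbhs_disc nC.
exists (disc p e); split; [exact: disc_open|exact: disc_center|].
move=> z /eE /= [Vz sz]; have [Uz sE] := sinvK Vz; have [_ Ow _ _] := Wd sz.
rewrite sE toC_ofC in Ow.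
split=> [[Dz sing]|[t /itvP td tz]].
  have := (singular_s sz).1; rewrite sE => /(_ sing) w1.
  exists (sinv (ofC z) 0 0).
    by apply/itvP; apply: le_lt_trans sz; exact: coord_le_norm.
  by rewrite /gam -w1 pt_eta sE toC_ofC.
split; first exact: discD.
by rewrite -tz ofC_toC; apply/(singular_s (pt_small td)); rewrite pt1.
Qed.

Lemma necessity : Im (phi_fn g h p : R[i]) != 0 /\
  exists (gam : R -> 'rV[R]_2) (eps : R), singular_curve D f p gam eps /\
    forall t, `]- eps, eps[%classic t -> Re (phi_fn g h (toC (gam t)) : R[i]) = 0.
Proof.
have Re0 (z : C) : z + cj z = 0 -> Re (z : R[i]) = 0.
  by rewrite /cj; case: z => a b /eqP; rewrite eq_complex /= => /andP[/eqP H _]; lra.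
split; last first.
  exists gam, d; split; first exact: necessity_curve.
  by move=> t /itvP td; have [_ /Re0] := necessity_at td.
have o0 : `|0 : R| < d by rewrite normr0.
have [] := necessity_at o0.
have -> : toC (s (pt 0 0)) = p.
  by rewrite (_ : pt 0 0 = 0) ?s0 ?toC_ofC //; apply/rowP => j; rewrite !mxE if_same.
move=> g' /Re0 ph; apply/eqP => ph'.
have [_ h' _ h0 _] := fd.
have o00 : `|0 : 'rV[R]_2| < d by rewrite normr0.
have pd : disc p r p by have [_ + _ _] := Wd o00; rewrite s0 toC_ofC.
have G0 : g p != 0.
  have := norm_g_at o0; rewrite (_ : toC (s (pt 0 0)) = p).
    by move=> GG; apply: contra_eq_neq GG => ->; rewrite mul0r eq_sym oner_eq0.
  by rewrite (_ : pt 0 0 = 0) ?s0 ?toC_ofC //; apply/rowP => j; rewrite !mxE if_same.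
(* As Re phi(p) = 0, a zero imaginary part would give phi(p) = 0, against g'(p) != 0. *)
have : phi_fn g h p = 0 by apply/eqP; rewrite eq_complex ph ph' !eqxx.
by move=> /eqP; rewrite mulf_eq0 (negbTE g') invr_eq0 mulf_eq0 expf_eq0 (negbTE G0) (negbTE (h0 p pd)).
Qed.

End edge_germ.

Lemma cuspidal_edge_necessity D P g h F (p : C) : cmc1_data D P g h F -> D p ->
  singular_point (cmc1_face F) (ofC p) -> cuspidal_edge_52 D (cmc1_face F) p ->
  Im (phi_fn g h p : R[i]) != 0 /\
  exists (gam : R -> 'rV[R]_2) (eps : R), singular_curve D (cmc1_face F) p gam eps /\
    forall t, `]- eps, eps[%classic t -> Re (phi_fn g h (toC (gam t)) : R[i]) = 0.
Proof.
move=> data Dp sing [Us [s [Ut [Psi [W [germ chart [oW [W0 WU]] WE]]]]]].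
have Pp : ~ P p by move=> /(nonsingular_pole data).
have [r r0 [discD discP fd]] := frame_at data Dp Pp.
have [V [sinv [[oUs U0] [oV Vp] s0 [Cs Csi] [sK siK]]]] := germ.
have [V' [Phi [[oUt _] [oV' V'0] Psi0 [CPsi CPhi] [PsiK PhiK]]]] := chart.
have cs0 : {for 0, continuous s} := Cs 0%N 0 U0.
have nO : nbhs (s 0) (prec (disc p r)).
  apply: open_nbhs_nbhs; split; first exact: prec_open (@disc_open R p r).
  by rewrite /prec /= s0 toC_ofC; exact: disc_center.
have nW : nbhs (0 : 'rV[R]_2) W by apply: open_nbhs_nbhs.
have : \forall w \near (0 : 'rV[R]_2), W w /\ prec (disc p r) (s w).
  by apply: filterI => //; exact: (cs0 _ nO).
move=> /nbhs_ballP[d /= d0 dE].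
have Wd w : `|w| < d -> [/\ Us w, disc p r (toC (s w)), V' (cusp52 w) & cmc1_face F (s w) = Phi (cusp52 w)].
  move=> wd; have [Ww Ow] : W w /\ prec (disc p r) (s w).
    by apply: dE; rewrite -ball_normE /= sub0r normrN.
  have [_ Utw PE] := WE w Ww.
  have dS : deSitter3 (cmc1_face F (s w)).
    rewrite cmc1_faceE; apply: face_deSitter.
    have [_ _ _ _ [det _ _]] := fd; rewrite det_M2; exact: det.
  have [V'w PP] := PsiK _ Utw dS; rewrite PE in V'w PP.
  split; [exact: WU|exact: Ow|exact: V'w|by rewrite PP].
exact: (necessity data fd discD discP oUs oV Cs Csi sK siK oUt oV' CPsi CPhi (fun y Vy => conj (PhiK y Vy).1.1 (PhiK y Vy).2) d0 Wd s0).
Qed.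

End edge_necessity.

(** * Sufficiency *)

Section edge_sufficiency.
Context {R : realType}.
Local Notation C := (Cplx R).
Local Notation Re := complex.Re.
Local Notation Im := complex.Im.

(** The real determinant of multiplication by k is |k|^2. *)
Lemma jac_mul_unit (f : 'rV[R]_2 -> 'rV[R]_2) (w : 'rV[R]_2) (k : C) : k != 0 ->
  (forall v : 'rV[R]_2, is_derive w v f (ofC (k * toC v))) -> jac f w \in unitmx.
Proof.
move=> k0 df; rewrite unitmxE unitfE.
have jE i j : jac f w i j = ofC (k * toC (delta_mx 0 i)) 0 j.
  by rewrite mxE; have [_ ->] := is_derive_rowP j (df (delta_mx 0 i)).
have t0 : toC (delta_mx 0 0 : 'rV[R]_2) = 1 by rewrite /toC !mxE.
have t1 : toC (delta_mx 0 1 : 'rV[R]_2) = i_ by rewrite /toC !mxE.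
have kiE j : ofC (k * i_) 0 j = if val j == 0%N then - Im (k : R[i]) else Re (k : R[i]).
  by rewrite mxE; congr (if _ then _ else _); case: (k) => a b /=; ring.
have -> : jac f w = \matrix_(i, j) (if val i == 0%N then ofC k 0 j
                                    else if val j == 0%N then - Im (k : R[i]) else Re (k : R[i])).
  apply/matrixP => i j; rewrite jE mxE.
  have [-> | ->] : i = 0 \/ i = 1 by case: i => -[|[|//]] jj; [left|right]; exact: val_inj.
  - by rewrite t0 mulr1.
  - by rewrite t1 kiE.
rewrite (expand_det_row _ 0) !big_ord_recl big_ord0 /cofactor !det_mx11 !mxE /= /bump /=.
rewrite [X in X != 0](_ : _ = Re (k : R[i]) ^+ 2 + Im (k : R[i]) ^+ 2); last by ring.
apply: contra_neq k0 => /eqP; rewrite paddr_eq0 ?sqr_ge0 // !sqrf_eq0 => /andP[/eqP a /eqP b].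
by apply/eqP; rewrite eq_complex a b !eqxx.
Qed.

Lemma is_derive_ofC (V : normedModType R) (c : V -> C) (x v : V) (d : C) :
  cder c x v d -> is_derive x v (fun y => ofC (c y)) (ofC d).
Proof.
move=> [dr di]; apply: is_derive_row => j; rewrite mxE.
have [-> | ->] : j = 0 \/ j = 1 by case: j => -[|[|//]] jj; [left|right]; exact: val_inj.
- by rewrite [X in is_derive _ _ X _](_ : _ = (fun y => Re (c y : R[i]))) //; apply/funext => y; rewrite mxE.
- by rewrite [X in is_derive _ _ X _](_ : _ = (fun y => Im (c y : R[i]))) //; apply/funext => y; rewrite mxE.
Qed.

Lemma smooth_ofC n (U : set 'rV[R]_n) (c : 'rV[R]_n -> C) : open U -> (forall k, cSk k U c) ->
  smooth_on U (fun x => ofC (c x)).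
Proof.
move=> oU Cc; apply/smoothP => // j k; have [Cr Ci] := Cc k.
have [-> | ->] : j = 0 \/ j = 1 by case: j => -[|[|//]] jj; [left|right]; exact: val_inj.
- by apply: sCk_ext Cr => // x _; rewrite mxE.
- by apply: sCk_ext Ci => // x _; rewrite mxE.
Qed.

(** The real inverse function theorem supplies a continuous inverse; its complex slope is the
    reciprocal of the slope of f, which makes it holomorphic. *)
Lemma chol_inverse (O : set C) (f : C -> C) (p : C) : open O -> O p -> chol O f -> 'D_1 f p != 0 ->
  exists2 r, 0 < r & exists2 q : C -> C, q (f p) = p & chol (disc (f p) r) q /\
    forall z, disc (f p) r z -> [/\ O (q z), f (q z) = z, 'D_1 f (q z) != 0 & 'D_1 q z = ('D_1 f (q z))^-1].
Proof.
move=> oO Op hf f'0.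
have hf' := chol_derive oO hf.
pose O' := [set z | O z /\ 'D_1 f z != 0].
have oO' : open O'.
  rewrite openE => z [Oz dz]; apply: filterI; first exact: open_nbhs_nbhs.
  exact: (chol_continuous hf' Oz) (open_nbhs_nbhs (conj openC0 dz)).
have hfO' : chol O' f by apply: chol_sub hf => z [].
have [W WO [V [sinv [[oW Wp] [oV Vp] _ [Cf Cs] [fK sK]]]]] :
    exists2 W, W `<=` prec O' & diffeo_germ (ofC p) (ofC (f (toC (ofC p)))) W (fun w => ofC (f (toC w))).
  apply: inverse_function; first exact: prec_open.
  - by rewrite /prec /= toC_ofC.
  - by apply: smooth_ofC => [|k]; [exact: prec_open|exact: cSk_holo].
  apply: (@jac_mul_unit _ _ ('D_1 f p)) => // v; apply: is_derive_ofC.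
  by have := @cder_holo R O' f (ofC p) v hfO'; rewrite toC_ofC; apply.
rewrite toC_ofC in Vp.
pose q z := toC (sinv (ofC z)).
have oV' : open [set z : C | V (ofC z)] by apply: open_comp => // z _; exact: ofC_continuous.
have [r r0 rV] := nbhs_disc (open_nbhs_nbhs (conj oV' Vp)).
have qO z : disc (f p) r z -> O' (q z) by move=> /rV Vz; exact: WO (sK _ Vz).1.
have fq z : disc (f p) r z -> f (q z) = z.
  by move=> /rV Vz; rewrite -[RHS]toC_ofC -(sK _ Vz).2 toC_ofC.
have cq z : disc (f p) r z -> {for z, continuous q}.
  move=> /rV Vz; apply: (@ccont_comp _ _ _ (@toC R) (fun z => sinv (ofC z))); first exact: toC_continuous.
  apply: (@continuous_comp _ _ _ (@ofC R) sinv); first exact: ofC_continuous.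
  exact: (Cs 0%N _ Vz).
have dq z : disc (f p) r z -> is_derive z 1 q ('D_1 f (q z))^-1.
  move=> zr; have [Oz dz] := qO z zr.
  have [a [fa ca az]] := caratheodory (chol_is_derive hf Oz).
  have caq : {for z, continuous (fun w => a (q w))}.
    by apply: (@ccont_comp _ _ _ a q); [exact: ca|exact: cq].
  rewrite -az; apply: (@caratheodory_der _ q (fun w => (a (q w))^-1)); last first.
    by apply: ccontV caq; rewrite az.
  have n0 : \forall w \near z, a (q w) != 0.
    by apply: (caq [set u : C | u != 0]); apply: open_nbhs_nbhs; split; [exact: openC0|rewrite /= az].
  near=> w.
  have a0 : a (q w) != 0 by near: w.
  have wr : disc (f p) r w by near: w; apply: open_nbhs_nbhs; split; [exact: disc_open|].
  have := fa (q w); rewrite (fq w wr) (fq z zr) => ->.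
  by rewrite (mulKf a0).
have oD := @disc_open R (f p) r.
exists r => //; exists q.
  by rewrite /q; have := (fK _ Wp).2; rewrite toC_ofC => ->; rewrite toC_ofC.
split; last first.
  by move=> z zr; have [Oz dz] := qO z zr; split; [exact: Oz|exact: fq|exact: dz|case: (dq z zr)].
apply: (chol_intro oD dq) => z zr.
have [Oz dz] := qO z zr; apply: ccontV; first exact: dz.
by apply: (@ccont_comp _ _ _ ('D_1 f) q); [exact: chol_continuous hf' Oz|exact: cq].
Unshelve. all: by end_near. Qed.

(** * The Cayley coordinate and the second-order equation *)

Section edge_coordinate.
Variables (g h : C -> C) (F : C -> 'M[C]_2) (p : C) (r : R).
Hypothesis fd : frame_data (disc p r) g h F.
Let g0 := g p.
Hypothesis g00 : g0 != 0.
Let D := disc p r.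
Let hg : chol D g. Proof. have [hg _ _ _ _] := fd; exact hg. Qed.

(* A Cayley transform in the value of [g]: real exactly where |g| = 1. *)
Definition edge_coord (z : C) : C := (- i_) * ((g z + (- g0)) * (g z + g0)^-1).

Lemma edge_coord_derive z : D z -> g z + g0 != 0 ->
  is_derive z 1 edge_coord (- (2%:R * i_ * g0 * 'D_1 g z) / (g z + g0) ^+ 2).
Proof.
move=> Dz gg; have dg := chol_is_derive hg Dz.
have dp := is_deriveDC dg (is_derive_cstC g0 z).
have dm := is_deriveDC dg (is_derive_cstC (- g0) z).
have di := @is_derive_compC _ (fun u : C => u^-1) (fun w => g w + g0) z _ _ (is_derive_invC gg) dp.
apply: is_derive_eqC (is_deriveZC (- i_) (is_deriveMC dm di)) _.
move: ('D_1 g z) (g z) gg => dgz gz gg.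
by field.
Qed.

Section row.
Variables c0 c1 : C.
Definition row_u (z : C) : C := c0 * F z 0 0 + c1 * F z 1 0.
Definition row_v (z : C) : C := c0 * F z 0 1 + c1 * F z 1 1.
(* [row_m] is one of the m_i of the header and [row_A] its zeta-derivative. *)
Definition row_m (z : C) : C := (row_u z * g z + row_v z) * (g z + g0)^-1.
Definition row_A (z : C) : C := i_ / (2%:R * g0) * (g0 * row_u z + (-1) * row_v z).

Lemma row_u_derive z : D z -> is_derive z 1 row_u (h z * (row_u z * g z + row_v z)).
Proof.
move=> Dz; have [_ _ hF _ [_ d0 d1]] := fd.
apply: is_derive_eqC (is_deriveDC (is_deriveZC c0 (chol_is_derive (hF 0 0) Dz))
  (is_deriveZC c1 (chol_is_derive (hF 1 0) Dz))) _.
by rewrite (d0 z 0 Dz) (d0 z 1 Dz) /row_u /row_v; ring.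
Qed.

Lemma row_v_derive z : D z -> is_derive z 1 row_v (- g z * (h z * (row_u z * g z + row_v z))).
Proof.
move=> Dz; have [_ _ hF _ [_ d0 d1]] := fd.
apply: is_derive_eqC (is_deriveDC (is_deriveZC c0 (chol_is_derive (hF 0 1) Dz))
  (is_deriveZC c1 (chol_is_derive (hF 1 1) Dz))) _.
by rewrite (d1 z 0 Dz) (d1 z 1 Dz) /row_u /row_v; ring.
Qed.

(** The terms in h cancel in (u g + v)' = u g', so the derivative of m with respect to the new
    coordinate contains no h. *)
Lemma row_m_derive z : D z -> g z + g0 != 0 ->
  is_derive z 1 row_m (row_A z * (- (2%:R * i_ * g0 * 'D_1 g z) / (g z + g0) ^+ 2)).
Proof.
move=> Dz gg; have dg := chol_is_derive hg Dz.
have dp := is_deriveDC dg (is_derive_cstC g0 z).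
have di := @is_derive_compC _ (fun u : C => u^-1) (fun w => g w + g0) z _ _ (is_derive_invC gg) dp.
have dn := is_deriveDC (is_deriveMC (row_u_derive Dz) dg) (row_v_derive Dz).
apply: is_derive_eqC (is_deriveMC dn di) _.
rewrite /row_A; move: ('D_1 g z) (g z) (row_u z) (row_v z) (h z) gg => dgz gz u v hz gg.
have i2 := @i_sqr R; field: i2.
by rewrite g00 gg.
Qed.

(** Here g0 u' - v' = h (g + g0) (u g + v) = h (g + g0)^2 m, which closes the second-order equation
    for m. *)
Lemma row_A_derive z : D z -> g z + g0 != 0 ->
  is_derive z 1 row_A (i_ / (2%:R * g0) * (h z * (g z + g0) ^+ 2 * row_m z)).
Proof.
move=> Dz gg.
apply: is_derive_eqC (is_deriveZC _ (is_deriveDC (is_deriveZC g0 (row_u_derive Dz))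
  (is_deriveZC (-1) (row_v_derive Dz)))) _.
rewrite /row_m; move: (g z) (row_u z) (row_v z) (h z) gg => gz u v hz gg.
field; by rewrite gg g00.
Qed.

End row.

End edge_coordinate.
(** Clearing denominators gives G (-i - x) = G0 (x - i), and both factors have squared modulus 1 +
    x^2. *)
Lemma cayley_unit (G G0 : C) (x : R) : G + G0 != 0 -> G0 * cj G0 = 1 ->
  (- i_) * ((G + (- G0)) * (G + G0)^-1) = x%:C%C -> G * cj G = 1.
Proof.
move=> GG H0 E.
have E1 : G * (- i_ + (-1) * x%:C%C) = G0 * (x%:C%C + (-1) * i_).
  move: E => /(congr1 (fun t => t * (G + G0))).
  rewrite -!mulrA mulVf // mulr1 => E.
  apply/eqP; rewrite -subr_eq0; apply/eqP; transitivity ((- i_) * (G + (- G0)) - x%:C%C * (G + G0)); first by ring.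
  by rewrite E subrr.
have := congr1 cj E1; rewrite (cjM G) (cjM G0) (cjD (- i_)) (cjD (x%:C%C)) (cjN i_) (cjM (-1)) (cjM (-1)) cj_i (cjN 1) cj1 cj_real => E2.
have x0 : (1 + x%:C%C ^+ 2 : C) != 0.
  have -> : (1 + x%:C%C ^+ 2 : C) = (1 + x ^+ 2)%:C%C by rewrite rmorphD rmorphXn.
  apply/eqP => /(congr1 (fun z : R[i] => Re z)) /= H.
  by have := sqr_ge0 x; rewrite -[X in 0 <= X](addKr 1) H addr0 oppr_ge0 ler10.
apply: (mulIf x0); rewrite mul1r.
have i2 := @i_sqr R.
have -> : G * cj G * (1 + x%:C%C ^+ 2) = (G * (- i_ + (-1) * x%:C%C)) * (cj G * (- - i_ + - 1 * x%:C%C)).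
  by ring: i2.
rewrite E1 E2.
by ring: i2 H0.
Qed.

(** On the unit circle (G + G0)^2 / (G G0) is real; the remaining factor is i / (4 phi), where the
    signs of conj(i) and conj(phi) compensate. *)
Lemma edge_coefficient_real (G G0 dG H : C) : G != 0 -> G0 != 0 -> dG != 0 -> H != 0 ->
  G * cj G = 1 -> G0 * cj G0 = 1 -> dG / (G ^+ 2 * H) + cj (dG / (G ^+ 2 * H)) = 0 ->
  cj (i_ * H * (G + G0) ^+ 4 / (4%:R * G0 ^+ 2 * dG)) = i_ * H * (G + G0) ^+ 4 / (4%:R * G0 ^+ 2 * dG).
Proof.
move=> Gn G0n dn Hn GG HG0.
set ph := dG / _ => pE.
have pn : ph != 0 by rewrite /ph mulf_neq0 // invr_eq0 mulf_neq0 // expf_neq0.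
have bE : i_ * H * (G + G0) ^+ 4 / (4%:R * G0 ^+ 2 * dG) = i_ * (G + G0) ^+ 4 / (4%:R * (G0 ^+ 2 * (G ^+ 2 * ph))).
  by rewrite /ph; field; rewrite dn G0n Gn Hn.
rewrite bE; move: pE pn; move: {bE} ph => ph pE pn.
have cG : cj G = G^-1 by apply: (mulfI Gn); rewrite GG mulfV.
have cG0 : cj G0 = G0^-1 by apply: (mulfI G0n); rewrite HG0 mulfV.
have cp : cj ph = - ph by apply/eqP; rewrite -addr_eq0 addrC pE.
have c4 : cj (4%:R : C) = 4%:R by have := @cj_real R 4%:R; rewrite rmorph_nat.
rewrite (cjM (_ * _)) (cjV (_ * _)) (cjM i_) (cjM 4%:R) (cjM (G0 ^+ 2)) (cjM (G ^+ 2)) (cjX (G + G0)) (cjX G0) (cjX G) (cjD G).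
rewrite cG cG0 cp c4 cj_i.
by field; rewrite pn Gn G0n.
Qed.

Lemma edge_hform_identity (G0 G u1 v1 u2 v2 : C) : G + G0 != 0 -> G0 * cj G0 = 1 ->
  let z := (- i_) * ((G + (- G0)) * (G + G0)^-1) in
  let m u v := (u * G + v) * (G + G0)^-1 in let A u v := i_ / (2%:R * G0) * (G0 * u + (-1) * v) in
  i_ * (m u1 v1 * cj (A u2 v2) - A u1 v1 * cj (m u2 v2)) + 2%:R * (Im (z : R[i]))%:C%C * (A u1 v1 * cj (A u2 v2)) =
  2%:R^-1 * (u1 * cj u2 + (-1) * (v1 * cj v2)).
Proof.
move=> GG H0 z m A.
have i2 := @i_sqr R.
have G0n : G0 != 0 by apply: contra_eq_neq H0 => ->; rewrite mul0r eq_sym oner_eq0.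
have zE : 2%:R * (Im (z : R[i]))%:C%C = - (i_ * (z + (-1) * cj z)).
  case: (z) => a b; rewrite /cj /=; apply/eqP; rewrite eq_complex /=; apply/andP; split; apply/eqP; ring.
(* The definitions of m and A are inverted: u and v are combinations of A and m - z A, after which
   the identity is polynomial. *)
have uE u v : u = (- i_) * A u v + (m u v + (-1) * (z * A u v)).
  by rewrite /A /m /z; field: i2; rewrite GG G0n.
have vE u v : v = G0 * (i_ * A u v + (m u v + (-1) * (z * A u v))).
  by rewrite /A /m /z; field: i2; rewrite GG G0n.
rewrite zE; move: (uE u1 v1) (uE u2 v2) (vE u1 v1) (vE u2 v2); move: {uE vE zE} z (A u1 v1) (A u2 v2) (m u1 v1) (m u2 v2).
move=> {}z A1 A2 m1 m2 -> -> -> -> {A m}.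
rewrite (cjD ((- i_) * A2)) (cjD m2) (cjM (- i_)) (cjM (-1)) (cjM z) (cjM G0) (cjD (i_ * A2)) (cjD m2) (cjM i_) (cjM (-1)) (cjM z) !cjN cj1 cj_i.
have n2 : (2%:R : C) != 0 by rewrite pnatr_eq0.
apply: (mulfI n2); rewrite [RHS]mulrA mulfV // mul1r.
by ring: i2 H0.
Qed.
Lemma mul_mx2E (A B : 'M[C]_2) i j : (A *m B) i j = A i 0 * B 0 j + A i 1 * B 1 j.
Proof.
by rewrite mxE !big_ord_recl big_ord0 addr0; congr (_ * _ + A i _ * B _ j); exact: val_inj.
Qed.

Section edge_frames.
Variables (g h : C -> C) (F : C -> 'M[C]_2) (p : C) (r : R).
Hypothesis r0 : 0 < r.
Hypothesis fd : frame_data (disc p r) g h F.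
Let g0 := g p.
Hypothesis unit0 : g0 * cj g0 = 1.
Hypothesis dg0 : 'D_1 g p != 0.
Variable U : set C.
Hypothesis oU : open U.
Hypothesis Up : U p.
Hypothesis imaginary : forall z, U z -> disc p r z -> g z * cj (g z) = 1 ->
  phi_fn g h z + cj (phi_fn g h z) = 0.

Let g00 : g0 != 0.
Proof. by apply: contra_eq_neq unit0 => ->; rewrite mul0r eq_sym oner_eq0. Qed.

Let O := [set z | [/\ disc p r z, U z & g z + g0 != 0]].
Let hg : chol (disc p r) g. Proof. have [hg _ _ _ _] := fd; exact hg. Qed.

Let oO : open O.
Proof.
rewrite openE => z [Dz Uz gz]; rewrite /interior.
have n1 : nbhs z (disc p r) by apply: open_nbhs_nbhs; split; [exact: disc_open|exact: Dz].
have n2 : nbhs z U by apply: open_nbhs_nbhs; split; [exact: oU|exact: Uz].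
have c : {for z, continuous (fun w => g w + g0)}.
  by apply: ccontD; [exact: chol_continuous hg Dz|exact: ccont_cst].
have n3 : \forall w \near z, g w + g0 != 0.
  by apply: (c [set u : C | u != 0]); apply: open_nbhs_nbhs; split; [exact: openC0|exact: gz].
near=> w; split; near: w; [exact: n1|exact: n2|exact: n3].
Unshelve. all: by end_near. Qed.

Let Op : O p.
Proof.
split; [exact: disc_center|exact: Up|].
by rewrite -/g0 -mulr2n mulrn_eq0 /= g00.
Qed.

Let hgO : chol O g. Proof. by apply: chol_sub hg => z []. Qed.

Let hzet : chol O (edge_coord g p).
Proof.
apply: (cholM oO (chol_cst _ oO)); apply: (cholM oO).
  exact: (cholD oO hgO (chol_cst _ oO)).
apply: (cholV oO); last exact: (cholD oO hgO (chol_cst _ oO)).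
by move=> z [].
Qed.

Let zet0 : edge_coord g p p = 0. Proof. by rewrite /edge_coord subrr mul0r mulr0. Qed.

Let dzet z : O z -> 'D_1 (edge_coord g p) z = - (2%:R * i_ * g0 * 'D_1 g z) / (g z + g0) ^+ 2.
Proof. by move=> [Dz _ gz]; have [] := edge_coord_derive fd Dz gz. Qed.

(* V F(p)^-1 with V = [[-i, i g0], [1, g0]], chosen so that (g, 1)^T is mapped by V
   to (g + g0) (zeta, 1)^T. *)
Definition edge_mx : 'M[C]_2 :=
  mx2 (- i_ * F p 1 1 - i_ * g0 * F p 1 0) (i_ * F p 0 1 + i_ * g0 * F p 0 0)
      (F p 1 1 - g0 * F p 1 0) (- F p 0 1 + g0 * F p 0 0).

(** The determinant is -2 i g0, of modulus 2; this is the origin of the factor 1/2 in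
    [edge_hform_identity] and in [mink]. *)
Lemma edge_mx_at : [/\ row_u F (edge_mx 0 0) (edge_mx 0 1) p = - i_,
  row_v F (edge_mx 0 0) (edge_mx 0 1) p = i_ * g0,
  row_u F (edge_mx 1 0) (edge_mx 1 1) p = 1,
  row_v F (edge_mx 1 0) (edge_mx 1 1) p = g0 & \det edge_mx * cj (\det edge_mx) = 4%:R].
Proof.
have [_ _ _ _ [d _ _]] := fd; have {}d := d p (@disc_center R p r r0).
rewrite /row_u /row_v det_M2 !mxE /=.
have e0 : (F p 0 0 : C) * F p 1 1 = 1 + F p 0 1 * F p 1 0 by rewrite -d; ring.
split; [by ring: e0|by ring: e0|by ring: e0|by ring: e0|].
rewrite [X in X * cj X](_ : _ = - (2%:R * i_ * g0)); last by ring: e0.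
have c2 : cj (2%:R : C) = 2%:R by have := @cj_real R 2%:R; rewrite rmorph_nat.
rewrite cjN (cjM (2%:R * i_)) (cjM 2%:R) c2 cj_i.
have i2 := @i_sqr R.
by ring: i2 unit0.
Qed.
Let A_c i := row_A g F p (edge_mx i 0) (edge_mx i 1).
Let m_c i := row_m g F p (edge_mx i 0) (edge_mx i 1).

Lemma edge_mx_face z i j :
  (edge_mx *m (F z *m e3 R *m adjC (F z)) *m adjC edge_mx) i j =
  row_u F (edge_mx i 0) (edge_mx i 1) z * cj (row_u F (edge_mx j 0) (edge_mx j 1) z) +
  (-1) * (row_v F (edge_mx i 0) (edge_mx i 1) z * cj (row_v F (edge_mx j 0) (edge_mx j 1) z)).
Proof.
have -> : edge_mx *m (F z *m e3 R *m adjC (F z)) *m adjC edge_mx =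
    (edge_mx *m F z) *m e3 R *m adjC (edge_mx *m F z).
  have -> : adjC (edge_mx *m F z) = adjC (F z) *m adjC edge_mx by rewrite /adjC map_mxM trmx_mul.
  by rewrite !mulmxA.
by rewrite (face_entry (fun z => edge_mx *m F z)) /hp !mul_mx2E.
Qed.

(** With q the inverse of [edge_coord], the chain rule divides z-derivatives by that of the
    coordinate: the derivative of m becomes A, and that of A becomes i b m. *)
Lemma edge_frame : exists (R0 : R) (q b : C -> C) (m : 'I_2 -> C -> C),
  [/\ 0 < R0,
    [/\ chol (disc 0 R0) q, q 0 = p, (forall z, disc 0 R0 z -> disc p r (q z)) & 'D_1 q 0 != 0],
    [/\ chol (disc 0 R0) b, (forall x : R, `|x| < R0 -> Im (b x%:C%C : R[i]) = 0) & b 0 != 0],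
    (forall i, ode R0 b (m i)) /\ [/\ m 0 0 = 0, 'D_1 (m 0) 0 = 1, m 1 0 = 1 & 'D_1 (m 1) 0 = 0] &
    forall z i j, disc 0 R0 z -> hform (m i) (m j) z =
      2%:R^-1 * (edge_mx *m (F (q z) *m e3 R *m adjC (F (q z))) *m adjC edge_mx) i j].
Proof.
have dz0 : 'D_1 (edge_coord g p) p != 0.
  rewrite (dzet Op) mulf_neq0 ?invr_eq0 ?expf_neq0 //; last by case: Op.
  by rewrite oppr_eq0 !mulf_neq0 ?pnatr_eq0 //; exact: i_neq0.
have [R0 R00 [q]] := chol_inverse oO Op hzet dz0; rewrite zet0 => q0 [hq qP].
have oD := @disc_open R 0 R0.
have qO z : disc 0 R0 z -> O (q z) by move=> /qP[].
have dgq z : disc 0 R0 z -> 'D_1 g (q z) != 0.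
  move=> zr; have [Oq _ dq _] := qP z zr; move: dq; rewrite (dzet Oq).
  by apply: contra_neq => ->; rewrite mulr0 oppr0 mul0r.
have hgq : chol (disc 0 R0) (fun z => g (q z)) := chol_comp oD oO qO hgO hq.
have hdgq : chol (disc 0 R0) (fun z => 'D_1 g (q z)) := chol_comp oD oO qO (chol_derive oO hgO) hq.
have [_ hh hF h0 _] := fd.
have OD : O `<=` disc p r by move=> z [].
have hhq : chol (disc 0 R0) (fun z => h (q z)) := chol_comp oD oO qO (chol_sub OD hh) hq.
(* Determined by the requirement that i b m be the quotient of the z-derivatives of [row_A] and
   [edge_coord]. *)
pose b z := i_ * h (q z) * (g (q z) + g0) ^+ 4 / (4%:R * g0 ^+ 2 * 'D_1 g (q z)).
have hb : chol (disc 0 R0) b.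
  apply: (cholM oD).
    apply: (cholM oD (cholM oD (chol_cst _ oD) hhq)).
    exact: (cholX _ oD (cholD oD hgq (chol_cst _ oD))).
  apply: (cholV oD); last exact: (cholM oD (chol_cst _ oD) hdgq).
  by move=> z zr; rewrite mulf_neq0 ?(dgq z zr) // mulf_neq0 ?pnatr_eq0 // expf_neq0.
pose m i z := m_c i (q z).
have dq z : disc 0 R0 z -> is_derive z 1 q ('D_1 (edge_coord g p) (q z))^-1.
  by move=> zr; have [_ _ _ <-] := qP z zr; exact: chol_is_derive hq zr.
have dm i z : disc 0 R0 z -> is_derive z 1 (m i) (A_c i (q z)).
  move=> zr; have [Oq _ dn _] := qP z zr; have [Dq _ gq] := Oq.
  have := @row_m_derive g h F p r fd g00 (edge_mx i 0) (edge_mx i 1) (q z) Dq gq; rewrite -(dzet Oq) => dmq.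
  apply: is_derive_eqC (is_derive_compC dmq (dq z zr)) _.
  by rewrite -mulrA mulfV // mulr1.
have dA i z : disc 0 R0 z -> is_derive z 1 (fun z => A_c i (q z)) (i_ * b z * m i z).
  move=> zr; have [Oq _ dn _] := qP z zr; have [Dq _ gq] := Oq.
  have dAq := @row_A_derive g h F p r fd g00 (edge_mx i 0) (edge_mx i 1) (q z) Dq gq.
  apply: is_derive_eqC (is_derive_compC dAq (dq z zr)) _.
  rewrite (dzet Oq) /b /m /m_c -/g0.
  move: (row_m _ _ _ _ _ _) ('D_1 g (q z)) (dgq z zr) (h (q z)) (g (q z)) gq => mm dg dgn hz gz gq.
  have i2 := @i_sqr R; have i0 := @i_neq0 R.
  by field: i2; rewrite i0 dgn g00 gq.
have dmE i z : disc 0 R0 z -> 'D_1 (m i) z = A_c i (q z) by move=> zr; have [] := dm i z zr.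
have ddm i z : disc 0 R0 z -> is_derive z 1 ('D_1 (m i)) (i_ * b z * m i z).
  move=> zr; apply: is_derive_nearC (dA i z zr).
  have : nbhs z (disc 0 R0) by apply: open_nbhs_nbhs; split; [exact: oD|exact: zr].
  by apply: filterS => w wr; rewrite (dmE i w wr).
have d00 : disc 0 R0 0 by exact: disc_center.
exists R0, q, b, m; split; [exact: R00| | | |].
- split; [exact: hq|exact: q0|by move=> z /qO[]|].
  by have [_ _ dn ->] := qP 0 d00; rewrite invr_eq0.
- split; [exact: hb| |].
    move=> x xR.
    have xr : disc 0 R0 x%:C%C by rewrite disc0E normc_real.
    have [Oq zq _ _] := qP _ xr; have [Dq Uq gq] := Oq.
    have u := cayley_unit gq unit0 zq.
    have gn : g (q x%:C%C) != 0 by apply: contra_eq_neq u => ->; rewrite mul0r eq_sym oner_eq0.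
    have := edge_coefficient_real gn g00 (dgq _ xr) (h0 _ Dq) u unit0 (imaginary Uq Dq u).
    rewrite -/(b _); case: (b _) => b1 b2 /eqP; rewrite eq_complex /= => /andP[_ /eqP]; lra.
  rewrite /b q0; have [Dp _ gp] := Op; have hp := h0 _ Dp.
  apply: mulf_neq0.
    by apply: mulf_neq0; [apply: mulf_neq0; [exact: i_neq0|exact: hp]|exact: expf_neq0 gp].
  rewrite invr_eq0; apply: mulf_neq0; last exact: dg0.
  by apply: mulf_neq0; [rewrite pnatr_eq0|exact: expf_neq0 g00].
- split.
    move=> i; split; last by move=> z zr; have [] := ddm i z zr.
    by apply: (chol_intro oD (dm i)) => z zr; have [dd _] := dA i z zr; exact: derivable_continuousC dd.
  have [e1 e2 e3 e4 _] := edge_mx_at; have gg : g p + g p != 0 by case: Op.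
  have i2 := @i_sqr R.
  rewrite /= (dmE _ 0 d00) (dmE _ 0 d00) /m /m_c /A_c q0 /row_m /row_A e1 e2 e3 e4 -/g0.
  split.
  + by rewrite (_ : _ + _ = 0) ?mul0r //; ring.
  + by field: i2.
  + by rewrite mul1r mulfV.
  + by rewrite (_ : _ + _ = 0) ?mulr0 //; ring.
move=> z i j zr; have [Oq zq _ _] := qP z zr; have [_ _ gq] := Oq.
rewrite edge_mx_face -(edge_hform_identity _ _ _ _ gq unit0) /hform (dmE i z zr) (dmE j z zr).
by move: zq; rewrite /edge_coord -/g0 => ->.
Qed.

End edge_frames.

(** * Isometries and charts of de Sitter space *)

Lemma smooth_comp n m l (U : set 'rV[R]_n) (V : set 'rV[R]_m) (f : 'rV[R]_m -> 'rV[R]_l)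
    (psi : 'rV[R]_n -> 'rV[R]_m) : open U -> open V -> (forall x, U x -> V (psi x)) ->
  smooth_on V f -> smooth_on U psi -> smooth_on U (fun x => f (psi x)).
Proof.
move=> oU oV UV /(smoothP _ oV) Cf /(smoothP _ oU) Cpsi; apply/(smoothP _ oU) => j k.
exact: (sCk_comp oU oV UV (Cf j k) (fun i => Cpsi i k)).
Qed.

Lemma smooth_sub n m (U V : set 'rV[R]_n) (f : 'rV[R]_n -> 'rV[R]_m) : V `<=` U -> open U -> open V ->
  smooth_on U f -> smooth_on V f.
Proof.
move=> VU oU oV /(smoothP _ oU) Cf; apply/(smoothP _ oV) => j k; exact: sCk_sub (Cf j k).
Qed.

(** The action of c on Hermitian matrices, halved so that it preserves the determinant when |det c|
    = 2. *)
Definition mink (c : 'M[C]_2) (x : 'rV[R]_4) : 'M[C]_2 := 2%:R^-1 *: (c *m herm_of x *m adjC c).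
Definition lorentz (c : 'M[C]_2) (x : 'rV[R]_4) : 'rV[R]_4 := herm_coord (mink c x).

Lemma adjCM (A B : 'M[C]_2) : adjC (A *m B) = adjC B *m adjC A.
Proof. by rewrite /adjC map_mxM trmx_mul. Qed.

Lemma adjCK (A : 'M[C]_2) : adjC (adjC A) = A.
Proof. by apply/matrixP => i j; rewrite !mxE conjCK. Qed.

Lemma adjC_herm (x : 'rV[R]_4) : adjC (herm_of x) = herm_of x.
Proof.
apply/matrixP => i j; rewrite !mxE conj_cj /cj.
by case: i => [[|[|//]]] i2; case: j => [[|[|//]]] j2 //=; rewrite ?oppr0 ?opprK.
Qed.

Lemma adjC_mink c x : adjC (mink c x) = mink c x.
Proof.
have half : cj (2%:R^-1 : C) = 2%:R^-1.
  by rewrite cjV; congr (_^-1); have := @cj_real R 2%:R; rewrite rmorph_nat.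
have -> : adjC (mink c x) = 2%:R^-1 *: adjC (c *m herm_of x *m adjC c).
  by apply/matrixP => i j; rewrite /adjC [LHS]mxE [LHS]mxE conj_cj [in LHS]mxE cjM half !mxE conj_cj.
by rewrite !adjCM adjCK adjC_herm mulmxA.
Qed.

Lemma herm_ofK (x : 'rV[R]_4) : herm_coord (herm_of x) = x.
Proof.
rewrite herm_coordE; apply/rowP => j; rewrite [LHS]mxE !mxE /=.
have [->|[->|[->|->]]] : j = 0 \/ j = 1 \/ j = 2 \/ j = 3; last by rewrite /=; field.
- by case: j => [[|[|[|[|//]]]]] jj; [left|right; left|right; right; left|right; right; right]; exact: val_inj.
- by rewrite /=; field.
- by [].
- by [].
Qed.

Lemma herm_coordK (X : 'M[C]_2) : adjC X = X -> herm_of (herm_coord X) = X.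
Proof.
move=> XX; have E i j : cj (X i j) = X j i by rewrite -[X in RHS]XX !mxE conj_cj.
rewrite herm_coordE hcoord_herm ?E //; apply/matrixP => i j; rewrite mxE.
by case: i => [[|[|//]]] i2; case: j => [[|[|//]]] j2; rewrite /=; congr (X _ _); exact/val_inj.
Qed.

Lemma herm_lorentz c x : herm_of (lorentz c x) = mink c x.
Proof. by rewrite /lorentz herm_coordK // adjC_mink. Qed.

Lemma lorentzK (c c' : 'M[C]_2) (e : C) x : c' *m c = e%:M -> e * cj e = 4%:R ->
  lorentz c' (lorentz c x) = x.
Proof.
move=> cc ee; rewrite -[RHS]herm_ofK {1}/lorentz; congr herm_coord.
rewrite {1}/mink herm_lorentz /mink.
have aE : adjC c *m adjC c' = (cj e)%:M.
  by rewrite -adjCM cc; apply/matrixP => i j; rewrite !mxE conj_cj eq_sym; case: eqP => _; rewrite ?mulr1n ?mulr0n // /cj conjc0.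
have -> : c' *m (2%:R^-1 *: (c *m herm_of x *m adjC c)) *m adjC c' =
    2%:R^-1 *: ((c' *m c) *m herm_of x *m (adjC c *m adjC c')).
  by rewrite -scalemxAr -scalemxAl !mulmxA.
rewrite cc aE mul_scalar_mx mul_mx_scalar !scalerA.
have n2 : (2%:R : C) != 0 by rewrite pnatr_eq0.
have -> : (2%:R^-1 / 2%:R * cj e * e : C) = 1; last exact: scale1r.
by rewrite -mulrA [cj e * e]mulrC ee; field.
Qed.

(** [\adj c] is the inverse of c up to the scalar det c, whose squared modulus 4 cancels the two
    halves. *)
Lemma lorentz_adj (c : 'M[C]_2) x : \det c * cj (\det c) = 4%:R ->
  lorentz (\adj c) (lorentz c x) = x /\ lorentz c (lorentz (\adj c) x) = x.
Proof.
by move=> d4; split; apply: (lorentzK _ _ d4); [exact: mul_adj_mx|exact: mul_mx_adj].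
Qed.

Lemma lorentz_deSitter (c : 'M[C]_2) x : \det c * cj (\det c) = 4%:R -> deSitter3 (lorentz c x) <-> deSitter3 x.
Proof.
move=> d4; rewrite /deSitter3 /= herm_lorentz /mink detZ !det_mulmx.
have -> : \det (adjC c) = cj (\det c) by rewrite !det_M2 !mxE !conj_cj cjB !cjM; ring.
rewrite (_ : _ * (_ * _ * _) = \det (herm_of x)) //.
have n2 : (2%:R : C) != 0 by rewrite pnatr_eq0.
apply: (mulfI (_ : (4%:R : C) != 0)); first by rewrite pnatr_eq0.
by rewrite -[X in _ = X * _]d4; field.
Qed.
(** In the Hermitian picture: lower diagonal entry, real part of the off-diagonal entry, upper
    diagonal entry. The diagonal ones are null coordinates. *)
Definition lightcone (y : 'rV[R]_4) : 'rV[R]_3 :=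
  \row_(j < 3) (match val j with 0%N => y 0 0 - y 0 3 | 1%N => y 0 1 | _ => y 0 0 + y 0 3 end).
(** On de Sitter space the equation det = -1 makes this the square of the coordinate that
    [lightcone] drops. *)
Definition deSitter_height (c : 'rV[R]_3) : R := 1 + (c 0 0 * c 0 2 - c 0 1 ^+ 2).
(** The negative root is the branch through the normalized base point, whose dropped coordinate is
    -1. *)
Definition deSitter_graph (c : 'rV[R]_3) : 'rV[R]_4 :=
  \row_(j < 4) (match val j with
    | 0%N => (c 0 0 + c 0 2) / 2
    | 1%N => c 0 1
    | 2%N => - Num.sqrt (deSitter_height c)
    | _ => (c 0 2 - c 0 0) / 2 end).

Lemma deSitter3P (y : 'rV[R]_4) :
  deSitter3 y <-> (y 0 0 + y 0 3) * (y 0 0 - y 0 3) - y 0 1 ^+ 2 - y 0 2 ^+ 2 = -1.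
Proof.
rewrite /deSitter3 /= /herm_of det_mx2; split=> [/eqP|H].
  by rewrite eq_complex /= => /andP[/eqP + _] => H; rewrite -H; ring.
by apply/eqP; rewrite eq_complex /=; apply/andP; split; apply/eqP; [rewrite -H|]; ring.
Qed.

Lemma lightconeE (y : 'rV[R]_4) : deSitter3 y -> deSitter_height (lightcone y) = y 0 2 ^+ 2.
Proof. by move=> /deSitter3P H; rewrite /deSitter_height !mxE /=; lra. Qed.

Lemma ord4P (j : 'I_4) : [\/ j = 0, j = 1, j = 2 | j = 3].
Proof.
by case: j => [[|[|[|[|//]]]]] jj; [constructor 1|constructor 2|constructor 3|constructor 4]; exact: val_inj.
Qed.

Lemma ord3P (j : 'I_3) : [\/ j = 0, j = 1 | j = 2].
Proof. by case: j => [[|[|[|//]]]] jj; [constructor 1|constructor 2|constructor 3]; exact: val_inj. Qed.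

Lemma deSitter_graphK (y : 'rV[R]_4) : deSitter3 y -> y 0 2 < 0 -> deSitter_graph (lightcone y) = y.
Proof.
move=> dS y2; apply/rowP => j; rewrite [LHS]mxE (lightconeE dS) sqrtr_sqr !mxE (ltr0_norm y2) opprK.
by have [->|->|->|->] := ord4P j; rewrite /=; try lra.
Qed.

Lemma lightconeK (c : 'rV[R]_3) : lightcone (deSitter_graph c) = c.
Proof. by apply/rowP => j; rewrite !mxE; have [->|->|->] := ord3P j; rewrite /=; try lra. Qed.

Lemma deSitter_graphP (c : 'rV[R]_3) : 0 < deSitter_height c ->
  deSitter3 (deSitter_graph c) /\ deSitter_graph c 0 2 < 0.
Proof.
move=> c0; split; last by rewrite mxE /= oppr_lt0 sqrtr_gt0.
apply/deSitter3P; rewrite !mxE /= sqrrN sqr_sqrtr ?ltW // /deSitter_height.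
by field.
Qed.

Lemma cSk_mink k c i j (U : set 'rV[R]_4) : open U -> cSk k U (fun x => mink c x i j).
Proof.
move=> oU.
have Ch i' j' : cSk k U (fun x => herm_of x i' j').
  have Cc n : sCk k U (fun x : 'rV[R]_4 => x 0 n) by exact: sCk_coord.
  have C0 : sCk k U (fun _ : 'rV[R]_4 => 0 : R) by exact: sCk_cst.
  have CD := sCkD oU (Cc 0) (Cc 3); have CB := sCkB oU (Cc 0) (Cc 3); have CN := sCkN oU (Cc 2).
  have [-> | ->] : i' = 0 \/ i' = 1 by case: i' => -[|[|//]] jj; [left|right]; exact: val_inj.
  - have [-> | ->] : j' = 0 \/ j' = 1 by case: j' => -[|[|//]] jj; [left|right]; exact: val_inj.
    + by split; [apply: sCk_ext CD|apply: sCk_ext C0] => // x _; rewrite mxE.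
    + by split; [apply: sCk_ext (Cc 1)|apply: sCk_ext (Cc 2)] => // x _; rewrite mxE.
  - have [-> | ->] : j' = 0 \/ j' = 1 by case: j' => -[|[|//]] jj; [left|right]; exact: val_inj.
    + by split; [apply: sCk_ext (Cc 1)|apply: sCk_ext CN] => // x _; rewrite mxE.
    + by split; [apply: sCk_ext CB|apply: sCk_ext C0] => // x _; rewrite mxE.
have Ccst (a : C) := cSk_cst k oU a.
have CL i' j' : cSk k U (fun x => c i' 0 * herm_of x 0 j' + c i' 1 * herm_of x 1 j').
  by apply: cSkD => //; apply: cSkM.
apply: (cSk_ext oU _ (cSkM oU (Ccst 2%:R^-1) (cSkD oU (cSkM oU (CL i 0) (Ccst (adjC c 0 j))) (cSkM oU (CL i 1) (Ccst (adjC c 1 j)))))) => x _.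
by rewrite /mink [RHS]mxE !mul_mx2E.
Qed.

Lemma smooth_lorentz c (U : set 'rV[R]_4) : open U -> smooth_on U (lorentz c).
Proof.
move=> oU; apply/(smoothP _ oU) => j k.
have C00 := cSk_mink k c 0 0 oU; have C01 := cSk_mink k c 0 1 oU; have C11 := cSk_mink k c 1 1 oU.
have h2 : sCk k U (fun _ : 'rV[R]_4 => 2^-1 : R) by exact: sCk_cst.
have E x : lorentz c x = hcoord (mink c x 0 0) (mink c x 0 1) (mink c x 1 1) by exact: herm_coordE.
have [->|->|->|->] := ord4P j.
- by apply: (sCk_ext oU _ (sCkM oU (sCkD oU C00.1 C11.1) h2)) => x _; rewrite E [RHS]mxE.
- by apply: (sCk_ext oU _ C01.1) => x _; rewrite E [RHS]mxE.
- by apply: (sCk_ext oU _ C01.2) => x _; rewrite E [RHS]mxE.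
- by apply: (sCk_ext oU _ (sCkM oU (sCkB oU C00.1 C11.1) h2)) => x _; rewrite E [RHS]mxE.
Qed.

Lemma smooth_lightcone (U : set 'rV[R]_4) : open U -> smooth_on U lightcone.
Proof.
move=> oU; apply/(smoothP _ oU) => j k.
have Cc n : sCk k U (fun x : 'rV[R]_4 => x 0 n) by exact: sCk_coord.
have [->|->|->] := ord3P j.
- by apply: (sCk_ext oU _ (sCkB oU (Cc 0) (Cc 3))) => x _; rewrite mxE.
- by apply: (sCk_ext oU _ (Cc 1)) => x _; rewrite mxE.
- by apply: (sCk_ext oU _ (sCkD oU (Cc 0) (Cc 3))) => x _; rewrite mxE.
Qed.

Lemma smooth_height k (U : set 'rV[R]_3) : open U -> sCk k U deSitter_height.
Proof.
move=> oU; have Cc n : sCk k U (fun x : 'rV[R]_3 => x 0 n) by exact: sCk_coord.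
have C1 : sCk k U (fun _ : 'rV[R]_3 => 1 : R) by exact: sCk_cst.
exact: (sCkD oU C1 (sCkB oU (sCkM oU (Cc 0) (Cc 2)) (sCkX 2 oU (Cc 1)))).
Qed.

Lemma smooth_graph (U : set 'rV[R]_3) : open U -> (forall c, U c -> 0 < deSitter_height c) ->
  smooth_on U deSitter_graph.
Proof.
move=> oU pU; apply/(smoothP _ oU) => j k.
have Cc n : sCk k U (fun x : 'rV[R]_3 => x 0 n) by exact: sCk_coord.
have h2 : sCk k U (fun _ : 'rV[R]_3 => 2^-1 : R) by exact: sCk_cst.
have [->|->|->|->] := ord4P j.
- by apply: (sCk_ext oU _ (sCkM oU (sCkD oU (Cc 0) (Cc 2)) h2)) => x _; rewrite mxE.
- by apply: (sCk_ext oU _ (Cc 1)) => x _; rewrite mxE.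
- by apply: (sCk_ext oU _ (sCkN oU (sCk_sqrt oU pU (smooth_height k oU)))) => x _; rewrite mxE.
- by apply: (sCk_ext oU _ (sCkM oU (sCkB oU (Cc 2) (Cc 0)) h2)) => x _; rewrite mxE.
Qed.
Lemma open_sub_preimage n m (U : set 'rV[R]_n) (V : set 'rV[R]_m) (f : 'rV[R]_n -> 'rV[R]_m) :
  open U -> open V -> (forall x, U x -> {for x, continuous f}) -> open [set x | U x /\ V (f x)].
Proof.
move=> oU oV cf; rewrite openE => x [Ux Vx]; rewrite /interior.
have n1 : nbhs x U by exact: open_nbhs_nbhs.
have n2 : nbhs x (f @^-1` V) by apply: (cf x Ux V); exact: open_nbhs_nbhs.
exact: filterI n1 n2.
Qed.

Lemma open_height : open [set c | 0 < deSitter_height c].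
Proof.
apply: (@open_comp _ _ deSitter_height [set t | 0 < t]); last exact: open_gt.
by move=> c _; exact: (smooth_height 0 (@openT _)).
Qed.

Lemma open_neg_coord n j : open [set y : 'rV[R]_n | y 0 j < 0].
Proof.
apply: (@open_comp _ _ (fun y : 'rV[R]_n => y 0 j) [set t | t < 0]); last exact: open_lt.
by move=> y _; exact: coord_continuous.
Qed.

(** The chart is the isometry followed by [lightcone] and [Tinv]. On the half space where the
    dropped coordinate is negative, [lightcone] is injective on de Sitter space, with
    [deSitter_graph] as inverse. *)
Lemma deSitter_chart (c : 'M[C]_2) (q : 'rV[R]_4) (W : set 'rV[R]_3) (T : 'rV[R]_3 -> 'rV[R]_3) :
  \det c * cj (\det c) = 4%:R -> deSitter3 q -> lightcone (lorentz c q) = 0 -> lorentz c q 0 2 < 0 ->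
  diffeo_germ 0 0 W T -> exists Ut Psi, chart_germ q Ut Psi /\
    forall x w, Ut x -> W w -> T w = lightcone (lorentz c x) -> Psi x = w.
Proof.
move=> d4 dSq lq hq [V [Tinv [[oW W0] [oV V0] T0 [CT CTi] [TK TiK]]]].
have dadj : \det (\adj c) * cj (\det (\adj c)) = 4%:R.
  have dc0 : \det c != 0 by apply: contra_eq_neq d4 => ->; rewrite mul0r eq_sym pnatr_eq0.
  have -> : \det (\adj c) = \det c; last exact: d4.
  apply: (mulfI dc0); rewrite -det_mulmx mul_mx_adj det_scalar; ring.
have cl := smooth_lorentz c (@openT _); have cl0 := cl 0%N.
have cL := smooth_lightcone (@openT _).
have oL : open [set x | V (lightcone (lorentz c x))].
  apply: (@open_comp _ _ (fun x => lightcone (lorentz c x)) V) => // x _.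
  exact: (smooth_comp (@openT _) (@openT _) (fun _ _ => I) cL cl 0%N).
have oN : open [set x | lorentz c x 0 2 < 0].
  apply: (@open_comp _ _ (lorentz c) [set y | y 0 2 < 0]); last exact: open_neg_coord.
  by move=> x _; exact: cl0.
pose Ut := [set x | lorentz c x 0 2 < 0] `&` [set x | V (lightcone (lorentz c x))].
have oUt : open Ut by exact: openI.
pose Psi x := Tinv (lightcone (lorentz c x)).
pose Vc := [set y | W y /\ [set z | 0 < deSitter_height z] (T y)].
have oVc : open Vc by apply: open_sub_preimage; [exact: oW|exact: open_height|exact: (CT 0%N)].
pose Phi y := lorentz (\adj c) (deSitter_graph (T y)).
have PhiK y : Vc y -> (Ut (Phi y) /\ deSitter3 (Phi y)) /\ Psi (Phi y) = y.
  move=> [Wy hy]; have [dg ng] := deSitter_graphP hy; have [Vy yK] := TK y Wy.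
  have E : lorentz c (Phi y) = deSitter_graph (T y) by have [_ ->] := lorentz_adj (deSitter_graph (T y)) d4.
  rewrite /Ut /Psi /setI /= E lightconeK; split; last exact: yK.
  by split; [split; [exact: ng|exact: Vy]|apply/(lorentz_deSitter _ dadj)].
exists Ut, Psi; split; last first.
  by move=> x w _ Ww E; rewrite /Psi -E; exact: (TK w Ww).2.
exists Vc, Phi; split.
- split; first exact: oUt.
  by split; [split; [exact: hq|rewrite /= lq]|exact: dSq].
- split; first exact: oVc.
  split; first exact: W0.
  by rewrite /= T0 -lq (lightconeE ((lorentz_deSitter q d4).2 dSq)) exprn_even_gt0 //= lt_eqF.
- by rewrite /Psi lq; have := (TK 0 W0).2; rewrite T0.
- split.
    apply: (smooth_comp oUt oV _ CTi); first by move=> x [].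
    apply: smooth_sub (@openT _) oUt _; first by [].
    exact: (smooth_comp (@openT _) (@openT _) (fun _ _ => I) cL cl).
  apply: (smooth_comp oVc (@openT _) _ (smooth_lorentz _ (@openT _))); first by [].
  apply: (smooth_comp oVc open_height _ (smooth_graph open_height _)); [by move=> y []|by []|].
  by apply: smooth_sub oW oVc CT => y [].
split; last exact: PhiK.
move=> x [hx Vx] dSx; have dl := (lorentz_deSitter x d4).2 dSx.
have [Wy yK] := TiK _ Vx.
rewrite /Vc /Phi /Psi /= yK (lightconeE dl) (deSitter_graphK dl hx).
split; last by have [-> _] := lorentz_adj x d4.
by split; [exact: Wy|rewrite exprn_even_gt0 //= lt_eqF].
Qed.

(** * Source coordinates and assembly of the equivalence *)

Lemma Re_shear (x l y : R) : Re (shear x l (y%:C%C : C) : R[i]) = x - l * y ^+ 3.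
Proof.
rewrite (_ : shear x l y%:C%C = x%:C%C + (i_ * y%:C%C + (- (l * y ^+ 3))%:C%C)).
  by rewrite /=; ring.
by rewrite /shear rmorphN rmorphM rmorphXn /= mulNr.
Qed.

(** The term l y^3 has no linear part, so (x, y) to x - l y^3 + i y has identity derivative at 0 and
    the composite inherits the invertible derivative of q. *)
Lemma edge_source (R0 d : R) (b q : C -> C) : 0 < d <= R0 -> chol (disc 0 R0) b -> chol (disc 0 R0) q ->
  'D_1 q 0 != 0 ->
  (forall x y : R, `|x| < d -> `|y| < d -> disc 0 R0 (shear x (lam b x) y%:C%C)) ->
  exists2 W : set 'rV[R]_2, W `<=` [set w : 'rV[R]_2 | `|w 0 0| < d /\ `|w 0 1| < d] &
    diffeo_germ 0 (ofC (q 0)) W (fun w => ofC (q (shear (w 0 0) (lam b (w 0 0)) (w 0 1)%:C%C))).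
Proof.
move=> /andP[d0 dR] hb hq dq sd.
pose U := [set w : 'rV[R]_2 | `|w 0 0| < d /\ `|w 0 1| < d].
have oD := @disc_open R 0 R0.
have oU : open U.
  have oj (j : 'I_2) : open [set w : 'rV[R]_2 | `|w 0 j| < d].
    apply: (@open_comp _ _ (fun w : 'rV[R]_2 => `|w 0 j|) [set t | t < d]); last exact: open_lt.
    move=> w _; apply: (@continuous_comp _ _ _ (fun w : 'rV[R]_2 => w 0 j) (fun t : R => `|t|)).
      exact: coord_continuous.
    exact: norm_continuous.
  exact: openI (oj 0) (oj 1).
have U0 : U 0 by rewrite /U /= !mxE normr0.
have Cc k (j : 'I_2) : sCk k U (fun w => w 0 j) by exact: sCk_coord.
have Cl k : sCk k U (fun w => lam b (w 0 0)).
  have c23 : sCk k U (fun _ => 2%:R / 3%:R : R) by exact: sCk_cst.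
  have Cb : cSk k U (fun w => b (w 0 0)%:C%C).
    apply: (@cSk_comp R _ k U (disc 0 R0) b (fun w : 'rV[R]_2 => (w 0 0)%:C%C) oU oD _ hb (cSk_real oU (Cc k 0))) => w [w0 _].
    by rewrite disc0E normc_real (lt_le_trans w0).
  exact: sCkM oU c23 Cb.1.
have Csh k : cSk k U (fun w => shear (w 0 0) (lam b (w 0 0)) (w 0 1)%:C%C).
  split.
    apply: sCk_ext (sCkB oU (Cc k 0) (sCkM oU (Cl k) (sCkX 3 oU (Cc k 1)))) => // w _.
    by rewrite Re_shear.
  by apply: sCk_ext (Cc k 1) => // w _; rewrite Im_shear.
have sh0 : shear ((0 : 'rV[R]_2) 0 0) (lam b ((0 : 'rV[R]_2) 0 0)) ((0 : 'rV[R]_2) 0 1)%:C%C = 0.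
  by rewrite !mxE /shear expr0n /= mulr0 mulr0 !addr0.
have Us w : U w -> disc 0 R0 (shear (w 0 0) (lam b (w 0 0)) (w 0 1)%:C%C) by move=> [] /sd + /[dup] w1; apply.
have -> : ofC (q 0) = ofC (q (shear ((0 : 'rV[R]_2) 0 0) (lam b ((0 : 'rV[R]_2) 0 0)) ((0 : 'rV[R]_2) 0 1)%:C%C)).
  by rewrite sh0.
apply: (@inverse_function _ _ U (fun w => ofC (q (shear (w 0 0) (lam b (w 0 0)) (w 0 1)%:C%C))) 0 oU U0).
  by apply: smooth_ofC => // k; exact: (cSk_comp oU oD Us hq (Csh k)).
apply: (@jac_mul_unit _ _ ('D_1 q 0) dq) => v; apply: is_derive_ofC.
have d00 : disc 0 R0 0 by apply: disc_center; exact: lt_le_trans dR.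
have dpsi : cder (fun w : 'rV[R]_2 => shear (w 0 0) (lam b (w 0 0)) (w 0 1)%:C%C) 0 v (toC v).
  split.
    have dl : is_derive (0 : 'rV[R]_2) v (fun w : 'rV[R]_2 => lam b (w 0 0)) ('D_v (fun w : 'rV[R]_2 => lam b (w 0 0)) 0).
      by apply: derivableP; exact: C1_derivable oU (Cl 1%N) U0.
    have d0' := is_derive_coord (0 : 'rV[R]_2) v 0; have d1' := is_derive_coord (0 : 'rV[R]_2) v 1.
    have H := is_deriveB d0' (is_deriveM dl (is_deriveM d1' (is_deriveM d1' d1'))).
    move: H; rewrite !fctE => H.
    rewrite [X in is_derive _ _ X _](_ : _ = (fun w : 'rV[R]_2 => w 0 0 - lam b (w 0 0) * (w 0 1 * (w 0 1 * w 0 1)))); last first.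
      by apply/funext => w; rewrite Re_shear; ring.
    apply: (is_derive_eq H).
    have z1 : (0 : 'rV[R]_2) 0 1 = 0 by rewrite mxE.
    by rewrite !z1 !scale0r !mul0r !scale0r !addr0 scaler0 subr0.
  rewrite [X in is_derive _ _ X _](_ : _ = (fun w : 'rV[R]_2 => w 0 1)); first exact: is_derive_coord.
  by apply/funext => w; rewrite Im_shear.
have cpsi : {for (0 : 'rV[R]_2), continuous (fun w : 'rV[R]_2 => shear (w 0 0) (lam b (w 0 0)) (w 0 1)%:C%C)}.
  by apply/continuous_complexP; split; [exact: (Csh 0%N).1|exact: (Csh 0%N).2].
have dq0 : is_derive (shear ((0 : 'rV[R]_2) 0 0) (lam b ((0 : 'rV[R]_2) 0 0)) ((0 : 'rV[R]_2) 0 1)%:C%C) 1 q ('D_1 q 0).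
  by rewrite sh0; exact: chol_is_derive hq d00.
exact: (chain_rule dq0 dpsi cpsi).
Qed.
Lemma smooth_cusp52 (U : set 'rV[R]_2) : open U -> smooth_on U (@cusp52 R).
Proof.
move=> oU; apply/(smoothP _ oU) => j k.
have Cc n : sCk k U (fun x : 'rV[R]_2 => x 0 n) by exact: sCk_coord.
have [->|->|->] := ord3P j.
- by apply: (sCk_ext oU _ (Cc 0)) => x _; rewrite mxE.
- by apply: (sCk_ext oU _ (sCkX 2 oU (Cc 1))) => x _; rewrite mxE.
- by apply: (sCk_ext oU _ (sCkX 5 oU (Cc 1))) => x _; rewrite mxE.
Qed.

Lemma adjC_face (F : C -> 'M[C]_2) z : adjC (F z *m e3 R *m adjC (F z)) = F z *m e3 R *m adjC (F z).
Proof. by apply/matrixP => i j; rewrite /adjC mxE mxE conj_cj !face_entry hp_sym. Qed.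

Lemma mink_face (c : 'M[C]_2) (F : C -> 'M[C]_2) z i j : mink c (cmc1_face F (ofC z)) i j =
  2%:R^-1 * (c *m (F z *m e3 R *m adjC (F z)) *m adjC c) i j.
Proof. by rewrite /mink mxE /cmc1_face toC_ofC herm_coordK ?adjC_face. Qed.

Lemma lightcone_lorentz c x : lightcone (lorentz c x) =
  \row_(j < 3) (match val j with 0%N => Re (mink c x 1 1 : R[i]) | 1%N => Re (mink c x 0 1 : R[i]) | _ => Re (mink c x 0 0 : R[i]) end).
Proof.
have E : lorentz c x = hcoord (mink c x 0 0) (mink c x 0 1) (mink c x 1 1) by exact: herm_coordE.
rewrite E; move: (mink c x 0 0) (mink c x 0 1) (mink c x 1 1) => a b d.
by apply/rowP => j; rewrite !mxE; have [->|->|->] := ord3P j; rewrite /=; try lra.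
Qed.

Lemma hform_at0 (m n : C -> C) (a a' b b' : C) : m 0 = a -> 'D_1 m 0 = a' -> n 0 = b -> 'D_1 n 0 = b' ->
  hform m n 0 = i_ * (a * cj b' - a' * cj b).
Proof. by rewrite /hform => -> -> -> ->; rewrite /= mulr0 mul0r addr0. Qed.

Lemma cuspidal_edge_sufficiency D P g h F (p : C) : cmc1_data D P g h F -> D p ->
  singular_point (cmc1_face F) (ofC p) -> Im (phi_fn g h p : R[i]) != 0 ->
  (exists (gam : R -> 'rV[R]_2) (eps : R), singular_curve D (cmc1_face F) p gam eps /\
    forall t, `]- eps, eps[%classic t -> Re (phi_fn g h (toC (gam t)) : R[i]) = 0) ->
  cuspidal_edge_52 D (cmc1_face F) p.
Proof.
move=> data Dp sing ph [gam [eps [[_ _ _ _ [U [oU Up UE]]] ReE]]].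
have Pp : ~ P p by move=> /(nonsingular_pole data).
have [r r0 [discD discP fd]] := frame_at data Dp Pp.
have unit0 := (singular_at data Dp Pp).1 sing.
have dg0 : 'D_1 g p != 0.
  by apply: contra_neq ph => dg; rewrite /phi_fn dg mul0r.
(* Near p every singular point lies on the given curve, so Re phi = 0 on all of |g| = 1 there. *)
have imaginary z : U z -> disc p r z -> g z * cj (g z) = 1 -> phi_fn g h z + cj (phi_fn g h z) = 0.
  move=> Uz Dz uz.
  have sz : singular_set D (cmc1_face F) z.
    split; [exact: discD|exact: (singular_at data (discD _ Dz) (discP _ Dz)).2 uz].
  have [t te zE] := (UE z Uz).1 sz; have := ReE t te; rewrite zE /cj.
  case: (phi_fn g h z) => a a' /= a0; apply/eqP; rewrite eq_complex /=; apply/andP; split; apply/eqP; lra.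
have [R0 [q [b [m [R00 [hq q0 qd dq] [hb breal b0] [odem [m00 m01 m10 m11]] hE]]]]] :=
  edge_frame r0 fd unit0 dg0 oU Up imaginary.
have [UT [T [d [[oUT UT0] CT JT /andP[d0 dR] TE]]]] :=
  normal_form R00 hb breal b0 (odem 0) (odem 1) m00 m01 m10 m11.
pose c := edge_mx g F p.
have oD := @disc_open R p r.
have [_ _ hF _ [detF _ _]] := fd.
have dc : \det c * cj (\det c) = 4%:R by have [] := edge_mx_at r0 fd unit0.
have minkE z i j : disc 0 R0 z -> mink c (cmc1_face F (ofC (q z))) i j = hform (m i) (m j) z.
  by move=> zr; rewrite (hE z i j zr) mink_face.
have d00 : disc 0 R0 0 by exact: disc_center.
(* The normalized base point is the matrix [[0, -i], [i, 0]]: its [lightcone] coordinates vanish and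
   its dropped coordinate is -1. *)
have h01 : hform (m 0) (m 1) 0 = - i_.
  by rewrite (hform_at0 m00 m01 m10 m11) mul0r sub0r mul1r cj1 mulrN mulr1.
have cjE0 : cj (0 : C) = 0 := conjc0 R.
have h00 : hform (m 0) (m 0) 0 = 0.
  by rewrite (hform_at0 m00 m01 m00 m01) mul0r sub0r mul1r cjE0 oppr0 mulr0.
have h11 : hform (m 1) (m 1) 0 = 0.
  by rewrite (hform_at0 m10 m11 m10 m11) cjE0 mulr0 mul0r subr0 mulr0.
have liteE z : disc 0 R0 z -> lightcone (lorentz c (cmc1_face F (ofC (q z)))) =
   \row_(j < 3) (match val j with 0%N => Re (hform (m 1) (m 1) z : R[i])
     | 1%N => Re (hform (m 0) (m 1) z : R[i]) | _ => Re (hform (m 0) (m 0) z : R[i]) end).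
  by move=> zr; rewrite lightcone_lorentz !minkE.
pose sh (w : 'rV[R]_2) := shear (w 0 0) (lam b (w 0 0)) (w 0 1)%:C%C.
pose f := cmc1_face F.
pose s w := ofC (q (sh w)).
have shP (w : 'rV[R]_2) : `|w 0 0| < d -> `|w 0 1| < d -> [/\ UT (cusp52 w), disc 0 R0 (sh w) &
    T (cusp52 w) = lightcone (lorentz c (f (s w)))].
  by move=> w0 w1; have [H1 H2 ->] := TE w w0 w1; split; [exact: H1|exact: H2|rewrite /f /s liteE].
have l0 : lightcone (lorentz c (f (ofC p))) = 0.
  have := liteE 0 d00; rewrite q0 => ->; rewrite h00 h01 h11.
  by apply/rowP => j; rewrite !mxE; have [->|->|->] := ord3P j; rewrite /= ?oppr0.
have y2 : lorentz c (f (ofC p)) 0 2 < 0.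
  have := minkE 0 0 1 d00; rewrite q0 h01 => M01.
  by rewrite /lorentz herm_coordE mxE /= /f M01 /= oppr_lt0 ltr01.
have sh00 : sh 0 = 0 by rewrite /sh !mxE /shear expr0n /= mulr0 mulr0 !addr0.
have s00 : s 0 = ofC p by rewrite /s sh00 q0.
have cusp0 : cusp52 (0 : 'rV[R]_2) = 0.
  by apply/rowP => j; rewrite !mxE; have [->|->|->] := ord3P j; rewrite /= ?expr0n.
have T0 : T 0 = 0.
  have o0 j : `|(0 : 'rV[R]_2) 0 j| < d by rewrite mxE normr0.
  by have [_ _] := shP 0 (o0 0) (o0 1); rewrite cusp0 s00 l0.
have [WT WTU germT] := inverse_function oUT UT0 CT JT; rewrite T0 in germT.
have dSp : deSitter3 (f (ofC p)).
  rewrite /f cmc1_faceE toC_ofC; apply: face_deSitter.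
  by rewrite det_M2; apply: detF; exact: disc_center.
have [Ut [Psi [chart PsiE]]] := deSitter_chart dc dSp l0 y2 germT.
have shd x y : `|x| < d -> `|y| < d -> disc 0 R0 (shear x (lam b x) y%:C%C).
  by move=> xd yd; have [] := shP (pt x y); rewrite ?pt0 ?pt1 // /sh pt0 pt1.
have dd : 0 < d <= R0 by rewrite d0.
have [Ws WsU germS] := edge_source dd hb hq dq shd; rewrite q0 in germS.
(* Where the source map, the chart and the local inverse of T are simultaneously usable; its
   interior is the neighbourhood on which the germs are compared. *)
pose A := [set w : 'rV[R]_2 | [/\ Ws w, Ut (f (s w)) & WT (cusp52 w)]].
have [V [sinv [[oWs Ws0] _ _ [Cs _] _]]] := germS.
have [VT [Tinv [[oWT WT0] _ _ _ _]]] := germT.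
have [V' [Phi [[oUt [Utp _]] _ _ _ _]]] := chart.
have A0 : nbhs (0 : 'rV[R]_2) A.
  have n1 : nbhs (0 : 'rV[R]_2) Ws by exact: open_nbhs_nbhs.
  have n2 : nbhs (0 : 'rV[R]_2) [set w | Ut (f (s w))].
    have cs : {for (0 : 'rV[R]_2), continuous s} := Cs 0%N 0 Ws0.
    have cf : {for s 0, continuous f}.
      rewrite s00; apply/for_continuous_mxP => i j; rewrite (ord1 i).
      apply: (ssmooth_face oD hF j 0); rewrite /prec /= toC_ofC; exact: disc_center.
    apply: (@continuous_comp _ _ _ s f 0 cs cf Ut); apply: open_nbhs_nbhs; split; first exact: oUt.
    by rewrite /= s00.
  have n3 : nbhs (0 : 'rV[R]_2) [set w | WT (cusp52 w)].
    have cc : {for (0 : 'rV[R]_2), continuous (@cusp52 R)} := @smooth_cusp52 setT (@openT _) 0%N 0 I.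
    by apply: (cc WT); rewrite cusp0; exact: open_nbhs_nbhs.
  near=> w; split; near: w; [exact: n1|exact: n2|exact: n3].
exists Ws, s, Ut, Psi, (interior A); split; [exact: germS|exact: chart| |].
  split; first exact: open_interior.
  by split; [exact: A0|move=> w /interior_subset[]].
move=> w /interior_subset[Wsw Utw WTw].
have [w0 w1] := WsU w Wsw; have [_ Dw TwE] := shP w w0 w1.
split; [|exact: Utw|exact: PsiE].
by rewrite /s toC_ofC; apply: discD; exact: qd.
Unshelve. all: by end_near. Qed.

End edge_sufficiency.

Theorem theorem4p3 (R : realType) (D P : set (Cplx R)) (g h : Cplx R -> Cplx R)
    (F : Cplx R -> 'M[Cplx R]_2) (p : Cplx R) :
  cmc1_data D P g h F -> D p -> singular_point (cmc1_face F) (ofC p) ->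
  (cuspidal_edge_52 D (cmc1_face F) p <->
   (complex.Im (phi_fn g h p : R[i]) != 0 /\
    exists (gam : R -> 'rV[R]_2) (eps : R),
      singular_curve D (cmc1_face F) p gam eps /\
      forall t, `]- eps, eps[%classic t -> complex.Re (phi_fn g h (toC (gam t)) : R[i]) = 0)).
Proof.
move=> data Dp sing; split; first exact: (cuspidal_edge_necessity data Dp sing).
by move=> [ph curve]; exact: (cuspidal_edge_sufficiency data Dp sing ph curve).
Qed.
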